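(* Assume that $E=-\nabla_x\phi\in L^1_{\mathrm{loc}}(\mathbb R_+;W^{2,\infty}(\mathbb R^3))$, $\partial_tE\in L^1_{\mathrm{loc}}(\mathbb R_+;L^\infty(\mathbb R^3))$, and that the initial condition $f^{\mathrm{in}}$ has compact support and belongs to $W^{2,\infty}(\mathbb R^3\times\mathbb R^3)$. Let $f^0=f^0(t,s,x,p)$ be the solution of $$\partial_t f^0+\Big(\frac pm-\frac{\omega_c}{2}(\theta(s)-\langle\theta\rangle)\,{}^\perp x\Big)\cdot\nabla_x f^0+\Big(eE(t,x)+\frac{\omega_c}{2}(\theta(s)+\langle\theta\rangle)\,{}^\perp p+\frac{m\omega_c^2}{4}(\langle\theta^2\rangle-\theta^2(s))\,{}^{\perp\perp}x\Big)\cdot\nabla_p f^0=0,$$ $$f^0(0,s,x,p)=f^{\mathrm{in}}\Big(x,\,p-\frac{m\omega_c}{2}(\theta(s)-\theta(0))\,{}^\perp x\Big),$$ and, for $\varepsilon>0$, let $f^\varepsilon=f^\varepsilon(t,x,p)$ be the solution of $$\partial_t f^\varepsilon+\frac pm\cdot\nabla_x f^\varepsilon+\Big(eE(t,x)+\frac{m\omega_c}{2\varepsilon}\theta'(t/\varepsilon)\,{}^\perp x+\omega_c\,\theta(t/\varepsilon)\,{}^\perp p\Big)\cdot\nabla_p f^\varepsilon=0,\qquad f^\varepsilon(0,x,p)=f^{\mathrm{in}}(x,p).$$ Then for any interval $[0,I]\subset\mathbb R_+$ there is a constant $C(I)$ such that $$\|f^\varepsilon(t,\cdot,\cdot)-f^0(t,t/\varepsilon,\cdot,\cdot)\|_{L^2(\mathbb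 R^3\times\mathbb R^3)}\le C(I)\,\varepsilon,\qquad t\in[0,I],\ \varepsilon>0.$$
   Context: Constants: $m>0$ (mass), $e$ (charge, a real number), $B>0$, $\omega_c=eB/m$. The profile $\theta:\mathbb R\to\mathbb R$ is of class $C^1$ and $T$-periodic ($T>0$); $\langle\theta\rangle=\frac1T\int_0^T\theta(s)\,ds$, $\langle\theta^2\rangle=\frac1T\int_0^T\theta^2(s)\,ds$. For $x\in\mathbb R^3$, ${}^\perp x=(x_2,-x_1,0)$ and ${}^{\perp\perp}x={}^\perp({}^\perp x)=(-x_1,-x_2,0)$. The electric field $E$ is given and irrotational, $E=-\nabla_x\phi$. The variable $s\in\mathbb R$ is a parameter in the equation for $f^0$. *)

(* Defs.v *)
From HB Require Import structures.
From mathcomp Require Import all_boot all_order all_algebra.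
From mathcomp Require Import all_classical all_reals all_analysis.

Set Implicit Arguments.
Unset Strict Implicit.
Unset Printing Implicit Defensive.

Import Order.TTheory GRing.Theory Num.Theory.
Import numFieldNormedType.Exports.

Local Open Scope classical_set_scope.
Local Open Scope ring_scope.

(* The product of two sigma-finite measures.  It is given its own head constant
   because the library's sigma-finite instance is not found on [m1 \x m2]. *)
Section sigma_finite_product.
Context d1 d2 (T1 : measurableType d1) (T2 : measurableType d2) (R : realType).
Variables (m1 : {sigma_finite_measure set T1 -> \bar R})
          (m2 : {sigma_finite_measure set T2 -> \bar R}).

Definition prod_measure : set (T1 * T2) -> \bar R := (m1 \x m2)%E.

HB.instance Definition _ := Measure.on prod_measure.

Let prod_measure_sigma_finite : sigma_finite setT prod_measure.
Proof.
have /sigma_finiteP[F [TF ndF Foo]] := sigma_finiteT m1.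
have /sigma_finiteP[G [TG ndG Goo]] := sigma_finiteT m2.
exists (fun n => F n `*` G n).
  rewrite -setXTT TF TG predeqE => -[x y]; split.
    move=> [/= [n _ Fnx] [k _ Gky]]; exists (maxn n k) => //; split.
    - by move: x Fnx; exact/subsetPset/ndF/leq_maxl.
    - by move: y Gky; exact/subsetPset/ndG/leq_maxr.
  by move=> [n _ []/= ? ?]; split; exists n.
move=> k; have [? ?] := Foo k; have [? ?] := Goo k.
split; first exact: measurableX.
rewrite /prod_measure product_measure1E//.
by rewrite lte_mul_pinfty// ge0_fin_numE.
Qed.

HB.instance Definition _ :=
  Measure_isSigmaFinite.Build _ _ _ prod_measure prod_measure_sigma_finite.

End sigma_finite_product.

(* Points of R^3 are nested pairs (x1, x2, x3) = ((x1, x2), x3).  [mR3 R] is the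
   same type, with the Borel structure carried by [lebesgue_measure]. *)
Notation R3 R := (R * R * R)%type.
Notation mR3 R :=
  (measurableTypeR R * measurableTypeR R * measurableTypeR R)%type.

Section spaces.
Variable R : realType.

Definition leb : {sigma_finite_measure set (measurableTypeR R) -> \bar R} :=
  @lebesgue_measure R.

Definition leb3 : {sigma_finite_measure set (mR3 R) -> \bar R} :=
  prod_measure (prod_measure leb leb) leb.

Definition leb6 : {sigma_finite_measure set (mR3 R * mR3 R)%type -> \bar R} :=
  prod_measure leb3 leb3.

Definition lebt3 :
    {sigma_finite_measure set (measurableTypeR R * mR3 R)%type -> \bar R} :=
  prod_measure leb leb3.

Definition coord3 (i : 'I_3) (x : R3 R) : R :=
  [:: x.1.1; x.1.2; x.2]`_i.

Definition basis3 (i : 'I_3) : R3 R :=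
  ((i == 0%N :> nat)%:R, (i == 1%N :> nat)%:R, (i == 2%N :> nat)%:R).

Definition basis6 (j : 'I_3 + 'I_3) : R3 R * R3 R :=
  match j with inl i => (basis3 i, 0) | inr i => (0, basis3 i) end.

Definition perp (x : R3 R) : R3 R := (x.1.2, - x.1.1, 0).

(* Test functions are C^1 with compact support; by mollification they define the
   same weak derivatives and weak solutions as the C^oo ones. *)
Definition C1c (V : normedModType R) : set (V -> R) :=
  [set phi | [/\ forall x, differentiable phi x,
                 forall v, continuous ('D_v phi) &
                 compact (closure [set x | phi x != 0])]].

End spaces.

Section Sobolev.
Context (R : realType) d (T : measurableType d) (mu : {measure set T -> \bar R}).
Variable tests : set (T -> R).

(* [g] is the weak [D]-derivative of [u], where [D] is a first-order partial
   derivative acting on the test functions. *)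
Definition weak_derivative (D : (T -> R) -> T -> R) (u g : T -> R) :=
  forall phi, tests phi ->
    \int[mu]_z (u z * D phi z) = - \int[mu]_z (g z * phi z).

(* [u] belongs to W^{k,oo} with norm at most [M], the norm being the maximum of
   the L^oo norms of the weak derivatives of order <= k; [D] is the family of
   the first-order partial derivatives. *)
Fixpoint Woo_le (I : Type) (D : I -> (T -> R) -> T -> R) (k : nat)
    (u : T -> R) (M : R) : Prop :=
  [/\ measurable_fun setT u,
      ('N[mu]_(+oo%E)[EFin \o u] <= M%:E)%E &
      if k is k'.+1 then
        forall i, exists2 g, weak_derivative (D i) u g & Woo_le D k' g M
      else True].

End Sobolev.

Section function_spaces.
Variable R : realType.

Definition Woo3_le (k : nat) (u : R3 R -> R) (M : R) : Prop :=
  Woo_le (leb3 R) (@C1c R (R3 R)) (fun i phi => 'D_(basis3 R i) phi) k u M.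

Definition Woo6 (k : nat) (u : R3 R * R3 R -> R) : Prop :=
  exists M, Woo_le (leb6 R) (@C1c R (R3 R * R3 R)%type)
                   (fun j phi => 'D_(basis6 R j) phi) k u M.

(* u = u(t, x) is in L^1_loc(R_+; W^{k,oo}(R^3)): it is jointly measurable and
   t |-> ||u(t)|| is dominated a.e. by a locally integrable function. *)
Definition L1loc_Woo (k : nat) (u : R -> R3 R -> R) : Prop :=
  measurable_fun ([set z | 0 <= z.1] : set (measurableTypeR R * mR3 R))
    (fun z => u z.1 z.2) /\
  exists K : R -> R,
    (forall b, (leb R).-integrable `[0, b] (EFin \o K)) /\
    {ae leb R, forall t, 0 <= t -> Woo3_le k (u t) (K t)}.

(* g is the time derivative of u in the distributions on ]0, +oo[ x R^3. *)
Definition weak_dt (u g : R -> R3 R -> R) : Prop :=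
  weak_derivative (lebt3 R)
    [set phi : R * R3 R -> R | @C1c R (R * R3 R)%type phi /\
       closure [set z | phi z != 0] `<=` [set z | 0 < z.1]]
    (fun phi => 'D_((1, 0) : R * R3 R) phi)
    (fun z => u z.1 z.2) (fun z => g z.1 z.2).

Definition L1loc3 (u : R3 R -> R) : Prop :=
  measurable_fun [set: mR3 R] u /\
  forall K : set (R3 R), compact K -> (leb3 R).-integrable K (EFin \o u).

(* E = - grad phi, in the distributions on R^3. *)
Definition is_minus_gradient (E : R3 R -> R3 R) (phi : R3 R -> R) : Prop :=
  L1loc3 phi /\
  forall i, weak_derivative (leb3 R) (@C1c R (R3 R))
    (fun psi => 'D_(basis3 R i) psi) phi (fun x => - coord3 i (E x)).

Definition ae_compact_support (u : R3 R * R3 R -> R) : Prop :=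
  exists2 K : set (R3 R * R3 R), compact K &
    {ae leb6 R, forall z, ~ K z -> u z = 0}.

(* f is in C(R_+; L^2(R^3 x R^3)). *)
Definition C_L2 (f : R -> R3 R * R3 R -> R) : Prop :=
  (forall t, 0 <= t -> (f t : mR3 R * mR3 R -> R) \in Lfun (leb6 R) 2%:E) /\
  (forall t0, 0 <= t0 ->
     ('N[leb6 R]_(2%:E)[EFin \o (f t \- f t0)%R])%E
       @[t --> within `[0, +oo[ (nbhs t0)] --> 0%E).

(* f is in C(R_+; L^2) and is a weak solution of
     d_t f + a . grad_x f + F . grad_p f = 0,   f(0) = g,
   for a velocity field (a, F) with div_x a + div_p F = 0 (so that no zero-order
   term appears when the equation is integrated by parts).  The direction
   (1, (a, F)) makes 'D the operator d_t + a . grad_x + F . grad_p.  The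
   integral is iterated because a function in C(R_+; L^2) fixes each f(t) only
   up to a null set, which does not give measurability in (t, x, p). *)
Definition weak_solution (a F : R -> R3 R -> R3 R -> R3 R)
    (g : R3 R * R3 R -> R) (f : R -> R3 R * R3 R -> R) : Prop :=
  C_L2 f /\
  forall phi : R * (R3 R * R3 R) -> R, C1c phi ->
    \int[leb R]_(t in `[0, +oo[) (\int[leb6 R]_z
       (f t z * 'D_((1, (a t z.1 z.2, F t z.1 z.2)) : R * (R3 R * R3 R)) phi (t, z)))
    + \int[leb6 R]_z (g z * phi (0, z)) = 0.

Definition mean (T : R) (h : R -> R) : R :=
  T^-1 * \int[leb R]_(s in `[0, T]) h s.

End function_spaces.

Section fields.
Variables (R : realType) (m e wc T : R) (theta : R -> R) (E : R -> R3 R -> R3 R).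

Definition velocity_eps (t : R) (x p : R3 R) : R3 R := m^-1 *: p.

Definition force_eps (eps t : R) (x p : R3 R) : R3 R :=
  e *: E t x
  + (m * wc / (2 * eps) * derive1 theta (t / eps)) *: perp x
  + (wc * theta (t / eps)) *: perp p.

Definition velocity0 (s t : R) (x p : R3 R) : R3 R :=
  m^-1 *: p - (wc / 2 * (theta s - mean T theta)) *: perp x.

Definition force0 (s t : R) (x p : R3 R) : R3 R :=
  e *: E t x
  + (wc / 2 * (theta s + mean T theta)) *: perp p
  + (m * wc ^+ 2 / 4 * (mean T (fun r => theta r ^+ 2) - theta s ^+ 2))
      *: perp (perp x).

Definition initial0 (fin : R3 R * R3 R -> R) (s : R) (z : R3 R * R3 R) : R :=
  fin (z.1, z.2 - (m * wc / 2 * (theta s - theta 0)) *: perp z.1).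

End fields.

(* Main.v *)
Require Import Defs.
From HB Require Import structures.
From mathcomp Require Import all_boot all_order all_algebra.
From mathcomp Require Import all_classical all_reals all_analysis.
From mathcomp Require Import measurable_realfun ring lra.
Import Order.TTheory GRing.Theory Num.Theory.
Import numFieldNormedType.Exports.
Local Open Scope classical_set_scope.
Local Open Scope ring_scope.
Set Implicit Arguments.
Unset Strict Implicit.
Unset Printing Implicit Defensive.

(** Put [frame c (x, p)] = (x, p - c perp x), with c = (m wc / 2) theta(t / eps) for f^eps and the
    constant c = (m wc / 2) theta(s) for f^0(., s). In frame coordinates the singular term theta' /
    eps disappears and both equations become transport by fields of one form: the force e E plus a
    linear field [lfield] with two coefficients u and v. For f^eps these are theta(t / eps) and
    theta(t / eps)^2; for f^0 they are the means of theta and theta^2 ([field_eps], [field_mean]).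
    Both initial data become the same function G ([initial0_frame]), and for s = t / eps the two
    frames agree at time t. A periodic function minus its mean has a bounded primitive, so the
    coefficients of the two fields have integrals that differ by O(eps) over every interval
    ([periodic_average]). Hence trajectories stay O(eps) close and, G being Lipschitz with bounded
    support, so do the solutions in L^2.

    The solutions are only weak, and the fields have weak Lipschitz bounds that are merely
    integrable in time. Characteristics are therefore replaced by a splitting scheme. Each component
    of the field is independent of its own coordinate, so moving one coordinate at a time gives
    shears, which preserve Lebesgue measure ([shear_mpres]) and have explicit inverses. A time step
    is a composition of six shears whose amplitudes [velo] are time integrals of the field, the
    force being mollified at scale d. Mollification keeps the Lipschitz constant uniform in d and
    changes the force by O(d) almost everywhere ([mollify_C11], [mollify_close]).

    The scheme acts on test functions. Testing the weak formulation with eta(t) chi(frame z) gives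
    the evolution of the pairing of f(t) with chi ([weak_evolution]). Over one step this evolution
    is the composition of chi with the step, up to a small multiple of the step size ([step_error]).
    Telescoping shows that the pairing at time t is the datum tested against chi composed with the
    discrete flow, up to Z d + eta with Z independent of d ([consistency]). A measure-preserving
    change of variables turns this into the integral of G(Y y) psi(y), with Y the inverse discrete
    flow.

    The two inverse flows are compared by a discrete Gronwall argument with a corrector [gap], the
    integral over the remaining times of the difference of the fields. The corrector is O(eps) and
    absorbs the first-order discrepancy of each step ([iflow_close]). Letting the mesh and d tend to
    0 bounds the integral of (f^eps - f^0) psi, read in the common frame, by C eps times the
    integral of psi over a fixed ball, for every test psi with values in [0, 1] ([weak_difference]).
    Such a bound is linear in psi and so holds pointwise almost everywhere ([local_ge0]); the L^2
    estimate follows ([difference_norm]). *)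

Notation V R := (R3 R * R3 R)%type.
Notation mV R := (mR3 R * mR3 R)%type.
Notation J := ('I_3 + 'I_3)%type.

(** * Coordinates, max norm and measurability on R^6 *)

Section coordinates.
Variable R : realType.
Implicit Types z h : V R.

Definition coord6 (j : J) (z : V R) : R :=
  match j with inl i => coord3 i z.1 | inr i => coord3 i z.2 end.

Lemma ord3_cases (P : 'I_3 -> Prop) :
  P (@Ordinal 3 0 isT) -> P (@Ordinal 3 1 isT) -> P (@Ordinal 3 2 isT) ->
  forall i, P i.
Proof.
by move=> P0 P1 P2 [[|[|[|//]]] i3]; [move: P0|move: P1|move: P2];
  rewrite (bool_irrelevance isT i3).
Qed.

Lemma coord3D (i : 'I_3) (x y : R3 R) :
  coord3 i (x + y) = coord3 i x + coord3 i y.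
Proof. by elim/ord3_cases: i. Qed.

Lemma coord3Z (i : 'I_3) a (x : R3 R) : coord3 i (a *: x) = a * coord3 i x.
Proof. by elim/ord3_cases: i. Qed.

Lemma coord6D j z h : coord6 j (z + h) = coord6 j z + coord6 j h.
Proof. by case: j => i /=; rewrite coord3D. Qed.

Lemma coord6Z j a z : coord6 j (a *: z) = a * coord6 j z.
Proof. by case: j => i /=; rewrite coord3Z. Qed.

Lemma coord6N j z : coord6 j (- z) = - coord6 j z.
Proof. by rewrite -scaleN1r coord6Z mulN1r. Qed.

Lemma coord6B j z h : coord6 j (z - h) = coord6 j z - coord6 j h.
Proof. by rewrite coord6D coord6N. Qed.

Lemma coord60 j : coord6 j 0 = 0.
Proof. by rewrite -(scale0r 0) coord6Z mul0r. Qed.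

Lemma coord6_sum (I : Type) (s : seq I) (F : I -> V R) j :
  coord6 j (\sum_(i <- s) F i) = \sum_(i <- s) coord6 j (F i).
Proof. by apply: (big_morph (coord6 j)); [exact: coord6D|exact: coord60]. Qed.

Lemma coord6_basis j k : coord6 j (basis6 R k) = (j == k)%:R.
Proof.
by case: j k => [i|i] [k|k]; elim/ord3_cases: i; elim/ord3_cases: k.
Qed.

Lemma normr_coord3 (i : 'I_3) (x : R3 R) : `|coord3 i x| <= `|x|.
Proof.
rewrite !prod_normE/=; elim/ord3_cases: i; rewrite /coord3/= !le_max lexx ?orbT//.
Qed.

Lemma normr_coord6 j z : `|coord6 j z| <= `|z|.
Proof.
by rewrite prod_normE; case: j => i /=;
  rewrite le_max normr_coord3 ?orbT.
Qed.

Lemma coord6_inj z h : (forall j, coord6 j z = coord6 j h) -> z = h.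
Proof.
case: z => [[[a b] c] [[d e] f]]; case: h => [[[a' b'] c'] [[d' e'] f']] H.
have := H (inl (@Ordinal 3 0 isT)); have := H (inl (@Ordinal 3 1 isT)).
have := H (inl (@Ordinal 3 2 isT)); have := H (inr (@Ordinal 3 0 isT)).
have := H (inr (@Ordinal 3 1 isT)); have := H (inr (@Ordinal 3 2 isT)).
by rewrite /coord6 /coord3 /= => -> -> -> -> -> ->.
Qed.

Lemma normr_le_coord6 z M :
  (forall j, `|coord6 j z| <= M) -> `|z| <= M.
Proof.
case: z => [[[a b] c] [[d e] f]] H.
have := H (inl (@Ordinal 3 0 isT)); have := H (inl (@Ordinal 3 1 isT)).
have := H (inl (@Ordinal 3 2 isT)); have := H (inr (@Ordinal 3 0 isT)).
have := H (inr (@Ordinal 3 1 isT)); have := H (inr (@Ordinal 3 2 isT)).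
rewrite /coord6 /coord3 /= !prod_normE /= => Hf He Hd Hc Hb Ha.
by rewrite !ge_max Ha Hb Hc Hd He Hf.
Qed.

Lemma coord6E z : z = \sum_(j : J) coord6 j z *: basis6 R j.
Proof.
apply: coord6_inj => j; rewrite coord6_sum (bigD1 j)//= big1 ?addr0.
  by rewrite coord6Z coord6_basis eqxx mulr1.
by move=> k kj; rewrite coord6Z coord6_basis eq_sym (negbTE kj) mulr0.
Qed.

Lemma normr_basis6 j : `|basis6 R j| <= 1.
Proof.
apply: normr_le_coord6 => k; rewrite coord6_basis.
by case: (k == j); rewrite ?normr1 ?normr0.
Qed.

Lemma measurable_coord6 j : measurable_fun [set: mV R] (coord6 j).
Proof.
case: j => i; elim/ord3_cases: i; rewrite /coord6 /coord3 /=;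
  repeat (apply: measurableT_comp => //).
Qed.

Lemma measurable_V d (T : measurableType d) (F : T -> mV R) :
  (forall j, measurable_fun setT (fun t => coord6 j (F t))) ->
  measurable_fun setT F.
Proof.
move=> H.
have := H (inl (@Ordinal 3 0 isT)); have := H (inl (@Ordinal 3 1 isT)).
have := H (inl (@Ordinal 3 2 isT)); have := H (inr (@Ordinal 3 0 isT)).
have := H (inr (@Ordinal 3 1 isT)); have := H (inr (@Ordinal 3 2 isT)).
rewrite /coord6 /coord3 /= => H5 H4 H3 H2 H1 H0.
apply/measurable_fun_pairP; split; apply/measurable_fun_pairP; split => //;
  by apply/measurable_fun_pairP; split.
Qed.

Lemma measurable_addV d (T : measurableType d) (F G : T -> mV R) :
  measurable_fun setT F -> measurable_fun setT G ->
  measurable_fun setT (fun t => ((F t : V R) + (G t : V R)) : mV R).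
Proof.
move=> mF mG; apply: measurable_V => j; under eq_fun do rewrite coord6D.
by apply: measurable_funD; apply: (measurableT_comp (measurable_coord6 j)).
Qed.

Lemma measurable_scaleV d (T : measurableType d) (a : T -> R) (F : T -> mV R) :
  measurable_fun setT a -> measurable_fun setT F ->
  measurable_fun setT (fun t => (a t *: (F t : V R)) : mV R).
Proof.
move=> mF mG; apply: measurable_V => j; under eq_fun do rewrite coord6Z.
by apply: measurable_funM => //; apply: (measurableT_comp (measurable_coord6 j)).
Qed.

Lemma measurable_normV : measurable_fun [set: mV R] (fun z : V R => `|z|).
Proof.
rewrite (_ : (fun z : V R => `|z|) = (fun z : V R =>
    Num.max (Num.max (Num.max `|z.1.1.1| `|z.1.1.2|) `|z.1.2|)
     (Num.max (Num.max `|z.2.1.1| `|z.2.1.2|) `|z.2.2|)))//.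
repeat apply: measurable_maxr; apply: measurableT_comp => //;
  repeat (apply: measurableT_comp => //).
Qed.

End coordinates.

(** Vector identities of R^6 become ring identities on a generic coordinate. *)
Ltac vring := apply: coord6_inj => ?;
  rewrite ?(coord6D, coord6B, coord6N, coord6Z, coord60); ring.

(** * Functions with a Lipschitz differential *)

Section C11.
Variable R : realType.
Implicit Types (f g chi : V R -> R) (z h k : V R).

(* [D z] is the differential of [f] at [z]; the Taylor bound makes [D] Lipschitz. *)
Definition C11 (L H : R) f (D : V R -> V R -> R) : Prop :=
  [/\ forall z a h k, D z (a *: h + k) = a * D z h + D z k,
      forall z h, `|D z h| <= L * `|h|,
      forall z h, `|f (z + h) - f z - D z h| <= H * `|h| ^+ 2,
      measurable_fun [set: mV R] f &
      forall h, measurable_fun [set: mV R] (D^~ h)].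

Definition vanish_off (rho : R) f : Prop := forall z, rho < `|z| -> f z = 0.

Variables (L H : R) (f : V R -> R) (D : V R -> V R -> R).
Hypothesis fC : C11 L H f D.

Lemma C11_D z h k : D z (h + k) = D z h + D z k.
Proof. by case: fC => lin _ _ _ _; rewrite -{1}[h]scale1r lin mul1r. Qed.

Lemma C11_0 z : D z 0 = 0.
Proof.
by apply: (@addIr _ (D z 0)); rewrite -C11_D !add0r.
Qed.

Lemma C11_Z z a h : D z (a *: h) = a * D z h.
Proof. by case: fC => lin _ _ _ _; rewrite -{1}[a *: h]addr0 lin C11_0 addr0. Qed.

Lemma C11_sum (I : Type) (s : seq I) (F : I -> V R) z :
  D z (\sum_(i <- s) F i) = \sum_(i <- s) D z (F i).
Proof. by apply: (big_morph (D z)); [exact: C11_D|exact: C11_0]. Qed.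

Lemma C11_B z h k : D z (h - k) = D z h - D z k.
Proof. by rewrite C11_D -scaleN1r C11_Z mulN1r. Qed.

Lemma normr_basis6_gt0 : exists h : V R, `|h| = 1.
Proof.
exists (basis6 R (inl ord0)); apply/eqP; rewrite eq_le normr_basis6/=.
by have := normr_coord6 (inl ord0) (basis6 R (inl ord0)); rewrite coord6_basis normr1.
Qed.

Lemma C11_L_ge0 : 0 <= L.
Proof.
have [h h1] := normr_basis6_gt0; case: fC => _ + _ _ _ => /(_ 0 h).
by rewrite h1 mulr1; exact: le_trans.
Qed.

Lemma C11_H_ge0 : 0 <= H.
Proof.
have [h h1] := normr_basis6_gt0; case: fC => _ _ + _ _ => /(_ 0 h).
by rewrite h1 expr1n mulr1; exact: le_trans.
Qed.

(* Subdividing the segment [z, z + h] makes the Taylor remainders negligible. *)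
Lemma C11_lip z h : `|f (z + h) - f z| <= L * `|h|.
Proof.
have L0 := C11_L_ge0; have H0 := C11_H_ge0.
case: fC => _ DL TH _ _.
suff step n : `|f (z + h) - f z| <= L * `|h| + H * `|h| ^+ 2 / n.+1%:R.
  apply/ler_addgt0Pr => e e0.
  have [n hn] : exists n : nat, H * `|h| ^+ 2 / e < n.+1%:R.
    exists (Num.truncn (H * `|h| ^+ 2 / e)); exact: truncnS_gt.
  apply: (le_trans (step n)); rewrite lerD2l.
  by rewrite ler_pdivrMr ?ltr0n// [e * _]mulrC -ler_pdivrMr// ltW.
pose x i := z + (i%:R / n.+1%:R) *: h.
have xS i : x i.+1 = x i + n.+1%:R^-1 *: h.
  by rewrite /x -addrA -scalerDl -natr1 mulrDl mul1r.
have -> : f (z + h) - f z = \sum_(0 <= i < n.+1) (f (x i.+1) - f (x i)).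
  by rewrite telescope_sumr// /x divff// scale1r mul0r scale0r addr0.
apply: (le_trans (ler_norm_sum _ _ _)).
have -> : L * `|h| + H * `|h| ^+ 2 / n.+1%:R =
   \sum_(0 <= i < n.+1) (L * (`|h| / n.+1%:R) + H * (`|h| / n.+1%:R) ^+ 2).
  rewrite big_const_nat subn0 iter_addr_0 -[RHS]mulr_natr.
  have : n.+1%:R != 0 :> R by rewrite pnatr_eq0.
  by move: (n.+1%:R) => a a0; field.
apply: ler_sum => i _; rewrite xS.
have nh : `|n.+1%:R^-1 *: h| = `|h| / n.+1%:R.
  by rewrite normrZ ger0_norm ?invr_ge0// mulrC.
rewrite -nh [leRHS]addrC.
have := TH (x i) (n.+1%:R^-1 *: h); have := DL (x i) (n.+1%:R^-1 *: h).
set A := f _ - f _; set B := D _ _ => h1 h2.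
apply: le_trans (lerD h2 h1).
by rewrite -{1}(subrK B A); exact: ler_normD.
Qed.

(** Combine the Taylor expansions at z along h, at z along h + k and at z + h along k. Once k is
    rescaled to the norm of h, the remainders are at most H|h|^2, 4H|h|^2 and H|h|^2, whence the
    factor 6. *)
Lemma C11_grad_lip z h k : `|D (z + h) k - D z k| <= 6 * H * `|h| * `|k|.
Proof.
have H0 := C11_H_ge0; case: (fC) => _ DL TH _ _.
have [->|k0] := eqVneq k 0; first by rewrite !C11_0 subrr normr0 mulr_ge0// !mulr_ge0.
have [->|h0] := eqVneq h 0; first by rewrite addr0 subrr normr0 mulr_ge0// !mulr_ge0.
have nk : 0 < `|k| by rewrite normr_gt0.
have nh : 0 < `|h| by rewrite normr_gt0.
pose k' := (`|h| / `|k|) *: k.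
have nk' : `|k'| = `|h|.
  by rewrite normrZ ger0_norm ?divr_ge0// divfK ?gt_eqF.
suff : `|D (z + h) k' - D z k'| <= 6 * H * `|h| ^+ 2.
  rewrite !C11_Z -mulrBr normrM ger0_norm ?divr_ge0// mulrAC ler_pdivrMr//.
  rewrite (_ : 6 * H * `|h| ^+ 2 * `|k| = `|h| * (6 * H * `|h| * `|k|)) ?ler_pM2l//.
  by ring.
have t1 := TH (z + h) k'; have t2 := TH z h; have t3 := TH z (h + k').
rewrite C11_D addrA in t3.
have t4 : H * `|h + k'| ^+ 2 <= 4 * H * `|h| ^+ 2.
  have : `|h + k'| <= 2 * `|h|.
    by apply: (le_trans (ler_normD _ _)); rewrite nk'; lra.
  move=> hk; have : `|h + k'| ^+ 2 <= (2 * `|h|) ^+ 2 by rewrite ler_sqr ?nnegrE// mulr_ge0.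
  move=> /(ler_wpM2l H0) /le_trans; apply; rewrite exprMn; lra.
rewrite nk' in t1.
move: t1 t2 t3 t4; set A := f (z + h + k'); set B := f (z + h); set X := D _ k'.
set Y := D z k'; set Z := D z h; set W := H * _.
move=> t1 t2 t3 t4.
have -> : X - Y = (A - f z - (Z + Y)) - (A - B - X) - (B - f z - Z) by ring.
apply: (le_trans (ler_normB _ _)).
have := ler_normB (A - f z - (Z + Y)) (A - B - X).
rewrite -mulrA -/W in t4; rewrite -mulrA -/W.
by move: (H * `|h + k'| ^+ 2) W t1 t2 t3 t4 => ? ? *; lra.
Qed.

(** Outside the support, f vanishes at z and at z + a h for small a, so the Taylor bound leaves |D z
    h| <= a H |h|^2. *)
Lemma C11_D_vanish rho : vanish_off rho f ->
  forall z h, rho < `|z| -> D z h = 0.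
Proof.
move=> f0 z h zr; have H0 := C11_H_ge0; case: fC => _ _ TH _ _.
apply/eqP; rewrite -normr_le0; apply/ler_addgt0Pr => e e0; rewrite add0r.
pose M := H * `|h| ^+ 2 + 1; pose N := `|h| + 1.
have M0 : 0 < M by rewrite ltr_wpDl// mulr_ge0// exprn_ge0.
have N0 : 0 < N by rewrite ltr_wpDl.
(* Small enough both to keep z + a h outside the ball of radius rho and to bring the remainder below
   [e]. *)
pose a := Num.min (e / M) ((`|z| - rho) / N).
have a0 : 0 < a by rewrite lt_min !divr_gt0// subr_gt0.
have zar : rho < `|z + a *: h|.
  have : `|a *: h| < `|z| - rho.
    rewrite normrZ gtr0_norm//; have : a <= (`|z| - rho) / N by rewrite ge_min lexx orbT.
    rewrite ler_pdivlMr// => /(lt_le_trans _); apply; rewrite ltr_pM2l// /N; lra.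
  have := lerB_dist z (- (a *: h)); rewrite opprK normrN => ? ?; lra.
have := TH z (a *: h); rewrite (f0 _ zar) (f0 _ zr) subrr sub0r normrN C11_Z.
rewrite normrM normrZ gtr0_norm// exprMn => A.
have : `|D z h| <= a * (H * `|h| ^+ 2).
  by rewrite -(ler_pM2l a0); apply: (le_trans A); rewrite le_eqVlt; apply/orP; left; apply/eqP; ring.
move=> /le_trans; apply; apply: (@le_trans _ _ (e / M * M)); last by rewrite divfK// gt_eqF.
apply: ler_pM => //; [exact: ltW|by rewrite mulr_ge0// exprn_ge0|by rewrite ge_min lexx|].
by rewrite /M lerDl.
Qed.

End C11.

(** * Sums, products and compositions with shears *)

Section C11_ops.
Variable R : realType.
Implicit Types (f g chi : V R -> R) (z h k : V R).

Lemma C11_le (L L' H H' : R) f D :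
  L <= L' -> H <= H' -> C11 L H f D -> C11 L' H' f D.
Proof.
move=> LL HH [a b c d e]; split => // z h.
  by apply: (le_trans (b z h)); rewrite ler_wpM2r.
by apply: (le_trans (c z h)); rewrite ler_wpM2r// exprn_ge0.
Qed.

Lemma C11_cst (c : R) : C11 0 0 (fun=> c) (fun _ _ => 0).
Proof.
by split=> *; rewrite ?mulr0 ?mul0r ?addr0 ?subrr ?subr0 ?normr0 //; exact: measurable_cst.
Qed.

Lemma C11_lin (a : R) (L L' H H' : R) f D g D' :
  C11 L H f D -> C11 L' H' g D' ->
  C11 (`|a| * L + L') (`|a| * H + H') (fun z => a * f z + g z)
    (fun z h => a * D z h + D' z h).
Proof.
move=> [f1 f2 f3 f4 f5] [g1 g2 g3 g4 g5]; split=> [z b h k|z h|z h||h].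
- by rewrite f1 g1; ring.
- rewrite mulrDl; apply: (le_trans (ler_normD _ _)); apply: lerD => //.
  by rewrite normrM -mulrA ler_wpM2l.
- rewrite [X in `|X|](_ : _ = a * (f (z + h) - f z - D z h) +
    (g (z + h) - g z - D' z h)); last by ring.
  rewrite mulrDl; apply: (le_trans (ler_normD _ _)); apply: lerD => //.
  by rewrite normrM -mulrA ler_wpM2l.
- by apply: measurable_funD => //; exact: measurable_funM.
- by apply: measurable_funD => //; exact: measurable_funM.
Qed.

Lemma C11_mul (M M' L L' H H' : R) f D g D' :
  (forall z, `|f z| <= M) -> (forall z, `|g z| <= M') ->
  C11 L H f D -> C11 L' H' g D' ->
  C11 (M' * L + M * L') (M * H' + L * L' + M' * H) (fun z => f z * g z)
    (fun z h => g z * D z h + f z * D' z h).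
Proof.
move=> fM gM fC gC; have lf := C11_lip fC; have lg := C11_lip gC.
have L0 := C11_L_ge0 fC; have L'0 := C11_L_ge0 gC.
case: fC gC => [f1 f2 f3 f4 f5] [g1 g2 g3 g4 g5]; split=> [z b h k|z h|z h||h].
- by rewrite f1 g1; ring.
- rewrite mulrDl; apply: (le_trans (ler_normD _ _)); apply: lerD;
    by rewrite normrM -mulrA ler_pM.
- rewrite [X in `|X|](_ : _ = f (z + h) * (g (z + h) - g z - D' z h) +
     (f (z + h) - f z) * D' z h + g z * (f (z + h) - f z - D z h)); last by ring.
  rewrite [leRHS]mulrDl; apply: (le_trans (ler_normD _ _)); apply: lerD.
    rewrite [leRHS]mulrDl; apply: (le_trans (ler_normD _ _)); apply: lerD.
      by rewrite normrM -mulrA ler_pM.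
    rewrite normrM (_ : L * L' * _ = (L * `|h|) * (L' * `|h|)); last by ring.
    by rewrite ler_pM.
  by rewrite normrM -mulrA ler_pM.
- exact: measurable_funM.
- by apply: measurable_funD => //; exact: measurable_funM.
Qed.

(** The elementary motion of the whole scheme: it preserves volume as soon as the amplitude [B] does
    not depend on the coordinate being moved. *)
Definition shear (j : J) (B : V R -> R) (z : V R) : V R := z + B z *: basis6 R j.

(** The shear has increments of size at most (1 + k)|h|, at which the Taylor bound of chi is used;
    the Taylor remainder of [B] enters through the bound L on the differential of chi. *)
Lemma C11_shear (L H k k' : R) chi D j B DB :
  C11 L H chi D -> C11 k k' B DB ->
  C11 (L * (1 + k)) (H * (1 + k) ^+ 2 + L * k') (chi \o shear j B)
    (fun z h => D (shear j B z) (h + DB z h *: basis6 R j)).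
Proof.
move=> cC BC; have lB := C11_lip BC; have H0 := C11_H_ge0 cC.
have L0 := C11_L_ge0 cC; have k0 := C11_L_ge0 BC; have k'0 := C11_H_ge0 BC.
have mS : measurable_fun setT (shear j B : mV R -> mV R).
  apply: measurable_addV => //; apply: measurable_scaleV => //.
  by case: BC.
have DD := C11_D cC; have DZ := C11_Z cC.
case: (cC) (BC) => [c1 c2 c3 c4 c5] [b1 b2 b3 b4 b5]; split=> [z a h l|z h|z h||h].
- rewrite b1 -c1; congr (D _ _).
  by rewrite scalerDr !scalerA scalerDl addrACA.
- apply: (le_trans (c2 _ _)); rewrite -mulrA ler_wpM2l// mulrDl mul1r.
  apply: (le_trans (ler_normD _ _)); rewrite lerD2l normrZ.
  by apply: le_trans (b2 z h); rewrite ler_piMr ?normr_basis6.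
- rewrite /comp; set e := basis6 R j.
  have nk : `|h + (B (z + h) - B z) *: e| <= (1 + k) * `|h|.
    rewrite mulrDl mul1r; apply: (le_trans (ler_normD _ _)); rewrite lerD2l normrZ.
    by apply: le_trans (lB z h); rewrite ler_piMr ?normr_basis6.
  have -> : shear j B (z + h) = shear j B z + (h + (B (z + h) - B z) *: e).
    by rewrite /shear; vring.
  set w := shear j B z; set l := h + _.
  rewrite [X in `|X|](_ : _ = (chi (w + l) - chi w - D w l) +
      D w ((B (z + h) - B z - DB z h) *: e)); last first.
    have -> : h + DB z h *: e = l - (B (z + h) - B z - DB z h) *: e.
      by rewrite /l; vring.
    by rewrite (C11_B cC); ring.
  rewrite mulrDl; apply: (le_trans (ler_normD _ _)); apply: lerD.
    apply: (le_trans (c3 _ _)); rewrite -mulrA ler_wpM2l// -exprMn.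
    by rewrite ler_sqr ?nnegrE// mulr_ge0// addr_ge0.
  rewrite DZ normrM [L * k']mulrC -mulrA.
  have := c2 w e; have := b3 z h; have := normr_basis6 R j.
  rewrite -/e => ne hb hd.
  rewrite (_ : k' * (L * `|h| ^+ 2) = (k' * `|h| ^+ 2) * L); last by ring.
  apply: ler_pM => //; apply: (le_trans hd); by rewrite ler_piMr.
- exact: measurableT_comp.
- under eq_fun do rewrite DD DZ.
  apply: measurable_funD.
    exact: (measurableT_comp (c5 h) mS).
  apply: measurable_funM => //; exact: (measurableT_comp (c5 _) mS).
Qed.

End C11_ops.

(** * A one-variable cutoff *)

Section smooth_step.
Variable R : realType.
Implicit Types t s : R.

(** Building block of the cutoff: its derivative 2 max(0, s) is Lipschitz, so its Taylor remainder
    is quadratic on the whole line. *)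
Definition sq_pos s : R := Num.max 0 s ^+ 2.

(* Quadratic spline: 0 on ]-oo, 0], 1 on [2, +oo[, with a tent-shaped derivative. *)
Definition step t : R := (sq_pos t - 2 * sq_pos (t - 1) + sq_pos (t - 2)) / 2.
Definition dstep t : R :=
  Num.max 0 t - 2 * Num.max 0 (t - 1) + Num.max 0 (t - 2).

Lemma sq_pos_taylor s (h : R) : `|sq_pos (s + h) - sq_pos s - 2 * Num.max 0 s * h| <= h ^+ 2.
Proof.
rewrite /sq_pos ler_norml; case: (leP 0 s) => s0; case: (leP 0 (s + h)) => sh0;
  apply/andP; split; nra.
Qed.

Lemma step_taylor t (h : R) : `|step (t + h) - step t - dstep t * h| <= 2 * h ^+ 2.
Proof.
rewrite /step /dstep.
have := sq_pos_taylor t h; have := sq_pos_taylor (t - 1) h.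
have := sq_pos_taylor (t - 2) h.
rewrite (addrAC t (-1)) (addrAC t (-2)); rewrite !ler_norml.
move=> /andP[? ?] /andP[? ?] /andP[? ?]; apply/andP; split; lra.
Qed.

Lemma dstep_bound t : 0 <= dstep t <= 1.
Proof.
rewrite /dstep; case: (leP 0 t) => ?; case: (leP 0 (t - 1)) => ?;
  case: (leP 0 (t - 2)) => ?; apply/andP; split; lra.
Qed.

Lemma step0 t : t <= 0 -> step t = 0.
Proof.
move=> t0; rewrite /step /sq_pos !max_l; [|lra|lra|lra].
by rewrite expr0n /=; lra.
Qed.

Lemma step1 t : 2 <= t -> step t = 1.
Proof.
move=> t0; rewrite /step /sq_pos !max_r; [|lra|lra|lra].
by field.
Qed.

Lemma step_bound t : 0 <= step t <= 1.
Proof.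
rewrite /step /sq_pos; case: (leP 0 t) => ?; case: (leP 0 (t - 1)) => ?;
  case: (leP 0 (t - 2)) => ?; apply/andP; split; nra.
Qed.

Lemma normr_step t : `|step t| <= 1.
Proof. by have /andP[? ?] := step_bound t; rewrite ger0_norm. Qed.

Lemma continuous_dstep : continuous dstep.
Proof.
move=> t; rewrite /dstep.
have M (a : R) : {for t, continuous (fun t => Num.max 0 (t - a))}.
  apply: (@continuous_max _ _ (cst 0) (fun t => t - a)); first exact: cvg_cst.
  by move=> ?; apply: cvgB; [exact: cvg_id|exact: cvg_cst].
apply: cvgD; first apply: cvgB; last exact: M.
  by have := M 0; rewrite (_ : (fun x => _) = Num.max 0) //; apply/funext => x; rewrite subr0.
by apply: cvgM; [exact: cvg_cst|exact: M].
Qed.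

Lemma measurable_step : measurable_fun [set: R] step.
Proof.
have M (a : R) : measurable_fun [set: R] (fun t => sq_pos (t - a)).
  apply: measurable_funX; apply: measurable_maxr => //.
  by apply: measurable_funB.
apply: measurable_funM => //; apply: measurable_funD => //.
apply: measurable_funB; last exact: measurable_funM.
by have := M 0; congr (measurable_fun _ _); apply/funext => x; rewrite subr0.
Qed.

Lemma measurable_dstep : measurable_fun [set: R] dstep.
Proof.
exact: continuous_measurable_fun continuous_dstep.
Qed.

Lemma C11_step (a b : R) (j : J) :
  C11 `|a| (2 * a ^+ 2) (fun z => step (a * coord6 j z + b))
   (fun z h => dstep (a * coord6 j z + b) * (a * coord6 j h)).
Proof.
have mc := @measurable_coord6 R j.
have ml : measurable_fun [set: mV R] (fun z => a * coord6 j z + b).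
  by apply: measurable_funD => //; exact: measurable_funM.
split=> [z c h k|z h|z h||h].
- by rewrite coord6D coord6Z; ring.
- rewrite normrM; have /andP[d0 d1] := dstep_bound (a * coord6 j z + b).
  rewrite (ger0_norm d0) normrM; apply: (le_trans (ler_piMl _ d1)).
    by rewrite mulr_ge0.
  by rewrite ler_wpM2l// normr_coord6.
- have := step_taylor (a * coord6 j z + b) (a * coord6 j h).
  rewrite (_ : a * coord6 j (z + h) + b = a * coord6 j z + b + a * coord6 j h); last first.
    by rewrite coord6D; ring.
  move=> /le_trans; apply; rewrite exprMn -mulrA ler_pM2l// ler_wpM2l ?sqr_ge0//.
  by rewrite -real_normK ?num_real// ler_sqr ?nnegrE// normr_coord6.
- exact: (measurableT_comp measurable_step).
- by apply: measurable_funM => //; exact: (measurableT_comp measurable_dstep).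
Qed.

End smooth_step.

(** * Cutoffs on R^6 *)

Section bump.
Variable R : realType.
Implicit Types (z h : V R).

Definition isC11 (f : V R -> R) := exists L H D, C11 L H f D.

Lemma isC11_prod (I : Type) (s : seq I) (F : I -> V R -> R) :
  (forall i, isC11 (F i)) -> (forall i z, 0 <= F i z <= 1) ->
  isC11 (fun z => \prod_(i <- s) F i z) /\
  forall z, 0 <= \prod_(i <- s) F i z <= 1.
Proof.
move=> FC F01; elim: s => [|i s [[L [H [D IC]]] I01]].
  split=> [|z]; last by rewrite big_nil ler01 lexx.
  exists 0, 0, (fun _ _ => 0).
  by under eq_fun do rewrite big_nil; exact: C11_cst.
split=> [|z].
  have [L' [H' [D' IC']]] := FC i.
  under eq_fun do rewrite big_cons.
  do 3 eexists; apply: (C11_mul (M:=1) (M':=1) _ _ IC' IC) => z.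
    by have /andP[a b] := F01 i z; rewrite ger0_norm.
  by have /andP[a b] := I01 z; rewrite ger0_norm.
rewrite big_cons; have /andP[a b] := F01 i z; have /andP[c d] := I01 z.
by rewrite mulr_ge0// mulr_ile1.
Qed.

(** Product over the six coordinates of a rising and a falling ramp of width [w]. For the max norm
    it is 1 on the ball of radius [r] and vanishes outside the ball of radius r + w. *)
Definition bump (r w : R) z : R :=
  \prod_(j <- enum {: J}) (step ((2 / w) * coord6 j z + (2 * (r + w) / w)) *
     step ((- (2 / w)) * coord6 j z + (2 * (r + w) / w))).

Lemma bump_C11 r w : isC11 (bump r w) /\ forall z, 0 <= bump r w z <= 1.
Proof.
apply: isC11_prod => [j|j z]; last first.
  set a := step _; set b := step _.
  have /andP[? ?] : 0 <= a <= 1 by exact: step_bound.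
  have /andP[? ?] : 0 <= b <= 1 by exact: step_bound.
  by rewrite mulr_ge0// mulr_ile1.
do 3 eexists; apply: (C11_mul (M:=1) (M':=1) _ _ (C11_step _ _ j) (C11_step _ _ j)) => z;
  exact: normr_step.
Qed.

Lemma bump1 r w z : 0 < w -> `|z| <= r -> bump r w z = 1.
Proof.
move=> w0 zr; rewrite /bump big1 // => j _.
have : `|coord6 j z| <= r := le_trans (normr_coord6 _ _) zr.
rewrite ler_norml => /andP[l u].
have e1 : 2 <= 2 / w * coord6 j z + 2 * (r + w) / w.
  rewrite (_ : _ + _ = (2 * coord6 j z + 2 * (r + w)) / w); last by ring.
  rewrite ler_pdivlMr//; lra.
have e2 : 2 <= - (2 / w) * coord6 j z + 2 * (r + w) / w.
  rewrite (_ : _ + _ = (- (2 * coord6 j z) + 2 * (r + w)) / w); last by ring.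
  rewrite ler_pdivlMr//; lra.
by rewrite !step1 ?mulr1.
Qed.

Lemma bump_vanish r w : 0 < w -> vanish_off (r + w) (bump r w).
Proof.
move=> w0 z zr.
have [j hj] : exists j, r + w < `|coord6 j z|.
  apply/not_existsP => H; move: zr; apply/negP; rewrite -leNgt.
  by apply: normr_le_coord6 => j; rewrite leNgt; apply/negP => /H.
rewrite /bump (bigD1_seq j) ?mem_enum ?enum_uniq//=.
suff -> : step (2 / w * coord6 j z + 2 * (r + w) / w) *
  step (- (2 / w) * coord6 j z + 2 * (r + w) / w) = 0 by rewrite mul0r.
case: (leP 0 (coord6 j z)) hj => z0 hj.
  rewrite [X in _ * X]step0 ?mulr0//.
  rewrite (_ : _ + _ = (- (2 * coord6 j z) + 2 * (r + w)) / w); last by ring.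
  rewrite pmulr_lle0 ?invr_gt0//; move: hj; rewrite ger0_norm//; lra.
rewrite step0 ?mul0r// (_ : _ + _ = (2 * coord6 j z + 2 * (r + w)) / w); last by ring.
rewrite pmulr_lle0 ?invr_gt0//; move: hj; rewrite ltr0_norm//; lra.
Qed.

End bump.

(** * Admissibility of these functions as test functions *)

Section test_functions.
Variable R : realType.

Definition compact_balls (U : normedModType R) :=
  forall rho : R, compact [set x : U | `|x| <= rho].

Lemma compact_balls_R : compact_balls R.
Proof.
move=> rho; have := @segment_compact R (- rho) rho.
congr compact; apply/seteqP; split => x /=; by rewrite in_itv/= ler_norml.
Qed.

Lemma compact_balls_prod (U W : normedModType R) :
  compact_balls U -> compact_balls W -> compact_balls (U * W)%type.
Proof.
move=> cU cW rho; have := compact_setX (cU rho) (cW rho).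
congr compact; apply/seteqP; split => x /=; rewrite prod_normE ge_max.
  by move=> [-> ->].
by move=> /andP[].
Qed.

Lemma compact_balls_R3 : compact_balls (R3 R).
Proof.
have cR := compact_balls_R; exact: (compact_balls_prod (compact_balls_prod cR cR) cR).
Qed.

Lemma compact_balls_V : compact_balls (V R).
Proof. exact: (compact_balls_prod compact_balls_R3 compact_balls_R3). Qed.

Lemma compact_support (U : normedModType R) (f : U -> R) rho : compact_balls U ->
  (forall x, rho < `|x| -> f x = 0) -> compact (closure [set x | f x != 0]).
Proof.
move=> cU f0; have cb := cU rho.
apply: (subclosed_compact (@closed_closure _ _) cb).
rewrite closureE; apply: smallest_sub.
  by apply: compact_closed => //; exact: norm_hausdorff.
by move=> x /=; rewrite leNgt => fx; apply/negP => /f0 /eqP; exact/negP.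
Qed.

Lemma taylor_is_diff (U : normedModType R) (f : U -> R) (D : {linear U -> R}) (L H : R) z :
  (forall h, `|D h| <= L * `|h|) ->
  (forall h, `|f (z + h) - f z - D h| <= H * `|h| ^+ 2) -> is_diff z f D.
Proof.
move=> DL TH.
have cD : continuous D.
  apply: bounded_linear_continuous; apply/linear_boundedP; exists L.
  split=> [|M /ltW LM h]; first exact: num_real.
  by apply: (le_trans (DL h)); rewrite ler_wpM2r.
have fD : f \o shift z = cst (f z) + D +o_ 0 id.
  apply/eqaddoP => e e0.
  have k0 : 0 < e / (`|H| + 1) by rewrite divr_gt0// ltr_wpDl.
  have := @nbhs0_lt _ U _ k0; apply: filterS => h /= /ltW hk.
  rewrite [X in `|X|](_ : _ = f (z + h) - f z - D h); last first.
    by rewrite !fctE /= opprD addrA (addrC z).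
  apply: (le_trans (TH h)); rewrite expr2 mulrA ler_wpM2r//.
  apply: (@le_trans _ _ (`|H| * `|h|)); first by rewrite ler_wpM2r// ler_norm.
  apply: (le_trans (ler_wpM2l _ hk)) => //; rewrite mulrCA ler_piMr ?(ltW e0)//.
  by rewrite ler_pdivrMr ?mul1r ?lerDl// ltr_wpDl.
have dE := diff_unique cD fD.
apply: DiffDef => //; apply/diff_locallyP; rewrite dE; split => //.
Qed.

Section taylor_C1c.
Variables (U : normedModType R) (L H C r : R) (f : U -> R) (D : U -> U -> R).
Hypothesis linD : forall z a h k, D z (a *: h + k) = a * D z h + D z k.
Hypothesis DL : forall z h, `|D z h| <= L * `|h|.
Hypothesis fT : forall z h, `|f (z + h) - f z - D z h| <= H * `|h| ^+ 2.

Lemma taylor_derive z v : differentiable f z /\ 'D_v f z = D z v.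
Proof.
have lD : linear (D z : U -> R^o) by move=> a h k; exact: linD.
pose isL := GRing.isLinear.Build R U R *:%R (D z) lD.
pose D' : {linear U -> R} := HB.pack (D z) isL.
have dz := @taylor_is_diff _ f D' L H z (DL z) (fT z).
have df : differentiable f z := @ex_diff _ _ _ _ _ _ _ dz.
by split=> //; rewrite deriveE// diff_val.
Qed.

Lemma taylor_C1c : 0 <= C -> (forall z h k, `|D (z + h) k - D z k| <= C * `|h| * `|k|) ->
  compact_balls U -> (forall x, r < `|x| -> f x = 0) -> C1c f.
Proof.
move=> C0 fG cU f0; split.
- by move=> z; have [] := taylor_derive z 0.
- move=> v z; apply/(@cvgrPdist_le _ _ _ (nbhs z)) => e e0.
  have k0 : 0 < e / (C * `|v| + 1) by rewrite divr_gt0// ltr_wpDl// !mulr_ge0.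
  have : \forall y \near nbhs z, `|z - y| < e / (C * `|v| + 1).
    by apply: (@cvgr_dist_lt _ U _ (nbhs z) _ id) => //; exact: cvg_id.
  apply: filterS => y /= /ltW hk.
  rewrite !(taylor_derive _ v).2 distrC (_ : y = z + (y - z)); last by rewrite addrC subrK.
  apply: (le_trans (fG _ _ _)); rewrite -normrN opprB.
  rewrite mulrAC; apply: (le_trans (ler_wpM2l _ hk)); first by rewrite !mulr_ge0.
  rewrite mulrCA ler_piMr ?(ltW e0)// ler_pdivrMr ?mul1r ?lerDl// ltr_wpDl//.
  by rewrite !mulr_ge0.
- exact: (compact_support cU f0).
Qed.

End taylor_C1c.

Section section_C1c.
Variables (L H r : R) (f : V R -> R) (D : V R -> V R -> R) (p : R3 R).
Hypothesis fC : C11 L H f D.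
Hypothesis fr : vanish_off r f.

Let normx (x : R3 R) : `|(x, 0) : V R| = `|x|.
Proof. by rewrite prod_normE /= normr0 max_l. Qed.

Let emb (x y q : R3 R) : (x + y, q) = (x, q) + (y, 0) :> V R.
Proof. by congr pair; rewrite addr0. Qed.

(** The weak derivatives of the electric field live on R^3; slices at fixed p are the tests they
    accept. *)
Lemma section_C1c : C1c (fun x : R3 R => f (x, p)) /\
  forall x v, 'D_v (fun x : R3 R => f (x, p)) x = D (x, p) (v, 0).
Proof.
have linD (x : R3 R) a (h k : R3 R) : D (x, p) (a *: h + k, 0) =
    a * D (x, p) (h, 0) + D (x, p) (k, 0).
  case: fC => lin _ _ _ _; rewrite -lin; congr (D _ _).
  by congr pair; rewrite /= scaler0 addr0.
have DL (x h : R3 R) : `|D (x, p) (h, 0)| <= L * `|h|.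
  by case: fC => _ b _ _ _; rewrite -normx; exact: b.
have fT (x h : R3 R) : `|f (x + h, p) - f (x, p) - D (x, p) (h, 0)| <= H * `|h| ^+ 2.
  by case: fC => _ _ b _ _; rewrite -normx emb; exact: b.
split; last by move=> x v; have [] := taylor_derive linD DL fT x v.
apply: (@taylor_C1c _ L H (6 * H) r _ (fun x h => D (x, p) (h, 0))) => //.
- by rewrite mulr_ge0// (C11_H_ge0 fC).
- by move=> x h k; rewrite emb -(normx h) -(normx k); exact: (C11_grad_lip fC).
- exact: compact_balls_R3.
- by move=> x xr; apply: fr; rewrite prod_normE lt_max xr.
Qed.

End section_C1c.

Lemma C11_derive L H (f : V R -> R) D z v : C11 L H f D ->
  differentiable f z /\ 'D_v f z = D z v.
Proof. by case=> lin DL T _ _; exact: taylor_derive lin DL T z v. Qed.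

Lemma C11_C1c L H (f : V R -> R) D rho : C11 L H f D -> vanish_off rho f -> C1c f.
Proof.
move=> fC f0; case: (fC) => lin DL T _ _.
apply: (taylor_C1c lin DL T (C := 6 * H) _ _ compact_balls_V f0).
- by rewrite mulr_ge0// (C11_H_ge0 fC).
- exact: C11_grad_lip fC.
Qed.

End test_functions.

(** * Measure-preserving maps *)

Section measure_preserving.
Context d (T : measurableType d) (R : realType).
Variable mu : {measure set T -> \bar R}.

Definition mpres (S : T -> T) :=
  measurable_fun setT S /\ forall A, measurable A -> mu (S @^-1` A) = mu A.

Lemma mpres_ge0_integral S (f : T -> \bar R) : mpres S ->
  measurable_fun setT f -> (forall x, 0 <= f x)%E ->
  (\int[mu]_x f (S x) = \int[mu]_x f x)%E.
Proof.
move=> [mS SA] mf f0.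
have := @ge0_integral_pushforward _ _ _ _ _ S mS mu setT f measurableT mf.
rewrite preimage_setT => <-//.
by apply: eq_measure_integral => A mA _ /=; exact: SA.
Qed.

Lemma mpres_integral S (f : T -> \bar R) : mpres S -> measurable_fun setT f ->
  (\int[mu]_x f (S x) = \int[mu]_x f x)%E.
Proof.
move=> mp mf; rewrite [LHS]integralE [RHS]integralE; congr (_ - _)%E.
  rewrite -[RHS](mpres_ge0_integral mp)//; last exact: measurable_funepos.
  by apply: eq_integral => x _; rewrite !funeposE.
rewrite -[RHS](mpres_ge0_integral mp)//; last exact: measurable_funeneg.
by apply: eq_integral => x _; rewrite !funenegE.
Qed.

Lemma mpres_Rintegral S (f : T -> R) : mpres S -> measurable_fun setT f ->
  \int[mu]_x f (S x) = \int[mu]_x f x.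
Proof.
move=> mp mf; congr fine; apply: (mpres_integral mp (f := EFin \o f)).
exact/measurable_EFinP.
Qed.

Lemma mpres_integrable S (f : T -> R) : mpres S ->
  mu.-integrable setT (EFin \o f) -> mu.-integrable setT (EFin \o (f \o S)).
Proof.
move=> mp /integrableP[mf fy]; apply/integrableP; split.
  have : measurable_fun setT f by exact/measurable_EFinP.
  by move=> mf'; apply/measurable_EFinP; apply: measurableT_comp => //; case: mp.
apply: le_lt_trans fy.
rewrite -[leRHS](mpres_ge0_integral mp (f := fun x => `|(EFin \o f) x|%E))//.
exact: measurableT_comp.
Qed.

Lemma mpres_ae S (P : T -> Prop) : mpres S ->
  {ae mu, forall x, P x} -> {ae mu, forall x, P (S x)}.
Proof.
move=> [mS SA] [N [mN N0 PN]]; exists (S @^-1` N); split.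
- by rewrite -[X in measurable X]setTI; exact: mS.
- by rewrite SA.
- by move=> x /= Px; apply: PN.
Qed.

Lemma mpres_comp S S' : mpres S -> mpres S' -> mpres (S \o S').
Proof.
move=> [mS SA] [mS' SA']; split; first exact: measurableT_comp.
move=> A mA; rewrite comp_preimage SA' ?SA//.
by rewrite -[X in measurable X]setTI; exact: mS.
Qed.

Lemma mpres_indic S : measurable_fun setT S ->
  (forall A, measurable A ->
    \int[mu]_x (\1_A (S x) : R)%:E = \int[mu]_x (\1_A x : R)%:E)%E -> mpres S.
Proof.
move=> mS SA; split=> // A mA.
have mSA : measurable (S @^-1` A) by rewrite -[X in measurable X]setTI; exact: mS.
by have := SA A mA; rewrite (integral_indic _ measurableT mA)
  (integral_indic _ measurableT mSA) !setIT.
Qed.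

Lemma mpres_id : mpres id.
Proof. by split. Qed.

End measure_preserving.

(** * Translations, shears and balls for Lebesgue measure on R^6 *)

Section leb6_invariance.
Variable R : realType.

(** The pushed-forward measure gives half-open intervals their length, and this characterises
    Lebesgue measure. *)
Lemma leb_translation (a : R) : mpres (leb R) (fun x : R => x + a).
Proof.
have ma : measurable_fun setT (fun x : R => x + a) by exact: measurable_funD.
split=> // A mA.
have ma' : measurable_fun setT
  ((fun x : R => x + a) : measurableTypeR R -> measurableTypeR R) by [].
apply/esym.
pose mu' : {measure set (measurableTypeR R) -> \bar R} :=
  pushforward (@lebesgue_measure R) ((fun x : R => x + a) : measurableTypeR R -> measurableTypeR R).
apply: (@lebesgue_measure_unique R (mu' ma')) => //.
move=> _ [[x y]] _ <-; rewrite /mu' /= /pushforward.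
rewrite (_ : _ @^-1` _ = `]x - a, y - a]%classic); last first.
  by apply/seteqP; split => z /=; rewrite !in_itv/= ltrBlDr lerBrDr.
rewrite !lebesgue_measure_itv/= !lte_fin ltrD2r; case: ifPn => // _.
by rewrite -!EFinB; congr EFin; ring.
Qed.

(** The pushed-forward measure has the product value on rectangles, hence is the product measure. *)
Lemma prod_mpres d1 d2 (T1 : measurableType d1) (T2 : measurableType d2)
    (m1 : {sigma_finite_measure set T1 -> \bar R})
    (m2 : {sigma_finite_measure set T2 -> \bar R}) (S1 : T1 -> T1) (S2 : T2 -> T2) :
  mpres m1 S1 -> mpres m2 S2 ->
  mpres (prod_measure m1 m2) (fun z => (S1 z.1, S2 z.2)).
Proof.
move=> [mS1 SA1] [mS2 SA2].
have mS : measurable_fun setT (fun z : T1 * T2 => (S1 z.1, S2 z.2)).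
  by apply: measurable_fun_pair; exact: measurableT_comp.
split=> // A mA; apply/esym.
pose m' : {measure set (T1 * T2) -> \bar R} :=
  pushforward (prod_measure m1 m2) (fun z : T1 * T2 => (S1 z.1, S2 z.2)).
apply: (@product_measure_unique _ _ _ _ _ m1 m2 (m' mS)) => // B C mB mC.
rewrite /m' /= /pushforward.
rewrite (_ : _ @^-1` _ = (S1 @^-1` B) `*` (S2 @^-1` C))//.
rewrite /prod_measure product_measure1E ?SA1 ?SA2//.
- by rewrite -[X in measurable X]setTI; exact: mS1.
- by rewrite -[X in measurable X]setTI; exact: mS2.
Qed.

Lemma prod_measureX d1 d2 (T1 : measurableType d1) (T2 : measurableType d2)
    (m1 : {sigma_finite_measure set T1 -> \bar R})
    (m2 : {sigma_finite_measure set T2 -> \bar R}) A B :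
  measurable A -> measurable B ->
  prod_measure m1 m2 (A `*` B) = (m1 A * m2 B)%E.
Proof. exact: product_measure1E. Qed.

Lemma leb6_translation (a : V R) : mpres (leb6 R) (fun z : V R => z + a).
Proof.
have tr3 (b : R3 R) : mpres (leb3 R) (fun x : R3 R => x + b).
  exact: (prod_mpres (prod_mpres (leb_translation b.1.1) (leb_translation b.1.2))
    (leb_translation b.2)).
exact: (prod_mpres (tr3 a.1) (tr3 a.2)).
Qed.

Lemma fubini6 (f : R * V R -> \bar R) :
  measurable_fun [set: measurableTypeR R * mV R] f -> (forall x, 0 <= f x)%E ->
  (\int[leb R]_r \int[leb6 R]_z f (r, z) = \int[leb6 R]_z \int[leb R]_r f (r, z))%E.
Proof. by move=> mf f0; exact: (@fubini_tonelli _ _ _ _ _ (leb R) (leb6 R) f). Qed.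

(* Averaging over translations along the shear direction, with a weight of unit
   integral on each line, turns the shear into a translation of that line. *)
Lemma shear_mpres (j : J) (B : V R -> R) : measurable_fun [set: mV R] B ->
  (forall z r, B (z + r *: basis6 R j) = B z) -> mpres (leb6 R) (shear j B).
Proof.
move=> mB Bj; set e := basis6 R j.
pose w (z : V R) : \bar R := (\1_(`[0%R, 1%R]%classic : set R) (coord6 j z))%:E.
have mw : measurable_fun [set: mV R] w.
  apply/measurable_EFinP.
  by apply: (measurableT_comp (measurable_indic _) (measurable_coord6 j)).
have w0 z : (0 <= w z)%E by rewrite lee_fin.
have w1 (z : V R) : (\int[leb R]_r w (z - r *: e)%R = 1)%E.
  transitivity (\int[leb R]_r (\1_(`[coord6 j z - 1, coord6 j z]%classic : set R) r)%:E)%E.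
    apply: eq_integral => r _.
    rewrite /w coord6B coord6Z coord6_basis eqxx mulr1; congr (_%:E).
    rewrite !indicE; congr (_%:R); congr nat_of_bool.
    by apply/idP/idP; rewrite !inE/= !in_itv/= => /andP[a b]; apply/andP; split; lra.
  rewrite integral_indic// setIT /leb /= lebesgue_measure_itv/= lte_fin ltrBlDr ltrDl ltr01.
  by rewrite -EFinB; congr EFin; ring.
have mS (B' : V R -> R) : measurable_fun [set: mV R] B' ->
    measurable_fun [set: mV R] (shear j B' : mV R -> mV R).
  by move=> mB'; apply: measurable_addV => //; exact: measurable_scaleV.
have key (B' : V R -> R) (h : V R -> \bar R) : measurable_fun [set: mV R] B' ->
   (forall z r, B' (z + r *: e) = B' z) ->
   measurable_fun [set: mV R] h -> (forall z, 0 <= h z)%E ->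
   (\int[leb6 R]_z h (shear j B' z) =
    \int[leb6 R]_z (w z * \int[leb R]_r h (z + r *: e)%R))%E.
  move=> mB' B'j mh h0.
  have mzr (s : R) : measurable_fun [set: measurableTypeR R * mV R]
      (fun q : R * V R => (q.2 + (s * q.1) *: e) : mV R).
    apply: measurable_addV => //; apply: measurable_scaleV => //.
    exact: measurable_funM.
  transitivity (\int[leb6 R]_z \int[leb R]_r (h (shear j B' z) * w (z - r *: e)%R))%E.
    apply: eq_integral => z _; rewrite ge0_integralZl ?w1 ?mule1//.
    apply: (measurableT_comp mw) => //.
    have := mzr (-1); move=> /(measurable_fun_pair1 z).
    by congr (measurable_fun _ _); apply/funext => r /=; rewrite mulN1r scaleNr.
  rewrite -(@fubini6 (fun q => h (shear j B' q.2) * w (q.2 - q.1 *: e)%R)%E); last 2 first.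
  - apply: emeasurable_funM.
      by apply: (measurableT_comp mh); apply: (measurableT_comp (mS _ mB')).
    apply: (measurableT_comp mw) => //.
    by have := mzr (-1); congr (measurable_fun _ _); apply/funext => q /=;
      rewrite mulN1r scaleNr.
  - by move=> x; exact: mule_ge0.
  transitivity (\int[leb R]_r \int[leb6 R]_z (h (z + (r + B' z) *: e)%R * w z))%E.
    apply: eq_integral => r _ /=.
    rewrite -(mpres_ge0_integral (leb6_translation (r *: e))); last 2 first.
    - apply: emeasurable_funM.
        by apply: (measurableT_comp mh); exact: mS.
      apply: (measurableT_comp mw) => //.
      have := mzr (-1); move=> /(measurable_fun_pair2 r).
      by congr (measurable_fun _ _); apply/funext => q /=; rewrite mulN1r scaleNr.
    - by move=> z; exact: mule_ge0.
    apply: eq_integral => z _; rewrite addrK; congr (h _ * _)%E.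
    by rewrite /shear B'j scalerDl addrA.
  have mr : measurable_fun [set: measurableTypeR R * mV R]
      (fun q : R * V R => (q.2 + (q.1 + B' q.2) *: e) : mV R).
    apply: measurable_addV => //; apply: measurable_scaleV => //.
    by apply: measurable_funD => //; exact: measurableT_comp.
  rewrite (@fubini6 (fun q => h (q.2 + (q.1 + B' q.2) *: e)%R * w q.2)%E); last 2 first.
  - apply: emeasurable_funM; first exact: (measurableT_comp mh).
    exact: measurableT_comp.
  - by move=> x; exact: mule_ge0.
  apply: eq_integral => z _ /=.
  have mhr : measurable_fun [set: measurableTypeR R]
      (fun r : R => h (z + (r + B' z) *: e)%R).
    by apply: (measurableT_comp mh); exact: (measurable_fun_pair1 z mr).
  transitivity (\int[leb R]_r (w z * h (z + (r + B' z) *: e)%R))%E.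
    by apply: eq_integral => r _; rewrite muleC.
  have E := ge0_integralZl (leb R) measurableT mhr (fun r _ => h0 _) (w0 z).
  apply: etrans E _.
  apply: (congr1 (fun y => w z * y)%E).
  have mh1 : measurable_fun [set: measurableTypeR R] (fun r : R => h (z + r *: e)%R).
    apply: (measurableT_comp mh); have := mzr 1 => /(measurable_fun_pair1 z).
    by congr (measurable_fun _ _); apply/funext => r /=; rewrite mul1r.
  exact: (mpres_ge0_integral (leb_translation (B' z)) mh1 (fun=> h0 _)).
apply: mpres_indic; first exact: mS.
move=> A mA; pose hA (z : V R) : \bar R := (\1_A z : R)%:E.
have mA1 : measurable_fun [set: mV R] hA.
  by apply/measurable_EFinP; exact: measurable_indic.
have h0 z : (0 <= hA z)%E by rewrite lee_fin.
(* The right-hand side of [key] does not involve the amplitude, so [B] and the zero amplitude, whose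
   shear is the identity, give the same value. *)
have kB := key B _ mB Bj mA1 h0.
have k0 := key (cst 0) _ (measurable_cst _) (fun _ _ => erefl) mA1 h0.
have mS0 : shear j (cst 0) = id :> (V R -> V R).
  by apply/funext => z; rewrite /shear scale0r addr0.
rewrite mS0 in k0; exact: etrans kB (esym k0).
Qed.

(** For the max norm a ball is a cube of side 2 r. *)
Lemma leb6_ball (r : R) : 0 <= r ->
  leb6 R [set z : V R | `|z| <= r] = ((2 * r) ^+ 6)%:E.
Proof.
move=> r0; pose I := `[- r, r]%classic : set (measurableTypeR R).
have mI : measurable I by exact: measurable_itv.
have lI : leb R I = (2 * r)%:E.
  rewrite /leb /= lebesgue_measure_itv/= lte_fin; case: ifPn => [_|].
    by rewrite -EFinD opprK; congr EFin; ring.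
  by rewrite -leNgt => ?; congr EFin; lra.
have l3 : leb3 R (I `*` I `*` I) = ((2 * r) ^+ 3)%:E.
  apply: etrans (prod_measureX (prod_measure (leb R) (leb R)) (leb R) _ mI) _.
    exact: measurableX.
  have l2 : prod_measure (leb R) (leb R) (I `*` I) = ((2 * r) * (2 * r))%:E.
    by apply: etrans (prod_measureX (leb R) (leb R) mI mI) _; rewrite lI.
  apply: etrans (congr1 (fun y => y * leb R I)%E l2) _.
  by rewrite lI -!EFinM; congr EFin; ring.
have -> : [set z : V R | `|z| <= r] = (I `*` I `*` I) `*` (I `*` I `*` I).
  apply/seteqP; split => z /=; rewrite !prod_normE /= /I /= !in_itv /= -!ler_norml !ge_max.
    by move=> /andP[/andP[/andP[-> ->] ->] /andP[/andP[-> ->] ->]].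
  by move=> [[[-> ->] ->] [[-> ->] ->]].
have mI3 : measurable (I `*` I `*` I) by do 2 apply: measurableX => //.
apply: etrans (prod_measureX (leb3 R) (leb3 R) mI3 mI3) _.
by rewrite l3 -EFinM -exprD.
Qed.

End leb6_invariance.

(** * Real-valued integrals *)

Section real_integrals.
Context d (T : measurableType d) (R : realType).
Variable mu : {measure set T -> \bar R}.
Implicit Types f g h : T -> R.

Definition itg f := mu.-integrable setT (EFin \o f).

Lemma aeS (P Q : T -> Prop) : (forall x, P x -> Q x) ->
  {ae mu, forall x, P x} -> {ae mu, forall x, Q x}.
Proof. by move=> PQ; apply: filterS. Qed.

Lemma aeI (P Q : T -> Prop) : {ae mu, forall x, P x} -> {ae mu, forall x, Q x} ->
  {ae mu, forall x, P x /\ Q x}.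
Proof. exact: filterI. Qed.

Lemma aeW (P : T -> Prop) : (forall x, P x) -> {ae mu, forall x, P x}.
Proof. by move=> *; exact: nearW. Qed.

Lemma ae_forall (P : nat -> T -> Prop) : (forall n, {ae mu, forall x, P n x}) ->
  {ae mu, forall x, forall n, P n x}.
Proof. by move=> ?; exact/ae_foralln. Qed.

Lemma itg_meas f : itg f -> measurable_fun setT f.
Proof. by move=> /integrableP[mf _]; exact/measurable_EFinP. Qed.

Lemma itg_dom_ae f g : measurable_fun setT f ->
  {ae mu, forall x, `|f x| <= g x} -> itg g -> itg f.
Proof.
move=> mf fg ig; have mg := itg_meas ig.
move: ig => /integrableP[_ gy]; apply/integrableP; split; first exact/measurable_EFinP.
apply: le_lt_trans gy; apply: ae_ge0_le_integral => //.
- by apply: measurableT_comp => //; exact/measurable_EFinP.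
- by apply: measurableT_comp => //; exact/measurable_EFinP.
- apply: filterS fg => x fx _ /=; by rewrite lee_fin (le_trans fx)// ler_norm.
Qed.

Lemma itg_dom f g : measurable_fun setT f ->
  (forall x, `|f x| <= g x) -> itg g -> itg f.
Proof. by move=> mf fg; apply: itg_dom_ae => //; exact: nearW. Qed.

Lemma itgD f g : itg f -> itg g -> itg (fun x => f x + g x).
Proof. by move=> fi gi; exact: (integrableD measurableT fi gi). Qed.

Lemma itgZ (a : R) f : itg f -> itg (fun x => a * f x).
Proof. by move=> fi; exact: (integrableZl measurableT a fi). Qed.

Lemma itgB f g : itg f -> itg g -> itg (fun x => f x - g x).
Proof. by move=> fi gi; exact: (integrableB measurableT fi gi). Qed.

Lemma itg_norm f : itg f -> itg (fun x => `|f x|).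
Proof. by move=> fi; exact: (integrable_abse fi). Qed.

Lemma itg0 : itg (fun=> 0).
Proof. exact: integrable0. Qed.

Lemma itg_mulb f h M : itg f -> measurable_fun setT h ->
  (forall x, `|h x| <= M) -> itg (fun x => f x * h x).
Proof.
move=> fi mh hM; apply: itg_dom (itgZ M (itg_norm fi)).
  by apply: measurable_funM => //; exact: itg_meas.
by move=> x; rewrite normrM mulrC ler_wpM2r.
Qed.

Lemma RintD f g : itg f -> itg g ->
  \int[mu]_x (f x + g x) = \int[mu]_x f x + \int[mu]_x g x.
Proof. by move=> fi gi; exact: RintegralD. Qed.

Lemma RintB f g : itg f -> itg g ->
  \int[mu]_x (f x - g x) = \int[mu]_x f x - \int[mu]_x g x.
Proof. by move=> fi gi; exact: RintegralB. Qed.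

Lemma RintZ (a : R) f : itg f -> \int[mu]_x (a * f x) = a * \int[mu]_x f x.
Proof. by move=> fi; exact: RintegralZl. Qed.

Lemma Rint_norm f : itg f -> `|\int[mu]_x f x| <= \int[mu]_x `|f x|.
Proof. by move=> fi; exact: le_normr_Rintegral. Qed.

Lemma Rint_ae_eq f g : measurable_fun setT f -> measurable_fun setT g ->
  {ae mu, forall x, f x = g x} -> \int[mu]_x f x = \int[mu]_x g x.
Proof.
move=> mf mg fg; congr fine; apply: ae_eq_integral => //; try exact/measurable_EFinP.
by apply: filterS fg => x fgx _; rewrite /= fgx.
Qed.

Lemma Rint_le f g : itg f -> itg g -> (forall x, f x <= g x) ->
  \int[mu]_x f x <= \int[mu]_x g x.
Proof. by move=> fi gi fg; apply: le_Rintegral. Qed.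

Lemma Rint_ge0_ae f : itg f -> {ae mu, forall x, 0 <= f x} -> 0 <= \int[mu]_x f x.
Proof.
move=> fi f0; rewrite (@Rint_ae_eq f (fun x => `|f x|)).
- exact: Rintegral_ge0.
- exact: itg_meas.
- by apply: measurableT_comp => //; exact: itg_meas.
- by apply: filterS f0 => x f0; rewrite ger0_norm.
Qed.

Lemma Rint_le_ae f g : itg f -> itg g -> {ae mu, forall x, f x <= g x} ->
  \int[mu]_x f x <= \int[mu]_x g x.
Proof.
move=> fi gi fg; rewrite -subr_ge0 -RintB//; apply: Rint_ge0_ae; first exact: itgB.
by apply: filterS fg => x; rewrite subr_ge0.
Qed.

Lemma Rint_norm_le f g : itg f -> itg g -> {ae mu, forall x, `|f x| <= g x} ->
  `|\int[mu]_x f x| <= \int[mu]_x g x.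
Proof.
move=> fi gi fg; apply: le_trans (Rint_norm fi) _.
by apply: Rint_le_ae => //; exact: itg_norm.
Qed.

Lemma Rint_dominated (f_ : nat -> T -> R) f g :
  (forall n, measurable_fun setT (f_ n)) -> measurable_fun setT f ->
  (forall x, f_ n x @[n --> \oo] --> f x) ->
  itg g -> (forall n x, `|f_ n x| <= g x) ->
  \int[mu]_x f_ n x @[n --> \oo] --> \int[mu]_x f x.
Proof.
move=> mf_ mf ff ig fg.
have h1 : {ae mu, forall x, setT x -> (f_ n x)%:E @[n --> \oo] --> (EFin \o f) x}.
  apply: nearW => x _; apply/fine_cvgP; split; last exact: ff.
  exact: nearW.
have h2 : {ae mu, forall x n, setT x -> (`|(f_ n x)%:E| <= (EFin \o g) x)%E}.
  by apply: nearW => x n _; rewrite lee_fin.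
have mE n : measurable_fun setT (fun x => (f_ n x)%:E) by exact/measurable_EFinP/mf_.
have mfE : measurable_fun setT (EFin \o f) by exact/measurable_EFinP.
have [fi _ cf] := dominated_convergence measurableT mE mfE h1 ig h2.
apply: fine_cvg; rewrite fineK//.
exact: integrable_fin_num.
Qed.

Lemma Rint0 : \int[mu]_x (0 : R) = 0.
Proof. by rewrite /Rintegral integral0. Qed.

Lemma cvg0_ex_le (u : nat -> R) (e : R) :
  u n @[n --> \oo] --> 0 -> 0 < e -> exists n, u n <= e.
Proof.
move=> u0 e0; have /cvgrPdist_le /(_ e e0)[N _ hN] := u0; exists N.
by have := hN N (leqnn N); rewrite sub0r normrN; apply: le_trans; exact: ler_norm.
Qed.

Lemma Rint0_ae f : itg f -> (forall x, 0 <= f x) -> \int[mu]_x f x = 0 ->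
  {ae mu, forall x, f x = 0}.
Proof.
move=> fi f0 If.
have mf : measurable_fun setT (EFin \o f) by case/integrableP: fi.
have /(ae_eq_integral_abs mu measurableT mf) : (\int[mu]_x `|(EFin \o f) x| = 0)%E.
  rewrite (eq_integral (EFin \o f)); last by move=> x _; rewrite /= ger0_norm.
  by rewrite -[LHS]fineK; [congr EFin|exact: integrable_fin_num].
by apply: filterS => x /(_ Logic.I) [].
Qed.

End real_integrals.

(** * Sign of an integrable function from its integrals against tests *)

Section sign.
Variable R : realType.
Implicit Types (v psi : V R -> R).

Section approximable.
Variable v : V R -> R.
Hypothesis vi : itg (leb6 R) v.

Let dist psi (A : set (V R)) := \int[leb6 R]_z (`|v z| * `|psi z - \1_A z|).

(** Approximation in L^1 with the weight |v|. Keeping the approximants in [0, 1] is what lets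
    complements, products and limits go through. *)
Let approximable (A : set (V R)) := measurable (A : set (mV R)) /\
  forall eta, 0 < eta -> exists psi, [/\ isC11 psi, (forall z, 0 <= psi z <= 1) &
    dist psi A <= eta].

Let isC11_meas psi : isC11 psi -> measurable_fun [set: mV R] psi.
Proof. by move=> [L [H [D []]]]. Qed.

Let indic01 (A : set (V R)) z : 0 <= (\1_A z : R) <= 1.
Proof. by rewrite indicE; case: (_ \in _); rewrite ?lexx ?ler01. Qed.

Let norm01 (a b : R) : 0 <= a <= 1 -> 0 <= b <= 1 -> `|a - b| <= 1.
Proof. by move=> /andP[? ?] /andP[? ?]; rewrite ler_norml; apply/andP; split; lra. Qed.

Let dist_itg (psi chi : V R -> R) : measurable_fun [set: mV R] psi ->
  measurable_fun [set: mV R] chi ->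
  (forall z, 0 <= psi z <= 1) -> (forall z, 0 <= chi z <= 1) ->
  itg (leb6 R) (fun z => `|v z| * `|psi z - chi z|).
Proof.
move=> mpsi mchi p01 c01; apply: (@itg_mulb _ _ _ _ _ _ 1).
- exact: itg_norm.
- by apply: measurableT_comp => //; exact: measurable_funB.
- by move=> z; rewrite normr_id; exact: norm01.
Qed.

(** Dominated convergence brings some [chi n] within eta / 2 of the indicator in the weighted
    distance, and that [chi n] is itself approximated within eta / 2. *)
Let limit_approximable (A : set (V R)) (chi : nat -> V R -> R) : measurable (A : set (mV R)) ->
  (forall n, measurable_fun [set: mV R] (chi n)) -> (forall n z, 0 <= chi n z <= 1) ->
  (forall z, chi n z @[n --> \oo] --> (\1_A z : R)) ->
  (forall n eta, 0 < eta -> exists psi, [/\ isC11 psi, (forall z, 0 <= psi z <= 1) &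
    \int[leb6 R]_z (`|v z| * `|psi z - chi n z|) <= eta]) -> approximable A.
Proof.
move=> mA mchi c01 cA H; split=> // eta eta0.
have mA1 : measurable_fun [set: mV R] (\1_A : _ -> R) by exact: measurable_indic.
have c0 : \int[leb6 R]_z (`|v z| * `|chi n z - \1_A z|) @[n --> \oo] --> \int[leb6 R]_z (0 : R).
  apply: (@Rint_dominated _ _ _ (leb6 R) _ _ (fun z => `|v z|)).
  - by move=> n; apply: itg_meas; apply: dist_itg.
  - exact: measurable_cst.
  - move=> z; rewrite -(mulr0 `|v z|); apply: cvgM; first exact: cvg_cst.
    rewrite -(normr0 R) -(subrr (\1_A z : R)); apply: cvg_norm.
    by apply: cvgB; [exact: cA|exact: cvg_cst].
  - exact: itg_norm.
  - move=> n z; rewrite normrM !normr_id ler_piMr//; exact: norm01.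
have eta2 : 0 < eta / 2 by rewrite divr_gt0.
have [n hn] : exists n, \int[leb6 R]_z (`|v z| * `|chi n z - \1_A z|) <= eta / 2.
  by rewrite Rint0 in c0; exact: cvg0_ex_le c0 eta2.
have [psi [pC p01 hp]] := H n _ eta2.
exists psi; split=> //; rewrite /dist.
have i1 := dist_itg (isC11_meas pC) (mchi n) p01 (c01 n).
have i2 := dist_itg (mchi n) mA1 (c01 n) (indic01 A).
have := lerD hp hn; rewrite -splitr -RintD//; apply: le_trans.
apply: Rint_le.
- exact: (dist_itg (isC11_meas pC) mA1).
- exact: itgD.
- move=> z; rewrite -mulrDr ler_wpM2l//; exact: ler_distD.
Qed.

Let approximableC A : approximable A -> approximable (~` A).
Proof.
move=> [mA H]; split; first exact: measurableC.
move=> eta /H [psi [[L [K [D pC]]] p01 hp]].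
exists (fun z => (-1) * psi z + 1); split.
- by do 3 eexists; apply: (C11_lin (-1) pC (C11_cst 1)).
- move=> z; have /andP[? ?] := p01 z; apply/andP; split; lra.
- move: hp; rewrite /dist; under [X in _ -> X <= _]eq_Rintegral => z _.
    rewrite (_ : -1 * psi z + 1 - \1_(~` A) z = - (psi z - \1_A z)); last first.
      by rewrite !indicE in_setC; case: (z \in A) => /=; ring.
    rewrite normrN; over.
  by [].
Qed.

Let approximableI A B : approximable A -> approximable B -> approximable (A `&` B).
Proof.
move=> [mA HA] [mB HB]; split; first exact: measurableI.
move=> eta eta0; have eta2 : 0 < eta / 2 by rewrite divr_gt0.
have [p [[L [K [D pC]]] p01 hp]] := HA _ eta2.
have [q [[L' [K' [D' qC]]] q01 hq]] := HB _ eta2.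
have mI : measurable_fun [set: mV R] (\1_(A `&` B) : _ -> R).
  by apply: measurable_indic; exact: measurableI.
have mA1 : measurable_fun [set: mV R] (\1_A : _ -> R) by exact: measurable_indic.
have mB1 : measurable_fun [set: mV R] (\1_B : _ -> R) by exact: measurable_indic.
have mp : measurable_fun [set: mV R] p by apply: isC11_meas; do 3 eexists; exact: pC.
have mq : measurable_fun [set: mV R] q by apply: isC11_meas; do 3 eexists; exact: qC.
have n1 (r : V R -> R) : (forall z, 0 <= r z <= 1) -> forall z, `|r z| <= 1.
  by move=> r01 z; have /andP[? ?] := r01 z; rewrite ger0_norm.
exists (fun z => p z * q z); split.
- by do 3 eexists; exact: (C11_mul (n1 _ p01) (n1 _ q01) pC qC).
- move=> z; have /andP[? ?] := p01 z; have /andP[? ?] := q01 z.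
  by rewrite mulr_ge0// mulr_ile1.
- have := lerD hp hq; rewrite -splitr /dist -RintD; last 2 first.
  + exact: dist_itg.
  + exact: dist_itg.
  apply: le_trans; apply: Rint_le.
  + apply: dist_itg => //; first exact: measurable_funM.
    move=> z; have /andP[? ?] := p01 z; have /andP[? ?] := q01 z.
    by rewrite mulr_ge0// mulr_ile1.
  + by apply: itgD; exact: dist_itg.
  + move=> z; rewrite -mulrDr ler_wpM2l//.
    rewrite (_ : \1_(A `&` B) z = \1_A z * \1_B z :> R); last by rewrite indicI.
    rewrite (_ : p z * q z - _ = (p z - \1_A z) * q z + (q z - \1_B z) * \1_A z); last by ring.
    apply: (le_trans (ler_normD _ _)); rewrite !normrM; apply: lerD; rewrite ler_piMr//.
      exact: n1.
    by have /andP[? ?] := indic01 A z; rewrite ger0_norm.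
Qed.

(** Complements use 1 - psi, intersections use products, and a countable union is the pointwise
    limit of its finite unions. *)
Let approximable_sigma : sigma_algebra setT approximable.
Proof.
have a0 : approximable set0.
  split => // eta eta0; exists (fun=> 0); split.
  - by do 3 eexists; exact: C11_cst.
  - by move=> z; rewrite lexx ler01.
  - rewrite /dist; under eq_Rintegral do rewrite indic0 subrr normr0 mulr0.
    by rewrite Rint0 ltW.
split=> //.
- by move=> A aA; rewrite setTD; exact: approximableC.
- move=> F aF.
  have aU n : approximable (\big[setU/set0]_(i < n) F i).
    elim: n => [|n IH]; first by rewrite big_ord0.
    rewrite big_ord_recr/= -[X in approximable X]setCK setCU.
    by apply: approximableC; apply: approximableI; exact: approximableC.
  apply: (@limit_approximable _ (fun n => \1_(\big[setU/set0]_(i < n) F i))).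
  - by apply: bigcupT_measurable => n; case: (aF n).
  - by move=> n; apply: measurable_indic; case: (aU n).
  - by move=> n z; exact: indic01.
  - move=> z; apply: cvg_near_cst.
    have [[n _ Fnz]|nF] := pselect ((\bigcup_n F n) z).
      exists n.+1 => // m /= nm; rewrite !indicE !mem_set//; first by exists n.
      by rewrite -bigcup_mkord; exists n.
    apply: nearW => m; rewrite !indicE !memNset// -bigcup_mkord => -[i _ Fi].
    by apply: nF; exists i.
  - by move=> n eta eta0; case: (aU n) => _ /(_ _ eta0).
Qed.

(** The ramps step(n (z_j - a)) converge pointwise to the indicator of the open half-space. *)
Let approximable_coord j (a : R) : approximable [set z | a < coord6 j z].
Proof.
have mA : measurable ([set z | a < coord6 j z] : set (mV R)).
  have := measurable_coord6 (R := R) j => /(_ measurableT `]a, +oo[%classic (measurable_itv _)).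
  by rewrite setTI; congr measurable; apply/seteqP; split => z /=; rewrite in_itv/= andbT.
have C n : isC11 (fun z : V R => step (n%:R * coord6 j z + - (n%:R * a))).
  by do 3 eexists; exact: C11_step.
apply: (@limit_approximable _ (fun n z => step (n%:R * coord6 j z + - (n%:R * a)))) => //.
- by move=> n; exact: isC11_meas.
- by move=> n z; exact: step_bound.
- move=> z; apply: cvg_near_cst; rewrite indicE.
  have [az|za] := ltP a (coord6 j z).
    rewrite mem_set//; exists (Num.truncn (2 / (coord6 j z - a))).+1 => // n /= hn.
    rewrite step1// -mulrBr -ler_pdivrMr ?subr_gt0//.
    apply: (le_trans (ltW (truncnS_gt _))); by rewrite ler_nat.
  rewrite memNset//=; last by apply/negP; rewrite -leNgt.
  by apply: nearW => n; rewrite step0// -mulrBr mulr_ge0_le0// subr_le0.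
- move=> n eta eta0; exists (fun z => step (n%:R * coord6 j z + - (n%:R * a))); split => //.
    by move=> z; exact: step_bound.
  under eq_Rintegral do rewrite subrr normr0 mulr0.
  by rewrite Rint0 ltW.
Qed.

(** Coordinates are measurable for the sigma-algebra of approximable sets, so the identity is
    measurable from it and every measurable set is approximable. *)
Let measurable_approximable A : measurable (A : set (mV R)) -> approximable A.
Proof.
pose T0 : measurableType _ := g_sigma_algebraType approximable.
have mid : measurable_fun [set: T0] (fun z : T0 => z : mV R).
  apply: measurable_V => j.
  apply: (measurability _ (RGenOInfty.measurableE R)) => _ [_ [a ->] <-].
  apply: sub_sigma_algebra; rewrite setTI.
  rewrite (_ : _ @^-1` _ = [set z | a < coord6 j z]); first exact: approximable_coord.
  by apply/seteqP; split => z /=; rewrite in_itv/= andbT.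
move=> mA; have := mid measurableT _ mA; rewrite setTI.
have : <<s approximable >> `<=` approximable by exact: smallest_sub.
by apply.
Qed.

(** Tests approximating the indicator of the set where v < 0 make the integral of v over this set
    nonnegative, which forces the set to be null. *)
Lemma itg_C11_ge0 :
  (forall psi, isC11 psi -> (forall z, 0 <= psi z <= 1) -> 0 <= \int[leb6 R]_z (v z * psi z)) ->
  {ae leb6 R, forall z, 0 <= v z}.
Proof.
move=> H.
have mv := itg_meas vi.
pose N := [set z | v z < 0].
have mN : measurable (N : set (mV R)).
  have := mv measurableT `]-oo, 0[%classic (measurable_itv _).
  by rewrite setTI; congr measurable; apply/seteqP; split => z /=; rewrite in_itv/=.
have iN (p : V R -> R) : measurable_fun [set: mV R] p -> (forall z, 0 <= p z <= 1) ->
    itg (leb6 R) (fun z => v z * p z).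
  move=> mp p01; apply: (@itg_mulb _ _ _ _ _ _ 1) => // z.
  by have /andP[? ?] := p01 z; rewrite ger0_norm.
have mN1 : measurable_fun [set: mV R] (\1_N : _ -> R) by exact: measurable_indic.
have iN1 := iN _ mN1 (indic01 N).
have IN : 0 <= \int[leb6 R]_z (v z * \1_N z).
  apply/ler_addgt0Pr => eta eta0.
  have [_ /(_ _ eta0)[psi [pC p01 hp]]] := measurable_approximable mN.
  have mp := isC11_meas pC.
  apply: le_trans (H _ pC p01) _; rewrite -lerBlDl.
  apply: le_trans hp; rewrite -RintB; [|exact: iN|exact: iN1].
  apply: le_trans (ler_norm _) _; apply: Rint_norm_le.
  - by apply: itgB => //; exact: iN.
  - exact: dist_itg.
  - by apply: nearW => z; rewrite -mulrBr normrM.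
have vN z : 0 <= - (v z * \1_N z).
  rewrite indicE; case: (boolP (z \in N)) => [|_]; last by rewrite mulr0 oppr0.
  by rewrite inE /N /= mulr1 oppr_ge0 => /ltW.
have := @Rint0_ae _ _ _ (leb6 R) (fun z => (-1) * (v z * \1_N z)) (itgZ (-1) iN1).
have e z : - (v z * \1_N z) = -1 * (v z * \1_N z) by rewrite mulN1r.
move=> W; have {}W : {ae leb6 R, forall z, -1 * (v z * \1_N z) = 0}.
  apply: W; first by move=> z; rewrite -e.
  apply: le_anti; rewrite RintZ// {1}mulN1r oppr_le0 IN/=.
  rewrite -RintZ//; apply: Rintegral_ge0 => z _; by rewrite -e.
apply: aeS W => z; rewrite indicE; case: (boolP (z \in N)) => [_|].
  by rewrite mulr1 mulN1r => /eqP; rewrite oppr_eq0 => /eqP ->.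
by move=> /negP zN _; rewrite leNgt; apply/negP => v0; apply: zN; rewrite inE.
Qed.

End approximable.

End sign.

(** * Fubini for real-valued integrals *)

Section real_fubini.
Context d1 d2 (T1 : measurableType d1) (T2 : measurableType d2) (R : realType).
Variables (m1 : {sigma_finite_measure set T1 -> \bar R})
          (m2 : {sigma_finite_measure set T2 -> \bar R}).

Lemma measurable_Rint (f : T1 * T2 -> R) : measurable_fun setT f ->
  measurable_fun setT (fun x => \int[m2]_y f (x, y)).
Proof.
move=> mf; have mfE : measurable_fun setT (EFin \o f) by exact/measurable_EFinP.
apply: measurableT_comp => //.
rewrite (_ : (fun x => _) = (fun x => \int[m2]_y (EFin \o f)^\+ (x, y) -
                                  \int[m2]_y (EFin \o f)^\- (x, y))%E).
  apply: emeasurable_funB; apply: measurable_fun_fubini_tonelli_F => //.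
    exact: measurable_funepos.
  exact: measurable_funeneg.
apply/funext => x; rewrite integralE; congr (_ - _)%E;
  apply: eq_integral => y _; by rewrite ?funeposE ?funenegE.
Qed.

Lemma Rfubini (f : T1 * T2 -> R) (g : T1 -> R) (h : T2 -> R) :
  measurable_fun setT f -> (forall x y, `|f (x, y)| <= g x * h y) ->
  itg m1 g -> itg m2 h ->
  \int[m1]_x \int[m2]_y f (x, y) = \int[m2]_y \int[m1]_x f (x, y).
Proof.
move=> mf fgh gi hi.
have i1 x : itg m2 (fun y => f (x, y)).
  apply: (itg_dom _ (fgh x)); last exact: itgZ.
  exact: measurableT_comp.
have i2 y : itg m1 (fun x => f (x, y)).
  apply: (@itg_dom _ _ _ m1 _ (fun x => h y * g x)); last exact: itgZ.
    exact: measurableT_comp.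
  by move=> x; rewrite mulrC.
have mfE : measurable_fun setT (EFin \o f) by exact/measurable_EFinP.
have fi : (m1 \x m2)%E.-integrable setT (EFin \o f).
  apply/(integrable12ltyP m1 m2 mfE).
  apply: (@le_lt_trans _ _ (\int[m1]_x ((\int[m2]_y `|h y|) * `|g x|)%:E)%E).
    apply: ge0_le_integral => //.
    - by move=> x _; apply: integral_ge0.
    - apply: (@measurable_fun_fubini_tonelli_F _ _ _ _ _ m2 (fun z => `|(EFin \o f) z|%E)) => //.
      exact: measurableT_comp.
    - apply/measurable_EFinP; apply: measurable_funM => //.
      by apply: measurableT_comp => //; exact: (itg_meas gi).
    - move=> x _.
      have ih := itgZ (`|g x|) (itg_norm hi).
      apply: (@le_trans _ _ (\int[m2]_y (`|g x| * `|h y|)%:E)%E).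
        apply: ge0_le_integral => //.
        + by apply: measurableT_comp => //; apply/measurable_EFinP; exact: (itg_meas (i1 x)).
        + by apply/measurable_EFinP; exact: (itg_meas ih).
        + move=> y _ /=; rewrite lee_fin (le_trans (fgh x y))//.
          by rewrite -normrM ler_norm.
      by rewrite mulrC -RintZ; [rewrite /Rintegral fineK//; exact: integrable_fin_num|exact: itg_norm].
  by have := itgZ (\int[m2]_y `|h y|) (itg_norm gi); move=> /integrable_fin_num;
    rewrite ltey_eq => ->.
have := Fubini fi; rewrite /= => FE.
rewrite /Rintegral; transitivity (fine (\int[m1]_x \int[m2]_y (f (x, y))%:E)%E).
  congr fine; apply: eq_integral => x _; rewrite fineK//.
  exact: (integrable_fin_num measurableT (i1 x)).
rewrite FE; congr fine; apply: eq_integral => y _; rewrite fineK//.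
exact: (integrable_fin_num measurableT (i2 y)).
Qed.

End real_fubini.

Section indicator_integral.
Context d (T : measurableType d) (R : realType) (mu : {measure set T -> \bar R}).

Lemma itg_indic A : measurable A -> (mu A < +oo)%E -> itg mu (\1_A : T -> R).
Proof.
move=> mA Ay; apply/integrableP; split; first by apply/measurable_EFinP; exact: measurable_indic.
rewrite (eq_integral (fun x => (\1_A x : R)%:E)); last first.
  by move=> x _; rewrite /= ger0_norm// indicE.
by rewrite (integral_indic _ measurableT mA) setIT.
Qed.

Lemma Rint_indic A : measurable A -> \int[mu]_x (\1_A x : R) = fine (mu A).
Proof. by move=> mA; rewrite /Rintegral (integral_indic _ measurableT mA) setIT. Qed.

End indicator_integral.

(** * Bounds for functions of bounded support *)

Section bounded_support.
Variable R : realType.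
Implicit Types u chi psi : V R -> R.

Definition ball_ind (r : R) : V R -> R := \1_[set z | `|z| <= r].

Lemma measurable_ball r : measurable ([set z : V R | `|z| <= r] : set (mV R)).
Proof.
have := @measurable_normV R measurableT `]-oo, r]%classic (measurable_itv _).
by rewrite setTI; congr measurable; apply/seteqP; split => z /=; rewrite in_itv/=.
Qed.

Lemma ball_indE r z : ball_ind r z = (`|z : V R| <= r)%R%:R.
Proof.
rewrite /ball_ind indicE; congr (_%:R); congr nat_of_bool.
by apply/idP/idP; rewrite inE.
Qed.

Lemma ball_ind_ge0 r z : 0 <= ball_ind r z.
Proof. by rewrite ball_indE. Qed.

Lemma measurable_ball_ind r : measurable_fun [set: mV R] (ball_ind r).
Proof. exact: measurable_indic (measurable_ball r). Qed.

Lemma itg_ball_ind r : 0 <= r -> itg (leb6 R) (ball_ind r).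
Proof.
move=> r0; apply: (itg_indic (measurable_ball r)).
by apply: le_lt_trans (ltry ((2 * r) ^+ 6)); rewrite -(leb6_ball r0).
Qed.

Lemma Rint_ball_ind r : 0 <= r -> \int[leb6 R]_z ball_ind r z = (2 * r) ^+ 6.
Proof.
move=> r0; apply: etrans (Rint_indic (leb6 R) (measurable_ball r)) _.
apply: (@etrans _ _ (fine ((2 * r) ^+ 6)%:E)) => //; apply: f_equal; exact: leb6_ball.
Qed.

Lemma bs_dom r A u z : vanish_off r u -> (forall z, `|u z| <= A) ->
  `|u z| <= A * ball_ind r z.
Proof.
move=> ur uA; rewrite ball_indE; case: (leP `|z| r) => zr; first by rewrite mulr1.
by rewrite ur// normr0 mulr0.
Qed.

Lemma bs_itg r A u : 0 <= r -> measurable_fun [set: mV R] u ->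
  vanish_off r u -> (forall z, `|u z| <= A) -> itg (leb6 R) u.
Proof.
move=> r0 mu ur uA; apply: (@itg_dom _ _ _ (leb6 R) u (fun z => A * ball_ind r z)) => //.
  by move=> z; exact: bs_dom.
by apply: itgZ; exact: itg_ball_ind.
Qed.

Lemma C11_bounded L H u D r : 0 <= r -> C11 L H u D -> vanish_off r u ->
  forall z, `|u z| <= L * (2 * r + 2).
Proof.
move=> r0 uC ur z; case: (leP `|z| r) => zr; last first.
  rewrite ur// normr0 mulr_ge0 ?(C11_L_ge0 uC)//; lra.
(* A point of norm r + 1, where [u] vanishes, at distance at most 2 r + 1 from [z]. *)
pose w := (r + 1) *: basis6 R (inl ord0).
have nw : `|w| = r + 1.
  have n1 : `|basis6 R (inl ord0)| = 1.
    apply/eqP; rewrite eq_le normr_basis6/=.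
    by have := normr_coord6 (inl ord0) (basis6 R (inl ord0)); rewrite coord6_basis normr1.
  by rewrite normrZ n1 mulr1 ger0_norm//; lra.
have := C11_lip uC w (z - w); rewrite [w + _]addrC subrK (ur w); last by rewrite nw; lra.
rewrite subr0 => /le_trans; apply; rewrite ler_wpM2l ?(C11_L_ge0 uC)//.
by apply: (le_trans (ler_normB _ _)); rewrite nw; lra.
Qed.

Lemma C11_itg L H u D r : 0 <= r -> C11 L H u D -> vanish_off r u -> itg (leb6 R) u.
Proof.
move=> r0 uC ur; apply: (bs_itg r0 _ ur (C11_bounded r0 uC ur)).
by case: uC.
Qed.

Lemma C11_D_itg L H u D r h : 0 <= r -> C11 L H u D -> vanish_off r u ->
  itg (leb6 R) (D^~ h).
Proof.
move=> r0 uC ur; apply: (@bs_itg r (L * `|h|)) => //.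
- by case: uC.
- by move=> z zr; exact: (C11_D_vanish uC ur).
- by move=> z; case: uC.
Qed.

Lemma C11_translate L H u D (w : V R) : C11 L H u D ->
  C11 L H (fun z => u (z + w)) (fun z => D (z + w)).
Proof.
case=> [a b c e f]; have mt := proj1 (leb6_translation w).
split=> [z|z|z h||h] //.
- by rewrite (addrAC z h).
- exact: (measurableT_comp e mt).
- exact: (measurableT_comp (f h) mt).
Qed.

Lemma C11_opp L H u D : C11 L H u D ->
  C11 L H (fun z => u (- z)) (fun z h => D (- z) (- h)).
Proof.
move=> [a b c e f].
have mo : measurable_fun [set: mV R] (fun z : V R => (- z : V R) : mV R).
  apply: measurable_V => j; under eq_fun do rewrite coord6N.
  by apply: measurable_funN; exact: measurable_coord6.
split=> [z x h k|z h|z h||h] //.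
- by rewrite -a opprD scalerN.
- by rewrite -[in leRHS](normrN h).
- by rewrite opprD -[in leRHS](normrN h).
- exact: (measurableT_comp e mo).
- exact: (measurableT_comp (f _) mo).
Qed.

End bounded_support.

(** * The sign criterion for locally integrable functions *)

Section local_sign.
Variable R : realType.

(** The integrable criterion applies to v times each cutoff [bump n 1], and every point lies where
    some cutoff equals 1. This turns integral inequalities that are linear in the test into
    inequalities holding almost everywhere. *)
Lemma local_ge0 (v : V R -> R) : measurable_fun [set: mV R] v ->
  (forall n : nat, itg (leb6 R) (fun z => v z * bump n%:R 1 z)) ->
  (forall psi r, isC11 psi -> (forall z, 0 <= psi z <= 1) -> 0 <= r -> vanish_off r psi ->
     0 <= \int[leb6 R]_z (v z * psi z)) ->
  {ae leb6 R, forall z, 0 <= v z}.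
Proof.
move=> mv vi H.
have W n : {ae leb6 R, forall z, 0 <= v z * bump n%:R 1 z}.
  apply: itg_C11_ge0; first exact: vi.
  move=> psi [L [K [D pC]]] p01.
  have [[L' [K' [D' bC]]] b01] := bump_C11 (R := R) n%:R 1.
  under eq_Rintegral do rewrite -mulrA.
  have n1 (f : V R -> R) : (forall z, 0 <= f z <= 1) -> forall z, `|f z| <= 1.
    by move=> f01 z; have /andP[? ?] := f01 z; rewrite ger0_norm.
  apply: (@H _ (n%:R + 1)).
  - by do 3 eexists; exact: (C11_mul (n1 _ b01) (n1 _ p01) bC pC).
  - move=> z; have /andP[? ?] := p01 z; have /andP[? ?] := b01 z.
    by rewrite mulr_ge0// mulr_ile1.
  - by rewrite addr_ge0.
  - by move=> z zn; rewrite (bump_vanish ltr01 zn) mul0r.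
apply: aeS (ae_forall W) => z /(_ (Num.truncn `|z|).+1).
by rewrite bump1 ?ltr01// ?mulr1// ltW// truncnS_gt.
Qed.

End local_sign.

Lemma Rint_ger0_norm d (T : measurableType d) (R : realType) (mu : {measure set T -> \bar R})
    (f : T -> R) : (forall x, 0 <= f x) -> \int[mu]_x `|f x| = \int[mu]_x f x.
Proof. by move=> f0; apply: eq_Rintegral => x _; rewrite ger0_norm. Qed.

Lemma Rint_sum d (T : measurableType d) (R : realType) (mu : {measure set T -> \bar R})
    (I : Type) (s : seq I) (F : I -> T -> R) : (forall i, itg mu (F i)) ->
  itg mu (fun x => \sum_(i <- s) F i x) /\
  \int[mu]_x (\sum_(i <- s) F i x) = \sum_(i <- s) \int[mu]_x F i x.
Proof.
move=> Fi; elim: s => [|i s [si IH]].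
  rewrite (_ : (fun x => _) = fun=> 0); last by apply/funext => x; rewrite big_nil.
  by rewrite big_nil Rint0; split => //; exact: itg0.
rewrite (_ : (fun x => _) = fun x => F i x + \sum_(i <- s) F i x); last first.
  by apply/funext => x; rewrite big_cons.
by split; [exact: itgD|rewrite RintD// IH big_cons].
Qed.

(** * Mollification of weakly Lipschitz functions *)

Section mollification.
Variable R : realType.
Implicit Types u chi psi : V R -> R.

Lemma Rint_transl (f : V R -> R) (w : V R) : measurable_fun [set: mV R] f ->
  \int[leb6 R]_z f (z + w) = \int[leb6 R]_z f z.
Proof. by move=> mf; exact: (mpres_Rintegral (leb6_translation w) mf). Qed.

Lemma itg_transl (f : V R -> R) (w : V R) : itg (leb6 R) f ->
  itg (leb6 R) (fun z => f (z + w)).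
Proof. by move=> fi; exact: (mpres_integrable (leb6_translation w) fi). Qed.

Lemma C11_scale (a L H : R) u D : C11 L H u D ->
  C11 (`|a| * L) (`|a| * H) (fun z => a * u z) (fun z h => a * D z h).
Proof.
move=> uC; have := C11_lin a uC (C11_cst 0); rewrite !addr0; congr C11.
  by apply/funext => z; rewrite addr0.
by apply/funext => z; apply/funext => h; rewrite addr0.
Qed.

(* The bounds on [int u * d_j chi] encode |d_j u| <= M in the sense of distributions. *)
Definition weak_lip (M : R) u := [/\ measurable_fun [set: mV R] u,
  forall z, `|u z| <= M &
  forall L H chi D r j, 0 <= r -> C11 L H chi D -> vanish_off r chi ->
    `|\int[leb6 R]_z (u z * D z (basis6 R j))| <= M * \int[leb6 R]_z `|chi z|].

(** A convolution up to reflection: derivatives in [w] fall on [chi], and for weakly Lipschitz [u]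
    they are controlled by the L^1 norm of [chi] alone. *)
Definition correlation u chi (w : V R) : R := \int[leb6 R]_y (u y * chi (y + w)).

Section correlation.
Variables (M : R) (u : V R -> R).
Hypothesis mu_ : measurable_fun [set: mV R] u.
Hypothesis ub : forall z, `|u z| <= M.
Variables (L H r : R) (chi : V R -> R) (D : V R -> V R -> R).
Hypothesis r0 : 0 <= r.
Hypothesis cC : C11 L H chi D.
Hypothesis cr : vanish_off r chi.

Let M0 : 0 <= M. Proof. exact: le_trans (normr_ge0 _) (ub 0). Qed.
Let ci : itg (leb6 R) chi. Proof. exact: C11_itg cC cr. Qed.

Let itg_tr (f : V R -> R) (w : V R) : itg (leb6 R) f ->
  itg (leb6 R) (fun y => u y * f (y + w)).
Proof.
move=> fi; have := itg_mulb (itg_transl w fi) mu_ ub.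
by congr itg; apply/funext => y; rewrite mulrC.
Qed.

Let mshift (f : V R -> R) : measurable_fun [set: mV R] f ->
  measurable_fun [set: mV R] (fun w => \int[leb6 R]_y (u y * f (y + w))).
Proof.
move=> mf.
apply: (@measurable_Rint _ _ _ _ _ (leb6 R) (fun q : mV R * mV R => u q.2 * f ((q.2 : V R) + q.1))).
apply: measurable_funM; first exact: measurableT_comp.
by apply: (measurableT_comp mf); exact: measurable_addV.
Qed.

Let vtr (w : V R) : vanish_off (r + `|w|) (fun y => chi (y + w)).
Proof.
move=> z zr; apply: cr.
have := ler_normB (z + w) w; rewrite addrK => h; lra.
Qed.

(** All derivatives fall on chi. The remainder lives on the balls of radius r around - w and - (w +
    h), each of volume (2 r)^6, whence the factor 2. *)
Lemma correlation_taylor (w h : V R) :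
  `|correlation u chi (w + h) - correlation u chi w -
    \int[leb6 R]_y (u y * D (y + w) h)| <= 2 * M * H * (2 * r) ^+ 6 * `|h| ^+ 2.
Proof.
have Di h' : itg (leb6 R) (D^~ h') by exact: C11_D_itg cC cr.
have iD h' : itg (leb6 R) (fun y => u y * D (y + w) h') by exact: (itg_tr w (Di h')).
have iT : itg (leb6 R) (fun y => u y * (chi (y + (w + h)) - chi (y + w) - D (y + w) h)).
  have := itgB (itgB (itg_tr (w + h) ci) (itg_tr w ci)) (iD h).
  by congr itg; apply/funext => y; ring.
rewrite /correlation -RintB ?itg_tr// -RintB//; last by apply: itgB; exact: itg_tr.
under eq_Rintegral do rewrite -!mulrBr.
have ib (w' : V R) : itg (leb6 R) (fun y => ball_ind r (y + w')).
  exact: itg_transl w' (itg_ball_ind r0).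
have Ib (w' : V R) : \int[leb6 R]_y ball_ind r (y + w') = (2 * r) ^+ 6.
  rewrite (@Rint_transl (ball_ind r) w')//.
    exact: Rint_ball_ind.
  exact: measurable_ball_ind.
have -> : 2 * M * H * (2 * r) ^+ 6 * `|h| ^+ 2 =
   \int[leb6 R]_y ((M * H * `|h| ^+ 2) * (ball_ind r (y + w) + ball_ind r (y + (w + h)))).
  by rewrite RintZ ?RintD ?Ib//; [ring|exact: itgD].
apply: Rint_norm_le => //; first by apply: itgZ; exact: itgD.
apply: aeW => y; rewrite normrM -[_ * H * _]mulrA -mulrA; apply: ler_pM => //.
have H0 := C11_H_ge0 cC.
rewrite !ball_indE; case: (leP `|y + w| r) => y1; last case: (leP `|y + (w + h)| r) => y2.
+ rewrite addrA; case: cC => _ _ T _ _; apply: le_trans (T (y + w) h) _.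
  by rewrite ler_peMr ?lerDl// mulr_ge0// sqr_ge0.
+ rewrite addrA; case: cC => _ _ T _ _; apply: le_trans (T (y + w) h) _.
  by rewrite add0r mulr1.
+ by rewrite !cr// (C11_D_vanish cC cr h y1) !subr0 normr0 addr0 mulr0.
Qed.

(** Decompose h on the six basis vectors and apply [weak_lip] to the translates of chi: the
    Lipschitz constant sees chi only through its L^1 norm, which is what makes it stable under
    concentration of chi. *)
Lemma correlation_C11 : weak_lip M u -> C11 (6 * M * \int[leb6 R]_z `|chi z|) (2 * M * H * (2 * r) ^+ 6)
  (correlation u chi) (fun w h => \int[leb6 R]_y (u y * D (y + w) h)).
Proof.
move=> uM; have Di h : itg (leb6 R) (D^~ h) by exact: C11_D_itg cC cr.
have iD w h : itg (leb6 R) (fun y => u y * D (y + w) h) by exact: (itg_tr w (Di h)).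
have trn w : \int[leb6 R]_z `|chi (z + w)| = \int[leb6 R]_z `|chi z|.
  rewrite (@Rint_transl (fun z => `|chi z|) w)//.
  by apply: measurableT_comp => //; case: cC.
split=> [w a h k|w h|w h||h].
- rewrite -RintZ// -RintD//; last exact: itgZ.
  by apply: eq_Rintegral => y _; case: cC => -> *; ring.
- rewrite {1}(coord6E h).
  have -> : \int[leb6 R]_x (u x * D (x + w) (\sum_j coord6 j h *: basis6 R j)) =
      \sum_j coord6 j h * \int[leb6 R]_x (u x * D (x + w) (basis6 R j)).
    have [_ FE] := Rint_sum (index_enum _) (fun j => itgZ (coord6 j h) (iD w (basis6 R j))).
    under [RHS]eq_bigr do rewrite -RintZ//.
    rewrite -FE; apply: eq_Rintegral => x _; rewrite (C11_sum cC) mulr_sumr.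
    by apply: eq_bigr => j _; rewrite (C11_Z cC); ring.
  apply: (le_trans (ler_norm_sum _ _ _)).
  apply: (@le_trans _ _ (\sum_(i : J) `|h| * (M * \int[leb6 R]_z `|chi z|))).
    apply: ler_sum => i _; rewrite normrM ler_pM//; first exact: normr_coord6.
    have := uM => -[_ _ W]; rewrite -(trn w).
    exact: (W _ _ _ _ _ i (addr_ge0 r0 (normr_ge0 w)) (C11_translate w cC) (@vtr w)).
  rewrite sumr_const card_sum !card_ord -mulr_natr le_eqVlt; apply/orP; left; apply/eqP; ring.
- exact: correlation_taylor.
- by apply: mshift; case: cC.
- exact: (mshift (itg_meas (Di h))).
Qed.

End correlation.

Variable delta : R.
Hypothesis delta0 : 0 < delta.

Let rho : V R -> R := bump (delta / 2) (delta / 2).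

Let rhoC := proj1 (bump_C11 (R := R) (delta / 2) (delta / 2)).
Let rho01 z : 0 <= rho z <= 1. Proof. by have [_] := bump_C11 (R := R) (delta / 2) (delta / 2). Qed.
Let rho0 z : 0 <= rho z. Proof. by case/andP: (rho01 z). Qed.
Let rhor : vanish_off delta rho.
Proof.
have d2 : 0 < delta / 2 by rewrite divr_gt0.
by have := @bump_vanish R (delta / 2) (delta / 2) d2; rewrite -splitr.
Qed.

Let mass := \int[leb6 R]_z rho z.

Let irho : itg (leb6 R) rho.
Proof. by have [L [H [D C]]] := rhoC; exact: C11_itg (ltW delta0) C rhor. Qed.

Let mass0 : 0 < mass.
Proof.
have d2 : 0 < delta / 2 by rewrite divr_gt0.
apply: (@lt_le_trans _ _ (\int[leb6 R]_z ball_ind (delta / 2) z)).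
  by rewrite Rint_ball_ind ?exprn_gt0// ?mulr_gt0// ltW.
apply: Rint_le => //; first exact/itg_ball_ind/ltW.
move=> z; rewrite ball_indE; case: (leP `|z| (delta / 2)) => zd //=.
by rewrite /rho bump1.
Qed.

(** The average of [u] around z with weight rho(y - z) / mass. Writing it as a correlation at - z
    makes [correlation_C11] available. *)
Definition mollify u (z : V R) : R := mass^-1 * correlation u rho (- z).

(* An average of [u] over translates, so it inherits the symmetries of [u]. *)
Lemma mollifyE u z : measurable_fun [set: mV R] u ->
  mollify u z = mass^-1 * \int[leb6 R]_y (u (y + z) * rho y).
Proof.
move=> mu_; rewrite /mollify /correlation; congr (_ * _).
rewrite -(@Rint_transl (fun y => u y * rho (y - z)) z).
  by apply: eq_Rintegral => y _; rewrite addrK.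
apply: measurable_funM => //; have [L [H [D []]]] := rhoC.
by move=> _ _ _ mr _; apply: (measurableT_comp mr); case: (leb6_translation (- z)).
Qed.

Lemma mollify_inv u j : measurable_fun [set: mV R] u ->
  (forall z a, u (z + a *: basis6 R j) = u z) ->
  forall z a, mollify u (z + a *: basis6 R j) = mollify u z.
Proof.
move=> mu_ uj z a; rewrite !mollifyE//; congr (_ * _).
by apply: eq_Rintegral => y _; rewrite addrA uj.
Qed.

(** Since rho >= 0, its L^1 norm is its mass, which the normalisation cancels: the Lipschitz
    constant 6 M is uniform in delta, and only the second-order constant depends on delta. *)
Lemma mollify_C11 : exists2 K, 0 <= K & forall M u, weak_lip M u ->
  exists D, C11 (6 * M) (K * M) (mollify u) D.
Proof.
have [L [H [D C]]] := rhoC; have H0 := C11_H_ge0 C.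
exists (mass^-1 * (2 * H * (2 * delta) ^+ 6)).
  by rewrite !mulr_ge0// ?invr_ge0 ?ltW// exprn_gt0// mulr_gt0.
move=> M u uM; eexists; have [mu_ ub _] := uM.
have := C11_scale mass^-1 (C11_opp (correlation_C11 mu_ ub (ltW delta0) C rhor uM)).
apply: C11_le.
  rewrite -/rho gtr0_norm ?invr_gt0// (Rint_ger0_norm (leb6 R) rho0).
  by rewrite -/mass le_eqVlt; apply/orP; left; apply/eqP; field; rewrite gt_eqF.
by rewrite gtr0_norm ?invr_gt0// le_eqVlt; apply/orP; left; apply/eqP; ring.
Qed.

Lemma mollify_bound M u z : weak_lip M u -> `|mollify u z| <= M.
Proof.
move=> [mu_ uM _]; rewrite mollifyE// normrM gtr0_norm ?invr_gt0//.
rewrite mulrC ler_pdivrMr// /mass -RintZ//.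
have mt := proj1 (leb6_translation z).
apply: Rint_norm_le; last first.
- by apply: aeW => y; rewrite normrM (ger0_norm (rho0 y)) ler_wpM2r.
- exact: itgZ.
- have := @itg_mulb _ _ _ (leb6 R) rho (fun y => u (y + z)) M irho (measurableT_comp mu_ mt) (fun=> uM _).
  by congr itg; apply/funext => y; rewrite mulrC.
Qed.

(** By duality: against psi >= 0, the difference is the average over |y| <= delta of the increments
    of [correlation u psi] between - y and 0, each at most 6 M |y| times the integral of psi. Being
    proportional to that integral, the bound becomes pointwise through [local_ge0], used with both
    signs. *)
Lemma mollify_close M u : weak_lip M u ->
  {ae leb6 R, forall z, `|mollify u z - u z| <= 6 * M * delta}.
Proof.
move=> uM; have [mu_ ub _] := uM.
have M0 : 0 <= M := le_trans (normr_ge0 _) (ub 0).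
have [K K0 /(_ _ _ uM)[Dm mC]] := mollify_C11.
have mm : measurable_fun [set: mV R] (mollify u) by case: mC.
have mrho : measurable_fun [set: mV R] rho by exact: itg_meas irho.
have key (s : R) : `|s| = 1 ->
    {ae leb6 R, forall z, 0 <= 6 * M * delta - s * (mollify u z - u z)}.
  move=> s1.
  have mv : measurable_fun [set: mV R] (fun z => 6 * M * delta - s * (mollify u z - u z)).
    apply: measurable_funB => //; apply: measurable_funM => //; exact: measurable_funB.
  have vb z : `|6 * M * delta - s * (mollify u z - u z)| <= 6 * M * delta + 2 * M.
    apply: (le_trans (ler_normB _ _)); apply: lerD.
      by rewrite ger0_norm// !mulr_ge0// ltW.
    rewrite normrM s1 mul1r; apply: (le_trans (ler_normB _ _)).
    have := mollify_bound z uM; have := ub z; lra.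
  apply: local_ge0 => //.
    move=> n; have [[L [H [D bC]]] b01] := bump_C11 (R := R) n%:R 1.
    have bi : itg (leb6 R) (bump n%:R 1).
      apply: (C11_itg _ bC (bump_vanish ltr01)); by rewrite addr_ge0.
    have := itg_mulb bi mv vb.
    by congr itg; apply/funext => z; rewrite mulrC.
  move=> psi r [L [H [D pC]]] p01 r0 pr.
  have p0 z : 0 <= psi z by case/andP: (p01 z).
  have pi : itg (leb6 R) psi by exact: C11_itg pC pr.
  have mp := itg_meas pi.
  have ip (f : V R -> R) A : measurable_fun [set: mV R] f -> (forall z, `|f z| <= A) ->
      itg (leb6 R) (fun z => f z * psi z).
    move=> mf fA; have := itg_mulb pi mf fA.
    by congr itg; apply/funext => z; rewrite mulrC.
  have im := ip _ _ mm (fun z => mollify_bound z uM).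
  have iu := ip _ _ mu_ ub.
  have Jlip w : `|correlation u psi w - correlation u psi 0| <=
      6 * M * (\int[leb6 R]_z psi z) * `|w|.
    have := C11_lip (correlation_C11 mu_ ub r0 pC pr uM) 0 w; rewrite add0r.
    by rewrite (Rint_ger0_norm (leb6 R) p0).
  (* Fubini, followed by a translation of the inner integral, moves the averaging from [u] onto the
     test function. *)
  have Im : \int[leb6 R]_z (mollify u z * psi z) =
      mass^-1 * \int[leb6 R]_y (rho y * correlation u psi (- y)).
    pose F (q : mV R * mV R) : R := (u ((q.2 : V R) + q.1) * rho q.2) * psi q.1.
    have mF : measurable_fun setT F.
      apply: measurable_funM; last exact: measurableT_comp.
      apply: measurable_funM; last exact: measurableT_comp.
      by apply: (measurableT_comp mu_); exact: measurable_addV.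
    have FM (x y : V R) : `|F (x, y)| <= M * psi x * rho y.
      rewrite !normrM (ger0_norm (rho0 y)) (ger0_norm (p0 x)) mulrAC ler_wpM2r//.
      exact: ler_wpM2r.
    have FE := Rfubini mF FM (itgZ M pi) irho.
    have iur z : itg (leb6 R) (fun y => u (y + z) * rho y).
      have mt := proj1 (leb6_translation z).
      have := @itg_mulb _ _ _ (leb6 R) rho (fun y => u (y + z)) M irho (measurableT_comp mu_ mt) (fun=> ub _).
      by congr itg; apply/funext => y; rewrite mulrC.
    have Fz z : mass^-1 * \int[leb6 R]_y F (z, y) = mollify u z * psi z.
      rewrite mollifyE// -mulrA; congr (_ * _); rewrite [RHS]mulrC -(RintZ (psi z) (iur z)).
      by apply: eq_Rintegral => y _; rewrite /F mulrC.
    have E1 : \int[leb6 R]_z (mollify u z * psi z) =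
        mass^-1 * \int[leb6 R]_z \int[leb6 R]_y F (z, y).
      under eq_Rintegral do rewrite -Fz.
      suff iF : itg (leb6 R) (fun z => \int[leb6 R]_y F (z, y)) by rewrite (RintZ _ iF).
      have := itgZ mass im.
      by congr itg; apply/funext => z; rewrite -Fz mulVKf ?gt_eqF.
    rewrite {}E1 {}FE; congr (_ * _); apply: eq_Rintegral => y _; rewrite /F /=.
    rewrite /correlation -RintZ; last first.
      have := itg_transl (- y) pi => tpi.
      have := itg_mulb tpi mu_ ub.
      by congr itg; apply/funext => z; rewrite mulrC.
    rewrite -(@Rint_transl (fun z => rho y * (u z * psi (z - y))) y).
      by apply: eq_Rintegral => z _; rewrite addrK (addrC y); ring.
    apply: measurable_funM => //; apply: measurable_funM => //.
    by apply: (measurableT_comp mp); case: (leb6_translation (- y)).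
  have Iu : \int[leb6 R]_z (u z * psi z) =
      mass^-1 * \int[leb6 R]_y (rho y * correlation u psi 0).
    have -> : \int[leb6 R]_y (rho y * correlation u psi 0) = correlation u psi 0 * mass.
      by rewrite -RintZ//; apply: eq_Rintegral => y _; rewrite mulrC.
    rewrite mulrCA mulVf ?gt_eqF// mulr1.
    by apply: eq_Rintegral => y _; rewrite addr0.
  have mJ : measurable_fun [set: mV R] (fun y => correlation u psi (- y)).
    by case: (C11_opp (correlation_C11 mu_ ub r0 pC pr uM)).
  have iJ w : itg (leb6 R) (fun y => rho y * (correlation u psi (- y) - w)).
    have [B hB] : exists B, forall y, `|correlation u psi (- y) - w| <= B.
      exists (M * (\int[leb6 R]_z `|psi z|) + `|w|) => y.
      apply: (le_trans (ler_normB _ _)); rewrite lerD2r /correlation.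
      have tpi := itg_transl (- y) pi.
      rewrite -(@Rint_transl (fun z => `|psi z|) (- y)); last first.
        exact: measurableT_comp.
      rewrite -RintZ; last exact: itg_norm.
      apply: Rint_norm_le.
      + have := itg_mulb tpi mu_ ub.
        by congr itg; apply/funext => z; rewrite mulrC.
      + by apply: itgZ; exact: itg_norm.
      + by apply: aeW => z; rewrite normrM ler_wpM2r.
    by apply: (itg_mulb irho _ hB); exact: measurable_funB.
  have Id : \int[leb6 R]_z ((mollify u z - u z) * psi z) =
    mass^-1 * \int[leb6 R]_y (rho y * (correlation u psi (- y) - correlation u psi 0)).
    under eq_Rintegral do rewrite mulrBl.
    rewrite RintB// Im Iu -mulrBr -RintB.
    + by congr (_ * _); apply: eq_Rintegral => y _; rewrite mulrBr.
    + by have := iJ 0; congr itg; apply/funext => y; rewrite subr0.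
    + by have := itgZ (correlation u psi 0) irho; congr itg; apply/funext => y; rewrite mulrC.
  have : `|\int[leb6 R]_z ((mollify u z - u z) * psi z)| <= 6 * M * delta * \int[leb6 R]_z psi z.
    rewrite Id normrM gtr0_norm ?invr_gt0// mulrC ler_pdivrMr//.
    rewrite /mass -[leRHS](RintZ _ irho); apply: Rint_norm_le => //; first exact: itgZ.
    apply: aeW => y; rewrite normrM (ger0_norm (rho0 y)) mulrC.
    case: (leP `|y| delta) => yd; last by rewrite rhor// !mulr0.
    rewrite ler_wpM2r//; apply: (le_trans (Jlip _)); rewrite normrN.
    rewrite [leRHS]mulrAC ler_wpM2l// !mulr_ge0//.
    by apply: Rintegral_ge0.
  move=> B; rewrite (_ : \int[leb6 R]_z _ = 6 * M * delta * (\int[leb6 R]_z psi z) -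
     s * \int[leb6 R]_z ((mollify u z - u z) * psi z)).
    rewrite subr_ge0; apply: le_trans (ler_norm _) _.
    by rewrite normrM s1 mul1r.
  have id : itg (leb6 R) (fun z => (mollify u z - u z) * psi z).
    by have := itgB im iu; congr itg; apply/funext => z; rewrite mulrBl.
  rewrite -RintZ// -RintZ// -RintB; [|exact: itgZ|exact: itgZ].
  by apply: eq_Rintegral => z _; ring.
have k1 := key 1 (normr1 _); have k2 := key (-1) (normrN1 _).
by apply: aeS (aeI k1 k2) => z [a b]; rewrite ler_norml; apply/andP; split; lra.
Qed.

End mollification.

(** * Compositions of shears *)

Section splitting.
Variable R : realType.
Implicit Types (s : seq (J * (V R -> R))) (z : V R) (B : V R -> R).

Definition shears s z : V R := foldl (fun w q => shear q.1 q.2 w) z s.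

Definition inv_shears s := rev [seq (q.1, fun z => - q.2 z) | q <- s].

(** Under this condition each shear preserves volume and is inverted by changing the sign of its
    amplitude. *)
Definition free_shears s :=
  forall q, List.In q s -> forall z a, q.2 (z + a *: basis6 R q.1) = q.2 z.

Lemma free_shears_cons q s : free_shears (q :: s) ->
  (forall z a, q.2 (z + a *: basis6 R q.1) = q.2 z) /\ free_shears s.
Proof. by move=> F; split; [apply: F; left|move=> p ps; apply: F; right]. Qed.

Lemma shears_mpres s : free_shears s ->
  (forall q, List.In q s -> measurable_fun [set: mV R] q.2) ->
  mpres (leb6 R) (shears s).
Proof.
elim: s => [|q s IH] F M; first exact: mpres_id.
have [Fq Fs] := free_shears_cons F.
apply: (@mpres_comp _ _ _ (leb6 R) (shears s) (shear q.1 q.2)).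
  by apply: IH => // p ps; apply: M; right.
by apply: shear_mpres => //; apply: M; left.
Qed.

Lemma shearK q z : (forall z a, q.2 (z + a *: basis6 R q.1) = q.2 z) ->
  shear q.1 (fun z => - q.2 z) (shear q.1 q.2 z) = z.
Proof. by move=> F; rewrite /shear F; vring. Qed.

Lemma shearKV q z : (forall z a, q.2 (z + a *: basis6 R q.1) = q.2 z) ->
  shear q.1 q.2 (shear q.1 (fun z => - q.2 z) z) = z.
Proof. by move=> F; rewrite /shear F; vring. Qed.

Lemma shears_rcons s q z : shears (rcons s q) z = shear q.1 q.2 (shears s z).
Proof. by rewrite /shears -cats1 foldl_cat. Qed.

Lemma inv_shears_cons q s : inv_shears (q :: s) =
  rcons (inv_shears s) (q.1, fun z => - q.2 z).
Proof. by rewrite /inv_shears /= rev_cons. Qed.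

Lemma shearsK s : free_shears s -> cancel (shears s) (shears (inv_shears s)).
Proof.
elim: s => [|q s IH] //= F z; have [Fq Fs] := free_shears_cons F.
by rewrite inv_shears_cons shears_rcons /= IH// shearK.
Qed.

Lemma shearsKV s : free_shears s -> cancel (shears (inv_shears s)) (shears s).
Proof.
elim: s => [|q s IH] //= F z; have [Fq Fs] := free_shears_cons F.
by rewrite inv_shears_cons shears_rcons /= shearKV// IH.
Qed.

Lemma in_inv_shears s q : List.In q (inv_shears s) ->
  exists2 p, List.In p s & q = (p.1, fun z => - p.2 z).
Proof.
elim: s => [|p s IH]//; rewrite inv_shears_cons -cats1 => /List.in_app_iff[/IH[p' p's ->]|/=].
  by exists p' => //; right.
by case=> // <-; exists p => //; left.
Qed.

Lemma free_inv_shears s : free_shears s -> free_shears (inv_shears s).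
Proof. by move=> F q /in_inv_shears[p ps -> /=] z a; rewrite (F p ps). Qed.

Definition small_shears (k : R) s := forall q, List.In q s ->
  (forall z, `|q.2 z| <= k * (1 + `|z|)) /\
  (forall z h, `|q.2 (z + h) - q.2 z| <= k * `|h|).

Lemma small_inv_shears k s : small_shears k s -> small_shears k (inv_shears s).
Proof.
move=> S q /in_inv_shears[p ps -> /=]; have [b l] := S p ps.
by split=> [z|z h]; rewrite -?opprD normrN.
Qed.

(** The increment of the explicit Euler step, with all amplitudes read at the starting point. *)
Definition drift s z : V R := \sum_(q <- s) q.2 z *: basis6 R q.1.

(** A sum ignores the order of its terms, so to first order the inverse composition is the opposite
    Euler step. *)
Lemma drift_inv s z : drift (inv_shears s) z = - drift s z.
Proof.
elim: s => [|q s IH]; first by rewrite /drift !big_nil oppr0.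
by rewrite inv_shears_cons /drift big_rcons/= -/(drift _ _) IH big_cons -/(drift s z); vring.
Qed.

Lemma small_shears_cons k q s : small_shears k (q :: s) ->
  [/\ forall z, `|q.2 z| <= k * (1 + `|z|),
      forall z h, `|q.2 (z + h) - q.2 z| <= k * `|h| & small_shears k s].
Proof.
move=> S; have [b l] := S q (or_introl erefl).
by split=> // p ps; apply: S; right.
Qed.

Lemma shear_displacement k q z : 0 <= k ->
  (forall z, `|q.2 z| <= k * (1 + `|z|)) ->
  `|shear q.1 q.2 z - z| <= k * (1 + `|z|).
Proof.
move=> k0 b; rewrite /shear addrAC subrr add0r normrZ; apply: le_trans (b z).
by rewrite ler_piMr// normr_basis6.
Qed.

Lemma shear_growth k q z : 0 <= k <= 1 ->
  (forall z, `|q.2 z| <= k * (1 + `|z|)) ->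
  1 + `|shear q.1 q.2 z| <= 2 * (1 + `|z|).
Proof.
move=> /andP[k0 k1] b; have := shear_displacement z k0 b.
have := ler_normD (shear q.1 q.2 z - z) z; rewrite subrK => h.
have : k * (1 + `|z|) <= 1 * (1 + `|z|) by rewrite ler_wpM2r// addr_ge0.
lra.
Qed.

(** As k <= 1, one shear at most doubles 1 + |z|; the factor then follows the recursion a -> 2 a +
    1. *)
Lemma shears_displacement k s z : 0 <= k <= 1 -> small_shears k s ->
  `|shears s z - z| <= (2 ^+ size s - 1) * (k * (1 + `|z|)).
Proof.
move=> k01; have /andP[k0 k1] := k01; elim: s z => [|q s IH] z S.
  by rewrite subrr normr0 expr0 subrr mul0r.
have [b _ Ss] := small_shears_cons S.
have {}IH := IH (shear q.1 q.2 z) Ss.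
have n1 := shear_displacement z k0 b; have n2 := shear_growth z k01 b.
rewrite /= -/(shears s _) exprS -(subrK (shear q.1 q.2 z) (shears s _)) -addrA.
apply: (le_trans (ler_normD _ _)); apply: (le_trans (lerD IH n1)).
have e1 : 0 <= 2 ^+ size s - 1 :> R by rewrite subr_ge0 -natrX ler1n expn_gt0.
have : (2 ^+ size s - 1) * (k * (1 + `|shear q.1 q.2 z|)) <=
    (2 ^+ size s - 1) * (k * (2 * (1 + `|z|))).
  by rewrite !ler_wpM2l.
move=> h; apply: (le_trans (lerD h (lexx _))).
by rewrite le_eqVlt; apply/orP; left; apply/eqP; ring.
Qed.

Lemma drift_lip k s z h : small_shears k s ->
  `|drift s (z + h) - drift s z| <= (size s)%:R * (k * `|h|).
Proof.
elim: s => [|q s IH] S; first by rewrite /drift !big_nil subrr normr0 mul0r.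
have [_ l Ss] := small_shears_cons S.
rewrite /drift !big_cons -/(drift s _).
rewrite (_ : _ - _ = (q.2 (z + h) - q.2 z) *: basis6 R q.1 +
   (drift s (z + h) - drift s z)); last by vring.
apply: (le_trans (ler_normD _ _)); rewrite /= -nat1r mulrDl mul1r.
apply: lerD (IH Ss); rewrite normrZ; apply: le_trans (l z h).
by rewrite ler_piMr// normr_basis6.
Qed.

(** Later amplitudes are read at a point displaced by O(k) and are k-Lipschitz, so the deviation
    from the Euler increment is O(k^2). The factor closes because 2 . 3^n + n <= 3^(n+1). *)
Lemma shears_consistent k s z : 0 <= k <= 1 -> small_shears k s ->
  `|shears s z - z - drift s z| <= 3 ^+ size s * (k ^+ 2 * (1 + `|z|)).
Proof.
move=> k01; have /andP[k0 k1] := k01; elim: s z => [|q s IH] z S.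
  by rewrite /drift big_nil subrr subr0 normr0 !mulr_ge0// ?sqr_ge0 ?addr_ge0.
have [b _ Ss] := small_shears_cons S.
have {}IH := IH (shear q.1 q.2 z) Ss.
have n1 := shear_displacement z k0 b; have n2 := shear_growth z k01 b.
set z1 := shear q.1 q.2 z in IH n1 n2 *.
have dl := drift_lip z (z1 - z) Ss; rewrite [z + _]addrC subrK in dl.
rewrite /drift big_cons -/(drift s z) /= -/(shears s _) -/z1 exprS.
rewrite (_ : _ - _ = (shears s z1 - z1 - drift s z1) + (drift s z1 - drift s z)); last first.
  by rewrite /z1 /shear; vring.
apply: (le_trans (ler_normD _ _)); apply: (le_trans (lerD IH dl)).
have a1 : 3 ^+ size s * (k ^+ 2 * (1 + `|z1|)) <= 3 ^+ size s * (k ^+ 2 * (2 * (1 + `|z|))).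
  by rewrite !ler_wpM2l ?sqr_ge0 ?exprn_ge0.
have a2 : (size s)%:R * (k * `|z1 - z|) <= (size s)%:R * (k ^+ 2 * (1 + `|z|)).
  by rewrite ler_wpM2l// expr2 -mulrA ler_wpM2l.
have a3 : (size s)%:R * (k ^+ 2 * (1 + `|z|)) <= 3 ^+ size s * (k ^+ 2 * (1 + `|z|)).
  rewrite ler_wpM2r ?mulr_ge0 ?sqr_ge0 ?addr_ge0// -natrX ler_nat.
  exact/ltnW/ltn_expl.
apply: (le_trans (lerD a1 (le_trans a2 a3))).
by rewrite le_eqVlt; apply/orP; left; apply/eqP; ring.
Qed.

(** Iteration of [C11_shear]. The exponent 2 n leaves room for the growth (1 + k)^n of the Lipschitz
    constant that multiplies the second-order constant of each new shear. *)
Lemma C11_shears (L H k k' : R) s chi D : 0 <= k -> 0 <= k' ->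
  (forall q, List.In q s -> exists DB, C11 k k' q.2 DB) -> C11 L H chi D ->
  exists D', C11 (L * (1 + k) ^+ size s)
    ((H + (size s)%:R * (L * k')) * (1 + k) ^+ (2 * size s)) (chi \o shears s) D'.
Proof.
move=> k0 k'0; elim: s => [|q s IH] SC cC.
  by exists D; rewrite mul0r addr0 muln0 !expr0 !mulr1.
have [D' C'] := IH (fun p ps => SC p (or_intror ps)) cC.
have [DB BC] := SC q (or_introl erefl).
have L0 := C11_L_ge0 cC; have H0 := C11_H_ge0 cC.
eexists; apply: C11_le (C11_shear q.1 C' BC); first by rewrite exprSr mulrA.
rewrite /= -mulrA -exprD (_ : (2 * (size s).+1 = 2 * size s + 2)%N); last by rewrite mulnS addnC.
set E := (1 + k) ^+ (2 * size s + 2).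
have PE : (1 + k) ^+ size s <= E.
  apply: ler_weXn2l; first by rewrite lerDl.
  by rewrite mul2n -addnn -!addnA leq_addr.
have : L * k' * (1 + k) ^+ size s <= L * k' * E by rewrite ler_wpM2l// mulr_ge0.
rewrite -natr1 => h; rewrite (mulrAC L) -lerBrDl; apply: (le_trans h).
by rewrite le_eqVlt; apply/orP; left; apply/eqP; ring.
Qed.

End splitting.

(** * The L^2 norm and pairings with functions carried by a set of finite measure *)

Section L2.
Context d (T : measurableType d) (R : realType) (mu : {measure set T -> \bar R}).
Implicit Types f g w : T -> R.

Local Notation L2 f := ((f : T -> R) \in Lfun mu 2%:E).

Definition nrm f := fine ('N[mu]_(2%:E)[EFin \o f])%E.

Lemma L2_meas f : L2 f -> measurable_fun setT f.
Proof. by move=> /andP[+ _]; rewrite inE. Qed.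

Lemma nrmE f : L2 f -> ('N[mu]_(2%:E)[EFin \o f] = (nrm f)%:E)%E.
Proof.
move=> /andP[_]; rewrite inE /finite_norm /= => fy.
by rewrite /nrm fineK// ge0_fin_numE// Lnorm_ge0.
Qed.

Lemma nrm_ge0 f : 0 <= nrm f.
Proof. by rewrite /nrm fine_ge0// Lnorm_ge0. Qed.

Lemma L2_sub f g : L2 f -> L2 g -> L2 (f \- g).
Proof.
have p1 : (1 <= 2%:E :> \bar R)%E by rewrite lee_fin ler1n.
move=> fL gL.
have Ng := Lfun_oppr_closed gL.
by have := (Lfun_addr_closed mu p1).2 _ _ fL Ng.
Qed.

Lemma nrm_triangle f g h : L2 f -> L2 g -> L2 h ->
  nrm (f \- h) <= nrm (f \- g) + nrm (g \- h).
Proof.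
move=> fL gL hL; rewrite -lee_fin EFinD -!nrmE ?L2_sub//.
have p1 : (1 <= 2%:E :> \bar R)%E by rewrite lee_fin ler1n.
have := eminkowski mu (L2_meas (L2_sub fL gL)) (L2_meas (L2_sub gL hL)) p1.
rewrite (_ : (f \- g) \+ (g \- h) = f \- h)//.
by apply/funext => x /=; ring.
Qed.

Lemma L2_mul_indic f B : L2 f -> measurable B -> (mu B < +oo)%E ->
  itg mu (fun x => f x * \1_B x) /\
  \int[mu]_x `|f x * \1_B x| <= nrm f * Num.sqrt (fine (mu B)).
Proof.
move=> fL mB By; have mf := L2_meas fL.
have mB1 : measurable_fun setT (\1_B : T -> R) by exact: measurable_indic.
have half : 2^-1 + 2^-1 = 1 :> R by lra.
have h := hoelder mu mf mB1 (ltr0n R 2) (ltr0n R 2) half.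
have NB : ('N[mu]_(2%:E)[EFin \o (\1_B : T -> R)] = (Num.sqrt (fine (mu B)))%:E)%E.
  rewrite unlock /Lnorm (eq_integral (fun x => (\1_B x : R)%:E)); last first.
    move=> x _; rewrite /= indicE; case: (x \in B) => /=.
      by rewrite normr1 powR1.
    by rewrite normr0 powR0// pnatr_eq0.
  rewrite (integral_indic _ measurableT mB) setIT -[X in (X `^ _)%E]fineK.
    by rewrite poweR_EFin powR12_sqrt// fine_ge0// measure_ge0.
  by rewrite ge0_fin_numE// measure_ge0.
rewrite Lnorm1 nrmE// NB -EFinM in h.
have mfB : measurable_fun setT (fun x => f x * \1_B x) by exact: measurable_funM.
have fB : itg mu (fun x => f x * \1_B x).
  apply/integrableP; split; first exact/measurable_EFinP.
  exact: (le_lt_trans h (ltry _)).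
split=> //; rewrite -lee_fin; apply: le_trans h.
rewrite /Rintegral fineK//; exact: (integrable_fin_num measurableT (itg_norm fB)).
Qed.

Lemma L2_pair f w A B : 0 <= A -> L2 f -> measurable B -> (mu B < +oo)%E ->
  measurable_fun setT w -> {ae mu, forall x, `|w x| <= A * \1_B x} ->
  itg mu (fun x => f x * w x) /\
  `|\int[mu]_x (f x * w x)| <= nrm f * A * Num.sqrt (fine (mu B)).
Proof.
move=> A0 fL mB By mw wA; have mf := L2_meas fL.
have [fB IB] := L2_mul_indic fL mB By.
have dom : {ae mu, forall x, `|f x * w x| <= A * `|f x * \1_B x|}.
  apply: aeS wA => x wx; rewrite !normrM mulrCA ler_wpM2l//.
  by rewrite (ger0_norm (_ : 0 <= \1_B x)) ?indicE//.
have fi : itg mu (fun x => f x * w x).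
  by apply: itg_dom_ae dom _; [exact: measurable_funM|apply: itgZ; exact: itg_norm].
split=> //; apply: (le_trans (Rint_norm_le fi (itgZ A (itg_norm fB)) dom)).
rewrite RintZ; last exact: itg_norm.
by rewrite (mulrC (nrm f)) -mulrA ler_wpM2l.
Qed.

End L2.

(** * Compactness of a time interval *)

Section heine.
Variable R : realType.

(** Heine's theorem for a pseudo-distance on times, by compactness of [0, b]; it serves both curves
    in L^2 and the scalar function that moves the frame. *)
Lemma heine (d : R -> R -> R) (b : R) :
  (forall r s q, d r s <= d r q + d s q) ->
  (forall r eta, 0 <= r <= b -> 0 < eta ->
     exists2 h, 0 < h & forall s, 0 <= s <= b -> `|s - r| < h -> d s r < eta) ->
  forall eta, 0 < eta -> exists2 h, 0 < h &
    forall r s, 0 <= r <= b -> 0 <= s <= b -> `|s - r| < h -> d s r < eta.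
Proof.
move=> tri H eta eta0.
have eta2 : 0 < eta / 2 by rewrite divr_gt0.
have := @segment_compact R 0 b.
rewrite compact_near_coveringP -near_covering_withinP => /(_ R (0^'+)
  (fun h r => forall s, 0 <= s <= b -> `|s - r| < h -> d s r < eta) _).
case.
  move=> r /=; rewrite in_itv/= => rb.
  have [h h0 hr] := H r _ rb eta2.
  exists ((ball r (h / 2) : set R), [set k : R | k < h / 2]) => /=.
    split; first by apply: nbhsx_ballx; rewrite divr_gt0.
    exists (h / 2) => /=; first by rewrite divr_gt0.
    move=> k /=; rewrite sub0r normrN => kh k0; exact: le_lt_trans (ler_norm _) kh.
  move=> [x k] /= [xr kh]; rewrite in_itv/= => xb s sb sx.
  have xr' : `|x - r| < h / 2 by rewrite distrC; exact: xr.
  have e1 : d s r < eta / 2.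
    apply: hr => //; have := ler_distD x s r; lra.
  have e2 : d x r < eta / 2 by apply: hr => //; lra.
  by apply: (le_lt_trans (tri s x r)); lra.
move=> h /= h0 Hh.
exists (h / 2); first by rewrite divr_gt0.
move=> r s rb sb sr; apply: (Hh (h / 2)) => //=.
- by rewrite sub0r normrN ger0_norm ?ltr_pdivrMr//; [lra|rewrite divr_ge0// ltW].
- by rewrite divr_gt0.
Qed.

Lemma compact_bound (F : R -> R) (b : R) :
  (forall r, 0 <= r <= b -> exists2 h, 0 < h &
     exists M, forall s, 0 <= s <= b -> `|s - r| < h -> F s <= M) ->
  exists M, forall r, 0 <= r <= b -> F r <= M.
Proof.
move=> H; have := @segment_compact R 0 b.
rewrite compact_near_coveringP -near_covering_withinP => /(_ R (+oo_R) (fun M r => F r <= M) _).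
case.
  move=> r /=; rewrite in_itv/= => rb; have [h h0 [M HM]] := H r rb.
  exists ((ball r h : set R), [set k : R | M < k]) => /=.
    split; first exact: nbhsx_ballx.
    by exists M; split => //; exact: num_real.
  move=> [x k] /= [xr Mk]; rewrite in_itv/= => xb.
  by apply: le_trans (ltW Mk); apply: HM => //; rewrite distrC; exact: xr.
move=> M [_ HM]; exists (M + 1) => r rb.
by apply: (HM (M + 1)); [rewrite ltrDl|rewrite /= in_itv].
Qed.

End heine.

(** * Continuous curves in L^2 *)

Section C_L2.
Variable R : realType.
Variable f : R -> V R -> R.
Hypothesis fC : C_L2 f.

(** The L^2 norm of the indicator of the ball of radius [r], a cube of side 2 r. *)
Definition cb (r : R) := Num.sqrt ((2 * r) ^+ 6).

Lemma cb_ge0 r : 0 <= cb r. Proof. exact: sqrtr_ge0. Qed.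

Lemma L2_pair_ball (g w : V R -> R) A r : (g : mV R -> R) \in Lfun (leb6 R) 2%:E ->
  0 <= A -> 0 <= r -> measurable_fun [set: mV R] w ->
  {ae leb6 R, forall z, `|w z| <= A * ball_ind r z} ->
  itg (leb6 R) (fun z => g z * w z) /\
  `|\int[leb6 R]_z (g z * w z)| <= nrm (leb6 R) g * A * cb r.
Proof.
move=> gL A0 r0 mw wA.
have By : (leb6 R [set z : V R | `|z| <= r]%R < +oo)%E.
  by apply: le_lt_trans (ltry ((2 * r) ^+ 6)); rewrite -(leb6_ball r0).
have [i b] := L2_pair A0 gL (measurable_ball r) By mw wA.
split=> //; apply: (le_trans b); rewrite le_eqVlt; apply/orP; left; apply/eqP.
rewrite /cb; congr (_ * Num.sqrt _).
apply: (@etrans _ _ (fine ((2 * r) ^+ 6)%:E)) => //; apply: f_equal; exact: leb6_ball.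
Qed.

Lemma C_L2_L2 t : 0 <= t -> (f t : mV R -> R) \in Lfun (leb6 R) 2%:E.
Proof. by case: fC => + _; apply. Qed.

Lemma C_L2_cts t eta : 0 <= t -> 0 < eta -> exists2 h, 0 < h &
  forall s, 0 <= s -> `|s - t| < h -> nrm (leb6 R) (f s \- f t) < eta.
Proof.
move=> t0 eta0; have [_ /(_ t t0)] := fC.
move=> /fine_cvgP[_ /cvgrPdist_lt /(_ _ eta0)].
rewrite near_withinE => /nbhs_ballP[h /= h0 H]; exists h => // s s0 sh.
have sb : ball t h s by rewrite /ball/= distrC.
have /(_ _) := H s sb; rewrite /= in_itv/= andbT s0 => /(_ isT).
by rewrite sub0r normrN; apply: le_lt_trans; exact: ler_norm.
Qed.

Lemma nrm_sym t s : 0 <= t -> 0 <= s ->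
  nrm (leb6 R) (f s \- f t) = nrm (leb6 R) (f t \- f s).
Proof.
move=> t0 s0; rewrite /nrm -oppe_Lnorm; congr fine; apply: eq_Lnorm => z /=.
by rewrite opprB.
Qed.

Lemma C_L2_unif b eta : 0 < eta -> exists2 h, 0 < h &
  forall r s, 0 <= r <= b -> 0 <= s <= b -> `|s - r| < h ->
  nrm (leb6 R) (f s \- f r) < eta.
Proof.
move=> eta0.
(* Times are clamped to nonnegative ones, where [f] is in L^2, so that the triangle inequality is
   available for all reals. *)
pose p (r : R) : R := Num.max 0 r.
pose d (r s : R) := nrm (leb6 R) (f (p r) \- f (p s)).
have p0 r : 0 <= p r by rewrite /p le_max lexx.
have pE r : 0 <= r <= b -> p r = r by rewrite /p => /andP[? _]; exact: max_r.
have tri r s q : d r s <= d r q + d s q.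
  rewrite /d (nrm_sym (p0 q) (p0 s)).
  by apply: nrm_triangle; exact: C_L2_L2.
have [|h h0 H] := @heine R d b tri _ eta eta0.
  move=> r e rb e0; have [h h0 H] := C_L2_cts (p0 r) e0.
  exists h => // s sb sr; apply: H => //; by rewrite !pE.
exists h => // r s rb sb sr; have := H r s rb sb sr.
by rewrite /d !pE.
Qed.

Lemma C_L2_bounded b : exists M, forall r, 0 <= r <= b -> nrm (leb6 R) (f r) <= M.
Proof.
apply: compact_bound => r rb; have r0 : 0 <= r by case/andP: rb.
have [h h0 H] := C_L2_cts r0 ltr01; exists h => //.
exists (1 + nrm (leb6 R) (f r)) => s /andP[s0 _] sr.
have p1 : (1 <= 2%:E :> \bar R)%E by rewrite lee_fin ler1n.
have z0 : (cst 0 : mV R -> R) \in Lfun (leb6 R) 2%:E.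
  by have [+ _] := Lfun_addr_closed (leb6 R) p1.
have := nrm_triangle (C_L2_L2 s0) (C_L2_L2 r0) z0.
have e g : g \- cst 0 = g :> (V R -> R) by apply/funext => z; rewrite /= subr0.
rewrite !e => /le_trans; apply; rewrite lerD2r; exact/ltW/H.
Qed.

End C_L2.

(** * From W^{k,oo} bounds to weak Lipschitz bounds on R^6 *)

Section weak_lipschitz_data.
Variable R : realType.

(** Turns an essential bound by [M] into a bound at every point, while changing the function only on
    a null set. *)
Definition clip (M x : R) : R := Num.max (- M) (Num.min M x).

Lemma clip_bound M x : 0 <= M -> `|clip M x| <= M.
Proof.
move=> M0; rewrite /clip ler_norml le_max lexx /= ge_max ge_min lexx /= andbT; lra.
Qed.

Lemma clip_id M x : `|x| <= M -> clip M x = x.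
Proof. by rewrite ler_norml /clip => /andP[a b]; rewrite min_r// max_r. Qed.

Lemma measurable_clip d (T : measurableType d) (M f : T -> R) :
  measurable_fun setT M -> measurable_fun setT f ->
  measurable_fun setT (fun x => clip (M x) (f x)).
Proof.
move=> mM mf; apply: measurable_maxr; first exact: measurable_funN.
exact: measurable_minr.
Qed.

Lemma Lnormy_ae d (T : measurableType d) (mu : {measure set T -> \bar R}) (u : T -> R) M :
  ('N[mu]_(+oo%E)[EFin \o u] <= M%:E)%E -> {ae mu, forall x, `|u x| <= M}.
Proof.
rewrite unlock /Lnorm; case: ifPn => [mT|mT].
  by move=> /ess_sup_inf.ess_supP; apply: aeS => x; rewrite /= lee_fin.
move=> _; exists setT; split => //.
by apply/eqP; rewrite eq_le measure_ge0 andbT leNgt.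
Qed.

Lemma ae_fst d1 d2 (T1 : measurableType d1) (T2 : measurableType d2)
    (m1 : {sigma_finite_measure set T1 -> \bar R})
    (m2 : {sigma_finite_measure set T2 -> \bar R}) (P : T1 -> Prop) :
  {ae m1, forall x, P x} -> {ae prod_measure m1 m2, forall z, P z.1}.
Proof.
move=> [N [mN N0 PN]]; exists (N `*` setT); split.
- exact: measurableX.
- by apply: etrans (prod_measureX m1 m2 mN measurableT) _; rewrite N0 mul0e.
- by move=> z /= Pz; split=> //; apply: PN.
Qed.

Lemma Rfubini_prod d1 d2 (T1 : measurableType d1) (T2 : measurableType d2)
    (m1 : {sigma_finite_measure set T1 -> \bar R})
    (m2 : {sigma_finite_measure set T2 -> \bar R}) (f : T1 * T2 -> R) :
  itg (prod_measure m1 m2) f ->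
  (forall y, itg m1 (fun x => f (x, y))) ->
  itg m2 (fun y => \int[m1]_x f (x, y)) /\
  \int[prod_measure m1 m2]_z f z = \int[m2]_y \int[m1]_x f (x, y).
Proof.
move=> fi iy.
have E := integral21_prod_meas1 fi.
have e1 y : (\int[m1]_x (EFin \o f) (x, y) = (\int[m1]_x f (x, y))%:E)%E.
  by rewrite /Rintegral fineK//; exact: (integrable_fin_num measurableT (iy y)).
have mfE : measurable_fun setT (EFin \o f) by case/integrableP: fi.
split.
  apply/integrableP; split.
    have := measurable_fubini_G fi.
    by congr (measurable_fun _ _); apply/funext => y; rewrite /fubini_G e1.
  have : (\int[m2]_y \int[m1]_x `|(EFin \o f) (x, y)| < +oo)%E.
    exact/(integrable21ltyP m1 m2 mfE).
  apply: le_lt_trans; apply: ge0_le_integral => //.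
  - apply: measurableT_comp => //; have := measurable_fubini_G fi.
    by congr (measurable_fun _ _); apply/funext => y; rewrite /fubini_G e1.
  - apply: (@measurable_fun_fubini_tonelli_G _ _ _ _ _ m1 (fun z => `|(EFin \o f) z|%E)) => //.
    exact: measurableT_comp.
  - move=> y _; have [my _] := integrableP _ _ _ (iy y).
    by have := le_abse_integral m1 measurableT my; rewrite e1.
rewrite /Rintegral; apply: (congr1 fine); apply: etrans (esym E) _.
by apply: eq_integral => y _; rewrite /fubini_G -e1.
Qed.

Lemma weak_lip_scale (a M : R) (u : V R -> R) : weak_lip M u ->
  weak_lip (`|a| * M) (fun z => a * u z).
Proof.
move=> [mu_ ub W]; split=> [|z|L H chi D r j r0 cC cr]; first exact: measurable_funM.
  by rewrite normrM ler_wpM2l.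
under eq_Rintegral do rewrite -mulrA.
have Di := C11_D_itg (basis6 R j) r0 cC cr.
rewrite RintZ; last first.
  have := itg_mulb Di mu_ ub.
  by congr itg; apply/funext => z; rewrite mulrC.
by rewrite normrM -mulrA ler_wpM2l//; exact: W cC cr.
Qed.

(* Integrating by parts along [e_j] a function that does not depend on [z_j] gives 0. *)
Lemma Rint_D_invariant (M L H r : R) (u chi : V R -> R) D j :
  measurable_fun [set: mV R] u -> (forall z, `|u z| <= M) ->
  (forall z a, u (z + a *: basis6 R j) = u z) ->
  0 <= r -> C11 L H chi D -> vanish_off r chi ->
  \int[leb6 R]_z (u z * D z (basis6 R j)) = 0.
Proof.
move=> mu_ ub uj r0 cC cr.
have M0 : 0 <= M := le_trans (normr_ge0 _) (ub 0).
have H0 := C11_H_ge0 cC; have mchi : measurable_fun [set: mV R] chi by case: cC.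
have Di := C11_D_itg (basis6 R j) r0 cC cr.
have ui : itg (leb6 R) (fun z => u z * D z (basis6 R j)).
  have := itg_mulb Di mu_ ub.
  by congr itg; apply/funext => z; rewrite mulrC.
have cst a : correlation u chi (0 + a *: basis6 R j) = correlation u chi 0.
  transitivity (\int[leb6 R]_y (u y * chi y)).
    rewrite -(Rint_transl (a *: basis6 R j)); last exact: measurable_funM.
    by apply: eq_Rintegral => y _; rewrite uj add0r.
  by apply: eq_Rintegral => y _; rewrite addr0.
set I := \int[leb6 R]_z _; set K := 2 * M * H * (2 * r) ^+ 6.
have K0 : 0 <= K by rewrite !mulr_ge0// exprn_ge0// mulr_ge0.
have T a : 0 < a -> `|I| <= K * a.
  move=> a0; have := correlation_taylor mu_ ub r0 cC cr 0 (a *: basis6 R j).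
  rewrite cst subrr sub0r normrN -/K.
  have -> : \int[leb6 R]_y (u y * D (y + 0) (a *: basis6 R j)) = a * I.
    rewrite -RintZ//; apply: eq_Rintegral => y _.
    by rewrite (C11_Z cC) addr0; ring.
  rewrite normrM (gtr0_norm a0) => h.
  rewrite -(ler_pM2l a0); apply: (le_trans h).
  rewrite (_ : a * (K * a) = K * a ^+ 2); last by ring.
  rewrite (ler_wpM2l K0)// normrZ (gtr0_norm a0).
  rewrite ler_sqr ?nnegrE ?mulr_ge0 ?(ltW a0)//.
  by rewrite ler_piMr ?normr_basis6 ?(ltW a0).
apply/eqP; rewrite -normr_le0; apply/ler_addgt0Pr => e e0; rewrite add0r.
have k1 : 0 < K + 1 by rewrite ltr_wpDl.
have := T (e / (K + 1)) (divr_gt0 e0 k1) => /le_trans; apply.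
rewrite (_ : K * (e / (K + 1)) = e * (K / (K + 1))); last by ring.
by rewrite ler_piMr ?(ltW e0)// ler_pdivrMr// mul1r lerDl.
Qed.

Definition ball3 (r : R) : set (R3 R) := [set x | `|x| <= r].

Lemma measurable_ball3 r : measurable (ball3 r : set (mR3 R)).
Proof.
have m3 : measurable_fun [set: mR3 R] (fun x : R3 R => (x, 0) : mV R).
  exact: measurable_fun_pair.
have := m3 measurableT _ (measurable_ball r); rewrite setTI.
congr measurable; apply/seteqP; split => x; rewrite /= prod_normE /= normr0 ge_max.
  by move=> /andP[].
by move=> xr; rewrite xr /=; exact: le_trans (normr_ge0 _) xr.
Qed.

Lemma itg_ball3 r : 0 <= r -> itg (leb3 R) (\1_(ball3 r) : R3 R -> R).
Proof.
move=> r0; apply: (itg_indic (measurable_ball3 r)).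
have E : leb6 R [set z : V R | `|z| <= r]%R = (leb3 R (ball3 r) * leb3 R (ball3 r))%E.
  have -> : [set z : V R | `|z| <= r]%R = ball3 r `*` ball3 r.
    apply/seteqP; split => z /=; rewrite prod_normE ge_max /ball3 /=; first by move=> /andP[].
    by move=> [-> ->].
  exact: (prod_measureX (leb3 R) (leb3 R) (measurable_ball3 r) (measurable_ball3 r)).
have := leb6_ball r0; rewrite E => {}E.
rewrite ltNge leye_eq; apply/negP => /eqP h; move: E; rewrite h.
by rewrite mulyy.
Qed.

(** In the p directions the function is invariant and pairs to zero with a derivative
    ([Rint_D_invariant]). In the x directions Fubini reduces to slices at fixed p, where chi is an
    admissible test for the weak derivative of u, itself essentially bounded by |M|. *)
Lemma W1oo3_weak_lip (u : R3 R -> R) (M : R) : Woo3_le 2 u M ->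
  weak_lip `|M| (fun z => clip `|M| (u z.1)) /\
  {ae leb6 R, forall z : V R, clip `|M| (u z.1) = u z.1}.
Proof.
move=> [mu_ uM ud]; set M' := `|M|.
have M'0 : 0 <= M' by exact: normr_ge0.
have uae : {ae leb3 R, forall x, clip M' (u x) = u x}.
  apply: aeS (Lnormy_ae uM) => x xM; apply: clip_id.
  exact: le_trans xM (ler_norm _).
split; last exact: (ae_fst (leb3 R) uae).
have mc : measurable_fun [set: mR3 R] (fun x => clip M' (u x)) by exact: measurable_clip.
split=> [|z|L H chi D r j r0 cC cr].
- exact: (measurableT_comp mc).
- exact: clip_bound.
case: j => i; last first.
  rewrite (@Rint_D_invariant M' L H r _ chi D (inr i))//.
  - by rewrite normr0 mulr_ge0//; apply: Rintegral_ge0.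
  - exact: (measurableT_comp mc).
  - by move=> z; exact: clip_bound.
  - by move=> z a /=; rewrite scaler0 addr0.
have [g gd [mg gM _]] := ud i.
have gae : {ae leb3 R, forall x, `|g x| <= M'}.
  by apply: aeS (Lnormy_ae gM) => x xM; exact: le_trans xM (ler_norm _).
have mchi : measurable_fun [set: mV R] chi by case: cC.
have mD : measurable_fun [set: mV R] (D^~ (basis6 R (inl i))) by case: cC.
have sec (q : V R -> R) p : measurable_fun [set: mV R] q ->
    measurable_fun [set: mR3 R] (fun x : R3 R => q (x, p)).
  by move=> mq; exact: (measurable_fun_pair1 p mq).
have dom3 (q : V R -> R) B p x : vanish_off r q -> (forall z, `|q z| <= B) ->
    `|q (x, p)| <= B * \1_(ball3 r) x.
  move=> qr qB; rewrite indicE; case: (boolP (x \in _)) => xr; first by rewrite mulr1.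
  rewrite qr ?normr0 ?mulr0//; rewrite prod_normE lt_max ltNge.
  by apply/orP; left; apply/negP => h; move/negP: xr; apply; rewrite inE.
have itg3 (q : V R -> R) B p : measurable_fun [set: mV R] q -> vanish_off r q ->
    (forall z, `|q z| <= B) -> itg (leb3 R) (fun x : R3 R => q (x, p)).
  move=> mq qr qB; apply: (@itg_dom _ _ _ (leb3 R) _ (fun x => B * \1_(ball3 r) x)).
  - exact: sec.
  - by move=> x; exact: dom3.
  - by apply: itgZ; exact: itg_ball3.
have Dr : vanish_off r (D^~ (basis6 R (inl i))).
  by move=> z zr; exact: (C11_D_vanish cC cr _ zr).
have DB z : `|D z (basis6 R (inl i))| <= L * `|basis6 R (inl i)| by case: cC.
have cB := C11_bounded r0 cC cr.
pose f (z : V R) := clip M' (u z.1) * D z (basis6 R (inl i)).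
have fi : itg (leb6 R) f.
  have := itg_mulb (C11_D_itg (basis6 R (inl i)) r0 cC cr)
    (measurableT_comp mc measurable_fst : measurable_fun [set: mV R] (fun z => clip M' (u z.1)))
    (fun z => clip_bound (u z.1) M'0).
  by congr itg; apply/funext => z; rewrite mulrC.
have f3 p : itg (leb3 R) (fun x => f (x, p)).
  have := itg_mulb (itg3 _ _ p mD Dr DB) mc (fun x => clip_bound (u x) M'0).
  by congr itg; apply/funext => x; rewrite mulrC.
have [fpi fpE] := Rfubini_prod fi f3.
have ci := C11_itg r0 cC cr.
have nc3 p : itg (leb3 R) (fun x => `|chi (x, p)|).
  by apply: itg_norm; exact: itg3 cB.
have [cpi cpE] := Rfubini_prod (itg_norm ci) nc3.
rewrite fpE cpE -RintZ//; apply: Rint_norm_le => //; first exact: itgZ.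
apply: aeW => p.
have [cC1 cd] := section_C1c p cC cr.
have -> : \int[leb3 R]_x f (x, p) = - \int[leb3 R]_x (g x * chi (x, p)).
  rewrite -(gd _ cC1); apply: Rint_ae_eq.
  - by have := itg_meas (f3 p).
  - apply: measurable_funM => //; under eq_fun do rewrite cd.
    exact: (sec _ p mD).
  - by apply: aeS uae => x ux; rewrite /f /= ux cd.
rewrite normrN -RintZ; last exact: nc3.
apply: Rint_norm_le.
- have c3 : itg (leb3 R) (fun x => chi (x, p)) by exact: itg3 cB.
  apply: (@itg_dom_ae _ _ _ (leb3 R) _ (fun x => M' * `|chi (x, p)|)).
  + by apply: measurable_funM => //; exact: sec.
  + by apply: aeS gae => x gx; rewrite normrM ler_wpM2r.
  + exact: itgZ.
- by apply: itgZ.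
- by apply: aeS gae => x gx; rewrite normrM ler_wpM2r.
Qed.

End weak_lipschitz_data.

(** * Representatives of the electric field *)

Section field_data.
Variable R : realType.

Lemma weak_lip_le (M M' : R) (u : V R -> R) : M <= M' -> weak_lip M u -> weak_lip M' u.
Proof.
move=> MM [a b c]; split=> [//|z|L H chi D r j r0 cC cr]; first exact: le_trans (b z) MM.
apply: le_trans (c _ _ _ _ _ j r0 cC cr) _; rewrite ler_wpM2r//.
by apply: Rintegral_ge0.
Qed.

Lemma weak_lip0 : weak_lip 0 (fun _ : V R => 0 : R).
Proof.
split=> [|z|L H chi D r j r0 cC cr]; [exact: measurable_cst|by rewrite normr0|].
by rewrite mul0r; under eq_Rintegral do rewrite mul0r; rewrite Rint0 normr0.
Qed.

(** With half-open intervals, the indicators of adjacent intervals add up at every point. *)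
Definition tind (s t : R) : R -> R := \1_(`[s, t[%classic).

Lemma measurable_tind s t : measurable_fun [set: measurableTypeR R] (tind s t).
Proof. by apply: measurable_indic; exact: measurable_itv. Qed.

Lemma tindE s t r : tind s t r = (s <= r < t)%R%:R.
Proof.
rewrite /tind indicE; congr (_%:R); congr nat_of_bool.
by apply/idP/idP; rewrite inE /= in_itv.
Qed.

Lemma tind_ge0 s t r : 0 <= tind s t r.
Proof. by rewrite tindE. Qed.

Lemma tind_le1 s t r : tind s t r <= 1.
Proof. by rewrite tindE; case: (_ && _). Qed.

Lemma tind_split s q t r : s <= q -> q <= t -> tind s t r = tind s q r + tind q t r.
Proof.
move=> sq qt; rewrite !tindE; case: (leP s r) => sr; case: (ltP r t) => rt;
  case: (leP q r) => qr /=; rewrite ?add0r ?addr0//; lra.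
Qed.

(** The representative is clipped at the good times G, where the W^{2,oo} bound holds, and zero at
    all others. The bounds then hold at every time and point, while equality with u survives almost
    everywhere, which is all the weak formulation sees. *)
Lemma field_component (u : R -> R3 R -> R) : L1loc_Woo 2 u ->
  exists (h : R -> V R -> R) (K : R -> R), [/\
   measurable_fun [set: measurableTypeR R * mV R] (fun q : R * V R => h q.1 q.2),
   forall t, weak_lip (K t) (h t),
   forall t z i a, h t (z + a *: basis6 R (inr i)) = h t z,
   forall b, itg (leb R) (fun t => tind 0 b t * K t) &
   {ae leb R, forall t, 0 <= t -> {ae leb6 R, forall z, h t z = u t z.1}}].
Proof.
move=> [mu_ [K [Ki [N [mN N0 KN]]]]].
pose G : set (measurableTypeR R) := `[0, +oo[%classic `\` N.
have mG : measurable G by apply: measurableD => //; exact: measurable_itv.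
have GW t : G t -> Woo3_le 2 (u t) (K t).
  move=> [/=]; rewrite in_itv/= andbT => t0 tN.
  by apply: contrapT => W; apply: tN; apply: KN => /= /(_ t0).
pose Dp : set (measurableTypeR R * mR3 R) := [set z | 0 <= z.1].
have mDp : measurable Dp.
  have := @measurable_fst _ _ (measurableTypeR R) (mR3 R) measurableT _
    (measurable_itv `[0, +oo[).
  by rewrite setTI; congr measurable; apply/seteqP; split => z /=; rewrite in_itv/= andbT.
pose v (q : R * R3 R) : R := ((fun z => u z.1 z.2) \_ Dp) q.
have mv : measurable_fun [set: measurableTypeR R * mR3 R] v.
  exact: (proj1 (measurable_restrictT _ mDp)).
pose K' (t : R) : R := ((fun t => `|K t|) \_ G) t.
have mK' : measurable_fun [set: measurableTypeR R] K'.
  apply/(measurable_restrictT _ mG).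
  have GE : G = \bigcup_n (`[0, n%:R]%classic `&` G).
    apply/seteqP; split=> [t Gt|t [n _ []//]].
    have t0 : 0 <= t by case: Gt => /=; rewrite in_itv/= andbT.
    exists (Num.truncn t).+1 => //; split=> //=; rewrite in_itv/= t0/=.
    exact/ltW/truncnS_gt.
  rewrite GE; apply/measurable_fun_bigcup.
    by move=> n; apply: measurableI => //; exact: measurable_itv.
  move=> n; apply: measurableT_comp => //.
  have /integrableP[mKn _] := Ki n%:R.
  have {}mKn : measurable_fun (`[0, n%:R]%classic : set (measurableTypeR R)) K by exact/measurable_EFinP.
  by apply: measurable_funS mKn => //; exact: measurable_itv.
have K'0 t : 0 <= K' t by rewrite /K' /patch; case: ifP.
pose h (t : R) (z : V R) : R := (\1_G t : R) * clip (K' t) (v (t, z.1)).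
exists h, K'; split.
- apply: measurable_funM.
    by apply: (measurableT_comp (measurable_indic mG)).
  apply: measurable_clip; first exact: (measurableT_comp mK').
  apply: (measurableT_comp mv); apply: measurable_fun_pair => //.
  exact: (measurableT_comp measurable_fst).
- move=> t; case: (pselect (G t)) => Gt; last first.
    rewrite (_ : h t = fun=> 0); last first.
      by apply/funext => z; rewrite /h indicE memNset// mul0r.
    by apply: weak_lip_le weak_lip0.
  have [W _] := W1oo3_weak_lip (GW t Gt).
  have t0 : 0 <= t by case: Gt => /=; rewrite in_itv/= andbT.
  rewrite (_ : h t = fun z => clip `|K t| (u t z.1)) /K' /patch ?mem_set//.
  apply/funext => z; rewrite /h indicE mem_set// mul1r /K' /v /patch mem_set//.
  by rewrite mem_set.
- by move=> t z i a; rewrite /h /= scaler0 addr0.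
- move=> b.
  apply: (@itg_dom_ae _ _ _ (leb R) _ (fun t => `|((fun t => `|K t|) \_ `[0, b]) t|)).
  + by apply: measurable_funM => //; exact: measurable_tind.
  + apply: aeW => t; rewrite tindE /K' /patch.
    case: (boolP (0 <= t < b)) => [/andP[t0 tb]|]; last by rewrite mul0r normr0.
    rewrite mul1r (_ : t \in `[0, b]%classic); last by rewrite inE /= in_itv/= t0 ltW.
    by rewrite normr_id; case: ifP => _; rewrite ?normr0// normr_id.
  + apply: itg_norm; have mI : measurable (`[0, b]%classic : set (measurableTypeR R)).
      exact: measurable_itv.
    have /(integrable_mkcond _ mI) := integrable_abse (Ki b).
    by congr (_.-integrable _ _); apply/funext => t; rewrite /= /patch; case: ifP.
- exists N; split => // t /= tW; apply: contrapT => tN; apply: tW => t0.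
  have Gt : G t by split => //=; rewrite in_itv/= t0.
  have [_ W] := W1oo3_weak_lip (GW t Gt).
  apply: aeS W => z zE; rewrite /h indicE mem_set// mul1r -[RHS]zE.
  by rewrite /K' /v /patch !mem_set.
Qed.

End field_data.

(** * Integrals of possibly nonmeasurable functions that agree almost everywhere *)

Section null_sets.
Import HBNNSimple.
Context d (T : measurableType d) (R : realType) (mu : {measure set T -> \bar R}).

(* The integrands need not be measurable, hence the detour through simple
   functions. *)
Lemma ae_integral_ge0_le (f g : T -> \bar R) : (forall x, 0 <= f x)%E ->
  (forall x, 0 <= g x)%E -> {ae mu, forall x, f x = g x} ->
  (\int[mu]_x f x <= \int[mu]_x g x)%E.
Proof.
move=> f0 g0 [N [mN N0 fgN]].
rewrite [leLHS]ge0_integralTE// ge_ereal_sup// => _ [h hf <-].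
have mNC : measurable (~` N) by exact: measurableC.
pose h' := mul_nnsfun h (indic_nnsfun R mNC).
have -> : sintegral mu h = sintegral mu h'.
  rewrite -[LHS]integralT_nnsfun -[RHS]integralT_nnsfun; apply: ae_eq_integral => //.
  - by apply/measurable_EFinP.
  - by apply/measurable_EFinP.
  exists N; split => // x /= hh; apply: contrapT => xN; apply: hh => _.
  by rewrite /h' /= mindicE mem_set// mulr1.
rewrite ge0_integralTE//; apply: ereal_sup_ubound; exists h' => // x.
rewrite /h' /= mindicE; case: (pselect (N x)) => xN.
  by rewrite memNset ?mulr0//; exact.
rewrite mem_set// mulr1; apply: le_trans (hf x) _.
rewrite (_ : f x = g x)//; apply: contrapT => fg; exact: xN (fgN x fg).
Qed.

Lemma ae_integral_eq (f g : T -> \bar R) : {ae mu, forall x, f x = g x} ->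
  (\int[mu]_x f x = \int[mu]_x g x)%E.
Proof.
move=> fg; have gf : {ae mu, forall x, g x = f x} by apply: aeS fg.
have W (u v : T -> \bar R) : (forall x, 0 <= u x)%E -> (forall x, 0 <= v x)%E ->
    {ae mu, forall x, u x = v x} -> (\int[mu]_x u x = \int[mu]_x v x)%E.
  move=> u0 v0 E; apply/eqP; rewrite eq_le !ae_integral_ge0_le//.
  by apply: aeS E.
rewrite integralE [RHS]integralE; congr (_ - _)%E; apply: W => //.
- by apply: aeS fg => x E; rewrite !funeposE E.
- by apply: aeS fg => x E; rewrite !funenegE E.
Qed.

(** Meant for the integrands of the weak formulation, which come without measurability. *)
Lemma ae_Rintegral_eq (D : set T) (f g : T -> R) : {ae mu, forall x, D x -> f x = g x} ->
  \int[mu]_(x in D) f x = \int[mu]_(x in D) g x.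
Proof.
move=> fg; rewrite /Rintegral [in LHS]integral_mkcond [in RHS]integral_mkcond; congr fine.
apply: ae_integral_eq; apply: aeS fg => x E; rewrite !patchE; case: ifPn => // /set_mem Dx.
by rewrite E.
Qed.

End null_sets.

(** * The force and the initial datum *)

Section solution_data.
Variable R : realType.

(** The force as a field on R^6 with one common bound K: zero in the x components, and in the p
    components a function of x alone, hence free of the coordinate it moves. *)
Lemma force_data (e : R) (E : R -> R3 R -> R3 R) :
  (forall i, L1loc_Woo 2 (fun t x => coord3 i (E t x))) ->
  exists (h : J -> R -> V R -> R) (K : R -> R), [/\
   forall j, measurable_fun [set: measurableTypeR R * mV R]
     (fun q : R * V R => h j q.1 q.2),
   forall j t, weak_lip (K t) (h j t),
   forall j t z a, h j t (z + a *: basis6 R j) = h j t z,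
   forall b, itg (leb R) (fun t => tind 0 b t * K t) &
   {ae leb R, forall t, 0 <= t -> {ae leb6 R, forall z, forall j,
      h j t z = match j with inl _ => 0 | inr i => e * coord3 i (E t z.1) end}}].
Proof.
move=> EW.
have /choice[hK hKP] : forall i : 'I_3, exists hK : (R -> V R -> R) * (R -> R), [/\
   measurable_fun [set: measurableTypeR R * mV R] (fun q : R * V R => hK.1 q.1 q.2),
   forall t, weak_lip (hK.2 t) (hK.1 t),
   forall t z i a, hK.1 t (z + a *: basis6 R (inr i)) = hK.1 t z,
   forall b, itg (leb R) (fun t => tind 0 b t * hK.2 t) &
   {ae leb R, forall t, 0 <= t -> {ae leb6 R, forall z, hK.1 t z = coord3 i (E t z.1)}}].
  by move=> i; have [h [K P]] := field_component (EW i); exists (h, K).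
pose h (j : J) t z : R := match j with inl _ => 0 | inr i => e * (hK i).1 t z end.
pose K t : R := \sum_(i < 3) `|e| * (hK i).2 t.
have K0 i t : 0 <= `|e| * (hK i).2 t.
  rewrite mulr_ge0//; have [_ W _ _ _] := hKP i; have [_ b _] := W t.
  exact: le_trans (b 0).
exists h, K; split.
- case=> i; first exact: measurable_cst.
  by apply: measurable_funM => //; have [] := hKP i.
- case=> i t.
    by apply: weak_lip_le (@weak_lip0 R); apply: sumr_ge0.
  have [_ W _ _ _] := hKP i; apply: weak_lip_le (weak_lip_scale e (W t)).
  rewrite /K (bigD1 i)//= lerDl; exact: sumr_ge0.
- by case=> i t z a //=; congr (_ * _); have [_ _ W _ _] := hKP i; exact: W.
- move=> b; have := @Rint_sum _ _ _ (leb R) _ (index_enum 'I_3)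
    (fun i t => `|e| * (tind 0 b t * (hK i).2 t)).
  case=> [i|+ _]; first by apply: itgZ; have [_ _ _ W _] := hKP i; exact: W.
  congr itg; apply/funext => t; rewrite /K mulr_sumr; apply: eq_bigr => i _; ring.
- have [_ _ _ _ W0] := hKP (@Ordinal 3 0 isT).
  have [_ _ _ _ W1] := hKP (@Ordinal 3 1 isT).
  have [_ _ _ _ W2] := hKP (@Ordinal 3 2 isT).
  apply: aeS (aeI W0 (aeI W1 W2)) => t [E0 [E1 E2]] t0.
  apply: aeS (aeI (E0 t0) (aeI (E1 t0) (E2 t0))) => z [e0 [e1 e2]] [//|].
  by apply: ord3_cases => /=; congr (_ * _).
Qed.

Lemma initial_data (fin : V R -> R) : Woo6 2 fin ->
  exists (M : R) (g : V R -> R), weak_lip M g /\ {ae leb6 R, forall z, g z = fin z}.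
Proof.
move=> [M [mu_ uM ud]]; set M' := `|M|.
have M'0 : 0 <= M' by exact: normr_ge0.
have uae : {ae leb6 R, forall x, clip M' (fin x) = fin x}.
  apply: aeS (Lnormy_ae uM) => x xM; apply: clip_id.
  exact: le_trans xM (ler_norm _).
exists M', (fun z => clip M' (fin z)); split=> //.
have mc : measurable_fun [set: mV R] (fun x => clip M' (fin x)) by exact: measurable_clip.
split=> [//|z|L H chi D r j r0 cC cr]; first exact: clip_bound.
have [g gd [mg gM _]] := ud j.
have gae : {ae leb6 R, forall x, `|g x| <= M'}.
  by apply: aeS (Lnormy_ae gM) => x xM; exact: le_trans xM (ler_norm _).
have mD : measurable_fun [set: mV R] (D^~ (basis6 R j)) by case: cC.
have mchi : measurable_fun [set: mV R] chi by case: cC.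
have dE z := proj2 (C11_derive z (basis6 R j) cC).
have ci := C11_itg r0 cC cr.
have -> : \int[leb6 R]_z (clip M' (fin z) * D z (basis6 R j)) =
    - \int[leb6 R]_z (g z * chi z).
  rewrite -(gd _ (C11_C1c cC cr)); apply: Rint_ae_eq.
  - exact: measurable_funM.
  - by apply: measurable_funM => //; under eq_fun do rewrite dE.
  - by apply: aeS uae => x ux; rewrite ux dE.
have gc : {ae leb6 R, forall z, `|g z * chi z| <= M' * `|chi z|}.
  by apply: aeS gae => z gz; rewrite normrM ler_wpM2r.
have cM : itg (leb6 R) (fun z => M' * `|chi z|) by apply: itgZ; exact: itg_norm.
rewrite normrN -RintZ; last exact: itg_norm.
by apply: Rint_norm_le => //; apply: itg_dom_ae gc cM; exact: measurable_funM.
Qed.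

End solution_data.

Lemma coord3N (R : realType) (i : 'I_3) (x : R3 R) : coord3 i (- x) = - coord3 i x.
Proof. by rewrite -scaleN1r coord3Z mulN1r. Qed.

(** Unlike [vring], it splits into the six explicit coordinates, because [perp] permutes them. *)
Ltac vcoord := apply: coord6_inj => -[]; apply: ord3_cases;
  rewrite ?(coord6D, coord6B, coord6N, coord6Z) /coord6 /=
    ?(coord3D, coord3N, coord3Z) /coord3 /perp /= /GRing.scale /=; ring.

(** * Moving frames and space-time test functions *)

Section time_frames.
Variable R : realType.

Lemma bounded_linear_is_diff (U W : normedModType R) (f : U -> W) (L : R) x :
  linear f -> (forall h, `|f h| <= L * `|h|) -> is_diff x f f.
Proof.
move=> lf fL; pose isL := GRing.isLinear.Build R U W *:%R f lf.
pose g : {linear U -> W} := HB.pack f isL.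
have cg : continuous g.
  apply: bounded_linear_continuous; apply/linear_boundedP; exists L.
  split=> [|M /ltW LM h]; first exact: num_real.
  by apply: (le_trans (fL h)); rewrite ler_wpM2r.
apply: DiffDef; first exact: (linear_differentiable x cg).
exact: (diff_lin x cg).
Qed.

Lemma is_diff1 (f : R -> R) x : derivable f x 1 ->
  is_diff x f (fun h => h * derive1 f x).
Proof.
move=> /derivable1_diffP df; apply: DiffDef => //; rewrite (diff1E df).
by apply/funext => h.
Qed.

Lemma is_diff_fst (U W : normedModType R) (q : U * W) :
  is_diff q (fst : U * W -> U) fst.
Proof.
apply: (@bounded_linear_is_diff _ _ _ 1) => [a u v|h]; first by [].
by rewrite mul1r [leRHS]prod_normE le_max lexx.
Qed.

Lemma is_diff_snd (U W : normedModType R) (q : U * W) :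
  is_diff q (snd : U * W -> W) snd.
Proof.
apply: (@bounded_linear_is_diff _ _ _ 1) => [a u v|h]; first by [].
by rewrite mul1r [leRHS]prod_normE le_max lexx orbT.
Qed.

(** A shift of the momentum that acts as a change of gauge: when [c] follows theta, its time
    derivative cancels the induced field in theta'. The inverse is [frame (- c)]. *)
Definition frame (c : R) (z : V R) : V R := (z.1, z.2 - c *: perp z.1).

Lemma frameE c z : frame c z =
  z + (- (c * z.1.1.2)) *: basis6 R (inr (@Ordinal 3 0 isT))
    + (c * z.1.1.1) *: basis6 R (inr (@Ordinal 3 1 isT)).
Proof.
rewrite /frame; vcoord.
Qed.

Lemma frameD c z h : frame c (z + h) = frame c z + frame c h.
Proof. by rewrite !frameE; vring. Qed.

Lemma frameZ c a z : frame c (a *: z) = a *: frame c z.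
Proof. by rewrite /frame; vcoord. Qed.

Lemma frameK c : cancel (frame c) (frame (- c)).
Proof. by move=> [x p]; rewrite /frame /= scaleNr opprK subrK. Qed.

Lemma frame_sub c c' z : frame c z - frame c' z = (c' - c) *: ((0, perp z.1) : V R).
Proof.
rewrite /frame; vcoord.
Qed.

Lemma normr_perp (x : R3 R) : `|perp x| <= `|x|.
Proof.
rewrite prod_normE ge_max normr0 normr_ge0 andbT prod_normE ge_max normrN /=.
by rewrite (normr_coord3 (@Ordinal 3 1 isT)) (normr_coord3 (@Ordinal 3 0 isT)).
Qed.

Lemma normr_fst (z : V R) : `|z.1| <= `|z|.
Proof. by rewrite [leRHS]prod_normE le_max lexx. Qed.

Lemma normr_perp_part (z : V R) : `|(0, perp z.1) : V R| <= `|z|.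
Proof.
rewrite prod_normE normr0 ge_max normr_ge0/=.
exact: le_trans (normr_perp _) (normr_fst z).
Qed.

Lemma frame_growth c z : `|frame c z| <= (1 + `|c|) * `|z|.
Proof.
have -> : frame c z = z - c *: ((0, perp z.1) : V R).
  rewrite /frame; vcoord.
apply: le_trans (ler_normB _ _) _; rewrite mulrDl mul1r lerD2l normrZ.
by rewrite ler_wpM2l// normr_perp_part.
Qed.

Variable vt : R -> R.
Hypothesis vt_derivable : forall s, derivable vt s 1.

Let dvt := derive1 vt.

(** The differential of (t, z) -> frame (vt t) z. On the direction (1, (velocity, force)) it gives
    the field seen in frame coordinates. *)
Definition dframe (q v : R * V R) : V R :=
  frame (vt q.1) v.2 - (v.1 * dvt q.1) *: ((0, perp q.2.1) : V R).

Lemma is_diff_frame q : is_diff q (fun q : R * V R => frame (vt q.1) q.2) (dframe q).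
Proof.
have d1 : is_diff q (fst : R * V R -> R) fst.
  exact: is_diff_fst.
have d2 : is_diff q (snd : R * V R -> V R) snd.
  exact: is_diff_snd.
have dc i : is_diff q (fun q : R * V R => coord3 i q.2.1) (fun q => coord3 i q.2.1).
  apply: (@bounded_linear_is_diff _ R _ 1) => [a u v|h].
    by rewrite /= coord3D coord3Z.
  rewrite mul1r; apply: le_trans (normr_coord3 _ _) _.
  apply: le_trans (normr_fst _) _.
  by rewrite [leRHS]prod_normE le_max lexx orbT.
have dv : is_diff q (fun q : R * V R => vt q.1) (fun v => dvt q.1 * v.1).
  have := is_diff_comp d1 (is_diff1 (@vt_derivable q.1)).
  by move=> dq; apply: is_diff_eq dq _; apply/funext => v /=; rewrite mulrC.
have dm i : is_diff q (fun q : R * V R => vt q.1 * coord3 i q.2.1)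
    (fun v => vt q.1 * coord3 i v.2.1 + coord3 i q.2.1 * (dvt q.1 * v.1)).
  exact: is_diff_eq (is_diffM dv (dc i)) _.
have ds (k : R * V R -> R) dk (e : V R) : is_diff q k dk ->
    is_diff q (fun q => k q *: e) (fun v => dk v *: e).
  by move=> dk'; exact: is_diff_comp (dk') (is_diff_scalel (k q) e).
have := is_diffD (is_diffD d2
   (ds _ _ (basis6 R (inr (@Ordinal 3 0 isT))) (is_diffN (dm (@Ordinal 3 1 isT)))))
   (ds _ _ (basis6 R (inr (@Ordinal 3 1 isT))) (dm (@Ordinal 3 0 isT))).
rewrite (_ : (_ + _ + _) = (fun q : R * V R => frame (vt q.1) q.2)); last first.
  by apply/funext => p; rewrite frameE.
move=> dd; apply: is_diff_eq dd _; apply/funext => v; rewrite !fctE /dframe.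
rewrite /frame; vcoord.
Qed.

Section test.
Variables (eta deta : R -> R) (L H : R) (chi : V R -> R) (D : V R -> V R -> R).
Hypothesis eta_derive : forall r : R, is_derive r 1 eta (deta r).
Hypothesis cC : C11 L H chi D.

Definition frame_test (q : R * V R) : R := eta q.1 * chi (frame (vt q.1) q.2).

Lemma frame_test_derive q v : differentiable frame_test q /\
  'D_v frame_test q = v.1 * deta q.1 * chi (frame (vt q.1) q.2) +
     eta q.1 * D (frame (vt q.1) q.2) (dframe q v).
Proof.
have d1 : is_diff q (fst : R * V R -> R) fst.
  exact: is_diff_fst.
have de : is_diff q (fun q : R * V R => eta q.1) (fun v => v.1 * deta q.1).
  have := is_diff_comp d1 (is_diff1 (@ex_derive _ _ _ _ _ _ _ (eta_derive q.1))).
  by move=> dq; apply: is_diff_eq dq _; apply/funext => w /=; rewrite derive1E derive_val.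
have [lin DL fT _ _] := cC.
set y := frame (vt q.1) q.2.
have lD : linear (D y : V R -> R^o) by move=> a h k; exact: lin.
pose isL := GRing.isLinear.Build R (V R) R *:%R (D y) lD.
pose D' : {linear V R -> R} := HB.pack (D y) isL.
have dz := @taylor_is_diff _ _ chi D' L H y (DL y) (fT y).
have dc := @is_diff_comp _ _ _ _ _ _ chi _ q (is_diff_frame q) dz.
have dM := is_diffM de dc.
have df : differentiable frame_test q := @ex_diff _ _ _ _ _ _ _ dM.
split=> //; rewrite deriveE// (@diff_val _ _ _ _ _ _ _ dM) !fctE /= addrC.
by congr (_ + _); exact: mulrC.
Qed.

Hypothesis deta_cts : continuous deta.
Hypothesis dvt_cts : continuous dvt.
Variables (T rho C : R).
Hypothesis eta0 : forall r, T < `|r| -> eta r = 0.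
Hypothesis vt_bound : forall r, `|vt r| <= C.
Hypothesis cr : vanish_off rho chi.

Let e0 : V R := basis6 R (inr (@Ordinal 3 0 isT)).
Let e1 : V R := basis6 R (inr (@Ordinal 3 1 isT)).

(** The direction [dframe q v] varies with q; splitting it over the fixed directions v.2, e0 and e1
    reduces continuity in q to [continuous_C11_grad]. *)
Lemma C11_dframe y (q v : R * V R) : D y (dframe q v) =
  D y v.2 - (vt q.1 * v.2.1.1.2 + v.1 * dvt q.1 * q.2.1.1.2) * D y e0
    + (vt q.1 * v.2.1.1.1 + v.1 * dvt q.1 * q.2.1.1.1) * D y e1.
Proof.
rewrite -!(C11_Z cC) -(C11_B cC) -(C11_D cC); congr (D y _).
rewrite /dframe /e0 /e1 /frame; vcoord.
Qed.

Lemma continuous_C11_grad h : continuous (D^~ h).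
Proof.
move=> z; apply/(@cvgrPdist_le _ _ _ (nbhs z)) => e e0'.
have B0 : 0 <= 6 * H * `|h| by rewrite mulr_ge0// mulr_ge0// (C11_H_ge0 cC).
have k0 : 0 < e / (6 * H * `|h| + 1) by rewrite divr_gt0// ltr_wpDl.
have : \forall y \near nbhs z, `|z - y| < e / (6 * H * `|h| + 1).
  by apply: (@cvgr_dist_lt _ (V R) _ (nbhs z) _ id) => //; exact: cvg_id.
apply: filterS => y /= /ltW hk.
rewrite distrC (_ : y = z + (y - z)); last by rewrite addrC subrK.
apply: (le_trans (C11_grad_lip cC _ _ _)); rewrite -normrN opprB mulrAC.
apply: (le_trans (ler_wpM2l _ hk)) => //.
by rewrite mulrCA ler_piMr ?(ltW e0')// ler_pdivrMr ?mul1r ?lerDl// ltr_wpDl.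
Qed.

Lemma frame_test_C1c : C1c frame_test.
Proof.
have cf : continuous (fun q : R * V R => frame (vt q.1) q.2).
  move=> q; apply: differentiable_continuous.
  exact: (@ex_diff _ _ _ _ _ _ _ (is_diff_frame q)).
have ccp (f : V R -> R) : continuous f ->
    continuous (fun q : R * V R => f (frame (vt q.1) q.2)).
  by move=> fc q; apply: (continuous_comp (cf q)); exact: fc.
have c1p (f : R -> R) : continuous f -> continuous (fun q : R * V R => f q.1).
  by move=> fc q; apply: (continuous_comp cvg_fst); exact: fc.
have cchi : continuous chi.
  by move=> z; apply: differentiable_continuous; have [] := C11_derive z 0 cC.
have ceta : continuous eta.
  move=> r; apply: differentiable_continuous; apply/derivable1_diffP.
  exact: (@ex_derive _ _ _ _ _ _ _ (eta_derive r)).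
have cvt : continuous vt.
  move=> r; apply: differentiable_continuous; apply/derivable1_diffP.
  exact: vt_derivable.
have cx i : continuous (fun q : R * V R => coord3 i q.2.1).
  move=> q; apply: differentiable_continuous.
  have dc : is_diff q (fun q : R * V R => coord3 i q.2.1) (fun q => coord3 i q.2.1).
    apply: (@bounded_linear_is_diff _ R _ 1) => [a u v|h].
      by rewrite /= coord3D coord3Z.
    rewrite mul1r; apply: le_trans (normr_coord3 _ _) _.
    apply: le_trans (normr_fst _) _.
    by rewrite [leRHS]prod_normE le_max lexx orbT.
  exact: (@ex_diff _ _ _ _ _ _ _ dc).
split.
- by move=> q; have [] := frame_test_derive q 0.
- move=> v; rewrite (_ : 'D_v frame_test = fun q =>
     v.1 * deta q.1 * chi (frame (vt q.1) q.2) +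
     eta q.1 * (D (frame (vt q.1) q.2) v.2
       - (vt q.1 * v.2.1.1.2 + v.1 * dvt q.1 * q.2.1.1.2) * D (frame (vt q.1) q.2) e0
       + (vt q.1 * v.2.1.1.1 + v.1 * dvt q.1 * q.2.1.1.1) * D (frame (vt q.1) q.2) e1)); last first.
    by apply/funext => q; rewrite (frame_test_derive q v).2 C11_dframe.
  have cD h := ccp _ (@continuous_C11_grad h).
  move=> q; apply: cvgD; apply: cvgM.
  + by apply: cvgM; [exact: cvg_cst|exact: c1p].
  + exact: ccp.
  + exact: c1p.
  + apply: cvgD; [apply: cvgB; first exact: cD|]; (apply: cvgM; last exact: cD);
      apply: cvgD; apply: cvgM; try exact: cvg_cst; try exact: c1p.
    * by apply: cvgM; [exact: cvg_cst|exact: c1p].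
    * exact: (cx (@Ordinal 3 1 isT)).
    * by apply: cvgM; [exact: cvg_cst|exact: c1p].
    * exact: (cx (@Ordinal 3 0 isT)).
- apply: (@compact_support _ _ _ (Num.max T ((1 + C) * rho))).
    apply: compact_balls_prod; [exact: compact_balls_R|exact: compact_balls_V].
  move=> q; rewrite prod_normE lt_max !gt_max => /orP[/andP[Tq _]|/andP[_ Cq]].
    by rewrite /frame_test eta0// mul0r.
  rewrite /frame_test cr ?mulr0// ltNge; apply/negP => le.
  move: Cq; rewrite ltNge => /negP; apply.
  rewrite -(frameK (vt q.1) q.2); apply: le_trans (frame_growth _ _) _.
  by rewrite normrN; apply: ler_pM => //; rewrite lerD2l.
Qed.

End test.

End time_frames.

(** * Integrals over time intervals *)

Section interval_integrals.
Variable R : realType.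

Lemma Rint_tind (F : R -> R) s t :
  \int[leb R]_r (tind s t r * F r) = \int[leb R]_(r in `[s, t[) F r.
Proof.
rewrite [RHS]Rintegral_mkcond; apply: eq_Rintegral => r _; rewrite patchE tindE.
by rewrite (_ : (r \in `[s, t[%classic) = (s <= r < t)%R) ?mem_setE ?in_itv//; case: ifP; rewrite ?mul1r ?mul0r.
Qed.

Lemma itg_tind_integrable (F : R -> R) s t :
  (leb R).-integrable `[s, t] (EFin \o F) -> itg (leb R) (fun r => tind s t r * F r).
Proof.
move=> Fi; have mI : measurable (`[s, t]%classic : set (measurableTypeR R)) by exact: measurable_itv.
have /(integrable_mkcond _ mI) := Fi.
rewrite (_ : (EFin \o F) \_ _ = EFin \o (F \_ `[s, t]%classic)); last first.
  by apply/funext => r; rewrite /= !patchE; case: ifP.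
move=> Fi'; apply: (@itg_dom _ _ _ (leb R) _ (fun r => `|(F \_ `[s, t]%classic) r|)).
- have := measurable_funM (measurable_tind s t) (itg_meas Fi').
  apply: eq_measurable_fun => r _ /=; rewrite tindE patchE.
  case: (boolP (s <= r < t)) => [/andP[sr rt]|]; last by rewrite !mul0r.
  by rewrite mem_setE in_itv/= sr ltW.
- move=> r; rewrite tindE patchE; case: (boolP (s <= r < t)) => [/andP[sr rt]|].
    by rewrite mem_setE in_itv/= sr (ltW rt) mul1r.
  by rewrite mul0r normr0.
- exact: itg_norm.
Qed.

Lemma continuous_itg_tind (F : R -> R) s t : continuous F ->
  itg (leb R) (fun r => tind s t r * F r).
Proof.
move=> Fc; apply: itg_tind_integrable; apply: continuous_compact_integrable.
  exact: segment_compact.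
exact: continuous_subspaceT.
Qed.

(** Stated on a half-line because the primitives built in [periodic_average] are known to be
    differentiable only beyond their base point. *)
Lemma Rint_tind_FTC_gt (F dF : R -> R) (b s t : R) : b < s -> s <= t ->
  (forall r : R, b < r -> is_derive r 1 F (dF r)) -> continuous dF ->
  \int[leb R]_r (tind s t r * dF r) = F t - F s.
Proof.
move=> bs st FdF cdF; move: st; rewrite le_eqVlt => /predU1P[<-|st].
  by under eq_Rintegral => r _ do
    [rewrite tindE; rewrite ltNge andbN mul0r]; rewrite Rint0 subrr.
have cF r : b < r -> {for r, continuous F}.
  move=> br; apply: differentiable_continuous; apply/derivable1_diffP.
  exact: (@ex_derive _ _ _ _ _ _ _ (FdF r br)).
rewrite Rint_tind Rintegral_itv_bndo_bndc; last first.
  have mI : measurable (`[s, t[%classic : set (measurableTypeR R)) by exact: measurable_itv.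
  have Fi : (leb R).-integrable `[s, t] (EFin \o dF).
    by apply: continuous_compact_integrable; [exact: segment_compact|exact: continuous_subspaceT].
  apply: (integrableS _ _ _ Fi) => //.
  by move=> r /=; rewrite !in_itv/= => /andP[-> /ltW].
have D : derivable_oo_LRcontinuous F s t.
  split=> [r /itvP rst||].
  - by apply: (@ex_derive _ _ _ _ _ _ _ (FdF r _)); apply: lt_trans bs _; rewrite rst.
  - by apply: cvg_at_right_filter; exact: cF.
  - by apply: cvg_at_left_filter; apply: cF; exact: lt_trans st.
rewrite /Rintegral (continuous_FTC2 st (continuous_subspaceT cdF) D)//.
move=> r /itvP rst; have br : b < r by apply: lt_trans bs _; rewrite rst.
by rewrite derive1E (@derive_val _ _ _ _ _ _ _ (FdF r br)).
Qed.

Lemma Rint_tind_FTC (F dF : R -> R) s t : s <= t ->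
  (forall r : R, is_derive r 1 F (dF r)) -> continuous dF ->
  \int[leb R]_r (tind s t r * dF r) = F t - F s.
Proof.
move=> st FdF; apply: (@Rint_tind_FTC_gt _ _ (s - 1)) => //.
by rewrite ltrBlDr ltrDl.
Qed.

Lemma Rint_tind_cst (s t : R) : s <= t -> \int[leb R]_r tind s t r = t - s.
Proof.
move=> st; under eq_Rintegral do rewrite -[tind _ _ _]mulr1.
apply: (@Rint_tind_FTC id (fun=> 1)) => //.
by move=> r; exact: cvg_cst.
Qed.

Lemma itg_tind s t : itg (leb R) (tind s t).
Proof.
have c1 : continuous (fun _ : R => 1 : R) by move=> r; exact: cvg_cst.
have := continuous_itg_tind s t c1.
by congr itg; apply/funext => r; rewrite mulr1.
Qed.

(** Absolute continuity of the integral: cut h at height n; the excess has a small integral and the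
    truncation contributes at most n (t - s). *)
Lemma small_intervals (h : R -> R) (eta : R) : itg (leb R) h -> (forall r, 0 <= h r) ->
  0 < eta -> exists2 d, 0 < d & forall s t, s <= t -> t - s <= d ->
    \int[leb R]_r (tind s t r * h r) <= eta.
Proof.
move=> hi h0 eta0.
have mh := itg_meas hi.
pose hM (n : nat) r := h r - Num.min (h r) n%:R.
have mM n : measurable_fun [set: measurableTypeR R] (hM n).
  by apply: measurable_funB => //; exact: measurable_minr.
have hM0 n r : 0 <= hM n r by rewrite subr_ge0 ge_min lexx.
have hMb n r : hM n r <= h r by rewrite lerBlDr lerDl le_min h0/=.
have c0 : \int[leb R]_r hM n r @[n --> \oo] --> (0 : R).
  rewrite -(@Rint0 _ _ _ (leb R)).
  apply: (@Rint_dominated _ _ _ (leb R) hM (fun=> 0) h) => //.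
  - move=> r; apply/cvgrPdist_le => e e0; near=> n.
    rewrite sub0r normrN /hM min_l ?subrr ?normr0 ?(ltW e0)//.
    apply: (@le_trans _ _ (Num.truncn (h r)).+1%:R); first exact/ltW/truncnS_gt.
    by rewrite ler_nat; near: n; exact: nbhs_infty_ge.
  - by move=> n r; rewrite ger0_norm.
have [n hn] := cvg0_ex_le c0 (divr_gt0 eta0 (ltr0n R 2)).
exists (eta / 2 / n.+1%:R) => [|s t st tsd]; first by rewrite !divr_gt0.
have hMi : itg (leb R) (hM n).
  by apply: (@itg_dom _ _ _ (leb R) _ h) => // r; rewrite ger0_norm.
apply: (@le_trans _ _ (\int[leb R]_r (hM n r + n%:R * tind s t r))).
  apply: Rint_le.
  - apply: (@itg_dom _ _ _ (leb R) _ h) => //.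
      by apply: measurable_funM => //; exact: measurable_tind.
    by move=> r; rewrite normrM !ger0_norm ?tind_ge0// ler_piMl// tind_le1.
  - by apply: itgD => //; apply: itgZ; exact: itg_tind.
  - move=> r; have t0 := tind_ge0 s t r; have t1 := tind_le1 s t r.
    apply: (@le_trans _ _ (tind s t r * (hM n r + n%:R))).
      by rewrite ler_wpM2l// /hM addrAC -addrA lerDl subr_ge0 ge_min lexx orbT.
    by rewrite mulrDr lerD// ?ler_piMl// mulrC.
rewrite RintD//; last by apply: itgZ; exact: itg_tind.
rewrite RintZ; last exact: itg_tind.
rewrite Rint_tind_cst// [leRHS]splitr lerD//.
apply: le_trans (ler_wpM2l _ tsd) _ => //.
rewrite mulrCA ler_piMr ?divr_ge0 ?(ltW eta0)//.
by rewrite ler_pdivrMr// mul1r ler_nat.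
Unshelve. all: by end_near. Qed.

End interval_integrals.

(** * Pairings of an L^2 curve with time-dependent functions *)

Section L2_curves.
Variables (R : realType) (f : R -> V R -> R).
Hypothesis fC : C_L2 f.

Lemma L2_pairing (w : V R -> R) (A rho t : R) : 0 <= t -> 0 <= A -> 0 <= rho ->
  measurable_fun [set: mV R] w -> (forall z, `|w z| <= A * ball_ind rho z) ->
  itg (leb6 R) (fun z => f t z * w z) /\
  `|\int[leb6 R]_z (f t z * w z)| <= nrm (leb6 R) (f t) * A * cb rho.
Proof.
move=> t0 A0 rho0 mw wA.
by apply: L2_pair_ball => //; [exact: C_L2_L2|exact: aeW].
Qed.

Lemma L2_pairing_diff (w : V R -> R) (A rho s t : R) : 0 <= s -> 0 <= t ->
  0 <= A -> 0 <= rho ->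
  measurable_fun [set: mV R] w -> (forall z, `|w z| <= A * ball_ind rho z) ->
  `|\int[leb6 R]_z (f s z * w z) - \int[leb6 R]_z (f t z * w z)| <=
    nrm (leb6 R) (f s \- f t) * A * cb rho.
Proof.
move=> s0 t0 A0 rho0 mw wA.
have [is_ _] := L2_pairing s0 A0 rho0 mw wA.
have [it_ _] := L2_pairing t0 A0 rho0 mw wA.
rewrite -RintB//; under eq_Rintegral do rewrite -mulrBl.
have L2d := L2_sub (C_L2_L2 fC s0) (C_L2_L2 fC t0).
by have [|_] := L2_pair_ball L2d A0 rho0 mw; first exact: aeW.
Qed.

Lemma measurable_L2_pairing (w : R -> V R -> R) (A : R -> R) (rho : R) : 0 <= rho ->
  measurable_fun [set: measurableTypeR R * mV R] (fun q : R * V R => w q.1 q.2) ->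
  (forall r : R, 0 <= r -> 0 <= A r) ->
  (forall (r : R) z, 0 <= r -> `|w r z| <= A r * ball_ind rho z) ->
  measurable_fun (`[0, +oo[%classic : set (measurableTypeR R))
    (fun r => \int[leb6 R]_z (f r z * w r z)).
Proof.
move=> rho0 mw A0 wA.
have mw1 r : measurable_fun [set: mV R] (w r) by exact: (measurable_fun_pair2 r mw).
pose q (n : nat) (r : R) : R := (Num.truncn (r * n.+1%:R))%:R / n.+1%:R.
have q0 n r : 0 <= q n r by rewrite divr_ge0.
have qr n r : 0 <= r -> `|q n r - r| <= n.+1%:R^-1.
  move=> r0; have rn0 : 0 <= r * n.+1%:R by rewrite mulr_ge0.
  have /andP[h1 h2] := truncn_itv rn0.
  rewrite distrC ger0_norm ?subr_ge0 ?ler_pdivrMr//.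
  rewrite lerBlDr -[X in X + _]mul1r -mulrDl ler_pdivlMr// nat1r.
  exact: ltW.
apply: (@measurable_fun_cvg _ _ _ _ (fun n r => \int[leb6 R]_z (f (q n r) z * w r z))).
- move=> n.
  pose I (k : nat) : set (measurableTypeR R) := `[k%:R / n.+1%:R, k.+1%:R / n.+1%:R[%classic.
  have mI k : measurable (I k) by exact: measurable_itv.
  have -> : (`[0, +oo[%classic : set (measurableTypeR R)) = \bigcup_k I k.
    apply/seteqP; split=> r /=.
      rewrite in_itv/= andbT => r0; exists (Num.truncn (r * n.+1%:R)) => //.
      have rn0 : 0 <= r * n.+1%:R by rewrite mulr_ge0.
      have /andP[h1 h2] := truncn_itv rn0.
      by rewrite /I /= in_itv/= ler_pdivrMr// h1 ltr_pdivlMr.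
    move=> [k _]; rewrite /I /= in_itv/= => /andP[h _]; rewrite in_itv/= andbT.
    by apply: le_trans h; rewrite divr_ge0.
  apply/(measurable_fun_bigcup _ mI) => k.
  apply: (@eq_measurable_fun _ _ _ _ _ (fun r => \int[leb6 R]_z (f (k%:R / n.+1%:R) z * w r z))).
    move=> r; rewrite inE /I /= in_itv/= => /andP[h1 h2]; rewrite /q.
    rewrite (_ : Num.truncn _ = k)//; apply: truncn_def.
    by rewrite -ler_pdivrMr// h1 -ltr_pdivlMr.
  apply: measurable_funTS.
  apply: (@measurable_Rint _ _ _ _ _ (leb6 R)
    (fun p : measurableTypeR R * mV R => f (k%:R / n.+1%:R) p.2 * w p.1 p.2)).
  apply: measurable_funM => //.
  have k0 : 0 <= k%:R / n.+1%:R :> R by rewrite divr_ge0.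
  exact: (measurableT_comp (L2_meas (C_L2_L2 fC k0))).
- move=> r /=; rewrite in_itv/= andbT => r0; apply/cvgrPdist_le => e e0.
  have B0 : 0 <= A r * cb rho by rewrite mulr_ge0 ?A0// cb_ge0.
  have [h h0 hP] := C_L2_cts fC r0 (divr_gt0 e0 (ltr_wpDl B0 ltr01)).
  near=> n.
  rewrite distrC; apply: le_trans (L2_pairing_diff (q0 n r) r0 (A0 _ r0) rho0 (mw1 r)
     (fun z => wA r z r0)) _.
  have qh : `|q n r - r| < h.
    apply: le_lt_trans (qr n r r0) _; rewrite invf_plt ?posrE//.
    apply: lt_le_trans (truncnS_gt _) _; rewrite ler_nat.
    by near: n; exact: nbhs_infty_ge.
  have /ltW := hP (q n r) (q0 n r) qh.
  rewrite -mulrA => N; apply: le_trans (ler_wpM2r B0 N) _.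
  by rewrite mulrAC ler_pdivrMr ?ltr_wpDl// ler_wpM2l ?(ltW e0)// lerDl.
Unshelve. all: by end_near. Qed.

End L2_curves.

Lemma dstep_out (R : realType) (t : R) : t <= 0 \/ 2 <= t -> dstep t = 0.
Proof.
rewrite /dstep => -[t0|t2]; first by rewrite !max_l; lra.
by rewrite !max_r; lra.
Qed.

Lemma is_derive_step (R : realType) (al be r : R) :
  is_derive r 1 (fun r => step (al * r + be)) (dstep (al * r + be) * al).
Proof.
have lin (z u h k : R) : dstep (al * z + be) * (al * (u *: h + k)) =
    u * (dstep (al * z + be) * (al * h)) + dstep (al * z + be) * (al * k).
  by rewrite /GRing.scale /=; ring.
have DL (z h : R) : `|dstep (al * z + be) * (al * h)| <= `|al| * `|h|.
  rewrite normrM; have /andP[d0 d1] := dstep_bound (al * z + be).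
  by rewrite (ger0_norm d0) normrM; apply: (ler_piMl _ d1); rewrite mulr_ge0.
have T (z h : R) : `|step (al * (z + h) + be) - step (al * z + be) -
    dstep (al * z + be) * (al * h)| <= 2 * al ^+ 2 * `|h| ^+ 2.
  have := step_taylor (al * z + be) (al * h).
  rewrite (_ : al * (z + h) + be = al * z + be + al * h); last by ring.
  by move=> /le_trans; apply; rewrite exprMn real_normK ?num_real// mulrA.
have [df dE] := taylor_derive lin DL T r 1.
by apply: DeriveDef; [exact/derivable1_diffP|rewrite dE mulr1].
Qed.

(** * Evolution of pairings with a test function in the moving frame *)

Section evolution.
Variables (R : realType) (a F : R -> R3 R -> R3 R -> R3 R) (g : V R -> R).
Variables (f : R -> V R -> R) (vt : R -> R) (C B : R) (b : J -> R -> V R -> R) (K : R -> R).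
Hypothesis fS : weak_solution a F g f.
Hypothesis vt_derivable : forall s, derivable vt s 1.
Hypothesis dvt_cts : continuous (derive1 vt).
Hypothesis vt_bound : forall r, `|vt r| <= C.
Hypothesis b_meas : forall j, measurable_fun [set: measurableTypeR R * mV R]
  (fun q : R * V R => b j q.1 q.2).
Hypothesis b_bound : forall j t z, `|b j t z| <= B * (1 + `|z|) + K t.
Hypothesis B_ge0 : 0 <= B.
Hypothesis K_ge0 : forall t, 0 <= K t.
Hypothesis K_itg : forall T, itg (leb R) (fun t => tind 0 T t * K t).
Hypothesis bE : {ae leb R, forall t, 0 <= t -> {ae leb6 R, forall z, forall j,
  coord6 j (dframe vt (t, z) (1, (a t z.1 z.2, F t z.1 z.2))) = b j t (frame (vt t) z)}}.

Let fC : C_L2 f. Proof. by case: fS. Qed.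
Let C0 : 0 <= C. Proof. exact: le_trans (vt_bound 0). Qed.

Let vt_cts : continuous vt.
Proof.
move=> r; apply: differentiable_continuous; apply/derivable1_diffP; exact: vt_derivable.
Qed.

Lemma measurable_frame : measurable_fun [set: measurableTypeR R * mV R]
  ((fun q : R * V R => frame (vt q.1) q.2) : measurableTypeR R * mV R -> mV R).
Proof.
have mvt : measurable_fun [set: measurableTypeR R * mV R] (fun q : R * V R => vt q.1).
  apply: (@measurableT_comp _ _ _ _ _ _ (vt : measurableTypeR R -> measurableTypeR R)) => //.
  exact: continuous_measurable_fun.
have mc j : measurable_fun [set: measurableTypeR R * mV R] (fun q : R * V R => coord6 j q.2).
  exact: (measurableT_comp (measurable_coord6 j)).
apply: measurable_V => j; under eq_fun do rewrite frameE !coord6D !coord6Z.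
have mm i : measurable_fun [set: measurableTypeR R * mV R]
    (fun q : R * V R => vt q.1 * coord6 (inl i) q.2) by exact: measurable_funM.
apply: measurable_funD; last by apply: measurable_funM => //; exact: (mm (@Ordinal 3 0 isT)).
apply: measurable_funD => //; apply: measurable_funM => //.
by apply: measurableT_comp => //; exact: (mm (@Ordinal 3 1 isT)).
Qed.

Section test_function.
Variables (L H rho : R) (chi : V R -> R) (D : V R -> V R -> R).
Hypothesis rho0 : 0 <= rho.
Hypothesis cC : C11 L H chi D.
Hypothesis cr : vanish_off rho chi.

(** The derivative of chi along the field [b], read in frame coordinates; [rate] is then the time
    derivative of [pairing] in integrated form. *)
Definition adv r z : R :=
  \sum_(j : J) D (frame (vt r) z) (basis6 R j) * b j r (frame (vt r) z).

Definition rate r : R := \int[leb6 R]_z (f r z * adv r z).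

Definition pairing r : R := \int[leb6 R]_z (f r z * chi (frame (vt r) z)).

Let rho' := (1 + C) * rho.
Let rho'0 : 0 <= rho'. Proof. by rewrite mulr_ge0// addr_ge0. Qed.

Lemma frame_support r z : rho' < `|z| -> rho < `|frame (vt r) z|.
Proof.
move=> zr; rewrite ltNge; apply/negP => le; move: zr; rewrite ltNge => /negP; apply.
rewrite -(frameK (vt r) z); apply: le_trans (frame_growth _ _) _.
by rewrite normrN; apply: ler_pM => //; rewrite lerD2l.
Qed.

Let A r := 6 * (L * (B * (1 + rho) + K r)).

Let L0 : 0 <= L. Proof. exact: C11_L_ge0 cC. Qed.

Let A0 r : 0 <= A r.
Proof. by rewrite mulr_ge0// mulr_ge0// addr_ge0// mulr_ge0// addr_ge0. Qed.

Lemma adv_bound r z : `|adv r z| <= A r * ball_ind rho' z.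
Proof.
rewrite ball_indE; case: (leP `|z| rho') => zr; last first.
  rewrite mulr0 /adv big1 ?normr0// => j _.
  by rewrite (C11_D_vanish cC cr) ?mul0r//; exact: frame_support.
rewrite mulr1 /adv.
case: (leP `|frame (vt r) z| rho) => fr; last first.
  by rewrite big1 ?normr0 ?A0// => j _; rewrite (C11_D_vanish cC cr) ?mul0r.
apply: le_trans (ler_norm_sum _ _ _) _.
apply: (@le_trans _ _ (\sum_(j : J) L * (B * (1 + rho) + K r))).
  apply: ler_sum => j _; rewrite normrM; apply: ler_pM => //.
    case: cC => _ DL _ _ _; apply: le_trans (DL _ _) _.
    by rewrite ler_piMr// normr_basis6.
  apply: le_trans (b_bound _ _ _) _; rewrite lerD2r ler_wpM2l// lerD2l.
  exact: fr.
by rewrite sumr_const card_sum !card_ord -mulr_natl.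
Qed.

Lemma measurable_adv : measurable_fun [set: measurableTypeR R * mV R]
  (fun q : R * V R => adv q.1 q.2).
Proof.
apply: measurable_sum => j; apply: measurable_funM.
  case: cC => _ _ _ _ mD.
  exact: (measurableT_comp (mD _) measurable_frame).
apply: (@measurableT_comp _ _ _ _ _ _ (fun q : measurableTypeR R * mV R => b j q.1 q.2)
  _ (fun q => (q.1, frame (vt q.1) q.2))) => //.
by apply: measurable_fun_pair => //; exact: measurable_frame.
Qed.

Lemma rate_bound r : 0 <= r -> itg (leb6 R) (fun z => f r z * adv r z) /\
  `|rate r| <= nrm (leb6 R) (f r) * A r * cb rho'.
Proof.
move=> r0; apply: L2_pairing => //; last exact: adv_bound.
exact: (measurable_fun_pair2 r measurable_adv).
Qed.

Let M := L * (2 * rho + 2).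
Let M0 : 0 <= M. Proof. by rewrite mulr_ge0// addr_ge0// mulr_ge0. Qed.

Lemma chi_frame_bound r z : `|chi (frame (vt r) z)| <= M * ball_ind rho' z.
Proof.
rewrite ball_indE; case: (leP `|z| rho') => zr.
  by rewrite mulr1; exact: C11_bounded cC cr _.
by rewrite cr ?normr0 ?mulr0//; exact: frame_support.
Qed.

Lemma measurable_chi_frame : measurable_fun [set: measurableTypeR R * mV R]
  (fun q : R * V R => chi (frame (vt q.1) q.2)).
Proof. by case: cC => _ _ _ mc _; exact: (measurableT_comp mc measurable_frame). Qed.

Lemma pairing_itg r s : 0 <= r ->
  itg (leb6 R) (fun z => f r z * chi (frame (vt s) z)).
Proof.
move=> r0; have [] := @L2_pairing _ _ fC (chi \o frame (vt s)) M rho' r r0 M0 rho'0 _ _ => //.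
  exact: (measurable_fun_pair2 s measurable_chi_frame).
exact: chi_frame_bound.
Qed.

Let half (s : R) : 0 <= s -> (forall t r : R, tind s t r != 0 -> 0 <= r).
Proof.
by move=> s0 t r; rewrite tindE; case: (leP s r) => [sr _|_]; [exact: le_trans s0 sr|rewrite /= eqxx].
Qed.

Lemma measurable_tind_half (q : R -> R) (s t : R) : 0 <= s ->
  measurable_fun (`[0, +oo[%classic : set (measurableTypeR R)) q ->
  measurable_fun [set: measurableTypeR R] (fun r => tind s t r * q r).
Proof.
move=> s0 mq; have mI : measurable (`[0, +oo[%classic : set (measurableTypeR R)).
  exact: measurable_itv.
have := measurable_funM (measurable_tind s t) ((measurable_restrictT _ mI).1 mq).
apply: eq_measurable_fun => r _ /=; rewrite patchE.
have [E|/(half s0) r0] := eqVneq (tind s t r) 0; first by rewrite E !mul0r.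
by rewrite mem_setE in_itv/= r0.
Qed.

Lemma measurable_rate : measurable_fun (`[0, +oo[%classic : set (measurableTypeR R)) rate.
Proof.
apply: (@measurable_L2_pairing _ _ fC adv A rho') => //; first exact: measurable_adv.
by move=> r z _; exact: adv_bound.
Qed.

Lemma measurable_pairing :
  measurable_fun (`[0, +oo[%classic : set (measurableTypeR R)) pairing.
Proof.
apply: (@measurable_L2_pairing _ _ fC (fun r z => chi (frame (vt r) z)) (fun=> M) rho') => //.
  exact: measurable_chi_frame.
by move=> r z _; exact: chi_frame_bound.
Qed.

Lemma rate_dominated (T : R) : exists h : R -> R, [/\ itg (leb R) h, forall r : R, 0 <= h r &
  forall r : R, 0 <= r < T -> `|rate r| <= h r].
Proof.
have [N fN] := C_L2_bounded fC T.
pose h r : R := `|N| * cb rho' * (6 * L * (B * (1 + rho) * tind 0 T r + tind 0 T r * K r)).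
exists h; split.
- apply: itgZ; apply: itgZ; apply: itgD => //; apply: itgZ; exact: itg_tind.
- move=> r; rewrite mulr_ge0 ?mulr_ge0 ?cb_ge0// addr_ge0// ?mulr_ge0 ?tind_ge0//.
  by rewrite addr_ge0.
- move=> r /andP[r0 rT]; apply: le_trans (rate_bound r0).2 _.
  have -> : h r = `|N| * A r * cb rho' by rewrite /h /A tindE r0 rT /=; ring.
  apply: ler_wpM2r; first exact: cb_ge0.
  apply: ler_wpM2r => //.
  by apply: le_trans (ler_norm N); apply: fN; rewrite r0 ltW.
Qed.

Lemma itg_tind_rate (s t : R) : 0 <= s -> itg (leb R) (fun r => tind s t r * rate r).
Proof.
move=> s0; have [h [hi h0 hP]] := rate_dominated t.
apply: (@itg_dom _ _ _ (leb R) _ h) => //.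
  by apply: measurable_tind_half => //; exact: measurable_rate.
move=> r; rewrite tindE; case: (boolP (s <= r < t)) => [/andP[sr rt]|_].
  by rewrite mul1r hP// rt (le_trans s0).
by rewrite mul0r normr0.
Qed.

(** Two variations add up: that of [f] in L^2, and that of the frame, controlled by the Lipschitz
    constant of chi. *)
Lemma pairing_cts (t e : R) : 0 <= t -> 0 < e -> exists2 h : R, 0 < h &
  forall s : R, 0 <= s -> `|s - t| < h -> `|pairing s - pairing t| <= e.
Proof.
move=> t0 e0; pose B1 := M * cb rho'; pose B2 := nrm (leb6 R) (f t) * (L * rho') * cb rho'.
have B10 : 0 <= B1 by rewrite mulr_ge0 ?cb_ge0.
have B20 : 0 <= B2 by apply: mulr_ge0 (cb_ge0 _); apply: mulr_ge0 (nrm_ge0 _ _) _; exact: mulr_ge0.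
have [h1 h10 h1P] := C_L2_cts fC t0 (divr_gt0 e0 (addr_gt0 (ltr_wpDl B10 ltr01) (ltr_wpDl B20 ltr01))).
have /cvgrPdist_lt /(_ _ (divr_gt0 e0 (addr_gt0 (ltr_wpDl B10 ltr01) (ltr_wpDl B20 ltr01)))) := @vt_cts t.
set k := e / _ in h1P *; have k0 : 0 < k by rewrite divr_gt0// addr_gt0// ltr_wpDl.
move=> /nbhs_ballP[h2 /= h20 h2P].
exists (Num.min h1 h2) => [|s s0]; first by rewrite lt_min h10.
rewrite lt_min => /andP[sh1 sh2].
have /ltW k1 := h1P s s0 sh1.
have /= /ltW k2 : `|vt t - vt s| < k by apply: h2P; rewrite /ball /= distrC.
pose w1 := chi \o frame (vt s).
pose w2 z := chi (frame (vt s) z) - chi (frame (vt t) z).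
have mw1 : measurable_fun [set: mV R] w1 by exact: (measurable_fun_pair2 s measurable_chi_frame).
have mw2 : measurable_fun [set: mV R] w2.
  by apply: measurable_funB; exact: (measurable_fun_pair2 _ measurable_chi_frame).
have w2b z : `|w2 z| <= L * k * rho' * ball_ind rho' z.
  rewrite ball_indE; case: (leP `|z| rho') => zr; last first.
    by rewrite mulr0 /w2 !cr ?subrr ?normr0//; exact: frame_support.
  rewrite mulr1 /w2 -{1}(subrK (frame (vt t) z) (frame (vt s) z)) [X in chi X - _]addrC.
  apply: le_trans (C11_lip cC _ _) _; rewrite -mulrA ler_wpM2l// frame_sub normrZ.
  by apply: ler_pM => //; apply: le_trans zr; exact: normr_perp_part.
have := L2_pairing_diff fC s0 t0 M0 rho'0 mw1 (chi_frame_bound s).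
have Lk0 : 0 <= L * k * rho' by apply: mulr_ge0 => //; apply: mulr_ge0 => //; exact: ltW.
have [_] := L2_pairing fC t0 Lk0 rho'0 mw2 w2b.
have -> : \int[leb6 R]_z (f t z * w2 z) =
    \int[leb6 R]_z (f t z * w1 z) - pairing t.
  rewrite -RintB; [|exact: pairing_itg|exact: pairing_itg].
  by apply: eq_Rintegral => z _; rewrite /w2 mulrBr.
set I1 := \int[leb6 R]_z (f t z * w1 z) => E2 E1.
rewrite -(subrKA I1).
apply: le_trans (ler_normD _ _) _; apply: le_trans (lerD E1 E2) _.
have ke : k * (B1 + 1 + (B2 + 1)) = e.
  by rewrite /k divfK// gt_eqF// addr_gt0// ltr_wpDl.
rewrite -mulrA -/B1 (_ : _ * (L * k * rho') * cb rho' = k * B2); last by rewrite /B2; ring.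
rewrite -ke mulrDr lerD//.
  apply: le_trans (ler_wpM2r B10 k1) _.
  by rewrite ler_wpM2l ?(ltW k0)// lerDl.
by rewrite ler_wpM2l ?(ltW k0)// lerDl.
Qed.

Lemma norm_le_eq0 (x : R) : (forall e, 0 < e -> `|x| <= 4 * e) -> x = 0.
Proof.
move=> H0; apply/eqP; rewrite -normr_le0 leNgt; apply/negP => x0.
by have := H0 (`|x| / 8) (divr_gt0 x0 _); lra.
Qed.

(** On a test read in the moving frame, the transport operator involves the fields only through
    [dframe], which [bE] identifies with [b]. *)
Lemma inner_integral (eta deta : R -> R) : (forall r : R, is_derive r 1 eta (deta r)) ->
  {ae leb R, forall r, (`[0, +oo[%classic : set R) r ->
    \int[leb6 R]_z (f r z *
      'D_((1, (a r z.1 z.2, F r z.1 z.2)) : R * V R) (frame_test vt eta chi) (r, z)) =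
    deta r * pairing r + eta r * rate r}.
Proof.
move=> ed; apply: aeS bE => r bEr /=; rewrite in_itv/= andbT => r0.
have [ir _] := rate_bound r0.
have -> : deta r * pairing r + eta r * rate r = \int[leb6 R]_z
    (deta r * (f r z * chi (frame (vt r) z)) + eta r * (f r z * adv r z)).
  by rewrite RintD ?RintZ//; [exact: pairing_itg|apply: itgZ; exact: pairing_itg|exact: itgZ].
apply: ae_Rintegral_eq; apply: aeS (bEr r0) => z bz _.
rewrite (frame_test_derive vt_derivable ed cC _ _).2 /= mul1r.
have -> : D (frame (vt r) z) (dframe vt (r, z) (1, (a r z.1 z.2, F r z.1 z.2))) = adv r z.
  rewrite (coord6E (dframe _ _ _)) (C11_sum cC) /adv; apply: eq_bigr => j _.
  by rewrite (C11_Z cC) bz mulrC.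
ring.
Qed.

(** Test with eta(t) chi(frame z), where eta drops from 1 to 0 on [t, t + d]. As d -> 0 the term in
    eta' tends to minus the pairing at t by continuity, and the rate over the layer is negligible by
    absolute continuity of the integral. *)
Lemma weak_evolution (t : R) : 0 <= t -> pairing t =
  \int[leb6 R]_z (g z * chi (frame (vt 0) z)) + \int[leb R]_r (tind 0 t r * rate r).
Proof.
move=> t0; apply/eqP; rewrite -subr_eq0; apply/eqP; apply: norm_le_eq0 => e e0.
have [h [hi h0 hP]] := rate_dominated (t + 1).
have [d1 d10 d1P] := small_intervals hi h0 e0.
have [d2 d20 d2P] := pairing_cts t0 e0.
pose d := Num.min (Num.min d1 (d2 / 2)) 1.
have d0 : 0 < d by rewrite !lt_min d10 divr_gt0//= ltr01.
have dd1 : d <= d1 by rewrite !ge_min lexx.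
have dd2 : d < d2 by apply: (@le_lt_trans _ _ (d2 / 2)); [rewrite !ge_min lexx orbT|lra].
have dl1 : d <= 1 by rewrite !ge_min lexx orbT.
(* The first factor cuts off times below -3 and is 1 from -1 on; the second falls from 1 at t to 0
   at t + d. *)
pose eta r := step (1 * r + 3) * step (- (2 / d) * r + (2 + 2 / d * t)).
pose deta r := step (1 * r + 3) * (dstep (- (2 / d) * r + (2 + 2 / d * t)) * - (2 / d)) +
  step (- (2 / d) * r + (2 + 2 / d * t)) * (dstep (1 * r + 3) * 1).
have ed (r : R) : is_derive r 1 eta (deta r).
  exact: is_deriveM (is_derive_step _ _ _) (is_derive_step _ _ _).
have kd : 2 / d * d = 2 by rewrite divfK// gt_eqF.
have k0 : 0 < 2 / d by rewrite divr_gt0.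
set k := 2 / d in eta deta ed kd k0.
have s1 (r : R) : -1 <= r -> step (1 * r + 3) = 1 /\ dstep (1 * r + 3) = 0.
  by move=> r1; rewrite step1 ?dstep_out//; [right; lra|lra].
have cdeta : continuous deta.
  have ca (al be : R) (q : R -> R) : continuous q -> continuous (fun r => q (al * r + be)).
    move=> qc r; apply: (@continuous_comp _ _ _ (fun r => al * r + be)); last exact: qc.
    by apply: cvgD; [apply: cvgM; [exact: cvg_cst|exact: cvg_id]|exact: cvg_cst].
  have cs : continuous (@step R).
    move=> r; apply: differentiable_continuous; apply/derivable1_diffP.
    by have := is_derive_step 1 0 r; rewrite (_ : (fun r => _) = @step R) ?mul1r => [[//]|];
       apply/funext => x; rewrite mul1r addr0.
  have cds := @continuous_dstep R.
  have p1 : continuous (fun r : R => step (1 * r + 3) * (dstep (- k * r + (2 + k * t)) * - k)).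
    move=> r; apply: cvgM; first exact: (ca _ _ _ cs).
    by apply: cvgM; [exact: (ca _ _ _ cds)|exact: cvg_cst].
  have p2 : continuous (fun r : R => step (- k * r + (2 + k * t)) * (dstep (1 * r + 3) * 1)).
    move=> r; apply: cvgM; first exact: (ca _ _ _ cs).
    by apply: cvgM; [exact: (ca _ _ _ cds)|exact: cvg_cst].
  by move=> r; exact: cvgD (p1 r) (p2 r).
have lo (r : R) : 0 <= r -> r < t -> eta r = 1 /\ deta r = 0.
  move=> r0 rt.
  have q2 : 2 <= - k * r + (2 + k * t) by nra.
  rewrite /eta /deta (s1 r _).1 ?(s1 r _).2; [|lra|lra].
  by rewrite step1// dstep_out ?mul0r ?mulr0 ?addr0 ?mulr1//; right.
have hi' (r : R) : 0 <= r -> t + d <= r -> eta r = 0 /\ deta r = 0.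
  move=> r0 rt; have q2 : - k * r + (2 + k * t) <= 0 by nra.
  rewrite /eta /deta (s1 r _).1 ?(s1 r _).2; [|lra|lra].
  by rewrite step0// dstep_out ?mul0r ?mulr0 ?addr0 ?mulr1//; left.
have C1 : C1c (frame_test vt eta chi).
  apply: (@frame_test_C1c _ vt vt_derivable eta deta L H chi D ed cC cdeta dvt_cts
    (Num.max 3 (t + d)) rho C _ vt_bound cr).
  move=> r; rewrite gt_max => /andP[r3 rt]; have [r0|r0] := leP 0 r.
    by rewrite ger0_norm// in rt; have [] := hi' r r0 (ltW rt).
  by rewrite /eta step0 ?mul0r//; rewrite ltr0_norm// in r3; lra.
have := (fS.2 _ C1).
rewrite (ae_Rintegral_eq (inner_integral ed)).
have -> : \int[leb6 R]_z (g z * frame_test vt eta chi (0, z)) =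
    \int[leb6 R]_z (g z * chi (frame (vt 0) z)).
  apply: eq_Rintegral => z _; congr (_ * _); rewrite /frame_test /= /eta.
  by rewrite (s1 0 _).1 ?step1 ?mul1r//; nra.
set G := \int[leb6 R]_z (g z * _).
have -> : \int[leb R]_(r in `[0, +oo[) (deta r * pairing r + eta r * rate r) =
   \int[leb R]_r (tind 0 t r * rate r + tind t (t + d) r * (deta r * pairing r + eta r * rate r)).
  rewrite Rintegral_mkcond; apply: eq_Rintegral => r _; rewrite patchE mem_setE in_itv/= andbT !tindE.
  case: (leP 0 r) => r0 /=; last by rewrite mul0r (_ : (t <= r) = false) ?mul0r ?addr0//; lra.
  case: (ltP r t) => rt /=; first by have [-> ->] := lo r r0 rt; rewrite !mul0r !mul1r add0r addr0.
  rewrite mul0r add0r; case: (ltP r (t + d)) => rtd /=; first by rewrite mul1r.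
  by have [-> ->] := hi' r r0 rtd; rewrite !mul0r addr0.
have ide : itg (leb R) (fun r => tind t (t + d) r * deta r) by exact: continuous_itg_tind.
have Ide : \int[leb R]_r (tind t (t + d) r * deta r) = -1.
  rewrite (Rint_tind_FTC _ ed cdeta); last by rewrite lerDl ltW.
  have [-> _] : eta (t + d) = 0 /\ deta (t + d) = 0 by apply: hi' => //; lra.
  rewrite /eta (s1 t _).1 ?step1 ?mul1r ?sub0r//; nra.
(* The error of the transition layer: eta' times the variation of the pairing, plus the part of the
   rate not yet cut off. *)
pose q r : R := tind t (t + d) r * (deta r * (pairing r - pairing t) + eta r * rate r).
have qb r : `|q r| <= tind t (t + d) r * (k * e + h r).
  rewrite /q tindE; case: (boolP (t <= r < t + d)) => [/andP[tr rt]|_]; last by rewrite !mul0r normr0.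
  rewrite !mul1r; have r0 : 0 <= r by lra.
  apply: le_trans (ler_normD _ _) _; rewrite (normrM (deta r)) (normrM (eta r)); apply: lerD.
    apply: ler_pM => //.
      rewrite /deta (s1 r _).1 ?(s1 r _).2; [|lra|lra].
      rewrite mul1r mul0r mulr0 addr0 mulrN normrN normrM (ger0_norm (ltW k0)).
      have /andP[u0 u1] := dstep_bound (- k * r + (2 + k * t)).
      by rewrite ger0_norm// ler_piMl// ltW.
    by apply: d2P => //; rewrite ger0_norm; lra.
  rewrite -[leRHS]mul1r; apply: ler_pM => //.
    by rewrite /eta (normrM (step _)); apply: mulr_ile1 => //; exact: normr_step.
  by apply: hP; rewrite r0 (lt_le_trans rt)// lerD2l.
have mq : measurable_fun [set: measurableTypeR R] q.
  apply: measurable_tind_half => //; apply: measurable_funD; apply: measurable_funM.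
  - exact: measurable_funTS (continuous_measurable_fun cdeta).
  - by apply: measurable_funB => //; exact: measurable_pairing.
  - apply: measurable_funTS; apply: continuous_measurable_fun => r.
    apply: differentiable_continuous; apply/derivable1_diffP.
    exact: (@ex_derive _ _ _ _ _ _ _ (ed r)).
  - exact: measurable_rate.
have idom : itg (leb R) (fun r => tind t (t + d) r * (k * e + h r)).
  have th : itg (leb R) (fun r => h r * tind t (t + d) r).
    apply: (@itg_mulb _ _ _ (leb R) h _ 1) => //; first exact: measurable_tind.
    by move=> r; rewrite ger0_norm ?tind_ge0// tind_le1.
  have := itgD (itgZ (k * e) (itg_tind t (t + d))) th.
  by congr itg; apply/funext => r; rewrite mulrDr mulrC [h r * _]mulrC.
have qi : itg (leb R) q by exact: itg_dom mq qb idom.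
(* The slope bound k times the width d is 2, so the two parts contribute at most 2 e and e. *)
have Iq : `|\int[leb R]_r q r| <= 3 * e.
  apply: (le_trans (Rint_norm_le qi idom (aeW (leb R) qb))).
  have th : itg (leb R) (fun r => tind t (t + d) r * h r).
    have := itgB idom (itgZ (k * e) (itg_tind t (t + d))).
    by congr itg; apply/funext => r; ring.
  under eq_Rintegral do rewrite mulrDr mulrC.
  rewrite RintD//; last by apply: itgZ; exact: itg_tind.
  rewrite RintZ; last exact: itg_tind.
  rewrite Rint_tind_cst; last by rewrite lerDl ltW.
  have := d1P t (t + d); rewrite lerDl (ltW d0) addrAC subrr add0r => /(_ isT dd1) I1.
  by rewrite mulrAC kd; lra.
have -> : \int[leb R]_r (tind 0 t r * rate r + tind t (t + d) r *
     (deta r * pairing r + eta r * rate r)) =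
   \int[leb R]_r (tind 0 t r * rate r) + \int[leb R]_r q r - pairing t.
  have ir := itg_tind_rate t (lexx 0).
  have -> : - pairing t = \int[leb R]_r (pairing t * (tind t (t + d) r * deta r)).
    by rewrite RintZ// Ide mulrN1.
  rewrite -RintD// -RintD//; [|exact: itgD|exact: itgZ].
  have alg (x1 x2 x3 x4 x5 x6 x7 : R) : x1 * x2 + x3 * (x4 * x6 + x5 * x2) =
    x1 * x2 + x3 * (x4 * (x6 - x7) + x5 * x2) + x7 * (x3 * x4) by ring.
  by apply: eq_Rintegral => r _; exact: alg.
set I0 := \int[leb R]_r (tind 0 t r * rate r) => E.
have -> : pairing t - (G + I0) = \int[leb R]_r q r by lra.
by apply: le_trans Iq _; lra.
Qed.

End test_function.
End evolution.

(** * Displacements over a time step as families of shears *)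

Section averaged_field.
Variable R : realType.
Variables (al be ga : R) (h : J -> R -> V R -> R) (K : R -> R).
Hypothesis h_meas : forall j, measurable_fun [set: measurableTypeR R * mV R]
  (fun q : R * V R => h j q.1 q.2).
Hypothesis h_lip : forall j t, weak_lip (K t) (h j t).
Hypothesis h_free : forall j t z a, h j t (z + a *: basis6 R j) = h j t z.
Hypothesis K_itg : forall T, itg (leb R) (fun t => tind 0 T t * K t).

Lemma K_ge0 t : 0 <= K t.
Proof. by have [_ b _] := h_lip (inl (@Ordinal 3 0 isT)) t; exact: le_trans (b 0). Qed.

Lemma itg_tind_K (s t : R) : 0 <= s -> itg (leb R) (fun r => tind s t r * K r).
Proof.
move=> s0; case: (leP s t) => st; last first.
  have := @itg0 _ _ _ (leb R); congr itg; apply/funext => r; rewrite tindE.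
  by case: (leP s r) => sr //=; rewrite ?mul0r// ltNge (ltW (lt_le_trans st sr)) mul0r.
have := itgB (K_itg t) (K_itg s); congr itg; apply/funext => r.
by rewrite (tind_split r s0 st); ring.
Qed.

Definition kbar s t : R := \int[leb R]_r (tind s t r * K r).

(** The force enters a step through its exact time integral, since in time it is only integrable and
    no point value is meaningful. *)
Definition hbar s t j z : R := \int[leb R]_r (tind s t r * h j r z).

Lemma kbar_ge0 s t : 0 <= kbar s t.
Proof. by apply: Rintegral_ge0 => r _; rewrite mulr_ge0 ?tind_ge0 ?K_ge0. Qed.

Lemma kbar_split (s q t : R) : 0 <= s -> s <= q -> q <= t -> kbar s t = kbar s q + kbar q t.
Proof.
move=> s0 sq qt; rewrite /kbar -RintD; [|exact: itg_tind_K|apply: itg_tind_K; lra].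
by apply: eq_Rintegral => r _; rewrite (tind_split r sq qt) mulrDl.
Qed.

Lemma h_bound j r z : `|h j r z| <= K r.
Proof. by have [_ b _] := h_lip j r. Qed.

Lemma itg_tind_h (s t : R) j z : 0 <= s -> itg (leb R) (fun r => tind s t r * h j r z).
Proof.
move=> s0; apply: (@itg_dom _ _ _ (leb R) _ (fun r => tind s t r * K r)).
- by apply: measurable_funM; [exact: measurable_tind|exact: (measurable_fun_pair1 z (h_meas j))].
- by move=> r; rewrite normrM ger0_norm ?tind_ge0// ler_wpM2l ?tind_ge0// h_bound.
- exact: itg_tind_K.
Qed.

Lemma hbar_free s t j z a : hbar s t j (z + a *: basis6 R j) = hbar s t j z.
Proof. by apply: eq_Rintegral => r _; rewrite h_free. Qed.

Lemma measurable_tind_h (s t : R) j : measurable_fun [set: measurableTypeR R * mV R]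
  (fun q : R * V R => tind s t q.1 * h j q.1 q.2).
Proof.
apply: measurable_funM => //.
exact: (measurableT_comp (measurable_tind s t)).
Qed.

Lemma Rfubini_hbar (s t : R) j (w : V R -> R) : 0 <= s -> itg (leb6 R) w ->
  \int[leb6 R]_z (hbar s t j z * w z) =
  \int[leb R]_r (tind s t r * \int[leb6 R]_z (h j r z * w z)).
Proof.
move=> s0 wi; have mw := itg_meas wi.
have mhr r : measurable_fun [set: mV R] (h j r) by exact: (measurable_fun_pair2 r (h_meas j)).
have ihw r : itg (leb6 R) (fun z => h j r z * w z).
  have := itg_mulb wi (mhr r) (h_bound j r).
  by congr itg; apply/funext => z; rewrite mulrC.
under [RHS]eq_Rintegral do rewrite -RintZ//.
rewrite (@Rfubini _ _ _ _ _ (leb R) (leb6 R)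
   (fun q : R * V R => tind s t q.1 * (h j q.1 q.2 * w q.2))
   (fun r => tind s t r * K r) (fun z => `|w z|)).
- apply: eq_Rintegral => z _ /=; rewrite /hbar mulrC -RintZ; last exact: itg_tind_h.
  by apply: eq_Rintegral => r _; ring.
- apply: measurable_funM; first exact: (measurableT_comp (measurable_tind s t)).
  by apply: measurable_funM => //; exact: (measurableT_comp mw).
- move=> r z /=; rewrite !normrM ger0_norm ?tind_ge0// mulrA ler_wpM2r//.
  by rewrite ler_wpM2l ?tind_ge0// h_bound.
- exact: itg_tind_K.
- exact: itg_norm.
Qed.

(** Fubini moves the time integral outside the pairing with a derivative of chi, where the bound K r
    applies at each instant. *)
Lemma hbar_weak_lip (s t : R) j : 0 <= s -> weak_lip (kbar s t) (hbar s t j).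
Proof.
move=> s0; split=> [|z|L H chi D r i r0 cC cr].
- apply: (@measurable_Rint _ _ _ _ _ (leb R)
    (fun q : mV R * measurableTypeR R => tind s t q.2 * h j q.2 q.1)).
  have sw : measurable_fun [set: mV R * measurableTypeR R] (fun q => (q.2, q.1)).
    by apply: measurable_fun_pair.
  exact: (measurableT_comp (measurable_tind_h s t j) sw).
- apply: Rint_norm_le; [exact: itg_tind_h|exact: itg_tind_K|].
  apply: aeW => q; rewrite normrM ger0_norm ?tind_ge0// ler_wpM2l ?tind_ge0//.
  exact: h_bound.
rewrite Rfubini_hbar//; last exact: (C11_D_itg _ r0 cC cr).
set X := \int[leb6 R]_z `|chi z|; have X0 : 0 <= X by exact: Rintegral_ge0.
have b q : `|tind s t q * \int[leb6 R]_z (h j q z * D z (basis6 R i))| <= tind s t q * K q * X.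
  rewrite normrM ger0_norm ?tind_ge0// -mulrA ler_wpM2l ?tind_ge0//.
  by have [_ _ W] := h_lip j q; exact: (W _ _ _ _ _ _ r0 cC cr).
have dom : itg (leb R) (fun q => X * (tind s t q * K q)) by apply: itgZ; exact: itg_tind_K.
rewrite /kbar mulrC -RintZ; last exact: itg_tind_K.
apply: Rint_norm_le => //; last by apply: aeW => q; rewrite [leRHS]mulrC; exact: b.
apply: itg_dom dom; last by move=> q; rewrite [leRHS]mulrC; exact: b.
apply: measurable_funM; first exact: measurable_tind.
apply: (@measurable_Rint _ _ _ _ _ (leb6 R) (fun p : measurableTypeR R * mV R =>
   h j p.1 p.2 * D p.2 (basis6 R i))).
apply: measurable_funM => //; case: cC => _ _ _ _ mD; exact: (measurableT_comp (mD _)).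
Qed.

(** The linear part common to both problems. The scalars are either instantaneous coefficients, with
    a = 1, or their integrals over a step, with a the length of the step. *)
Definition lfield (a u v : R) (z : V R) : V R :=
  ((al * a) *: z.2 + (be * u) *: perp z.1,
   (be * u) *: perp z.2 + (ga * v) *: perp (perp z.1)).

Definition lsize (a u v : R) : R := `|al| * `|a| + `|be| * `|u| + `|ga| * `|v|.

Lemma lfieldD a u v z w : lfield a u v (z + w) = lfield a u v z + lfield a u v w.
Proof. by rewrite /lfield; vcoord. Qed.

Lemma lfieldZ a u v c z : lfield a u v (c *: z) = c *: lfield a u v z.
Proof. by rewrite /lfield; vcoord. Qed.

Lemma lfieldB a u v a' u' v' z :
  lfield a u v z - lfield a' u' v' z = lfield (a - a') (u - u') (v - v') z.
Proof. by rewrite /lfield; vcoord. Qed.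

Lemma lfield_lin a u v z j : coord6 j (lfield a u v z) =
  a * coord6 j (lfield 1 0 0 z) + u * coord6 j (lfield 0 1 0 z) + v * coord6 j (lfield 0 0 1 z).
Proof.
by rewrite -!coord6Z -!coord6D; congr coord6; rewrite /lfield; vcoord.
Qed.

Lemma lsize_ge0 a u v : 0 <= lsize a u v.
Proof. by rewrite !addr_ge0// mulr_ge0. Qed.

Lemma lfield_bound a u v z : `|lfield a u v z| <= lsize a u v * `|z|.
Proof.
have z1 := normr_fst z; have z2 : `|z.2| <= `|z| by rewrite [leRHS]prod_normE le_max lexx orbT.
have p1 := le_trans (normr_perp z.1) z1; have p2 := le_trans (normr_perp z.2) z2.
have p3 := le_trans (normr_perp (perp z.1)) p1.
have m1 := ler_wpM2l (normr_ge0 (al * a)) z2.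
have m2 := ler_wpM2l (normr_ge0 (be * u)) p1.
have m3 := ler_wpM2l (normr_ge0 (be * u)) p2.
have m4 := ler_wpM2l (normr_ge0 (ga * v)) p3.
have n1 : 0 <= `|al * a| * `|z| by rewrite mulr_ge0.
have n4 : 0 <= `|ga * v| * `|z| by rewrite mulr_ge0.
rewrite /lsize -!normrM !mulrDl prod_normE ge_max; apply/andP; split.
  have l1 : `|(lfield a u v z).1| <= `|al * a| * `|z.2| + `|be * u| * `|perp z.1|.
    by rewrite -!normrZ; exact: ler_normD.
  by apply: le_trans l1 _; apply: le_trans (lerD m1 m2) _; rewrite lerDl.
have l2 : `|(lfield a u v z).2| <= `|be * u| * `|perp z.2| + `|ga * v| * `|perp (perp z.1)|.
  by rewrite -!normrZ; exact: ler_normD.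
by apply: le_trans l2 _; apply: le_trans (lerD m3 m4) _; rewrite -addrA lerDr.
Qed.

(** [perp] exchanges the first two coordinates, and the double [perp] of x enters only the p
    components. This is stronger than zero divergence and is what permits splitting into shears. *)
Lemma lfield_free a u v j z c : coord6 j (lfield a u v (z + c *: basis6 R j)) =
  coord6 j (lfield a u v z).
Proof.
case: j; apply: ord3_cases; rewrite /lfield /coord6 /= ?(coord3D, coord3N, coord3Z) /coord3
  /perp /= /GRing.scale /=; ring.
Qed.

(** The displacement of coordinate j over [s, t], [u] and [v] standing for time integrals of the
    coefficients. Mollifying the force makes the amplitude [C11], so that tests remain [C11] along
    the scheme. *)
Definition velo (d s t u v : R) j z : R :=
  coord6 j (lfield (t - s) u v z) + mollify d (hbar s t j) z.

Definition ksize (s t u v : R) : R := lsize (t - s) u v + 6 * kbar s t.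

Section velo.
Variables d s t u v : R.
Hypothesis d0 : 0 < d.
Hypothesis s0 : 0 <= s.

Lemma velo_free j z a : velo d s t u v j (z + a *: basis6 R j) = velo d s t u v j z.
Proof.
rewrite /velo lfield_free mollify_inv//; first by have [] := hbar_weak_lip t j s0.
by move=> w b; rewrite hbar_free.
Qed.

Lemma velo_bound j z : `|velo d s t u v j z| <= ksize s t u v * (1 + `|z|).
Proof.
apply: le_trans (ler_normD _ _) _; rewrite /ksize mulrDl; apply: lerD.
  apply: le_trans (normr_coord6 _ _) _; apply: le_trans (lfield_bound _ _ _ _) _.
  by rewrite ler_wpM2l ?lsize_ge0// lerDr.
apply: le_trans (mollify_bound d0 z (hbar_weak_lip t j s0)) _.
have := kbar_ge0 s t; have := normr_ge0 z; nra.
Qed.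

Lemma velo_C11 : exists2 K', 0 <= K' & forall s t u v j, 0 <= s ->
  exists D, C11 (ksize s t u v) (K' * kbar s t) (velo d s t u v j) D.
Proof.
have [K' K'0 KP] := mollify_C11 d0; exists K' => // s' t' u' v' j s'0.
have [D DC] := KP _ _ (hbar_weak_lip t' j s'0).
have cl : C11 (lsize (t' - s') u' v') 0 (fun z => coord6 j (lfield (t' - s') u' v' z))
    (fun _ z => coord6 j (lfield (t' - s') u' v' z)).
  have mc : measurable_fun [set: mV R] (fun z => coord6 j (lfield (t' - s') u' v' z)).
    under eq_fun do rewrite [X in lfield _ _ _ X]coord6E.
    rewrite (_ : (fun z => _) = fun z => \sum_(i : J) coord6 i z *
       coord6 j (lfield (t' - s') u' v' (basis6 R i))); last first.
      apply/funext => z; rewrite (big_morph _ (lfieldD _ _ _) (_ : lfield _ _ _ 0 = 0)).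
        by rewrite coord6_sum; apply: eq_bigr => i _; rewrite lfieldZ coord6Z.
      by have := lfieldZ (t' - s') u' v' 0 0; rewrite !scale0r.
    apply: measurable_sum => i; apply: measurable_funM => //; exact: measurable_coord6.
  split=> [z c w k|z w|z w||w] //.
  - by rewrite lfieldD lfieldZ coord6D coord6Z.
  - by apply: le_trans (normr_coord6 _ _) _; exact: lfield_bound.
  - by rewrite lfieldD coord6D mul0r -addrA -opprD subrr normr0.
exists (fun z w => 1 * coord6 j (lfield (t' - s') u' v' w) + D z w).
have := C11_lin 1 cl DC; rewrite normr1 !mul1r add0r /velo.
by congr C11; apply/funext => z; rewrite mul1r.
Qed.

Definition vsteps := [seq (j, velo d s t u v j) | j <- enum {: J}].

Lemma size_vsteps : size vsteps = 6%N.
Proof. by rewrite size_map -cardE card_sum !card_ord. Qed.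

Lemma in_vsteps q : List.In q vsteps -> exists j, q = (j, velo d s t u v j).
Proof.
rewrite /vsteps; elim: (enum _) => //= j l IH [<-|/IH//]; by exists j.
Qed.

Lemma velo_lip j z w : `|velo d s t u v j (z + w) - velo d s t u v j z| <=
  ksize s t u v * `|w|.
Proof.
have [K' _ KP] := velo_C11; have [D DC] := KP s t u v j s0.
exact: C11_lip DC z w.
Qed.

Lemma small_vsteps : small_shears (ksize s t u v) vsteps.
Proof.
move=> q /in_vsteps[j ->]; split=> [z|z w]; [exact: velo_bound|exact: velo_lip].
Qed.

Lemma free_vsteps : free_shears vsteps.
Proof. by move=> q /in_vsteps[j ->] z a; exact: velo_free. Qed.

Lemma measurable_vsteps q : List.In q vsteps -> measurable_fun [set: mV R] q.2.
Proof.
move=> /in_vsteps[j ->]; have [K' _ KP] := velo_C11; have [D DC] := KP s t u v j s0.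
by case: DC.
Qed.

End velo.

End averaged_field.

(** A frame is two successive shears, of p_1 and p_2, with amplitudes depending on x alone. *)
Lemma frame_mpres (R : realType) (c : R) : mpres (leb6 R) (frame c).
Proof.
pose x1 (z : V R) := c * coord6 (inl (@Ordinal 3 0 isT)) z.
pose x2 (z : V R) := - (c * coord6 (inl (@Ordinal 3 1 isT)) z).
pose s := [:: (inr (@Ordinal 3 0 isT) : J, x2); (inr (@Ordinal 3 1 isT) : J, x1)].
have -> : frame c = shears s.
  by apply/funext => z; rewrite frameE /s /shears /= /shear /x1 coord6D coord6Z coord6_basis mulr0 addr0.
apply: shears_mpres => q /=.
  by move=> [<-|[<-|//]] z a /=; rewrite /x1 /x2 ?coord6D ?coord6Z ?coord6_basis /= mulr0 addr0.
have m j : measurable_fun [set: mV R] (fun z => c * coord6 j z).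
  by apply: measurable_funM => //; exact: measurable_coord6.
by move=> [<-|[<-|//]] /=; [exact: measurableT_comp (m _)|exact: m].
Qed.

(** * Consistency of the splitting scheme with a weak solution *)

Section scheme.
Variables (R : realType) (a F : R -> R3 R -> R3 R -> R3 R) (g : V R -> R).
Variables (f : R -> V R -> R) (vt : R -> R) (C U al be ga : R) (u v : R -> R).
Variables (h : J -> R -> V R -> R) (K : R -> R).
Hypothesis h_meas : forall j, measurable_fun [set: measurableTypeR R * mV R]
  (fun q : R * V R => h j q.1 q.2).
Hypothesis h_lip : forall j t, weak_lip (K t) (h j t).
Hypothesis h_free : forall j t z a, h j t (z + a *: basis6 R j) = h j t z.
Hypothesis K_itg : forall T, itg (leb R) (fun t => tind 0 T t * K t).
Hypothesis u_cts : continuous u.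
Hypothesis v_cts : continuous v.
Hypothesis u_bound : forall t, `|u t| <= U.
Hypothesis v_bound : forall t, `|v t| <= U.

Definition field j t z : R := coord6 j (lfield al be ga 1 (u t) (v t) z) + h j t z.

Hypothesis fS : weak_solution a F g f.
Hypothesis vt_derivable : forall s, derivable vt s 1.
Hypothesis dvt_cts : continuous (derive1 vt).
Hypothesis vt_bound : forall r, `|vt r| <= C.
Hypothesis bE : {ae leb R, forall t, 0 <= t -> {ae leb6 R, forall z, forall j,
  coord6 j (dframe vt (t, z) (1, (a t z.1 z.2, F t z.1 z.2))) = field j t (frame (vt t) z)}}.

Let B := lsize al be ga 1 U U.

Let B0 : 0 <= B. Proof. exact: lsize_ge0. Qed.
Let U0 : 0 <= U. Proof. exact: le_trans (u_bound 0). Qed.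
Let C0 : 0 <= C. Proof. exact: le_trans (vt_bound 0). Qed.
Let K0 t : 0 <= K t. Proof. exact: (K_ge0 h_lip). Qed.
Let fC : C_L2 f. Proof. by case: fS. Qed.

Lemma lfield_field_bound t z : `|lfield al be ga 1 (u t) (v t) z| <= B * `|z|.
Proof.
apply: le_trans (lfield_bound _ _ _ _ _ _ _) _; rewrite ler_wpM2r// /B /lsize.
apply: lerD; [apply: lerD => //|]; rewrite ler_wpM2l//.
  by rewrite (ger0_norm U0).
by rewrite (ger0_norm U0).
Qed.

Lemma field_bound j t z : `|field j t z| <= B * (1 + `|z|) + K t.
Proof.
apply: le_trans (ler_normD _ _) _; apply: lerD; last exact: (h_bound h_lip).
apply: le_trans (normr_coord6 _ _) _; apply: le_trans (lfield_field_bound _ _) _.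
by rewrite ler_wpM2l// lerDr.
Qed.

Lemma measurable_field j : measurable_fun [set: measurableTypeR R * mV R]
  (fun q : R * V R => field j q.1 q.2).
Proof.
rewrite /field; under eq_fun do rewrite lfield_lin.
have mt (w : R -> R) : continuous w ->
    measurable_fun [set: measurableTypeR R * mV R] (fun q : R * V R => w q.1).
  move=> cw; apply: (@measurableT_comp _ _ _ _ _ _ (w : measurableTypeR R -> measurableTypeR R)) => //.
  exact: continuous_measurable_fun.
have ml a1 u1 v1 : measurable_fun [set: measurableTypeR R * mV R]
    (fun q : R * V R => coord6 j (lfield al be ga a1 u1 v1 q.2)).
  apply: (@measurableT_comp _ _ _ _ _ _ (fun z : mV R => coord6 j (lfield al be ga a1 u1 v1 z))) => //.
  rewrite (_ : (fun z => _) = fun z => \sum_(i : J) coord6 i z *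
     coord6 j (lfield al be ga a1 u1 v1 (basis6 R i))); last first.
    apply/funext => z; rewrite [in LHS](coord6E z).
    rewrite (big_morph _ (lfieldD _ _ _ _ _ _) (_ : lfield _ _ _ _ _ _ 0 = 0)).
      by rewrite coord6_sum; apply: eq_bigr => i _; rewrite lfieldZ coord6Z.
    by have := lfieldZ al be ga a1 u1 v1 0 0; rewrite !scale0r.
  by apply: measurable_sum => i; apply: measurable_funM => //; exact: measurable_coord6.
apply: measurable_funD => //; apply: measurable_funD; last by apply: measurable_funM => //; exact: mt.
by apply: measurable_funD; apply: measurable_funM => //; exact: mt.
Qed.

(** The size of a step: it bounds growth and Lipschitz constant of the displacement, tends to 0 with
    the length of the interval, and is additive, so that step contributions sum to its value on the
    whole interval. *)
Definition kk (s t : R) : R := B * (t - s) + 6 * kbar K s t.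

Lemma kk_split (s q t : R) : 0 <= s -> s <= q -> q <= t -> kk s t = kk s q + kk q t.
Proof. by move=> s0 sq qt; rewrite /kk (kbar_split K_itg s0 sq qt); ring. Qed.

Lemma kk_ge0 (s t : R) : s <= t -> 0 <= kk s t.
Proof.
by move=> st; rewrite addr_ge0 ?mulr_ge0 ?subr_ge0 ?(kbar_ge0 h_lip).
Qed.

Lemma kkE (s t : R) : 0 <= s -> s <= t ->
  kk s t = \int[leb R]_r (tind s t r * (B + 6 * K r)) /\
  itg (leb R) (fun r => tind s t r * (B + 6 * K r)).
Proof.
move=> s0 st; have i1 := itgZ B (itg_tind s t).
have i2 := itgZ 6 (itg_tind_K K_itg t s0).
have E : (fun r => tind s t r * (B + 6 * K r)) =
    fun r => B * tind s t r + 6 * (tind s t r * K r) by apply/funext => r; ring.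
rewrite E; split; last exact: itgD.
by rewrite RintD// !RintZ ?Rint_tind_cst//; [exact: (itg_tind_K K_itg)|exact: itg_tind].
Qed.

Definition ubar (s t : R) : R := \int[leb R]_r (tind s t r * u r).
Definition vbar (s t : R) : R := \int[leb R]_r (tind s t r * v r).

Lemma bar_bound (w : R -> R) (s t : R) : continuous w -> (forall r, `|w r| <= U) -> s <= t ->
  `|\int[leb R]_r (tind s t r * w r)| <= U * (t - s).
Proof.
move=> cw wU st; rewrite -(Rint_tind_cst st) -RintZ; last exact: itg_tind.
apply: Rint_norm_le; [exact: continuous_itg_tind|by apply: itgZ; exact: itg_tind|].
apply: aeW => r; rewrite normrM ger0_norm ?tind_ge0// mulrC.
by rewrite ler_wpM2r ?tind_ge0.
Qed.

Lemma ksize_le_kk (s t : R) : s <= t ->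
  ksize al be ga K s t (ubar s t) (vbar s t) <= kk s t.
Proof.
move=> st; rewrite /ksize /kk lerD2r /B /lsize.
have ub := bar_bound u_cts u_bound st; have vb := bar_bound v_cts v_bound st.
rewrite !mulrDl; apply: lerD; [apply: lerD|].
- by rewrite normr1 mulr1 (ger0_norm (_ : 0 <= t - s)) ?subr_ge0.
- by rewrite -mulrA ler_wpM2l// (ger0_norm U0).
- by rewrite -mulrA ler_wpM2l// (ger0_norm U0).
Qed.

Section fixed_scale.
Variable d : R.
Hypothesis d0 : 0 < d.

Definition vstep (s t : R) := vsteps al be ga h d s t (ubar s t) (vbar s t).

Local Notation vel s t := (velo al be ga h d s t (ubar s t) (vbar s t)).

(** Before mollification, the amplitudes of the step are the time integrals of the field at a fixed
    point. *)
Lemma Rint_field (s t : R) j y : 0 <= s -> s <= t ->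
  \int[leb R]_r (tind s t r * field j r y) =
  coord6 j (lfield al be ga (t - s) (ubar s t) (vbar s t) y) + hbar h s t j y.
Proof.
move=> s0 st; set c0 := coord6 j (lfield al be ga 1 0 0 y).
set c1 := coord6 j (lfield al be ga 0 1 0 y); set c2 := coord6 j (lfield al be ga 0 0 1 y).
have iu := continuous_itg_tind s t u_cts; have iv := continuous_itg_tind s t v_cts.
have ih := itg_tind_h h_meas h_lip K_itg t j y s0.
have E : (fun r => tind s t r * field j r y) = fun r =>
    (c0 * tind s t r + c1 * (tind s t r * u r) + c2 * (tind s t r * v r)) + tind s t r * h j r y.
  by apply/funext => r; rewrite /field lfield_lin -/c0 -/c1 -/c2; ring.
rewrite E lfield_lin -/c0 -/c1 -/c2.
have i0 := itgZ c0 (itg_tind s t); have i1 := itgZ c1 iu; have i2 := itgZ c2 iv.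
rewrite RintD//; last by apply: itgD => //; exact: itgD.
rewrite RintD//; last exact: itgD.
rewrite RintD// !RintZ//; last exact: itg_tind.
by rewrite Rint_tind_cst// /ubar /vbar /hbar; ring.
Qed.

(** [h] is Lipschitz only up to null sets. Passing through its mollification costs 6 K d at each of
    the two points, and frames do not create null-set problems since they preserve measure. *)
Lemma h_frame_close (w r s : R) j : `|vt r - vt s| <= w ->
  {ae leb6 R, forall z : V R, `|h j r (frame (vt r) z) - h j r (frame (vt s) z)| <=
     6 * K r * (w * `|z| + 2 * d)}.
Proof.
move=> vw; have mc := mollify_close d0 (h_lip j r).
have [K' _ KP] := mollify_C11 d0; have [D DC] := KP _ _ (h_lip j r).
have := aeI (mpres_ae (frame_mpres (vt r)) mc) (mpres_ae (frame_mpres (vt s)) mc).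
apply: aeS => z [c1 c2].
set y1 := frame (vt r) z in c1 *; set y2 := frame (vt s) z in c2 *.
have yw : `|y1 - y2| <= w * `|z|.
  rewrite frame_sub normrZ distrC; apply: ler_pM => //; exact: normr_perp_part.
have := C11_lip DC y2 (y1 - y2); rewrite (addrC y2) subrK => L1.
have L2 := ler_wpM2l (_ : 0 <= 6 * K r) yw.
have aux (p q m n x y e : R) : `|m - p| <= x -> `|n - q| <= x -> `|m - n| <= y -> y <= e ->
    `|p - q| <= 2 * x + e.
  rewrite !ler_norml => /andP[? ?] /andP[? ?] /andP[? ?] ?; apply/andP; split; lra.
apply: le_trans (aux _ _ _ _ _ _ _ c1 c2 L1 (L2 _)) _; first by rewrite mulr_ge0.
by rewrite le_eqVlt; apply/orP; left; apply/eqP; ring.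
Qed.

(** * The error of one time step *)

Section time_step.
Variables (L H rho w N s t : R) (chi : V R -> R) (D : V R -> V R -> R).
Hypothesis rho0 : 0 <= rho.
Hypothesis cC : C11 L H chi D.
Hypothesis cr : vanish_off rho chi.
Hypothesis s0 : 0 <= s.
Hypothesis st : s <= t.
Hypothesis fN : nrm (leb6 R) (f s) <= N.
Hypothesis fw : forall r, s <= r <= t -> nrm (leb6 R) (f r \- f s) <= w.
Hypothesis vw : forall r, s <= r <= t -> `|vt r - vt s| <= w.

Let L0 : 0 <= L. Proof. exact: C11_L_ge0 cC. Qed.
Let H0 : 0 <= H. Proof. exact: C11_H_ge0 cC. Qed.
Let N0 : 0 <= N. Proof. exact: le_trans (nrm_ge0 _ _) fN. Qed.
Let w0 : 0 <= w. Proof. by apply: le_trans (nrm_ge0 _ _) (@fw s _); rewrite lexx st. Qed.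

Let rho1 := (1 + C) * rho.
Let rho2 := (1 + C) * rho1.
Let rho10 : 0 <= rho1. Proof. by apply: mulr_ge0 => //; exact: addr_ge0. Qed.
Let rho20 : 0 <= rho2. Proof. by apply: mulr_ge0 => //; exact: addr_ge0. Qed.

(** [adv] with the frame frozen at time q and the field replaced by arbitrary components [c]. *)
Definition dsum q (c : J -> V R -> R) z : R :=
  \sum_(j : J) D (frame (vt q) z) (basis6 R j) * c j (frame (vt q) z).

Lemma D_basis_bound y j : `|D y (basis6 R j)| <= L.
Proof.
case: cC => _ DL _ _ _; apply: le_trans (DL _ _) _.
by rewrite ler_piMr// normr_basis6.
Qed.

Lemma dsum_bound q c z X : 0 <= X ->
  (forall j, `|frame (vt q) z| <= rho -> `|c j (frame (vt q) z)| <= X) ->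
  `|dsum q c z| <= 6 * (L * X) * ball_ind rho1 z.
Proof.
move=> X0 cX; rewrite ball_indE.
case: (leP `|frame (vt q) z| rho) => fr; last first.
  rewrite /dsum big1 ?normr0 => [|j _]; last by rewrite (C11_D_vanish cC cr) ?mul0r.
  by rewrite mulr_ge0// mulr_ge0// mulr_ge0.
rewrite (_ : `|z| <= rho1); last first.
  rewrite leNgt; apply/negP => zr.
  have : rho < `|frame (vt q) z| by exact: (frame_support vt_bound).
  by rewrite ltNge fr.
rewrite mulr1; apply: le_trans (ler_norm_sum _ _ _) _.
apply: (@le_trans _ _ (\sum_(j : J) L * X)).
  apply: ler_sum => j _; rewrite normrM; apply: ler_pM => //; last exact: cX.
  exact: D_basis_bound.
by rewrite sumr_const card_sum !card_ord mulr_natl.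
Qed.

Lemma measurable_dsum q c : (forall j, measurable_fun [set: mV R] (c j)) ->
  measurable_fun [set: mV R] (dsum q c).
Proof.
move=> mc; have mf : measurable_fun [set: mV R] (frame (vt q) : mV R -> mV R).
  by have [] := frame_mpres (vt q).
apply: measurable_sum => j; apply: measurable_funM; last exact: (measurableT_comp (mc j)).
by case: cC => _ _ _ _ mD; exact: (measurableT_comp (mD _)).
Qed.

Let kap r := (1 + rho2) * (B + 6 * K r).

Let kap_ge r : B + 6 * K r <= kap r.
Proof. by rewrite /kap ler_peMl ?lerDl// addr_ge0// mulr_ge0. Qed.

Let kap0 r : 0 <= kap r.
Proof. by apply: le_trans (kap_ge r); rewrite addr_ge0// mulr_ge0. Qed.

Lemma field_le_kap j r y : `|y| <= rho2 -> `|field j r y| <= kap r.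
Proof.
move=> yr; apply: le_trans (field_bound _ _ _) _; rewrite /kap [leRHS]mulrDr; apply: lerD.
  by rewrite mulrC ler_wpM2r// lerD2l.
have := K0 r; have := mulr_ge0 rho20 (K0 r); nra.
Qed.

Let Q := 6 * (6 * H * (w * rho1) + L * (w * rho1 + 2 * d)).

Let Q0 : 0 <= Q.
Proof.
apply: mulr_ge0 => //; apply: addr_ge0; apply: mulr_ge0 => //.
- exact: mulr_ge0.
- exact: mulr_ge0.
- apply: addr_ge0; first exact: mulr_ge0.
  by apply: mulr_ge0 => //; exact: ltW.
Qed.

Lemma frame_bound r z : `|z| <= rho1 -> `|frame (vt r) z| <= rho2.
Proof.
by move=> zr; apply: le_trans (frame_growth _ _) _; apply: ler_pM => //; rewrite lerD2l.
Qed.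

(** Difference of products: the gradient of chi varies with constant 6 H, the field as in
    [h_frame_close]. The second-order constant H comes only with the small factor w, while the term
    in d carries only L; this drives the order of limits in [consistency]. *)
Lemma dsum_time_close r : s <= r <= t ->
  {ae leb6 R, forall z : V R, `|dsum r (field^~ r) z - dsum s (field^~ r) z| <=
     Q * kap r * ball_ind rho1 z}.
Proof.
move=> rst; have hc : {ae leb6 R, forall z, forall j : J, 
    `|h j r (frame (vt r) z) - h j r (frame (vt s) z)| <= 6 * K r * (w * `|z| + 2 * d)}.
  have hj j := @h_frame_close w r s j (vw rst).
  have H1 := aeI (hj (inl (@Ordinal 3 0 isT))) (aeI (hj (inl (@Ordinal 3 1 isT))) (hj (inl (@Ordinal 3 2 isT)))).
  have H2 := aeI (hj (inr (@Ordinal 3 0 isT))) (aeI (hj (inr (@Ordinal 3 1 isT))) (hj (inr (@Ordinal 3 2 isT)))).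
  apply: aeS (aeI H1 H2) => z [[a0 [a1 a2]] [b0 [b1 b2]]] [].
    exact: ord3_cases.
  exact: ord3_cases.
apply: aeS hc => z hz; rewrite ball_indE; case: (leP `|z| rho1) => zr; last first.
  have v0 q : dsum q (field^~ r) z = 0.
    rewrite /dsum big1// => j _; rewrite (C11_D_vanish cC cr) ?mul0r//.
    by apply: (frame_support vt_bound).
  by rewrite !v0 subrr normr0 mulr0.
rewrite mulr1 /dsum -sumrB; apply: le_trans (ler_norm_sum _ _ _) _.
apply: (@le_trans _ _ (\sum_(j : J) (6 * H * (w * rho1) + L * (w * rho1 + 2 * d)) * kap r)).
  apply: ler_sum => j _; set y1 := frame (vt r) z; set y2 := frame (vt s) z.
  have yw : `|y1 - y2| <= w * rho1.
    rewrite frame_sub normrZ distrC; apply: ler_pM => //; first exact: vw.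
    by apply: le_trans zr; exact: normr_perp_part.
  have -> : D y1 (basis6 R j) * field j r y1 - D y2 (basis6 R j) * field j r y2 =
    (D y1 (basis6 R j) - D y2 (basis6 R j)) * field j r y1 +
    D y2 (basis6 R j) * (field j r y1 - field j r y2) by ring.
  apply: le_trans (ler_normD _ _) _; rewrite !normrM mulrDl; apply: lerD.
    apply: ler_pM => //; last by apply: field_le_kap; exact: frame_bound.
    have := C11_grad_lip cC y2 (y1 - y2) (basis6 R j); rewrite (addrC y2) subrK.
    move=> /le_trans; apply; rewrite -[leRHS]mulr1; apply: ler_pM => //; last exact: normr_basis6.
      by rewrite mulr_ge0// mulr_ge0.
    by rewrite ler_wpM2l// mulr_ge0.
  rewrite -[leRHS]mulrA; apply: ler_pM => //; first exact: D_basis_bound.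
  have -> : field j r y1 - field j r y2 =
     coord6 j (lfield al be ga 1 (u r) (v r) (y1 - y2)) + (h j r y1 - h j r y2).
    rewrite /field; have -> : coord6 j (lfield al be ga 1 (u r) (v r) y1) =
       coord6 j (lfield al be ga 1 (u r) (v r) (y1 - y2)) + coord6 j (lfield al be ga 1 (u r) (v r) y2).
      by rewrite -coord6D -lfieldD subrK.
    ring.
  apply: le_trans (ler_normD _ _) _.
  have b1 : `|coord6 j (lfield al be ga 1 (u r) (v r) (y1 - y2))| <= B * (w * rho1).
    apply: le_trans (normr_coord6 _ _) _; apply: le_trans (lfield_field_bound _ _) _.
    by rewrite ler_wpM2l.
  have b2 : `|h j r y1 - h j r y2| <= 6 * K r * (w * rho1 + 2 * d).
    apply: le_trans (hz j) _; rewrite ler_wpM2l ?mulr_ge0// lerD2r ler_wpM2l//.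
  apply: le_trans (lerD b1 b2) _.
  apply: (@le_trans _ _ ((w * rho1 + 2 * d) * (B + 6 * K r))).
    have := mulr_ge0 B0 (ltW d0); set X := w * rho1; set Y := K r; set B' := B; nra.
  apply: ler_wpM2l (kap_ge r); apply: addr_ge0; first exact: mulr_ge0.
  by apply: mulr_ge0 => //; exact: ltW.
by rewrite sumr_const card_sum !card_ord /Q -[leRHS]mulrA [leRHS]mulr_natl.
Qed.

Lemma measurable_dsum_field q r :
  measurable_fun [set: mV R] (dsum q (field^~ r)).
Proof.
by apply: measurable_dsum => j; exact: (measurable_fun_pair2 r (measurable_field j)).
Qed.

(** Two freezings at the left end of the step: that of [f] costs its L^2 oscillation, that of the
    frame costs [dsum_time_close]. *)
Lemma rate_close r : s <= r <= t ->
  `|rate f vt field D r - \int[leb6 R]_z (f s z * dsum s (field^~ r) z)| <=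
    kap r * ((6 * L * w + N * Q) * cb rho1).
Proof.
move=> /andP[sr rt]; have r0 : 0 <= r by exact: le_trans sr.
have srt : s <= r <= t by rewrite sr.
have A0 : 0 <= 6 * (L * kap r) by rewrite mulr_ge0// mulr_ge0.
have ab z : `|dsum r (field^~ r) z| <= 6 * (L * kap r) * ball_ind rho1 z.
  apply: dsum_bound => // j yr; apply: field_le_kap.
  apply: le_trans yr _; rewrite /rho2 /rho1 mulrA ler_peMl//.
  by rewrite -[leLHS]mulr1; apply: ler_pM; rewrite ?lerDl.
have mr := measurable_dsum_field r r; have ms := measurable_dsum_field s r.
have E1 := L2_pairing_diff fC r0 s0 A0 rho10 mr ab.
have QA0 : 0 <= Q * kap r by rewrite mulr_ge0.
have mrs : measurable_fun [set: mV R] (fun z => dsum r (field^~ r) z - dsum s (field^~ r) z).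
  exact: measurable_funB.
have [i2 E2] := L2_pair_ball (C_L2_L2 fC s0) QA0 rho10 mrs (dsum_time_close srt).
have [i1 _] := L2_pairing fC s0 A0 rho10 mr ab.
have i3 : itg (leb6 R) (fun z => f s z * dsum s (field^~ r) z).
  by have := itgB i1 i2; congr itg; apply/funext => z; ring.
have E : \int[leb6 R]_z (f s z * (dsum r (field^~ r) z - dsum s (field^~ r) z)) =
    \int[leb6 R]_z (f s z * dsum r (field^~ r) z) - \int[leb6 R]_z (f s z * dsum s (field^~ r) z).
  by rewrite -RintB//; apply: eq_Rintegral => z _; rewrite mulrBr.
rewrite E in E2.
have -> : rate f vt field D r = \int[leb6 R]_z (f r z * dsum r (field^~ r) z) by [].
apply: le_trans (_ : _ <= nrm (leb6 R) (f r \- f s) * (6 * (L * kap r)) * cb rho1 +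
  nrm (leb6 R) (f s) * (Q * kap r) * cb rho1) _.
  rewrite -[X in `|X|](subrKA (\int[leb6 R]_z (f s z * dsum r (field^~ r) z))).
  by apply: le_trans (ler_normD _ _) _; exact: lerD.
have c0 := cb_ge0 rho1.
have -> : kap r * ((6 * L * w + N * Q) * cb rho1) =
    w * (6 * (L * kap r)) * cb rho1 + N * (Q * kap r) * cb rho1 by ring.
apply: lerD; (apply: ler_wpM2r => //; apply: ler_wpM2r => //).
exact: fw.
Qed.

Definition vel_pairing : R :=
  \int[leb6 R]_z (f s z * dsum s (fun j => vel s t j) z).

Let Ib : 0 <= \int[leb R]_r (tind s t r * kap r) <= (1 + rho2) * kk s t /\
  itg (leb R) (fun r => tind s t r * kap r).
Proof.
have [E i] := kkE s0 st.
have E' : (fun r => tind s t r * kap r) = fun r => (1 + rho2) * (tind s t r * (B + 6 * K r)).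
  by apply/funext => r; rewrite /kap; ring.
split; last by rewrite E'; exact: itgZ.
by rewrite E' RintZ// -E lexx andbT mulr_ge0 ?kk_ge0// addr_ge0.
Qed.

(** After freezing, Fubini puts the time integral on the field, which becomes the averaged
    displacement; mollifying the averaged force costs a multiple of kbar times d. *)
Lemma rate_integral_close :
  `|\int[leb R]_r (tind s t r * rate f vt field D r) - vel_pairing| <=
    (1 + rho2) * kk s t * ((6 * L * w + N * (Q + 6 * L * d)) * cb rho1).
Proof.
have [/andP[I0 Ile] Ii] := Ib.
pose G r := \int[leb6 R]_z (f s z * dsum s (field^~ r) z).
pose W z := \int[leb R]_r (tind s t r * dsum s (field^~ r) z).
have A0 r : 0 <= 6 * (L * kap r) by rewrite mulr_ge0// mulr_ge0.
have ab r z : `|dsum s (field^~ r) z| <= 6 * (L * kap r) * ball_ind rho1 z.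
  apply: dsum_bound => // j yr; apply: field_le_kap.
  apply: le_trans yr _; rewrite /rho2 /rho1 mulrA ler_peMl//.
  by rewrite -[leLHS]mulr1; apply: ler_pM; rewrite ?lerDl.
have mj : measurable_fun [set: measurableTypeR R * mV R]
    (fun q : R * V R => dsum s (field^~ q.1) q.2).
  have mf : measurable_fun [set: measurableTypeR R * mV R]
      ((fun q : R * V R => frame (vt s) q.2) : measurableTypeR R * mV R -> mV R).
    have [m _] := frame_mpres (vt s); exact: (measurableT_comp m).
  apply: measurable_sum => j; apply: measurable_funM.
    by case: cC => _ _ _ _ mD; exact: (measurableT_comp (mD _) mf).
  apply: (@measurableT_comp _ _ _ _ _ _ (fun q : measurableTypeR R * mV R => field j q.1 q.2)
    _ (fun q => (q.1, frame (vt s) q.2))); first exact: measurable_field.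
  by apply: measurable_fun_pair.
have L2s := C_L2_L2 fC s0.
have fi : itg (leb6 R) (fun z => `|f s z * ball_ind rho1 z|).
  apply: itg_norm; have [] := @L2_pairing _ _ fC (ball_ind rho1) 1 rho1 s s0 ler01 rho10.
  - exact: measurable_ball_ind.
  - by move=> z; rewrite mul1r ger0_norm// ball_ind_ge0.
  - by [].
have mG : measurable_fun [set: measurableTypeR R] G.
  apply: (@measurable_Rint _ _ _ _ _ (leb6 R) (fun q : measurableTypeR R * mV R =>
    f s q.2 * dsum s (field^~ q.1) q.2)).
  apply: measurable_funM => //; exact: (measurableT_comp (L2_meas L2s)).
have Gb r : `|G r| <= 6 * L * N * cb rho1 * kap r.
  have [_ b] := L2_pairing fC s0 (A0 r) rho10 (measurable_dsum_field s r) (ab r).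
  apply: le_trans b _; have -> : 6 * L * N * cb rho1 * kap r = N * (6 * (L * kap r)) * cb rho1 by ring.
  by apply: ler_wpM2r (cb_ge0 _) _ _ _; apply: ler_wpM2r.
have dG : itg (leb R) (fun r => 6 * L * N * cb rho1 * (tind s t r * kap r)) by exact: itgZ.
have Gi : itg (leb R) (fun r => tind s t r * G r).
  apply: itg_dom dG; first by apply: measurable_funM => //; exact: measurable_tind.
  move=> r; rewrite normrM ger0_norm ?tind_ge0// mulrCA ler_wpM2l ?tind_ge0//.
have Fub : \int[leb R]_r (tind s t r * G r) = \int[leb6 R]_z (f s z * W z).
  have fsi r : itg (leb6 R) (fun z => f s z * dsum s (field^~ r) z).
    by have [] := L2_pairing fC s0 (A0 r) rho10 (measurable_dsum_field s r) (ab r).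
  under eq_Rintegral do rewrite -RintZ//.
  rewrite (@Rfubini _ _ _ _ _ (leb R) (leb6 R)
    (fun q : R * V R => tind s t q.1 * (f s q.2 * dsum s (field^~ q.1) q.2))
    (fun r => 6 * L * (tind s t r * kap r)) (fun z => `|f s z * ball_ind rho1 z|)) //.
  - apply: eq_Rintegral => z _ /=; rewrite /W -RintZ.
      by apply: eq_Rintegral => r _; ring.
    apply: itg_dom (itgZ (6 * L * ball_ind rho1 z) Ii).
      apply: measurable_funM; first exact: measurable_tind.
      exact: (measurable_fun_pair1 z mj).
    move=> r; rewrite normrM ger0_norm ?tind_ge0// mulrCA ler_wpM2l ?tind_ge0//.
    by apply: le_trans (ab r z) _; rewrite le_eqVlt; apply/orP; left; apply/eqP; ring.
  - apply: measurable_funM; first exact: (measurableT_comp (measurable_tind s t)).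
    apply: measurable_funM => //; exact: (measurableT_comp (L2_meas L2s)).
  - move=> r z /=; rewrite !normrM (ger0_norm (tind_ge0 _ _ _)) (ger0_norm (ball_ind_ge0 _ _)).
    have := ab r z; have := tind_ge0 s t r => t0 b.
    have := ler_wpM2l t0 (ler_wpM2l (normr_ge0 (f s z)) b) => /le_trans; apply.
    by rewrite le_eqVlt; apply/orP; left; apply/eqP; ring.
  - exact: itgZ.
have WE z : W z = dsum s (fun j y => coord6 j (lfield al be ga (t - s) (ubar s t) (vbar s t) y) +
    hbar h s t j y) z.
  rewrite /W /dsum; set y := frame (vt s) z.
  have fji j : itg (leb R) (fun r => tind s t r * field j r y).
    have k1 := itgZ (1 + `|y|) (kkE s0 st).2.
    apply: itg_dom k1; first by apply: measurable_funM;
      [exact: measurable_tind|exact: (measurable_fun_pair1 y (measurable_field j))].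
    move=> r; rewrite normrM ger0_norm ?tind_ge0// mulrCA ler_wpM2l ?tind_ge0//.
    apply: le_trans (field_bound _ _ _) _.
    have := mulr_ge0 (normr_ge0 y) (K0 r); have := K0 r; set b := B; set k := K r; nra.
  under eq_Rintegral do rewrite mulr_sumr.
  rewrite (proj2 (@Rint_sum _ _ _ (leb R) _ _ (fun j r => tind s t r *
      (D y (basis6 R j) * field j r y)) _)); last first.
    move=> j; have := itgZ (D y (basis6 R j)) (fji j); congr itg; apply/funext => r; ring.
  apply: eq_bigr => j _; rewrite -Rint_field// -RintZ//.
  by apply: eq_Rintegral => r _; ring.
pose X := 6 * (L * (6 * kbar K s t * d)).
have kb0 := kbar_ge0 h_lip s t.
have X0 : 0 <= X by rewrite !mulr_ge0// ltW.
have Wv : {ae leb6 R, forall z, `|W z - dsum s (fun j => vel s t j) z| <= X * ball_ind rho1 z}.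
  have hj j := mpres_ae (frame_mpres (vt s)) (mollify_close d0 (hbar_weak_lip h_meas h_lip K_itg t j s0)).
  have H1 := aeI (hj (inl (@Ordinal 3 0 isT))) (aeI (hj (inl (@Ordinal 3 1 isT))) (hj (inl (@Ordinal 3 2 isT)))).
  have H2 := aeI (hj (inr (@Ordinal 3 0 isT))) (aeI (hj (inr (@Ordinal 3 1 isT))) (hj (inr (@Ordinal 3 2 isT)))).
  have hc : {ae leb6 R, forall z, forall j : J, `|mollify d (hbar h s t j) (frame (vt s) z) -
      hbar h s t j (frame (vt s) z)| <= 6 * kbar K s t * d}.
    apply: aeS (aeI H1 H2) => z [[a0 [a1 a2]] [b0 [b1 b2]]] []; exact: ord3_cases.
  apply: aeS hc => z hz; rewrite WE.
  have -> : dsum s (fun j y => coord6 j (lfield al be ga (t - s) (ubar s t) (vbar s t) y) +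
       hbar h s t j y) z - dsum s (fun j => vel s t j) z =
     dsum s (fun j y => hbar h s t j y - mollify d (hbar h s t j) y) z.
    rewrite /dsum -sumrB; apply: eq_bigr => j _; rewrite /velo; ring.
  apply: dsum_bound; first by rewrite !mulr_ge0// ltW.
  by move=> j _; rewrite distrC; exact: hz.
have mW : measurable_fun [set: mV R] W.
  rewrite (funext WE); apply: measurable_dsum => j; apply: measurable_funD.
    have [K' _ KP] := velo_C11 al be ga h_meas h_lip K_itg d0.
    have [DV DVC] := KP s t (ubar s t) (vbar s t) j s0.
    have mv : measurable_fun [set: mV R] (vel s t j) by case: DVC.
    have mm : measurable_fun [set: mV R] (mollify d (hbar h s t j)).
      have [K2 _ K2P] := mollify_C11 d0.
      by have [D2 []] := K2P _ _ (hbar_weak_lip h_meas h_lip K_itg t j s0).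
    have := measurable_funB mv mm; apply: eq_measurable_fun => z _.
    by rewrite /= /velo addrK.
  by have [] := hbar_weak_lip h_meas h_lip K_itg t j s0.
have mvel : measurable_fun [set: mV R] (dsum s (fun j => vel s t j)).
  apply: measurable_dsum => j; have [K' _ KP] := velo_C11 al be ga h_meas h_lip K_itg d0.
  by have [DV []] := KP s t (ubar s t) (vbar s t) j s0.
have mWv := measurable_funB mW mvel.
have [i5 E5] := L2_pair_ball L2s X0 rho10 mWv Wv.
have k0 := kk_ge0 st.
have Wb z : `|W z| <= 6 * L * ((1 + rho2) * kk s t) * ball_ind rho1 z.
  have -> : 6 * L * ((1 + rho2) * kk s t) * ball_ind rho1 z =
      (6 * L * ball_ind rho1 z) * ((1 + rho2) * kk s t) by ring.
  have i6 := itgZ (6 * L * ball_ind rho1 z) Ii.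
  apply: (@le_trans _ _ (\int[leb R]_r (6 * L * ball_ind rho1 z * (tind s t r * kap r)))).
    apply: Rint_norm_le => //; last first.
      apply: aeW => r; rewrite normrM ger0_norm ?tind_ge0// mulrCA ler_wpM2l ?tind_ge0//.
      by apply: le_trans (ab r z) _; rewrite le_eqVlt; apply/orP; left; apply/eqP; ring.
    apply: itg_dom i6.
      apply: measurable_funM; first exact: measurable_tind.
      exact: (measurable_fun_pair1 z mj).
    move=> r; rewrite normrM ger0_norm ?tind_ge0// mulrCA ler_wpM2l ?tind_ge0//.
    by apply: le_trans (ab r z) _; rewrite le_eqVlt; apply/orP; left; apply/eqP; ring.
  rewrite RintZ//; apply: ler_wpM2l => //.
  by rewrite mulr_ge0 ?ball_ind_ge0// mulr_ge0.
have W0 : 0 <= 6 * L * ((1 + rho2) * kk s t).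
  by apply: mulr_ge0; [exact: mulr_ge0|apply: mulr_ge0 => //; exact: addr_ge0].
have [i7 _] := L2_pairing fC s0 W0 rho10 mW Wb.
have E6 : \int[leb6 R]_z (f s z * (W z - dsum s (fun j => vel s t j) z)) =
    \int[leb R]_r (tind s t r * G r) - vel_pairing.
  rewrite Fub /vel_pairing -RintB//.
    by apply: eq_Rintegral => z _; rewrite mulrBr.
  by have := itgB i7 i5; congr itg; apply/funext => z /=; ring.
rewrite E6 in E5.
have Ri : itg (leb R) (fun r => tind s t r * rate f vt field D r).
  exact: (itg_tind_rate fS vt_derivable vt_bound measurable_field field_bound B0 K0 K_itg rho0 cC cr).
have E7 : `|\int[leb R]_r (tind s t r * rate f vt field D r) - \int[leb R]_r (tind s t r * G r)| <=
    (1 + rho2) * kk s t * ((6 * L * w + N * Q) * cb rho1).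
  rewrite -RintB//; have i8 := itgZ ((6 * L * w + N * Q) * cb rho1) Ii.
  have c0 : 0 <= (6 * L * w + N * Q) * cb rho1.
    by apply: mulr_ge0 (cb_ge0 _); apply: addr_ge0; apply: mulr_ge0 => //; apply: mulr_ge0.
  apply: (@le_trans _ _ (\int[leb R]_r ((6 * L * w + N * Q) * cb rho1 * (tind s t r * kap r)))).
    apply: Rint_norm_le => //; first exact: itgB.
    have z1 (x y : R) : true%:R * x - true%:R * y = x - y by rewrite !mul1r.
    have z0 (x y : R) : false%:R * x - false%:R * y = 0 by rewrite !mul0r subrr.
    apply: aeW => r; rewrite tindE; case: (boolP (s <= r < t)) => [/andP[sr rt]|_].
      have := @rate_close r; rewrite sr (ltW rt) => /(_ isT) rc.
      by rewrite z1 (_ : true%:R * kap r = kap r) ?mul1r// mulrC.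
    by rewrite z0 normr0 (_ : false%:R * kap r = 0) ?mul0r// mulr0.
  by rewrite RintZ// mulrC; apply: ler_wpM2r.
rewrite -(subrKA (\int[leb R]_r (tind s t r * G r))).
apply: le_trans (ler_normD _ _) _; apply: le_trans (lerD E7 E5) _.
have -> : (1 + rho2) * kk s t * ((6 * L * w + N * (Q + 6 * L * d)) * cb rho1) =
  (1 + rho2) * kk s t * ((6 * L * w + N * Q) * cb rho1) +
  N * (6 * (L * ((1 + rho2) * kk s t * d))) * cb rho1 by ring.
rewrite lerD2l; apply: ler_wpM2r (cb_ge0 _) _ _ _; apply: ler_pM => //; first exact: nrm_ge0.
rewrite /X ler_wpM2l// ler_wpM2l// ler_wpM2r ?(ltW d0)//.
apply: (@le_trans _ _ (kk s t)); first by rewrite /kk lerDr mulr_ge0 ?subr_ge0.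
by rewrite ler_peMl// lerDl.
Qed.

Let S := shears (vstep s t).

Lemma small_vstep : small_shears (kk s t) (vstep s t).
Proof.
have sm : small_shears (ksize al be ga K s t (ubar s t) (vbar s t)) (vstep s t).
  exact: small_vsteps.
have kl := ksize_le_kk st.
move=> q qi; have [b1 b2] := sm q qi; split=> [z|z k].
  by apply: le_trans (b1 z) _; apply: ler_wpM2r kl; rewrite addr_ge0.
by apply: le_trans (b2 z k) _; apply: ler_wpM2r kl.
Qed.

Lemma free_vstep : free_shears (vstep s t).
Proof. exact: free_vsteps. Qed.

Lemma vstep_mpres : mpres (leb6 R) S.
Proof.
apply: shears_mpres free_vstep _ => q qi.
by apply: (measurable_vsteps h_meas h_lip K_itg d0 s0 qi).
Qed.

Hypothesis k1 : kk s t <= 1.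

Lemma vstep_displacement y : `|S y - y| <= 63 * (kk s t * (1 + `|y|)).
Proof.
have k01 : 0 <= kk s t <= 1 by rewrite kk_ge0.
apply: le_trans (shears_displacement y k01 small_vstep) _.
by rewrite size_vsteps (_ : 2 ^+ 6 - 1 = 63 :> R) //; ring.
Qed.

Lemma vstep_inv_displacement y : `|shears (inv_shears (vstep s t)) y - y| <= 63 * (kk s t * (1 + `|y|)).
Proof.
have k01 : 0 <= kk s t <= 1 by rewrite kk_ge0.
apply: le_trans (shears_displacement y k01 (small_inv_shears small_vstep)) _.
by rewrite /inv_shears size_rev size_map size_vsteps (_ : 2 ^+ 6 - 1 = 63 :> R) //; ring.
Qed.

Let k0 : 0 <= kk s t. Proof. exact: kk_ge0. Qed.

(** If S y lies in the support of chi, the displacement bound for the inverse step at S y locates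
    y. *)
Lemma vstep_vanish : vanish_off (rho + 63 * (kk s t * (1 + rho))) (chi \o S).
Proof.
move=> y yr; apply: cr; rewrite ltNge; apply/negP => le.
move: yr; rewrite ltNge => /negP; apply.
rewrite -{1}(shearsK free_vstep y) -/S.
have := vstep_inv_displacement (S y) => dd.
have := ler_normD (shears (inv_shears (vstep s t)) (S y) - S y) (S y); rewrite subrK => E.
have : kk s t * (1 + `|S y|) <= kk s t * (1 + rho) by rewrite ler_wpM2l// lerD2l.
by move: E dd le; lra.
Qed.

(** Since kk <= 1, this dominates the radius rho + 63 kk (1 + rho) of [vstep_vanish]. *)
Let rr := 64 * (1 + rho).
Let rho3 := (1 + C) * rr.
Let X := kk s t ^+ 2 * (H * (63 * (1 + rr)) ^+ 2 + L * (729 * (1 + rr))).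

Let rr0 : 0 <= rr. Proof. by apply: mulr_ge0 => //; exact: addr_ge0. Qed.
Let rho30 : 0 <= rho3. Proof. by apply: mulr_ge0 => //; exact: addr_ge0. Qed.
Let X0 : 0 <= X.
Proof.
apply: mulr_ge0; first exact: sqr_ge0.
apply: addr_ge0; first exact: mulr_ge0 H0 (sqr_ge0 _).
exact: mulr_ge0 L0 (mulr_ge0 (ler0n _ 729) (addr_ge0 ler01 rr0)).
Qed.

(** The displacement of the step is O(kk) and differs from its Euler increment by O(kk^2)
    ([shears_consistent]); the Taylor bound of chi at this displacement gives the rest. The term in
    [dsum] is the differential of chi applied to the Euler increment. *)
Lemma vstep_taylor z :
  `|chi (S (frame (vt s) z)) - chi (frame (vt s) z) - dsum s (fun j => vel s t j) z| <=
    X * ball_ind rho3 z.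
Proof.
set y := frame (vt s) z.
have k01 : 0 <= kk s t <= 1 by rewrite k0.
rewrite ball_indE; case: (leP `|z| rho3) => zr; last first.
  have yr : rr < `|y|.
    rewrite ltNge; apply/negP => le; move: zr; rewrite ltNge => /negP; apply.
    rewrite -(frameK (vt s) z); apply: le_trans (frame_growth _ _) _.
    by rewrite normrN; apply: ler_pM => //; rewrite lerD2l.
  have krr : rho + 63 * (kk s t * (1 + rho)) < `|y|.
    by apply: le_lt_trans yr; have := ler_wpM2r (addr_ge0 ler01 rho0) k1; rewrite /rr; lra.
  have kr : rho < `|y| by apply: le_lt_trans krr; rewrite lerDl !mulr_ge0// addr_ge0.
  rewrite [chi (S y)](vstep_vanish krr) (cr kr) /dsum big1; last first.
    by move=> j _; rewrite (C11_D_vanish cC cr) ?mul0r.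
  by rewrite !subrr normr0 mulr_ge0.
rewrite mulr1.
case: (leP `|y| rr) => yr; last first.
  have krr : rho + 63 * (kk s t * (1 + rho)) < `|y|.
    by apply: le_lt_trans yr; have := ler_wpM2r (addr_ge0 ler01 rho0) k1; rewrite /rr; lra.
  have kr : rho < `|y| by apply: le_lt_trans krr; rewrite lerDl !mulr_ge0// addr_ge0.
  rewrite [chi (S y)](vstep_vanish krr) (cr kr) /dsum big1; last first.
    by move=> j _; rewrite (C11_D_vanish cC cr) ?mul0r.
  by rewrite !subrr normr0.
have -> : dsum s (fun j => vel s t j) z = D y (drift (vstep s t) y).
  rewrite /drift /vstep /vsteps big_map (C11_sum cC) big_enum /dsum -/y.
  by apply: eq_bigr => j _ /=; rewrite (C11_Z cC) mulrC.
have [lin DL fT _ _] := cC.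
have -> : chi (S y) - chi y - D y (drift (vstep s t) y) =
   (chi (y + (S y - y)) - chi y - D y (S y - y)) + D y (S y - y - drift (vstep s t) y).
  by rewrite (addrC y) subrK (C11_B cC _ (S y - y)) addrA subrK.
apply: le_trans (ler_normD _ _) _; rewrite /X mulrDr; apply: lerD.
  apply: le_trans (fT _ _) _; rewrite [leRHS]mulrCA; apply: ler_wpM2l => //.
  rewrite -exprMn ler_sqr ?nnegrE//; last first.
    by apply: mulr_ge0 => //; exact: mulr_ge0 (ler0n _ 63) (addr_ge0 ler01 rr0).
  apply: le_trans (vstep_displacement y) _; rewrite [leRHS]mulrCA.
  by apply: ler_wpM2l => //; apply: ler_wpM2l => //; rewrite lerD2l.
apply: le_trans (DL _ _) _; rewrite [leRHS]mulrCA; apply: ler_wpM2l => //.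
apply: le_trans (shears_consistent y k01 small_vstep) _.
rewrite size_vsteps (_ : 3 ^+ 6 = 729 :> R); last by ring.
rewrite mulrCA; apply: ler_wpM2l; first exact: sqr_ge0.
apply: ler_wpM2l; first exact: (ler0n _ 729).
by rewrite lerD2l.
Qed.

(** The evolution of the pairing and the composition of the test with the step share the first-order
    term [vel_pairing]; the errors are those of [rate_integral_close] and [vstep_taylor]. *)
Lemma step_error : `|pairing f vt chi t - pairing f vt (chi \o S) s| <=
  (1 + rho2) * kk s t * ((6 * L * w + N * (Q + 6 * L * d)) * cb rho1) + N * X * cb rho3.
Proof.
have t0 : 0 <= t by exact: le_trans st.
have WE (r : R) (r0 : 0 <= r) := weak_evolution fS vt_derivable dvt_cts vt_bound measurable_field
  field_bound B0 K0 K_itg bE rho0 cC cr r0.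
have Ri (s r : R) (s0 : 0 <= s) := itg_tind_rate fS vt_derivable vt_bound measurable_field
  field_bound B0 K0 K_itg rho0 cC cr r s0.
have E1 : pairing f vt chi t = pairing f vt chi s +
    \int[leb R]_r (tind s t r * rate f vt field D r).
  rewrite (WE t t0) (WE s s0) -addrA -RintD; [|exact: Ri|exact: Ri].
  by congr (_ + _); apply: eq_Rintegral => r _; rewrite (tind_split r s0 st) mulrDl.
have [mS _] := vstep_mpres; have [mf _] := frame_mpres (vt s).
have mc : measurable_fun [set: mV R] chi by case: cC.
have mw : measurable_fun [set: mV R] (fun z => chi (S (frame (vt s) z)) - chi (frame (vt s) z)
    - dsum s (fun j => vel s t j) z).
  apply: measurable_funB; first apply: measurable_funB.
  - exact: (measurableT_comp mc (measurableT_comp mS mf)).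
  - exact: (measurableT_comp mc mf).
  apply: measurable_dsum => j; have [K' _ KP] := velo_C11 al be ga h_meas h_lip K_itg d0.
  by have [DV []] := KP s t (ubar s t) (vbar s t) j s0.
have [i1 E2] := L2_pairing fC s0 X0 rho30 mw vstep_taylor.
have c1 := C11_bounded rho0 cC cr; set M := L * (2 * rho + 2) in c1.
have M0 : 0 <= M by rewrite mulr_ge0// addr_ge0// mulr_ge0.
have c2 z : `|chi (S (frame (vt s) z))| <= M * ball_ind rho3 z.
  rewrite ball_indE; case: (leP `|z| rho3) => zr; first by rewrite mulr1.
  have yr : rr < `|frame (vt s) z|.
    rewrite ltNge; apply/negP => le; move: zr; rewrite ltNge => /negP; apply.
    rewrite -(frameK (vt s) z); apply: le_trans (frame_growth _ _) _.
    by rewrite normrN; apply: ler_pM => //; rewrite lerD2l.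
  have krr : rho + 63 * (kk s t * (1 + rho)) < `|frame (vt s) z|.
    by apply: le_lt_trans yr; have := ler_wpM2r (addr_ge0 ler01 rho0) k1; rewrite /rr; lra.
  by rewrite [chi (S _)](vstep_vanish krr) normr0 mulr0.
have [i2 _] := L2_pairing fC s0 M0 rho30 (measurableT_comp mc (measurableT_comp mS mf)) c2.
have i3 : itg (leb6 R) (fun z => f s z * chi (frame (vt s) z)).
  exact: (pairing_itg fS vt_derivable vt_bound rho0 cC cr s s0).
have i4 : itg (leb6 R) (fun z => f s z * dsum s (fun j => vel s t j) z).
  by have := itgB (itgB i2 i3) i1; congr itg; apply/funext => z /=; ring.
have E3 : \int[leb6 R]_z (f s z * (chi (S (frame (vt s) z)) - chi (frame (vt s) z)
    - dsum s (fun j => vel s t j) z)) =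
    pairing f vt (chi \o S) s - pairing f vt chi s - vel_pairing.
  rewrite /pairing /vel_pairing -RintB// -RintB//; last exact: itgB.
  by apply: eq_Rintegral => z _ /=; ring.
rewrite E3 in E2; rewrite E1.
have E4 := rate_integral_close.
set a1 := \int[leb R]_r (tind s t r * _) in E4 *.
set p1 := pairing f vt chi s in E2 *; set p2 := pairing f vt (chi \o S) s in E2 *.
have -> : p1 + a1 - p2 = (a1 - vel_pairing) - (p2 - p1 - vel_pairing) by ring.
apply: le_trans (ler_normB _ _) _; apply: lerD => //.
apply: le_trans E2 _; apply: ler_wpM2r (cb_ge0 _) _ _ _.
exact: ler_wpM2r.
Qed.

End time_step.

Fixpoint flow (p : nat -> R) (k m : nat) (z : V R) : V R :=
  if m is m'.+1 then flow p k.+1 m' (shears (vstep (p k) (p k.+1)) z) else z.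

Lemma exp_pow (x : R) n : 0 <= x -> (1 + x) ^+ n <= expR (n%:R * x).
Proof.
move=> x0; rewrite expRM_natl; apply: lerXn2r; rewrite ?nnegrE ?expR_ge0 ?addr_ge0//.
exact: expR_ge1Dx.
Qed.

(** * Accumulation of the errors over a partition *)

Section telescoping.
Variables (L H rho w N K' : R) (chi : V R -> R) (D : V R -> V R -> R).
Variables (p : nat -> R) (n : nat).
Hypothesis rho0 : 0 <= rho.
Hypothesis cC : C11 L H chi D.
Hypothesis cr : vanish_off rho chi.
Hypothesis p0 : forall k, 0 <= p k.
Hypothesis p_le : forall i j, (i <= j)%N -> p i <= p j.
Hypothesis fN : forall k, (k < n)%N -> nrm (leb6 R) (f (p k)) <= N.
Hypothesis fw : forall k r, (k < n)%N -> p k <= r <= p k.+1 ->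
  nrm (leb6 R) (f r \- f (p k)) <= w.
Hypothesis vw : forall k r, (k < n)%N -> p k <= r <= p k.+1 -> `|vt r - vt (p k)| <= w.
Hypothesis kw : forall k, (k < n)%N -> kk (p k) (p k.+1) <= w.
Hypothesis w0 : 0 <= w.
Hypothesis w1 : w <= 1.
Hypothesis N0 : 0 <= N.
Hypothesis K'0 : 0 <= K'.
Hypothesis K'P : forall s t u v j, 0 <= s ->
    exists D, C11 (ksize al be ga K s t u v) (K' * kbar K s t) (velo al be ga h d s t u v j) D.

Let sg k := kk (p k) (p n).
(** [Lk], [Hk] and [rk] bound chi composed with the steps from k to n. Only [Hk] contains K', and so
    depends on the mollification scale beyond [sg]. *)
Let Lk k := L * expR (6 * sg k).
Let Hk k := (H + 6 * L * K' * sg k * expR (6 * sg k)) * expR (12 * sg k).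
Let rk k := (1 + rho) * expR (63 * sg k) - 1.

Let L0 : 0 <= L. Proof. exact: C11_L_ge0 cC. Qed.
Let H0 : 0 <= H. Proof. exact: C11_H_ge0 cC. Qed.

Let sg0 k : (k <= n)%N -> 0 <= sg k. Proof. by move=> kn; apply: kk_ge0; exact: p_le. Qed.

Let sgS k : (k < n)%N -> sg k = kk (p k) (p k.+1) + sg k.+1.
Proof. by move=> kn; apply: kk_split; [exact: p0|exact: p_le|exact: p_le]. Qed.

Let expge1 (x : R) : 0 <= x -> 1 <= expR x.
Proof. by move=> x0; rewrite -[leLHS]expR0 ler_expR. Qed.

Let rk0 k : (k <= n)%N -> 0 <= rk k.
Proof.
move=> kn; rewrite subr_ge0; apply: (@le_trans _ _ (1 + rho)); first by rewrite lerDl.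
by apply: ler_peMr; rewrite ?addr_ge0// expge1// mulr_ge0// sg0.
Qed.

Let Q := 6 * (6 * Hk 0 * (w * ((1 + C) * rk 0)) + Lk 0 * (w * ((1 + C) * rk 0) + 2 * d)).
Let X := Hk 0 * (63 * (1 + 64 * (1 + rk 0))) ^+ 2 + Lk 0 * (729 * (1 + 64 * (1 + rk 0))).
Let Z := (1 + (1 + C) * ((1 + C) * rk 0)) *
    ((6 * Lk 0 * w + N * (Q + 6 * Lk 0 * d)) * cb ((1 + C) * rk 0)) +
  N * (w * X) * cb ((1 + C) * (64 * (1 + rk 0))).

Let Lk0 k : 0 <= Lk k. Proof. by rewrite mulr_ge0 ?expR_ge0. Qed.
Let Hk0 k : (k <= n)%N -> 0 <= Hk k.
Proof.
by move=> kn; rewrite mulr_ge0 ?expR_ge0// addr_ge0// !mulr_ge0 ?expR_ge0 ?sg0.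
Qed.

Let mono k : (k <= n)%N -> [/\ Lk k <= Lk 0, Hk k <= Hk 0 & rk k <= rk 0].
Proof.
move=> kn; have sk : sg k <= sg 0.
  rewrite /sg (kk_split (p0 0) (p_le (leq0n k)) (p_le kn)) lerDr.
  by apply: kk_ge0; exact: p_le.
have s0 := sg0 kn; have s00 := sg0 (leq0n n).
have ex (x : R) : 0 <= x -> expR (x * sg k) <= expR (x * sg 0).
  by move=> x0; rewrite ler_expR; exact: ler_wpM2l x0 _ _ sk.
have LK : 0 <= 6 * L * K' by exact: mulr_ge0 (mulr_ge0 (ler0n _ 6) L0) K'0.
split.
- exact: ler_wpM2l L0 _ _ (ex 6 (ler0n _ 6)).
- apply: ler_pM (ex 12 (ler0n _ 12)); [|exact: expR_ge0|].
    exact: addr_ge0 H0 (mulr_ge0 (mulr_ge0 LK s0) (expR_ge0 _)).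
  rewrite lerD2l; apply: ler_pM (ex 6 (ler0n _ 6)); [exact: mulr_ge0 LK s0|exact: expR_ge0|].
  exact: ler_wpM2l LK _ _ sk.
- rewrite lerD2r; exact: ler_wpM2l (addr_ge0 ler01 rho0) _ _ (ex 63 (ler0n _ 63)).
Qed.

(** Induction on the number of remaining steps: each multiplies the constants by powers of 1 + kap,
    bounded by exponentials whose exponents add up, and the contributions K' kap to the second-order
    constant sum to K' sg. *)
Lemma flow_C11 m k : (k + m = n)%N ->
  (exists D', C11 (Lk k) (Hk k) (chi \o flow p k m) D') /\
  vanish_off (rk k) (chi \o flow p k m).
Proof.
elim: m k => [|m IH] k.
  rewrite addn0 => ->; split.
    exists D; apply: C11_le cC.
      by rewrite ler_peMr// expge1// mulr_ge0// sg0.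
    apply: (@le_trans _ _ (H + 6 * L * K' * sg n * expR (6 * sg n))).
      by rewrite lerDl !mulr_ge0 ?expR_ge0 ?sg0.
    by rewrite ler_peMr ?expge1 ?mulr_ge0 ?sg0// addr_ge0// !mulr_ge0 ?expR_ge0 ?sg0.
  move=> z zr; apply: cr; apply: le_lt_trans zr.
  rewrite /rk lerBrDl addrC [rho + 1]addrC; apply: ler_peMr; first by rewrite addr_ge0.
  by rewrite expge1// mulr_ge0// sg0.
move=> kmn; have kn : (k < n)%N by rewrite -kmn -addSnnS leq_addr.
have [|[D' C'] r'] := IH k.+1; first by rewrite addSnnS.
set kap := kk (p k) (p k.+1).
have kap0 : 0 <= kap by apply: kk_ge0; exact: p_le.
have kap1 : kap <= 1 by apply: le_trans (kw kn) w1.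
have pk := p_le (leqnSn k).
split.
  have vC q : List.In q (vstep (p k) (p k.+1)) -> exists DB, C11 kap (K' * kap) q.2 DB.
    move=> /in_vsteps[j ->]; have [DB DBC] := K'P (p k.+1) (ubar (p k) (p k.+1)) (vbar (p k) (p k.+1)) j (p0 k).
    exists DB; apply: C11_le DBC; first exact: ksize_le_kk.
    rewrite ler_wpM2l// /kap /kk.
    have := kbar_ge0 h_lip (p k) (p k.+1); have : 0 <= B * (p k.+1 - p k).
      by rewrite mulr_ge0 ?subr_ge0.
    by lra.
  have [D2 D2C] := C11_shears kap0 (mulr_ge0 K'0 kap0) vC C'.
  exists D2; apply: C11_le D2C; rewrite size_vsteps.
    rewrite /Lk (sgS kn) -/kap.
    rewrite (_ : expR (6 * (kap + sg k.+1)) = expR (6 * sg k.+1) * expR (6 * kap)); last first.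
      by rewrite -expRD; congr expR; ring.
    rewrite mulrA; apply: ler_wpM2l; first exact: Lk0.
    exact: exp_pow.
  have e6 : 1 <= expR (6 * kap) by rewrite expge1 ?mulr_ge0.
  rewrite /Hk (sgS kn) -/kap (_ : expR (12 * (kap + sg k.+1)) = expR (12 * sg k.+1) * expR (12 * kap)); last first.
    by rewrite -expRD; congr expR; ring.
  rewrite [leRHS]mulrA; apply: ler_pM.
  - by rewrite addr_ge0 ?Hk0// !mulr_ge0 ?expR_ge0.
  - by rewrite exprn_ge0// addr_ge0.
  - rewrite /Hk /Lk (_ : expR (6 * (kap + sg k.+1)) = expR (6 * sg k.+1) * expR (6 * kap)); last first.
      by rewrite -expRD; congr expR; ring.
    set E := expR (6 * sg k.+1); set G := expR (12 * sg k.+1); set s := sg k.+1.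
    set F1 := expR (6 * kap) in e6 *.
    have E0 : 0 <= E by exact: expR_ge0.
    have G1 : 1 <= G by rewrite expge1// mulr_ge0// sg0.
    have s0 : 0 <= s by rewrite sg0.
    have LK : 0 <= 6 * L * K' by rewrite !mulr_ge0.
    have a1 : 6 * L * K' * s * E <= 6 * L * K' * s * E * F1.
      exact: (ler_peMr (mulr_ge0 (mulr_ge0 LK s0) E0) e6).
    have a2 : 6 * (L * E * (K' * kap)) <= 6 * L * K' * kap * E * F1.
      rewrite (_ : 6 * (L * E * (K' * kap)) = 6 * L * K' * kap * E); last by ring.
      exact: (ler_peMr (mulr_ge0 (mulr_ge0 LK kap0) E0) e6).
    have a3 : 6 * L * K' * kap * E * F1 <= 6 * L * K' * kap * E * F1 * G.
      apply: (ler_peMr _ G1); apply: mulr_ge0 (expR_ge0 _).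
      exact: mulr_ge0 (mulr_ge0 LK kap0) E0.
    rewrite (_ : (H + 6 * L * K' * (kap + s) * (E * F1)) * G =
      (H + 6 * L * K' * s * E * F1) * G + 6 * L * K' * kap * E * F1 * G); last by ring.
    apply: lerD; last exact: le_trans a2 a3.
    by apply: (ler_wpM2r (le_trans ler01 G1)); rewrite lerD2l; exact: a1.
  - exact: (exp_pow 12 kap0).
have sk1 : (k.+1 <= n)%N by [].
have V := @vstep_vanish (rk k.+1) (p k) (p k.+1) (chi \o flow p k.+1 m) r' (p0 k) pk kap1.
move=> z zr; apply: V; apply: le_lt_trans zr; rewrite -/kap.
rewrite /rk (sgS kn) -/kap.
rewrite (_ : expR (63 * (kap + sg k.+1)) = expR (63 * sg k.+1) * expR (63 * kap)); last first.
  by rewrite -expRD; congr expR; ring.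
have := exp_pow 1 (mulr_ge0 (ler0n _ 63) kap0); rewrite expr1 mul1r => e63.
have a4 : 0 <= (1 + rho) * expR (63 * sg k.+1) by rewrite mulr_ge0 ?expR_ge0// addr_ge0.
have := ler_wpM2l a4 e63; rewrite [X in _ <= X - 1]mulrA; set q := (1 + rho) * _.
have qE (q' x : R) : q' - 1 + 63 * (x * (1 + (q' - 1))) = q' * (1 + 63 * x) - 1 by ring.
by move=> a5; rewrite qE lerD2r.
Qed.

(** Each step costs at most kap Z, one factor of the quadratic term being absorbed by w, and the
    sizes kap add up to [sg]. *)
Lemma flow_error m k : (k + m = n)%N ->
  `|pairing f vt chi (p n) - pairing f vt (chi \o flow p k m) (p k)| <= sg k * Z.
Proof.
have Q0 : 0 <= Q.
  apply: mulr_ge0 => //; apply: addr_ge0; apply: mulr_ge0; rewrite ?Lk0//.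
  - by rewrite mulr_ge0// Hk0.
  - by rewrite mulr_ge0// mulr_ge0 ?rk0// addr_ge0.
  - by rewrite addr_ge0// mulr_ge0// ?(ltW d0)// mulr_ge0 ?rk0// addr_ge0.
have X0 : 0 <= X.
  apply: addr_ge0; first exact: mulr_ge0 (Hk0 (leq0n n)) (sqr_ge0 _).
  apply: mulr_ge0 (Lk0 0) _; apply: mulr_ge0 (ler0n _ 729) _.
  by rewrite addr_ge0// mulr_ge0// addr_ge0// rk0.
have Z0 : 0 <= Z.
  apply: addr_ge0; apply: mulr_ge0 => //; try exact: cb_ge0.
  - by rewrite addr_ge0// mulr_ge0// ?addr_ge0// mulr_ge0 ?rk0// addr_ge0.
  - apply: mulr_ge0 (cb_ge0 _); apply: addr_ge0; first by rewrite !mulr_ge0.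
    by rewrite mulr_ge0// addr_ge0// !mulr_ge0// ltW.
  - by rewrite !mulr_ge0.
elim: m k => [|m IH] k.
  by rewrite addn0 => ->; rewrite subrr normr0 mulr_ge0// sg0.
move=> kmn; have kn : (k < n)%N by rewrite -kmn -addSnnS leq_addr.
have k1n : (k.+1 + m = n)%N by rewrite addSnnS.
have IHk := IH k.+1 k1n.
have [[D' C'] r'] := flow_C11 k1n.
have [mL mH mr] := mono kn.
have {}C' := C11_le mL mH C'.
have {}r' : vanish_off (rk 0) (chi \o flow p k.+1 m).
  by move=> z zr; apply: r'; exact: le_lt_trans zr.
have pk := p_le (leqnSn k).
have kap1 : kk (p k) (p k.+1) <= 1 by apply: le_trans (kw kn) w1.
have := step_error (rk0 (leq0n n)) C' r' (p0 k) pk (fN kn) (fun r => fw kn) (fun r => vw kn) kap1.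
set kap := kk (p k) (p k.+1) in kap1 *.
have kap0 : 0 <= kap by exact: kk_ge0.
move=> E1; rewrite (sgS kn) -/kap mulrDl [leRHS]addrC.
set P1 := pairing f vt (chi \o flow p k.+1 m) (p k.+1) in IHk E1.
rewrite -(subrKA P1); apply: le_trans (ler_normD _ _) _; apply: lerD => //.
apply: le_trans E1 _; rewrite /Z [leRHS]mulrDr; apply: lerD.
  by rewrite le_eqVlt; apply/orP; left; apply/eqP; rewrite -/Q; ring.
rewrite -/X; set c := cb _; have c0 : 0 <= c by exact: cb_ge0.
have -> : N * (kap ^+ 2 * X) * c = N * X * c * kap * kap by ring.
have -> : kap * (N * (w * X) * c) = N * X * c * kap * w by ring.
by apply: ler_wpM2l (kw kn); rewrite !mulr_ge0.
Qed.

End telescoping.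
End fixed_scale.

Definition part (t : R) (n i : nat) : R := t / n.+1%:R * i%:R.

Lemma part_le t n i j : 0 <= t -> (i <= j)%N -> part t n i <= part t n j.
Proof. by move=> t0 ij; rewrite /part ler_wpM2l ?divr_ge0// ler_nat. Qed.

Lemma part0 t n : part t n 0 = 0. Proof. by rewrite /part mulr0. Qed.

Lemma partn t n : part t n n.+1 = t. Proof. by rewrite /part divfK// pnatr_eq0. Qed.

Lemma partS t n i : part t n i.+1 - part t n i = t / n.+1%:R.
Proof. by rewrite /part -mulrBr -[i.+1]addn1 natrD addrC addKr mulr1. Qed.

Lemma kk_small (t w : R) : 0 <= t -> 0 < w -> exists2 e, 0 < e &
  forall s r, 0 <= s -> s <= r -> r <= t -> r - s <= e -> kk s r <= w.
Proof.
move=> t0 w0; have [_ i] := kkE (lexx 0) t0.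
have b0 r : 0 <= tind 0 t r * (B + 6 * K r).
  by rewrite mulr_ge0 ?tind_ge0// addr_ge0// mulr_ge0.
have [e e0 eP] := small_intervals i b0 w0; exists e => // s r s0 sr rt re.
apply: le_trans (eP s r sr re); rewrite (kkE s0 sr).1.
rewrite le_eqVlt; apply/orP; left; apply/eqP; apply: eq_Rintegral => q _.
rewrite !tindE; case: (boolP (s <= q < r)) => [/andP[sq qr]|_]; last by rewrite !mul0r.
by rewrite (le_trans s0 sq) (lt_le_trans qr rt) !mul1r.
Qed.

Lemma vt_unif (t w : R) : 0 < w -> exists2 e, 0 < e &
  forall r s, 0 <= r <= t -> 0 <= s <= t -> `|s - r| < e -> `|vt s - vt r| < w.
Proof.
move=> w0; apply: (@heine _ (fun r s => `|vt r - vt s|)) => //.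
  by move=> r s q; rewrite (distrC (vt s)); exact: ler_distD.
move=> r e r0 e0; have cvt : {for r, continuous vt}.
  apply: differentiable_continuous; apply/derivable1_diffP; exact: vt_derivable.
have /cvgrPdist_lt /(_ _ e0) /nbhs_ballP[h2 /= h20 h2P] := cvt.
by exists h2 => // s _ sr; rewrite distrC; apply: h2P; rewrite /ball /= distrC.
Qed.

(** The order of choices matters. Z uses the Lipschitz bound Lc and not Hc, so it is independent of
    d. Once d is fixed, Hc is a constant, and the partition is refined until every term in w is
    below eta. *)
Lemma consistency (L H rho t : R) (chi : V R -> R) (D : V R -> V R -> R) :
  0 <= t -> 0 <= rho -> C11 L H chi D -> vanish_off rho chi ->
  exists2 Z : R, 0 <= Z & forall d eta : R, 0 < d -> 0 < eta -> exists n0, forall n, (n0 <= n)%N ->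
    `|pairing f vt chi t -
      \int[leb6 R]_z (g z * chi (flow d (part t n) 0 n.+1 (frame (vt 0) z)))| <= Z * d + eta.
Proof.
move=> t0 rho0 cC cr.
have [N' fN'] := C_L2_bounded fC t; pose N := `|N'|.
have N0 : 0 <= N by exact: normr_ge0.
have fN r : 0 <= r <= t -> nrm (leb6 R) (f r) <= N.
  by move=> /fN' /le_trans; apply; exact: ler_norm.
have sg0 : 0 <= kk 0 t by exact: kk_ge0.
pose sg := kk 0 t; pose Lc := L * expR (6 * sg); pose rc := (1 + rho) * expR (63 * sg) - 1.
have rc0 : 0 <= rc.
  rewrite subr_ge0; apply: (@le_trans _ _ (1 + rho)); first by rewrite lerDl.
  by apply: ler_peMr; rewrite ?addr_ge0// -expR0 ler_expR mulr_ge0.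
have L0 := C11_L_ge0 cC; have H0 := C11_H_ge0 cC.
have Lc0 : 0 <= Lc by rewrite mulr_ge0 ?expR_ge0.
pose r1 := (1 + C) * rc; pose r2 := (1 + C) * r1.
have r10 : 0 <= r1 by rewrite mulr_ge0// addr_ge0.
have r20 : 0 <= r2 by apply: mulr_ge0 => //; exact: addr_ge0.
(* 18 = 6 . 2 + 6: over six coordinates, freezing the frame costs 2 d and mollifying the averaged
   force costs d. *)
pose Z := sg * ((1 + r2) * (18 * N * Lc * cb r1)).
exists Z.
  apply: mulr_ge0 => //; apply: mulr_ge0; first exact: addr_ge0.
  by rewrite !mulr_ge0// cb_ge0.
move=> d eta d0 eta0.
have [K' K'0 K'P] := velo_C11 al be ga h_meas h_lip K_itg d0.
pose Hc := (H + 6 * L * K' * sg * expR (6 * sg)) * expR (12 * sg).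
have Hc0 : 0 <= Hc by rewrite mulr_ge0 ?expR_ge0// addr_ge0// !mulr_ge0 ?expR_ge0.
pose X := Hc * (63 * (1 + 64 * (1 + rc))) ^+ 2 + Lc * (729 * (1 + 64 * (1 + rc))).
have X0 : 0 <= X.
  apply: addr_ge0; first exact: mulr_ge0 Hc0 (sqr_ge0 _).
  apply: mulr_ge0 Lc0 _; apply: mulr_ge0 (ler0n _ 729) _.
  by rewrite addr_ge0// mulr_ge0// addr_ge0.
pose c3 := cb ((1 + C) * (64 * (1 + rc))); pose c1 := cb r1.
have c10 : 0 <= c1 := cb_ge0 _; have c30 : 0 <= c3 := cb_ge0 _.
pose W := sg * ((1 + r2) * ((6 * Lc + N * (6 * (6 * Hc * r1 + Lc * r1))) * c1) + N * X * c3).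
have W0 : 0 <= W.
  apply: mulr_ge0 => //; apply: addr_ge0; last by rewrite !mulr_ge0.
  apply: mulr_ge0; first exact: addr_ge0.
  apply: mulr_ge0 => //; apply: addr_ge0; first exact: mulr_ge0.
  apply: mulr_ge0 N0 _; apply: mulr_ge0 => //; apply: addr_ge0; last exact: mulr_ge0.
  by apply: mulr_ge0 r10; exact: mulr_ge0.
pose w := Num.min 1 (eta / (W + 1)).
have W1 : 0 < W + 1 by apply: ltr_wpDl.
have w0 : 0 < w by rewrite lt_min ltr01 divr_gt0.
have ww : W * w <= eta.
  apply: (@le_trans _ _ (W * (eta / (W + 1)))).
    by rewrite ler_wpM2l// ge_min lexx orbT.
  by rewrite mulrCA ler_piMr ?(ltW eta0)// ler_pdivrMr// mul1r lerDl.
have [e1 e10 e1P] := C_L2_unif fC t w0.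
have [e2 e20 e2P] := vt_unif t w0.
have [e3 e30 e3P] := kk_small t0 w0.
pose e := Num.min e1 (Num.min e2 e3).
have e0 : 0 < e by rewrite !lt_min e10 e20.
exists (Num.truncn (t / e)).+1 => n nn.
have tn : t / n.+1%:R < e.
  rewrite ltr_pdivrMr// mulrC -ltr_pdivrMr//; apply: lt_le_trans (truncnS_gt _) _.
  by rewrite ler_nat; apply: leq_trans nn _.
pose p := part t n.
have pr k : (k < n.+1)%N -> forall r, p k <= r <= p k.+1 ->
    [/\ 0 <= p k <= t, 0 <= r <= t & `|r - p k| < e].
  move=> kn r /andP[pkr rpk].
  have pk0 : 0 <= p k by rewrite -(part0 t n); exact: part_le.
  have pkt : p k.+1 <= t by rewrite -[leRHS](partn t n); exact: part_le.
  have pS : p k.+1 - p k = t / n.+1%:R by exact: partS.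
  split; first by rewrite pk0 (le_trans pkr (le_trans rpk pkt)).
    by rewrite (le_trans pk0 pkr) (le_trans rpk pkt).
  by rewrite ger0_norm ?subr_ge0//; apply: le_lt_trans tn; rewrite -pS lerD2r.
have pn0 k : 0 <= p k by rewrite -(part0 t n); exact: part_le.
have ple i j : (i <= j)%N -> p i <= p j by move=> ij; exact: part_le.
have hN k : (k < n.+1)%N -> nrm (leb6 R) (f (p k)) <= N.
  by move=> kn; apply: fN; have [|] := pr k kn (p k); rewrite ?lexx ?ple.
have hf k r : (k < n.+1)%N -> p k <= r <= p k.+1 -> nrm (leb6 R) (f r \- f (p k)) <= w.
  move=> kn kr; have [a1 a2 a3] := pr k kn r kr; apply: ltW; apply: e1P => //.
  by apply: lt_le_trans a3 _; rewrite !ge_min lexx.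
have hv k r : (k < n.+1)%N -> p k <= r <= p k.+1 -> `|vt r - vt (p k)| <= w.
  move=> kn kr; have [a1 a2 a3] := pr k kn r kr; apply: ltW; apply: e2P => //.
  by apply: lt_le_trans a3 _; rewrite !ge_min lexx orbT.
have hk k : (k < n.+1)%N -> kk (p k) (p k.+1) <= w.
  move=> kn; have [|a1 /andP[_ a2] a3] := pr k kn (p k.+1); first by rewrite ple ?lexx.
  apply: e3P => //; first exact: ple.
  apply: ltW; apply: le_lt_trans (ler_norm _) _; apply: lt_le_trans a3 _.
  by rewrite !ge_min lexx !orbT.
have w1 : w <= 1 by rewrite ge_min lexx.
have [[D' C'] r'] := flow_C11 d0 rho0 cC cr pn0 ple hk w1 K'0 K'P (add0n n.+1).
have E := flow_error d0 rho0 cC cr pn0 ple hN hf hv hk (ltW w0) w1 N0 K'0 K'P (add0n n.+1).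
rewrite /p !part0 !partn -/sg -/Lc -/rc in r' C' E.
(* At time 0 the integral term is empty, which identifies the pairing with the integral of the
   datum. *)
have WE := weak_evolution fS vt_derivable dvt_cts vt_bound measurable_field
  field_bound B0 K0 K_itg bE rc0 C' r' (lexx 0).
have z0 : \int[leb R]_r (tind 0 0 r * rate f vt field D' r) = 0.
  rewrite -[RHS](@Rint0 _ _ _ (leb R)); apply: eq_Rintegral => r _.
  by rewrite tindE; case: ltP => //= r0; rewrite ?andbF ?mul0r// leNgt r0 mul0r.
rewrite z0 addr0 in WE; rewrite -[X in _ - X]WE.
apply: le_trans E _.
have -> : Z * d + eta = Z * d + W * w + (eta - W * w) by ring.
apply: (@le_trans _ _ (Z * d + W * w)); last by rewrite lerDl subr_ge0.
rewrite le_eqVlt; apply/orP; left; apply/eqP.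
rewrite -/Hc -/r1 -/r2 -/X -/c1 -/c3 /Z /W -/c1; ring.
Qed.

End scheme.

(** * Backward discrete trajectories and their comparison *)

Section trajectories.
Variables (R : realType) (al be ga U : R) (h : J -> R -> V R -> R) (K : R -> R) (d : R).
Hypothesis h_meas : forall j, measurable_fun [set: measurableTypeR R * mV R]
  (fun q : R * V R => h j q.1 q.2).
Hypothesis h_lip : forall j t, weak_lip (K t) (h j t).
Hypothesis h_free : forall j t z a, h j t (z + a *: basis6 R j) = h j t z.
Hypothesis K_itg : forall T, itg (leb R) (fun t => tind 0 T t * K t).
Hypothesis d0 : 0 < d.
Variables (p : nat -> R) (n : nat) (w : R).
Hypothesis p0 : forall k, 0 <= p k.
Hypothesis p_le : forall i j, (i <= j)%N -> p i <= p j.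

Local Notation kap k := (kk U al be ga K (p k) (p k.+1)).
Local Notation sg k := (kk U al be ga K (p k) (p n)).

Hypothesis kw : forall k, (k < n)%N -> kap k <= w.
Hypothesis w0 : 0 <= w.
Hypothesis w1 : w <= 1.

Let kap0 k : 0 <= kap k. Proof. by apply: (kk_ge0 _ _ _ _ h_lip); exact: p_le. Qed.
Let sg0 k : (k <= n)%N -> 0 <= sg k.
Proof. by move=> kn; apply: (kk_ge0 _ _ _ _ h_lip); exact: p_le. Qed.
Let sgS k : (k < n)%N -> sg k = kap k + sg k.+1.
Proof. by move=> kn; apply: (kk_split _ _ _ _ K_itg); [exact: p0|exact: p_le|exact: p_le]. Qed.

Section one_flow.
Variables u v : R -> R.
Hypothesis u_cts : continuous u.
Hypothesis v_cts : continuous v.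
Hypothesis u_bound : forall t, `|u t| <= U.
Hypothesis v_bound : forall t, `|v t| <= U.

Local Notation st k := (vstep al be ga u v h d (p k) (p k.+1)).

(** The inverse discrete flow: starting from the final point [y], the steps are undone from the last
    one back to step k. *)
Fixpoint iflow (k m : nat) (y : V R) : V R :=
  if m is m'.+1 then shears (inv_shears (st k)) (iflow k.+1 m' y) else y.

Let st_free k : free_shears (st k).
Proof. exact: free_vstep. Qed.

Lemma iflowK k m : cancel (iflow k m) (flow al be ga u v h d p k m).
Proof.
by elim: m k => [//|m IH] k z /=; rewrite shearsKV// IH.
Qed.

Lemma flow_mpres k m : mpres (leb6 R) (flow al be ga u v h d p k m).
Proof.
elim: m k => [|m IH] k /=; first exact: mpres_id.
apply: (mpres_comp (IH k.+1)).
exact: vstep_mpres.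
Qed.

Lemma measurable_inv_step k q : List.In q (inv_shears (st k)) ->
  measurable_fun [set: mV R] q.2.
Proof.
move=> /in_inv_shears[r /in_vsteps[j ->] ->] /=; apply: measurableT_comp => //.
have [K' _ KP] := velo_C11 al be ga h_meas h_lip K_itg d0.
by have [DV []] := KP (p k) (p k.+1) (ubar u (p k) (p k.+1)) (vbar v (p k) (p k.+1)) j (p0 k).
Qed.

Lemma iflow_mpres k m : mpres (leb6 R) (iflow k m).
Proof.
elim: m k => [|m IH] k /=; first exact: mpres_id.
apply: mpres_comp (IH k.+1); apply: shears_mpres => [|q]; last exact: measurable_inv_step.
exact: free_inv_shears.
Qed.

Lemma inv_step_small k : small_shears (kap k) (inv_shears (st k)).
Proof.
apply: small_inv_shears.
by apply: (small_vstep (U := U)) => //; exact: p_le.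
Qed.

Lemma size_inv_step k : size (inv_shears (st k)) = 6%N.
Proof. by rewrite /inv_shears size_rev size_map size_vsteps. Qed.

Lemma inv_step_displacement k y : (k < n)%N ->
  `|shears (inv_shears (st k)) y - y| <= 63 * (kap k * (1 + `|y|)).
Proof.
move=> kn; have k01 : 0 <= kap k <= 1 by rewrite kap0 (le_trans (kw kn)).
have := shears_displacement y k01 (@inv_step_small k).
by rewrite size_inv_step (_ : 2 ^+ 6 - 1 = 63 :> R) //; ring.
Qed.

(** Discrete Gronwall: one inverse step multiplies 1 + |y| by at most 1 + 63 kap <= exp(63 kap). *)
Lemma iflow_growth k m y : (k + m = n)%N -> 1 + `|iflow k m y| <= (1 + `|y|) * expR (63 * sg k).
Proof.
elim: m k => [|m IH] k.
  rewrite addn0 => -> /=; rewrite ler_peMr ?addr_ge0//.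
  by rewrite -expR0 ler_expR mulr_ge0// sg0.
move=> kmn; have kn : (k < n)%N by rewrite -kmn -addSnnS leq_addr.
have [|/= IHk] := (IH k.+1 _, tt); first by rewrite addSnnS.
move=> _; have D := inv_step_displacement (iflow k.+1 m y) kn.
set x := iflow k.+1 m y in IHk D *.
have := ler_normD (shears (inv_shears (st k)) x - x) x; rewrite subrK => E.
have e63 : 1 + 63 * kap k <= expR (63 * kap k) by exact: expR_ge1Dx.
rewrite (sgS kn) (_ : expR (63 * (kap k + sg k.+1)) = expR (63 * sg k.+1) * expR (63 * kap k)); last first.
  by rewrite -expRD; congr expR; ring.
rewrite mulrA; apply: (@le_trans _ _ ((1 + `|x|) * (1 + 63 * kap k))).
  by move: E D; set a := `|_|; set b := `|_|; set c := `|x|; set e := kap k; lra.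
exact: (ler_pM (addr_ge0 ler01 (normr_ge0 _)) (addr_ge0 ler01 (mulr_ge0 (ler0n _ 63) (kap0 k))) IHk e63).
Qed.

Lemma flow_growth k m z : (k + m = n)%N ->
  1 + `|flow al be ga u v h d p k m z| <= (1 + `|z|) * expR (63 * sg k).
Proof.
elim: m k z => [|m IH] k z.
  rewrite addn0 => -> /=; rewrite ler_peMr ?addr_ge0//.
  by rewrite -expR0 ler_expR mulr_ge0// sg0.
move=> kmn; have kn : (k < n)%N by rewrite -kmn -addSnnS leq_addr.
have k1n : (k.+1 + m = n)%N by rewrite addSnnS.
rewrite /=; set x := shears (st k) z.
have k01 : 0 <= kap k <= 1 by rewrite kap0 (le_trans (kw kn)).
have sm : small_shears (kap k) (st k) by apply: (small_vstep (U := U)) => //; exact: p_le.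
have D := shears_displacement z k01 sm.
rewrite size_vsteps (_ : 2 ^+ 6 - 1 = 63 :> R) // -/x in D; last by ring.
have := ler_normD (x - z) z; rewrite subrK => E.
have e63 : 1 + 63 * kap k <= expR (63 * kap k) by exact: expR_ge1Dx.
apply: le_trans (IH _ x k1n) _.
rewrite (sgS kn) (_ : expR (63 * (kap k + sg k.+1)) = expR (63 * kap k) * expR (63 * sg k.+1)); last first.
  by rewrite -expRD; congr expR; ring.
rewrite mulrA; apply: ler_wpM2r; first exact: expR_ge0.
apply: (@le_trans _ _ ((1 + `|z|) * (1 + 63 * kap k))).
  by move: E D; set a := `|_|; set b := `|_|; set c := `|z|; set e := kap k; lra.
exact: ler_wpM2l (addr_ge0 ler01 (normr_ge0 _)) _ _ e63.
Qed.

End one_flow.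

Variables u1 v1 u2 v2 : R -> R.
Hypothesis u1_cts : continuous u1.
Hypothesis v1_cts : continuous v1.
Hypothesis u2_cts : continuous u2.
Hypothesis v2_cts : continuous v2.
Hypothesis u1_bound : forall t, `|u1 t| <= U.
Hypothesis v1_bound : forall t, `|v1 t| <= U.
Hypothesis u2_bound : forall t, `|u2 t| <= U.
Hypothesis v2_bound : forall t, `|v2 t| <= U.
Variable gam : R.
Hypothesis u_close : forall s t, 0 <= s -> s <= t -> `|ubar u1 s t - ubar u2 s t| <= gam.
Hypothesis v_close : forall s t, 0 <= s -> s <= t -> `|vbar v1 s t - vbar v2 s t| <= gam.

Local Notation st1 k := (vstep al be ga u1 v1 h d (p k) (p k.+1)).
Local Notation st2 k := (vstep al be ga u2 v2 h d (p k) (p k.+1)).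

(** The integral over [s, t] of the difference of the two fields, in which the force cancels. It is
    small whatever the length of the interval, whereas the fields themselves are not close at a
    given time. *)
Definition gap s t : V R -> V R :=
  lfield al be ga 0 (ubar u1 s t - ubar u2 s t) (vbar v1 s t - vbar v2 s t).

Let gam' := (`|be| + `|ga|) * gam.

Lemma gap_bound (s t : R) z : 0 <= s -> s <= t -> `|gap s t z| <= gam' * `|z|.
Proof.
move=> s0 st; apply: le_trans (lfield_bound _ _ _ _ _ _ _) _.
rewrite ler_wpM2r// /lsize normr0 mulr0 add0r /gam' mulrDl.
by apply: lerD; rewrite ler_wpM2l// ?u_close// v_close.
Qed.

Lemma gap_split (s q t : R) z : 0 <= s -> s <= q -> q <= t ->
  gap s t z = gap s q z + gap q t z.
Proof.
move=> s0 sq qt.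
have bar (x : R -> R) : continuous x -> \int[leb R]_r (tind s t r * x r) =
    \int[leb R]_r (tind s q r * x r) + \int[leb R]_r (tind q t r * x r).
  move=> cx; rewrite -RintD; [|exact: continuous_itg_tind|exact: continuous_itg_tind].
  by apply: eq_Rintegral => r _; rewrite (tind_split r sq qt) mulrDl.
have lA a1 b1 c1 a2 b2 c2 : lfield al be ga a1 b1 c1 z + lfield al be ga a2 b2 c2 z =
    lfield al be ga (a1 + a2) (b1 + b2) (c1 + c2) z by rewrite /lfield; vcoord.
rewrite /gap lA addr0 /ubar /vbar (bar _ u1_cts) (bar _ u2_cts) (bar _ v1_cts) (bar _ v2_cts).
by congr (lfield _ _ _ _ _ _ _); ring.
Qed.

Lemma drift_vsteps (u v : R -> R) s t z j : coord6 j (drift (vstep al be ga u v h d s t) z) =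
  velo al be ga h d s t (ubar u s t) (vbar v s t) j z.
Proof.
rewrite /drift /vstep /vsteps big_map big_enum coord6_sum (bigD1 j)//= big1 => [|i ij].
  by rewrite coord6Z coord6_basis eqxx mulr1 addr0.
by rewrite coord6Z coord6_basis eq_sym (negbTE ij) mulr0.
Qed.

Lemma drift_gap k z : drift (st1 k) z - drift (st2 k) z = gap (p k) (p k.+1) z.
Proof.
apply: coord6_inj => j; rewrite coord6B !drift_vsteps /velo /gap.
rewrite -{1}(subrr (p k.+1 - p k)) -lfieldB coord6B.
by move: (mollify _ _ _) => x; ring.
Qed.

Let gam'0 : 0 <= gam'.
Proof.
apply: mulr_ge0; first exact: addr_ge0.
exact: le_trans (normr_ge0 _) (u_close (lexx 0) (lexx 0)).
Qed.

Local Notation Y1 k m y := (iflow u1 v1 k m y).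
Local Notation Y2 k m y := (iflow u2 v2 k m y).

(** The corrector [gap], accumulated from p k to p n, absorbs exactly the first-order difference of
    the two steps ([drift_gap], [gap_split]). Per step there remain kap times the previous error,
    kap gam' from moving the argument of the corrector and from the Lipschitz bound on the drift,
    and kap w from second-order terms; Gronwall sums them. *)
Lemma iflow_close k m y r : (k + m = n)%N ->
  (forall i q, (i + q = n)%N -> 1 + `|Y1 i q y| <= r /\ 1 + `|Y2 i q y| <= r) ->
  `|Y1 k m y - Y2 k m y + gap (p k) (p n) (Y2 k m y)| <=
    sg k * expR (6 * sg k) * ((69 * gam' + 1458 * w) * r).
Proof.
move=> + rb; have r0 : 0 <= r.
  have [b _] := rb n 0%N (addn0 n); by apply: le_trans b; rewrite addr_ge0.
(* 69 = 6 + 63: the Lipschitz bound of the drift and the displacement of the argument of [gap]. 1458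
   = 2 . 729: the consistency errors of the two flows. *)
set F := (69 * gam' + 1458 * w) * r.
have F0 : 0 <= F.
  apply: mulr_ge0 r0; apply: addr_ge0; [exact: mulr_ge0 (ler0n _ 69) gam'0|exact: mulr_ge0 (ler0n _ 1458) w0].
elim: m k => [|m IH] k.
  rewrite addn0 => -> /=; rewrite subrr add0r /gap.
  have z x : ubar x (p n) (p n) = 0.
    rewrite /ubar -[RHS](@Rint0 _ _ _ (leb R)); apply: eq_Rintegral => q _.
    by rewrite tindE; case: ltP => //= q0; rewrite ?andbF ?mul0r// leNgt q0 mul0r.
  have z' x : vbar x (p n) (p n) = 0 by exact: z.
  rewrite !z !z' subrr /lfield !mulr0 !scale0r addr0 normr0.
  by rewrite mulr_ge0// mulr_ge0 ?expR_ge0 ?sg0.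
move=> kmn; have kn : (k < n)%N by rewrite -kmn -addSnnS leq_addr.
have k1n : (k.+1 + m = n)%N by rewrite addSnnS.
have IHk := IH k.+1 k1n.
have [b1 b2] := rb _ _ k1n; have [b1' b2'] := rb _ _ kmn.
have k01 : 0 <= kap k <= 1 by rewrite kap0 (le_trans (kw kn)).
rewrite /= in b1' b2' *.
set x1 := Y1 k.+1 m y in b1 b1' IHk *; set x2 := Y2 k.+1 m y in b2 b2' IHk *.
set z1 := shears _ x1 in b1' *; set z2 := shears _ x2 in b2' *.
have c1 := shears_consistent x1 k01 (inv_step_small u1_cts v1_cts u1_bound v1_bound (k := k)).
have c2 := shears_consistent x2 k01 (inv_step_small u2_cts v2_cts u2_bound v2_bound (k := k)).
rewrite size_inv_step drift_inv opprK (_ : 3 ^+ 6 = 729 :> R) in c1; last by ring.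
rewrite size_inv_step drift_inv opprK (_ : 3 ^+ 6 = 729 :> R) in c2; last by ring.
rewrite -/z1 in c1; rewrite -/z2 in c2.
have sm : small_shears (kap k) (st1 k) by apply: (small_vstep (U := U)) => //; exact: p_le.
have dl := drift_lip x2 (x1 - x2) sm.
rewrite (addrC x2) subrK size_vsteps in dl.
have dd := inv_step_displacement u2_cts v2_cts u2_bound v2_bound x2 kn; rewrite -/z2 in dd.
have gk := drift_gap k x2.
have gs := gap_split x2 (p0 k) (p_le (leqnSn k)) (p_le kn).
have gL : gap (p k) (p n) z2 = gap (p k) (p n) x2 + gap (p k) (p n) (z2 - x2).
  by rewrite /gap -lfieldD (addrC x2) subrK.
have gb1 := gap_bound (z2 - x2) (p0 k) (p_le (ltnW kn)).
have gb2 := gap_bound x2 (p0 k.+1) (p_le kn).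
set e' := x1 - x2 + gap (p k.+1) (p n) x2 in IHk.
(* Previous error, variation of the first drift between the two points, the two consistency errors,
   and the corrector applied to the displacement of x2. *)
have -> : z1 - z2 + gap (p k) (p n) z2 =
   e' - (drift (st1 k) x1 - drift (st1 k) x2) +
   ((z1 - x1 + drift (st1 k) x1) - (z2 - x2 + drift (st2 k) x2)) + gap (p k) (p n) (z2 - x2).
  have alg (y1 y2 y3 y4 y5 y6 y7 y8 y9 : V R) : y1 - y2 + ((y6 - y7 + y8) + y9) =
      (y3 - y4 + y8) - (y5 - y6) + ((y1 - y3 + y5) - (y2 - y4 + y7)) + y9 by vring.
  rewrite gL gs -gk; exact: alg.
have ne : `|x1 - x2| <= `|e'| + gam' * r.
  have -> : x1 - x2 = e' - gap (p k.+1) (p n) x2 by rewrite /e'; vring.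
  apply: le_trans (ler_normB _ _) _; rewrite lerD2l; apply: le_trans gb2 _.
  by apply: ler_wpM2l => //; apply: le_trans b2; rewrite lerDr.
set k1 := kap k in k01 c1 c2 dl dd *.
have /andP[k10 k1w] : 0 <= k1 <= w by rewrite kap0 kw.
set A := drift (st1 k) x1 - _; set B1 := z1 - x1 + _; set B2 := z2 - x2 + _; set G := gap _ _ (z2 - x2).
have hA : `|A| <= 6 * (k1 * (`|e'| + gam' * r)).
  by apply: le_trans dl _; apply: ler_wpM2l => //; apply: ler_wpM2l.
have kk2 b : 1 + b <= r -> 729 * (k1 ^+ 2 * (1 + b)) <= 729 * (k1 * (w * r)).
  move=> br; apply: ler_wpM2l; first exact: (ler0n _ 729).
  rewrite expr2 -mulrA; apply: ler_wpM2l => //.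
  apply: (@le_trans _ _ (k1 * r)); first exact: ler_wpM2l.
  exact: ler_wpM2r.
have hB1 : `|B1| <= 729 * (k1 * (w * r)) := le_trans c1 (kk2 _ b1).
have hB2 : `|B2| <= 729 * (k1 * (w * r)) := le_trans c2 (kk2 _ b2).
have hG : `|G| <= gam' * (63 * (k1 * r)).
  apply: le_trans gb1 _; apply: ler_wpM2l => //; apply: le_trans dd _.
  by apply: ler_wpM2l => //; apply: ler_wpM2l.
apply: (@le_trans _ _ (`|e'| + `|A| + (`|B1| + `|B2|) + `|G|)).
  apply: le_trans (ler_normD _ _) _; rewrite lerD2r.
  apply: le_trans (ler_normD _ _) _; apply: lerD; first exact: ler_normB.
  exact: ler_normB.
have e6 : 1 + 6 * k1 <= expR (6 * k1) by exact: expR_ge1Dx.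
have kn1 := sg0 kn.
rewrite (sgS kn) -/k1 (_ : expR (6 * (k1 + sg k.+1)) = expR (6 * sg k.+1) * expR (6 * k1)); last first.
  by rewrite -expRD; congr expR; ring.
set s' := sg k.+1 in IHk kn1 *; set E := expR (6 * s') in IHk *; set X := expR (6 * k1) in e6 *.
have E1 : 1 <= E by rewrite -expR0 ler_expR mulr_ge0.
have X1 : 1 <= X by rewrite -expR0 ler_expR mulr_ge0.
apply: (@le_trans _ _ (`|e'| * (1 + 6 * k1) + k1 * F)).
  apply: le_trans (lerD (lerD (lerD (lexx _) hA) (lerD hB1 hB2)) hG) _.
  by rewrite le_eqVlt; apply/orP; left; apply/eqP; rewrite /F; ring.
have s'EF : 0 <= s' * E * F by exact: mulr_ge0 (mulr_ge0 kn1 (expR_ge0 _)) F0.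
have t1 : `|e'| * (1 + 6 * k1) <= s' * E * F * X.
  exact: (ler_pM (normr_ge0 _) (addr_ge0 ler01 (mulr_ge0 (ler0n _ 6) k10)) IHk e6).
have t2 : k1 * F <= k1 * (E * X) * F.
  by apply: ler_wpM2r => //; rewrite ler_peMr// mulr_ege1.
apply: le_trans (lerD t1 t2) _.
by rewrite le_eqVlt; apply/orP; left; apply/eqP; ring.
Qed.

End trajectories.

(** * The L^2 norm from a pointwise bound on a set of finite measure *)

Section square_norm.
Context d (T : measurableType d) (R : realType) (mu : {measure set T -> \bar R}).

Lemma Lnorm2_le (w : T -> R) (A : R) (S : set T) : 0 <= A -> measurable_fun setT w ->
  measurable S -> (mu S < +oo)%E -> {ae mu, forall x, `|w x| <= A * \1_S x} ->
  ('N[mu]_(2%:E)[EFin \o w] <= (A * Num.sqrt (fine (mu S)))%:E)%E.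
Proof.
move=> A0 mw mS Sy wA; rewrite unlock /Lnorm.
have mw2 : measurable_fun setT (fun x => `|w x| `^ 2 : R).
  by apply: (measurableT_comp (measurable_powR _)); exact: measurableT_comp.
have le1 : (\int[mu]_x (`|(EFin \o w) x| `^ 2) <= (A ^+ 2)%:E * mu S)%E.
  rewrite (_ : (A ^+ 2)%:E * mu S = \int[mu]_x ((A ^+ 2 * \1_S x)%:E))%E; last first.
    under eq_integral do rewrite EFinM.
    rewrite ge0_integralZl//; last 2 first.
    - by apply/measurable_EFinP; exact: measurable_indic.
    - by rewrite lee_fin sqr_ge0.
    by rewrite integral_indic// setIT.
  rewrite (eq_integral (fun x => (`|w x| `^ 2)%:E)); last by move=> x _.
  apply: ae_ge0_le_integral => //.
  - exact/measurable_EFinP.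
  - by move=> x _; rewrite lee_fin mulr_ge0// sqr_ge0.
  - by apply/measurable_EFinP; apply: measurable_funM => //; exact: measurable_indic.
  - apply: aeS wA => x wx _; rewrite lee_fin powR_mulrn// (_ : \1_S x = (\1_S x) ^+ 2); last first.
      by rewrite indicE; case: (_ \in _); rewrite ?expr1n ?expr0n.
    by rewrite -exprMn lerXn2r ?nnegrE// mulr_ge0.
have muE : mu S = (fine (mu S))%:E by rewrite fineK// ge0_fin_numE.
apply: (@le_trans _ _ (((A ^+ 2)%:E * mu S) `^ (2^-1))%E).
  apply: gt0_ler_poweR => //; rewrite ?in_itv/= ?leey ?andbT.
  - by apply: integral_ge0 => x _; rewrite lee_fin powR_ge0.
  - by rewrite mule_ge0// lee_fin sqr_ge0.
rewrite muE -EFinM poweR_EFin lee_fin powR12_sqrt; last by rewrite mulr_ge0 ?sqr_ge0// fine_ge0.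
by rewrite sqrtrM ?sqr_ge0// sqrtr_sqr ger0_norm.
Qed.

End square_norm.

(** * Averages of rapidly oscillating periodic functions *)

Section periodic_functions.
Variable R : realType.

Lemma periodic_reduce (T s : R) : 0 < T -> exists2 r, 0 <= r <= T &
  forall f : R -> R, periodic f T -> f s = f r.
Proof.
move=> T0; pose n := Num.truncn (`|s| / T).
have sT0 : 0 <= `|s| / T by rewrite divr_ge0// ltW.
have /andP[n1 n2] := truncn_itv sT0; rewrite -/n in n1 n2.
rewrite ler_pdivlMr// in n1; rewrite ltr_pdivrMr// in n2.
rewrite -natr1 mulrDl mul1r in n2.
have [s0|s0] := leP 0 s.
  rewrite (ger0_norm s0) in n1 n2.
  exists (s - T *+ n); first by rewrite -mulr_natl; lra.
  by move=> f fT; rewrite -(periodicn fT n (s - T *+ n)) subrK.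
rewrite (ltr0_norm s0) in n1 n2.
exists (s + T *+ n.+1); first by rewrite mulrS -mulr_natl; lra.
by move=> f fT; rewrite (periodicn fT n.+1 s).
Qed.

Lemma continuous_segment_bound (f : R -> R) (T : R) : 0 <= T ->
  (forall x, 0 <= x -> {for x, continuous f}) -> exists U, forall s, 0 <= s <= T -> `|f s| <= U.
Proof.
move=> T0 fc; have cf : {within `[0, T], continuous (fun x => `|f x|)}.
  apply: continuous_in_subspaceT => x; rewrite inE /= in_itv/= => /andP[x0 _].
  by apply: continuous_comp; [exact: fc|exact: norm_continuous].
have [c _ cP] := EVT_max T0 cf; exists `|f c| => s sT.
by apply: cP; rewrite in_itv.
Qed.

Lemma periodic_bound (f : R -> R) (T : R) : 0 < T -> periodic f T -> continuous f ->
  exists U, forall s, `|f s| <= U.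
Proof.
move=> T0 fT fc; have [U fU] := continuous_segment_bound (ltW T0) (fun x _ => fc x).
by exists U => s; have [r r0 ->//] := periodic_reduce s T0; exact: fU.
Qed.

Lemma continuous_scaled (f : R -> R) (e : R) : continuous f -> continuous (fun r : R => f (r / e)).
Proof.
move=> fc r; apply: (@continuous_comp _ _ _ (fun r : R => r / e)); last exact: fc.
exact: mulrr_continuous.
Qed.

(** The primitive F of w minus its mean is T-periodic, hence bounded, on nonnegative times, and e
    F(r / e) is a primitive of the rescaled function. The integral over any interval is therefore at
    most 2 e sup |F|. *)
Lemma periodic_average (w : R -> R) (T : R) : 0 < T -> periodic w T -> continuous w ->
  exists2 A, 0 <= A & forall e s t : R, 0 < e -> 0 <= s -> s <= t ->
    `|\int[leb R]_r (tind s t r * w (r / e)) - \int[leb R]_r (tind s t r * mean T w)| <= A * e.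
Proof.
move=> T0 wT wc; pose g r := w r - mean T w.
have gc : continuous g by move=> r; apply: cvgB; [exact: wc|exact: cvg_cst].
(* Based at -1 so that F is differentiable at 0 as well. *)
pose F x : R := \int[leb R]_(r in `[-1, x]) g r.
have FD (r : R) : -1 < r -> is_derive r 1 F (g r).
  move=> r1; have gi : (leb R).-integrable `[-1, r + 1] (EFin \o g).
    by apply: continuous_compact_integrable; [exact: segment_compact|exact: continuous_subspaceT].
  have rr : r < r + 1 by rewrite ltrDl.
  have [dF FE] := continuous_FTC1_closed rr gi r1 (@gc r).
  by apply: DeriveDef; [exact: dF|rewrite -derive1E; exact: FE].
have FI s t : 0 <= s -> s <= t -> \int[leb R]_r (tind s t r * g r) = F t - F s.
  by move=> s0 st; apply: (Rint_tind_FTC_gt _ st FD gc); lra.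
have F0T : F T = F 0.
  apply/eqP; rewrite -subr_eq0 -FI ?(ltW T0)//.
  have i1 := continuous_itg_tind 0 T wc.
  have E : (fun r => tind 0 T r * g r) = fun r => tind 0 T r * w r - mean T w * tind 0 T r.
    by apply/funext => r; rewrite /g; ring.
  rewrite E RintB//; last by apply: itgZ; exact: itg_tind.
  rewrite RintZ ?Rint_tind_cst ?(ltW T0)//; last exact: itg_tind.
  rewrite Rint_tind Rintegral_itv_bndo_bndc; last first.
    have mI : measurable (`[0, T[%classic : set (measurableTypeR R)) by exact: measurable_itv.
    have Fi : (leb R).-integrable `[0, T] (EFin \o w).
      by apply: continuous_compact_integrable; [exact: segment_compact|exact: continuous_subspaceT].
    apply: (integrableS _ _ _ Fi) => //.
    by move=> r /=; rewrite !in_itv/= => /andP[-> /ltW].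
  by rewrite /mean subr0 mulrAC mulVf ?mul1r ?subrr// gt_eqF.
have FT x : 0 <= x -> F (x + T) = F x.
  move=> x0; have FD' (r : R) : -1 < r -> is_derive r 1 (fun x => F (x + T)) (g r).
    move=> r1; have h1 : is_derive r 1 (fun x : R => x + T) (1 : R).
      by apply: is_derive_eq; rewrite addr0.
    have h2 : is_derive (r + T) 1 F (g (r + T)) by apply: FD; lra.
    have := @is_derive1_comp _ F (fun x => x + T) r _ _ h2 h1.
    by rewrite mulr1 /g wT.
  have E1 := FI 0 x (lexx 0) x0.
  have E2 : \int[leb R]_r (tind 0 x r * g r) = F (x + T) - F (0 + T).
    by apply: (Rint_tind_FTC_gt _ x0 FD' gc); lra.
  by rewrite add0r in E2; lra.
have Fc x : 0 <= x -> {for x, continuous F}.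
  move=> x0; apply: differentiable_continuous; apply/derivable1_diffP.
  by apply: (@ex_derive _ _ _ _ _ _ _ (FD x _)); lra.
have [U FU] := continuous_segment_bound (ltW T0) Fc.
have FB x : 0 <= x -> `|F x| <= U.
  move=> x0; pose n := Num.truncn (x / T).
  have xT0 : 0 <= x / T by rewrite divr_ge0// ltW.
  have /andP[n1 n2] := truncn_itv xT0; rewrite -/n in n1 n2.
  rewrite ler_pdivlMr// in n1; rewrite ltr_pdivrMr// in n2; rewrite -natr1 mulrDl mul1r in n2.
  have Fn m y : 0 <= y -> F (y + m%:R * T) = F y.
    elim: m => [|m IH] y0; first by rewrite mul0r addr0.
    by rewrite -natr1 mulrDl mul1r addrA FT ?IH// addr_ge0// mulr_ge0// ltW.
  have y0 : 0 <= x - n%:R * T by lra.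
  have := Fn n _ y0; rewrite subrK => ->; apply: FU; lra.
exists (2 * `|U|); first by rewrite mulr_ge0.
move=> e s t e0 s0 st.
have eD (r : R) : - e < r -> is_derive r 1 (fun r : R => e * F (r / e)) (g (r / e)).
  move=> re; have h1 : is_derive r 1 (fun x : R => x / e) (e^-1 : R).
    have h0 := @is_deriveZ _ _ _ id (e^-1) r 1 1 (is_derive_id _ _).
    rewrite (_ : (fun x : R => x / e) = (e^-1 \*: id)); last first.
      by apply/funext => x; rewrite /= mulrC.
    by apply: is_derive_eq h0 _; rewrite /GRing.scale /= mulr1.
  have h2 : is_derive (r / e) 1 F (g (r / e)).
    by apply: FD; rewrite ltr_pdivlMr// mulN1r.
  have h3 := @is_derive1_comp _ F (fun x => x / e) r _ _ h2 h1.
  have h4 := @is_deriveZ _ _ _ _ e r 1 _ h3.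
  by apply: is_derive_eq h4 _; rewrite /GRing.scale /= mulrCA divff ?mulr1// gt_eqF.
have gec : continuous (fun r : R => g (r / e)) by exact: continuous_scaled.
have es : - e < s by lra.
have E := Rint_tind_FTC_gt es st eD gec.
have iw := continuous_itg_tind s t (continuous_scaled (e := e) wc).
have im : itg (leb R) (fun r => tind s t r * mean T w).
  by have := itgZ (mean T w) (itg_tind s t); congr itg; apply/funext => r; rewrite mulrC.
rewrite -RintB//; under eq_Rintegral do rewrite -mulrBr.
rewrite E -mulrBr normrM (gtr0_norm e0) mulrC; apply: ler_wpM2r; first exact: ltW.
apply: le_trans (ler_normB _ _) _; rewrite mulr2n mulrDl mul1r.
have U1 := ler_norm U.
have t1 : `|F (t / e)| <= U by apply: FB; rewrite divr_ge0 ?(ltW e0)//; lra.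
have t2 : `|F (s / e)| <= U by apply: FB; rewrite divr_ge0 ?(ltW e0).
by lra.
Qed.

End periodic_functions.

(** * Comparison of two weak solutions with the same force and the same datum in frame
    coordinates *)

Section comparison.
Variables (R : realType) (al be ga U : R) (h : J -> R -> V R -> R) (K : R -> R).
Hypothesis h_meas : forall j, measurable_fun [set: measurableTypeR R * mV R]
  (fun q : R * V R => h j q.1 q.2).
Hypothesis h_lip : forall j t, weak_lip (K t) (h j t).
Hypothesis h_free : forall j t z a, h j t (z + a *: basis6 R j) = h j t z.
Hypothesis K_itg : forall T, itg (leb R) (fun t => tind 0 T t * K t).

Variables (a1 F1 a2 F2 : R -> R3 R -> R3 R -> R3 R) (g1 g2 : V R -> R).
Variables (f1 f2 : R -> V R -> R) (vt1 vt2 : R -> R) (C1 C2 : R) (u1 v1 u2 v2 : R -> R).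
Hypothesis f1S : weak_solution a1 F1 g1 f1.
Hypothesis f2S : weak_solution a2 F2 g2 f2.
Hypothesis vt1_derivable : forall s, derivable vt1 s 1.
Hypothesis vt2_derivable : forall s, derivable vt2 s 1.
Hypothesis dvt1_cts : continuous (derive1 vt1).
Hypothesis dvt2_cts : continuous (derive1 vt2).
Hypothesis vt1_bound : forall r, `|vt1 r| <= C1.
Hypothesis vt2_bound : forall r, `|vt2 r| <= C2.
Hypothesis b1E : {ae leb R, forall t, 0 <= t -> {ae leb6 R, forall z, forall j,
  coord6 j (dframe vt1 (t, z) (1, (a1 t z.1 z.2, F1 t z.1 z.2))) =
  field al be ga u1 v1 h j t (frame (vt1 t) z)}}.
Hypothesis b2E : {ae leb R, forall t, 0 <= t -> {ae leb6 R, forall z, forall j,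
  coord6 j (dframe vt2 (t, z) (1, (a2 t z.1 z.2, F2 t z.1 z.2))) =
  field al be ga u2 v2 h j t (frame (vt2 t) z)}}.
Hypothesis u1_cts : continuous u1.
Hypothesis v1_cts : continuous v1.
Hypothesis u2_cts : continuous u2.
Hypothesis v2_cts : continuous v2.
Hypothesis u1_bound : forall t, `|u1 t| <= U.
Hypothesis v1_bound : forall t, `|v1 t| <= U.
Hypothesis u2_bound : forall t, `|u2 t| <= U.
Hypothesis v2_bound : forall t, `|v2 t| <= U.
Variable gam : R.
Hypothesis u_close : forall s t, 0 <= s -> s <= t -> `|ubar u1 s t - ubar u2 s t| <= gam.
Hypothesis v_close : forall s t, 0 <= s -> s <= t -> `|vbar v1 s t - vbar v2 s t| <= gam.
Variables (G : V R -> R) (MG rG : R).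
Hypothesis g1_meas : measurable_fun [set: mV R] g1.
Hypothesis g2_meas : measurable_fun [set: mV R] g2.
Hypothesis G_meas : measurable_fun [set: mV R] G.
Hypothesis g1E : forall z, g1 (frame (- vt1 0) z) = G z.
Hypothesis g2E : forall z, g2 (frame (- vt2 0) z) = G z.
Hypothesis MG0 : 0 <= MG.
(** Phrased along measure-preserving maps because G is Lipschitz only up to a null set, and
    preimages of null sets under such maps are null; 2 d is the price of mollification. *)
Hypothesis G_lip : forall d S1 S2, 0 < d -> mpres (leb6 R) S1 -> mpres (leb6 R) S2 ->
  {ae leb6 R, forall y, `|G (S1 y) - G (S2 y)| <= MG * (`|S1 y - S2 y| + 2 * d)}.
Hypothesis rG0 : 0 <= rG.
Hypothesis G_supp : {ae leb6 R, forall z, rG < `|z| -> G z = 0}.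

Variable BG : R.
Hypothesis G_bound : {ae leb6 R, forall z, `|G z| <= BG}.

Variable t : R.
Hypothesis t0 : 0 <= t.
Hypothesis vtE : vt1 t = vt2 t.

Let sg := kk U al be ga K 0 t.
(** R1 bounds the support of G composed with an inverse flow, r bounds 1 + |.| along backward
    trajectories issued from the ball of radius R1, and S0 is the Gronwall factor of
    [iflow_close]. *)
Let R1 := (1 + rG) * expR (63 * sg).
Let r := (1 + R1) * expR (63 * sg).
Let S0 := sg * expR (6 * sg).
Let gam' := (`|be| + `|ga|) * gam.

Definition gap_constant : R := MG * ((69 * S0 + 1) * (`|be| + `|ga|) * r).

Let sg0 : 0 <= sg. Proof. exact: (kk_ge0 _ _ _ _ h_lip t0). Qed.
Let S00 : 0 <= S0. Proof. exact: mulr_ge0 sg0 (expR_ge0 _). Qed.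
Let R10 : 0 <= R1. Proof. exact: mulr_ge0 (addr_ge0 ler01 rG0) (expR_ge0 _). Qed.
Let r0 : 0 <= r. Proof. exact: mulr_ge0 (addr_ge0 ler01 R10) (expR_ge0 _). Qed.

Let p n := part t n.
Let p0 n k : 0 <= p n k. Proof. by rewrite -(part0 t n); exact: part_le. Qed.
Let p_le n i j : (i <= j)%N -> p n i <= p n j. Proof. by move=> ij; exact: part_le. Qed.

Section discrete.
Variables (d w : R) (n : nat).
Hypothesis d0 : 0 < d.
Hypothesis w0 : 0 <= w.
Hypothesis w1 : w <= 1.
Hypothesis kw : forall k, (k < n.+1)%N -> kk U al be ga K (p n k) (p n k.+1) <= w.

Local Notation Fl u v := (flow al be ga u v h d (p n) 0 n.+1).
Local Notation Yf u v := (iflow al be ga h d (p n) u v 0 n.+1).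

Let sgE k : (k <= n.+1)%N -> kk U al be ga K (p n k) (p n n.+1) <= sg.
Proof.
move=> kn; rewrite /sg -{1}(partn t n) -/(p n n.+1).
rewrite (kk_split _ _ _ _ K_itg (lexx 0) (p0 n k) (p_le n kn)) lerDr.
exact: (kk_ge0 _ _ _ _ h_lip).
Qed.

(** Substitute z = frame (- c) (Y y) with Y the inverse flow: the map preserves measure, undoes the
    frame and the flow inside the test, and turns the datum into G at the backward point. *)
Lemma flow_change_of_variable (g : V R -> R) (c : R) (u v : R -> R) (psi : V R -> R) :
  continuous u -> continuous v -> (forall t, `|u t| <= U) -> (forall t, `|v t| <= U) ->
  measurable_fun [set: mV R] g -> measurable_fun [set: mV R] psi ->
  (forall z, g (frame (- c) z) = G z) ->
  \int[leb6 R]_z (g z * psi (Fl u v (frame c z))) = \int[leb6 R]_y (G (Yf u v y) * psi y).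
Proof.
move=> cu cv bu bv mg mpsi gE.
have mF : mpres (leb6 R) (Fl u v).
  by apply: flow_mpres.
have mY : mpres (leb6 R) (Yf u v) by apply: iflow_mpres.
have mS := mpres_comp (frame_mpres (- c)) mY.
have mPhi : measurable_fun [set: mV R] (fun z => g z * psi (Fl u v (frame c z))).
  apply: measurable_funM => //.
  exact: (measurableT_comp mpsi (measurableT_comp mF.1 (frame_mpres c).1)).
rewrite -(mpres_Rintegral mS mPhi); apply: eq_Rintegral => y _.
rewrite -[LHS]/(g (frame (- c) (Yf u v y)) * psi (Fl u v (frame c (frame (- c) (Yf u v y))))) gE.
have -> : frame c (frame (- c) (Yf u v y)) = Yf u v y.
  by have := frameK (- c) (Yf u v y); rewrite opprK.
have fK : cancel (Yf u v) (Fl u v) by apply: iflowK.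
by rewrite fK.
Qed.

Lemma iflow_gap y : `|y| <= R1 ->
  `|Yf u1 v1 y - Yf u2 v2 y| <= (S0 * (69 * gam' + 1458 * w) + gam') * r.
Proof.
move=> yR.
have rb i q : (i + q = n.+1)%N -> 1 + `|iflow al be ga h d (p n) u1 v1 i q y| <= r /\
    1 + `|iflow al be ga h d (p n) u2 v2 i q y| <= r.
  move=> iq; have inn : (i <= n.+1)%N by rewrite -iq leq_addr.
  have b : (1 + `|y|) * expR (63 * kk U al be ga K (p n i) (p n n.+1)) <= r.
    have y1 : 1 + `|y| <= 1 + R1 by rewrite lerD2l.
    apply: (ler_pM (addr_ge0 ler01 (normr_ge0 _)) (expR_ge0 _) y1).
    by rewrite ler_expR; exact: ler_wpM2l (ler0n _ 63) _ _ (sgE inn).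
  split; apply: le_trans b.
    exact: (iflow_growth h_meas h_lip K_itg d0 (p0 n) (@p_le n) kw w1 u1_cts v1_cts u1_bound v1_bound y iq).
  exact: (iflow_growth h_meas h_lip K_itg d0 (p0 n) (@p_le n) kw w1 u2_cts v2_cts u2_bound v2_bound y iq).
have := iflow_close h_meas h_lip K_itg d0 (p0 n) (@p_le n) kw w0 w1
  u1_cts v1_cts u2_cts v2_cts u1_bound v1_bound u2_bound v2_bound u_close v_close (add0n n.+1) rb.
set x1 := Yf u1 v1 y; set x2 := Yf u2 v2 y; set gp := gap _ _ _ _ _ _ _ _ _ x2 => E1.
have E2 : `|gp| <= gam' * r.
  apply: le_trans (gap_bound _ _ _ u_close v_close x2 (p0 n 0) (p_le n (leq0n n.+1))) _.
  apply: ler_wpM2l.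
    apply: mulr_ge0; first exact: addr_ge0.
    exact: le_trans (normr_ge0 _) (u_close (lexx 0) (lexx 0)).
  have [_ b] := rb 0%N n.+1 (add0n _).
  by apply: le_trans b; rewrite lerDr.
have -> : x1 - x2 = (x1 - x2 + gp) - gp by rewrite addrK.
apply: le_trans (ler_normB _ _) _; rewrite mulrDl; apply: lerD => //.
apply: le_trans E1 _; rewrite /p part0 partn -/sg -/S0 -mulrA.
exact: lexx.
Qed.

(** In the ball of radius R1 this is the Lipschitz bound on G with [iflow_gap]. Outside, the growth
    bound for the forward flow keeps both backward points out of the support of G. *)
Lemma pulled_back_data_close : {ae leb6 R, forall y,
  `|G (Yf u1 v1 y) - G (Yf u2 v2 y)| <=
   MG * ((S0 * (69 * gam' + 1458 * w) + gam') * r + 2 * d) * ball_ind R1 y}.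
Proof.
have m1 : mpres (leb6 R) (Yf u1 v1) by apply: iflow_mpres.
have m2 : mpres (leb6 R) (Yf u2 v2) by apply: iflow_mpres.
have s1 := mpres_ae m1 G_supp; have s2 := mpres_ae m2 G_supp.
apply: aeS (aeI (G_lip d0 m1 m2) (aeI s1 s2)) => y [L [z1 z2]].
rewrite ball_indE; case: (leP `|y| R1) => yR.
  rewrite mulr1; apply: le_trans L _; apply: ler_wpM2l => //; rewrite lerD2r.
  exact: iflow_gap.
rewrite mulr0.
have out (u v : R -> R) : continuous u -> continuous v -> (forall t, `|u t| <= U) ->
    (forall t, `|v t| <= U) -> rG < `|Yf u v y|.
  move=> cu cv bu bv; rewrite ltNge; apply/negP => le; move: yR; rewrite ltNge => /negP; apply.
  have := flow_growth h_meas h_lip K_itg d0 (p0 n) (@p_le n) kw w1 cu cv bu bv (Yf u v y) (add0n n.+1).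
  have fK : cancel (Yf u v) (Fl u v) by apply: iflowK.
  rewrite fK => E.
  have : (1 + `|Yf u v y|) * expR (63 * kk U al be ga K (p n 0) (p n n.+1)) <= R1.
    have y1 : 1 + `|Yf u v y| <= 1 + rG by rewrite lerD2l.
    apply: (ler_pM (addr_ge0 ler01 (normr_ge0 _)) (expR_ge0 _) y1).
    by rewrite ler_expR; exact: ler_wpM2l (ler0n _ 63) _ _ (sgE (leq0n n.+1)).
  by move=> /(le_trans E) E'; apply: le_trans E'; rewrite lerDr.
by rewrite (z1 (out _ _ u1_cts v1_cts u1_bound v1_bound))
  (z2 (out _ _ u2_cts v2_cts u2_bound v2_bound)) subrr normr0.
Qed.

End discrete.

Lemma le_of_small_excess (x b c : R) : (forall eta : R, 0 < eta -> eta <= 1 -> x <= b + eta * c) -> x <= b.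
Proof.
move=> H; rewrite leNgt; apply/negP => bx.
have c1 : 0 < `|c| + 1 by rewrite ltr_wpDl.
pose eta := Num.min 1 ((x - b) / 2 / (`|c| + 1)).
have e0 : 0 < eta by rewrite lt_min ltr01 !divr_gt0// subr_gt0.
have e1 : eta <= 1 by rewrite ge_min lexx.
have ec : eta * (`|c| + 1) <= (x - b) / 2.
  by rewrite -ler_pdivlMr// ge_min lexx orbT.
have := H eta e0 e1; have := ler_wpM2l (ltW e0) (ler_norm c).
by move: ec; rewrite mulrDr mulr1; lra.
Qed.

Section weak_test.
Variables (L H rho : R) (psi : V R -> R) (D : V R -> V R -> R).
Hypothesis rho0 : 0 <= rho.
Hypothesis pC : C11 L H psi D.
Hypothesis psi01 : forall z, 0 <= psi z <= 1.
Hypothesis pr : vanish_off rho psi.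

Let P := \int[leb6 R]_y (ball_ind R1 y * psi y).

(** Choose the mollification scale, the tolerance and the bound on step sizes all equal to eta:
    every error except the term in gam is O(eta), and eta tends to 0. *)
Lemma weak_difference :
  `|pairing f1 vt1 psi t - pairing f2 vt2 psi t| <= gap_constant * gam * P.
Proof.
have mpsi : measurable_fun [set: mV R] psi by case: pC.
have bpi : itg (leb6 R) (fun y => ball_ind R1 y * psi y).
  apply: (itg_mulb (M := 1)) => //; first exact: itg_ball_ind.
  by move=> z; have /andP[p1 p2] := psi01 z; rewrite ger0_norm.
have P0 : 0 <= P.
  apply: Rintegral_ge0 => y _; rewrite mulr_ge0 ?ball_ind_ge0//.
  by have /andP[] := psi01 y.
have [Z1 Z10 Z1P] : exists2 Z : R, 0 <= Z & forall d eta : R, 0 < d -> 0 < eta ->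
    exists n0, forall n, (n0 <= n)%N -> `|pairing f1 vt1 psi t -
      \int[leb6 R]_z (g1 z * psi (flow al be ga u1 v1 h d (part t n) 0 n.+1 (frame (vt1 0) z)))|
      <= Z * d + eta.
  exact: (consistency h_meas h_lip h_free K_itg u1_cts v1_cts u1_bound v1_bound f1S
    vt1_derivable dvt1_cts vt1_bound b1E t0 rho0 pC pr).
have [Z2 Z20 Z2P] : exists2 Z : R, 0 <= Z & forall d eta : R, 0 < d -> 0 < eta ->
    exists n0, forall n, (n0 <= n)%N -> `|pairing f2 vt2 psi t -
      \int[leb6 R]_z (g2 z * psi (flow al be ga u2 v2 h d (part t n) 0 n.+1 (frame (vt2 0) z)))|
      <= Z * d + eta.
  exact: (consistency h_meas h_lip h_free K_itg u2_cts v2_cts u2_bound v2_bound f2S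
    vt2_derivable dvt2_cts vt2_bound b2E t0 rho0 pC pr).
apply: (@le_of_small_excess _ _ (Z1 + Z2 + 2 + MG * (S0 * 1458 * r + 2) * P)) => eta eta0 eta1.
have [n1 n1P] := Z1P eta eta eta0 eta0.
have [n2 n2P] := Z2P eta eta eta0 eta0.
have [e e0 eP] := kk_small U al be ga h_lip K_itg t0 eta0.
pose n := maxn (maxn n1 n2) (Num.truncn (t / e)).+1.
have E1 := n1P n (leq_trans (leq_maxl _ _) (leq_maxl _ _)).
have E2 := n2P n (leq_trans (leq_maxr _ _) (leq_maxl _ _)).
have tn : t / n.+1%:R < e.
  rewrite ltr_pdivrMr// mulrC -ltr_pdivrMr//; apply: lt_le_trans (truncnS_gt _) _.
  by rewrite ler_nat; apply: leqW; exact: leq_maxr.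
have kw k : (k < n.+1)%N -> kk U al be ga K (p n k) (p n k.+1) <= eta.
  move=> kn; apply: eP => //; first exact: p_le.
    by rewrite -[leRHS](partn t n); exact: p_le.
  by rewrite /p partS ltW.
rewrite (flow_change_of_variable n eta0 u1_cts v1_cts u1_bound v1_bound g1_meas mpsi g1E) in E1.
rewrite (flow_change_of_variable n eta0 u2_cts v2_cts u2_bound v2_bound g2_meas mpsi g2E) in E2.
set Y1 := iflow al be ga h eta (p n) u1 v1 0 n.+1 in E1.
set Y2 := iflow al be ga h eta (p n) u2 v2 0 n.+1 in E2.
have m1 : mpres (leb6 R) Y1 by apply: iflow_mpres.
have m2 : mpres (leb6 R) Y2 by apply: iflow_mpres.
have Gi (Y : V R -> V R) : mpres (leb6 R) Y -> itg (leb6 R) (fun y => G (Y y) * psi y).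
  move=> mY; have BGi := itgZ BG (itg_norm (C11_itg rho0 pC pr)).
  apply: itg_dom_ae BGi.
    by apply: measurable_funM => //; exact: (measurableT_comp G_meas mY.1).
  by apply: aeS (mpres_ae mY G_bound) => y Gy; rewrite normrM ler_wpM2r.
have close := pulled_back_data_close eta0 (ltW eta0) eta1 kw.
set Q := MG * _ in close.
have E3 : `|\int[leb6 R]_y (G (Y1 y) * psi y) - \int[leb6 R]_y (G (Y2 y) * psi y)| <= Q * P.
  rewrite -RintB; [|exact: Gi|exact: Gi].
  rewrite /P -RintZ//; apply: Rint_norm_le; [|exact: itgZ|].
    by apply: itgB; exact: Gi.
  apply: aeS close => y cy; have /andP[p1 p2] := psi01 y.
  by rewrite -mulrBl normrM (ger0_norm p1) mulrA ler_wpM2r.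
set I1 := \int[leb6 R]_y (G (Y1 y) * psi y) in E1 E3.
set I2 := \int[leb6 R]_y (G (Y2 y) * psi y) in E2 E3.
set q1 := pairing f1 vt1 psi t in E1 *; set q2 := pairing f2 vt2 psi t in E2 *.
have -> : q1 - q2 = (q1 - I1) + (I1 - I2) - (q2 - I2) by ring.
apply: le_trans (ler_normB _ _) _; apply: le_trans (lerD (ler_normD _ _) E2) _.
apply: le_trans (lerD (lerD E1 E3) (lexx _)) _.
rewrite le_eqVlt; apply/orP; left; apply/eqP.
by rewrite /Q /gap_constant /gam'; ring.
Qed.

End weak_test.

(** Since vt1 t = vt2 t, a single frame serves both solutions at time t, and their difference can be
    tested there. *)
Let W y : R := f1 t (frame (- vt1 t) y) - f2 t (frame (- vt1 t) y).

Let f1L := C_L2_L2 (proj1 f1S) t0.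
Let f2L := C_L2_L2 (proj1 f2S) t0.

Let test_itg (f : R -> V R -> R) (psi : V R -> R) : C_L2 f -> 
  (exists L H D, C11 L H psi D) -> forall rho, 0 <= rho -> vanish_off rho psi ->
  itg (leb6 R) (fun y => f t (frame (- vt1 t) y) * psi y) /\
  \int[leb6 R]_y (f t (frame (- vt1 t) y) * psi y) = \int[leb6 R]_z (f t z * psi (frame (vt1 t) z)).
Proof.
move=> fC [L [H [D pC]]] rho rho0 pr.
have C10 : 0 <= C1 by exact: le_trans (vt1_bound 0).
have M0 : 0 <= L * (2 * rho + 2) by rewrite mulr_ge0 ?(C11_L_ge0 pC)// addr_ge0// mulr_ge0.
have R0 : 0 <= (1 + C1) * rho by rewrite mulr_ge0// addr_ge0.
have mf := frame_mpres (vt1 t).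
have mpsi : measurable_fun [set: mV R] psi by case: pC.
have mw : measurable_fun [set: mV R] (fun z => psi (frame (vt1 t) z)).
  exact: (measurableT_comp mpsi mf.1).
have wb z : `|psi (frame (vt1 t) z)| <= L * (2 * rho + 2) * ball_ind ((1 + C1) * rho) z.
  rewrite ball_indE; case: (leP `|z| _) => zr.
    by rewrite mulr1; exact: C11_bounded pC pr _.
  rewrite pr ?normr0 ?mulr0//.
  by have : rho < `|frame (vt1 t) z| by apply: (frame_support vt1_bound).
have [fi _] := L2_pairing fC t0 M0 R0 mw wb.
have mS := frame_mpres (- vt1 t).
have E : (fun y => f t (frame (- vt1 t) y) * psi y) =
    (fun z => f t z * psi (frame (vt1 t) z)) \o frame (- vt1 t).
  apply/funext => y /=; have := frameK (- vt1 t) y; rewrite opprK => -> //.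
split; first by rewrite E; exact: mpres_integrable mS fi.
rewrite -(mpres_Rintegral mS (itg_meas fi)).
by apply: eq_Rintegral => y _; rewrite -[LHS]/((fun y => f t (frame (- vt1 t) y) * psi y) y) E.
Qed.

Let mW : measurable_fun [set: mV R] W.
Proof.
have m := (frame_mpres (- vt1 t)).1.
by apply: measurable_funB; [exact: (measurableT_comp (L2_meas f1L))|exact: (measurableT_comp (L2_meas f2L))].
Qed.

Let cst_ge0 : 0 <= gap_constant * gam.
Proof.
have gam0 : 0 <= gam by exact: le_trans (normr_ge0 _) (u_close (lexx 0) (lexx 0)).
apply: mulr_ge0 => //; apply: mulr_ge0 => //; apply: mulr_ge0 => //; apply: mulr_ge0.
  by apply: addr_ge0 => //; exact: mulr_ge0.
exact: addr_ge0.
Qed.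

(** [weak_difference] is proportional to the integral of [ball_ind R1] times psi, so this
    combination has nonnegative integral against every test and [local_ge0] applies. *)
Let signed_ge0 (b : R) : `|b| <= 1 ->
  {ae leb6 R, forall y, 0 <= gap_constant * gam * ball_ind R1 y + b * W y}.
Proof.
move=> b1.
have vi psi (rho : R) : isC11 psi -> (forall z, 0 <= psi z <= 1) -> 0 <= rho -> vanish_off rho psi ->
    itg (leb6 R) (fun y => (gap_constant * gam * ball_ind R1 y + b * W y) * psi y) /\
    0 <= \int[leb6 R]_y ((gap_constant * gam * ball_ind R1 y + b * W y) * psi y).
  move=> pC p01 rho0 pr; have [L [H [D pD]]] := pC.
  have [i1 E1] := test_itg (proj1 f1S) pC rho0 pr.
  have [i2 E2] := test_itg (proj1 f2S) pC rho0 pr.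
  have bpi : itg (leb6 R) (fun y => ball_ind R1 y * psi y).
    apply: (itg_mulb (M := 1)) => //; [exact: itg_ball_ind|by case: pD|].
    by move=> z; have /andP[p1 p2] := p01 z; rewrite ger0_norm.
  have E : (fun y => (gap_constant * gam * ball_ind R1 y + b * W y) * psi y) =
      fun y => gap_constant * gam * (ball_ind R1 y * psi y) +
        b * (f1 t (frame (- vt1 t) y) * psi y - f2 t (frame (- vt1 t) y) * psi y).
    by apply/funext => y; rewrite /W; ring.
  have i3 := itgZ (gap_constant * gam) bpi; have i4 := itgZ b (itgB i1 i2).
  rewrite E; split; first exact: itgD.
  rewrite RintD// RintZ// RintZ; last exact: itgB.
  have E2' : \int[leb6 R]_y (f2 t (frame (- vt1 t) y) * psi y) = pairing f2 vt2 psi t.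
    by rewrite E2 vtE.
  rewrite RintB// E1 E2'.
  have := weak_difference rho0 pD p01 pr; rewrite -/(pairing f1 vt1 psi t).
  set x := pairing f1 vt1 psi t - pairing f2 vt2 psi t; set c := _ * _ => xc.
  have : `|b * x| <= `|x| by rewrite normrM ler_piMl.
  by rewrite ler_norml => /andP[]; lra.
apply: local_ge0.
- apply: measurable_funD; apply: measurable_funM => //; exact: measurable_ball_ind.
- move=> n; have [bC b01] := bump_C11 n%:R (1 : R).
  have bv := @bump_vanish R n%:R 1 ltr01.
  have n0 : 0 <= n%:R + 1 :> R by rewrite addr_ge0.
  by have [] := vi _ _ bC b01 n0 bv.
- by move=> psi rho pC p01 rho0 pr; have [] := vi _ _ pC p01 rho0 pr.
Qed.

(** The signs b = 1 and b = -1 give a pointwise bound carried by a ball; undoing the frame enlarges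
    its radius by the factor 1 + C1, and [cb] is the L^2 norm of its indicator. *)
Lemma difference_norm :
  ('N[leb6 R]_(2%:E)[EFin \o (f1 t \- f2 t)%R] <=
    (gap_constant * gam * cb ((1 + C1) * R1))%:E)%E.
Proof.
have C10 : 0 <= C1 by exact: le_trans (vt1_bound 0).
have R20 : 0 <= (1 + C1) * R1 by rewrite mulr_ge0// addr_ge0.
have n1 : `|1 : R| <= 1 by rewrite normr1.
have n2 : `|-1 : R| <= 1 by rewrite normrN1.
have Wb : {ae leb6 R, forall z, `|f1 t z - f2 t z| <= gap_constant * gam * ball_ind ((1 + C1) * R1) z}.
  have := mpres_ae (frame_mpres (vt1 t)) (aeI (signed_ge0 n1) (signed_ge0 n2)).
  apply: aeS => z; rewrite /W frameK mul1r mulN1r => -[w1 w2].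
  apply: (@le_trans _ _ (gap_constant * gam * ball_ind R1 (frame (vt1 t) z))).
    by rewrite ler_norml; apply/andP; split; lra.
  apply: ler_wpM2l => //; rewrite !ball_indE ler_nat.
  case: (leP `|z| ((1 + C1) * R1)) => zr; first exact: leq_b1.
  have : R1 < `|frame (vt1 t) z| by apply: (frame_support vt1_bound).
  by rewrite ltNge => /negbTE ->.
have mb := @measurable_ball R ((1 + C1) * R1).
have muE := leb6_ball R20.
have muy : (leb6 R [set z : V R | (`|z| <= (1 + C1) * R1)%R] < +oo)%E.
  by apply: le_lt_trans (ltry _); rewrite le_eqVlt; apply/orP; left; apply/eqP; exact: muE.
have := Lnorm2_le cst_ge0 (L2_meas (L2_sub f1L f2L)) mb muy Wb.
by rewrite (_ : fine _ = (2 * ((1 + C1) * R1)) ^+ 6)// /cb; have := f_equal fine muE.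
Qed.

End comparison.

(** * The two Vlasov equations in frame coordinates *)

Section vlasov_fields.
Variables (R : realType) (m e wc T : R) (theta : R -> R) (E : R -> R3 R -> R3 R).
Hypothesis m_neq0 : m != 0.
Hypothesis theta_derivable : forall s, derivable theta s 1.
Hypothesis theta_C1 : continuous (derive1 theta).

Definition vshift (eps r : R) : R := m * wc / 2 * theta (r / eps).

Lemma is_derive_vshift (eps r : R) : is_derive r 1 (vshift eps)
  (m * wc / 2 * (derive1 theta (r / eps) / eps)).
Proof.
have h1 : is_derive r 1 (fun x : R => x / eps) (eps^-1 : R).
  have h0 := @is_deriveZ _ _ _ id (eps^-1) r 1 1 (is_derive_id _ _).
  rewrite (_ : (fun x : R => x / eps) = (eps^-1 \*: id)); last first.
    by apply/funext => x; rewrite /= mulrC.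
  by apply: is_derive_eq h0 _; rewrite /GRing.scale /= mulr1.
have h2 : is_derive (r / eps) 1 theta (derive1 theta (r / eps)).
  by apply: DeriveDef; [exact: theta_derivable|rewrite derive1E].
have h3 := @is_derive1_comp _ theta (fun x => x / eps) r _ _ h2 h1.
exact: (@is_deriveZ _ _ _ _ (m * wc / 2) r 1 _ h3).
Qed.

Lemma derive1_vshift (eps : R) : derive1 (vshift eps) =
  fun r => m * wc / 2 * (derive1 theta (r / eps) / eps).
Proof.
by apply/funext => r; rewrite derive1E (@derive_val _ _ _ _ _ _ _ (is_derive_vshift eps r)).
Qed.

Lemma continuous_derive1_vshift (eps : R) : continuous (derive1 (vshift eps)).
Proof.
rewrite derive1_vshift => r; apply: cvgM; first exact: cvg_cst.
by apply: cvgM; [exact: (continuous_scaled theta_C1)|exact: cvg_cst].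
Qed.

Variable h : J -> R -> V R -> R.

(** The time derivative of the frame cancels the term in theta'. Of the rotation wc theta perp p,
    half is cancelled by the motion of x in the frame, and expressing the other half by the shifted
    momentum produces the term in theta^2. *)
Lemma field_eps (eps t : R) z j : eps != 0 ->
  h j t (frame (vshift eps t) z) =
    match j with inl _ => 0 | inr i => e * coord3 i (E t z.1) end ->
  coord6 j (dframe (vshift eps) (t, z) (1, (velocity_eps m t z.1 z.2,
     force_eps m e wc theta E eps t z.1 z.2))) =
  field m^-1 (wc / 2) (m * wc ^+ 2 / 4) (fun r => theta (r / eps))
    (fun r => theta (r / eps) ^+ 2) h j t (frame (vshift eps t) z).
Proof.
move=> eps0 hz; rewrite /field hz /dframe derive1_vshift /lfield /frame /vshift
  /velocity_eps /force_eps.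
case: j hz => i _; elim/ord3_cases: i;
  rewrite ?(coord6D, coord6B, coord6N, coord6Z) /coord6 /=
    ?(coord3D, coord3N, coord3Z) /coord3 /perp /= /GRing.scale /=; field; rewrite ?m_neq0 ?eps0 //.
Qed.

(** With s frozen the frame does not depend on time, and the terms in theta(s) of the limit equation
    are exactly those it removes; only the two means remain. *)
Lemma field_mean (s t : R) z j :
  h j t (frame (m * wc / 2 * theta s) z) =
    match j with inl _ => 0 | inr i => e * coord3 i (E t z.1) end ->
  coord6 j (dframe (fun=> m * wc / 2 * theta s) (t, z) (1, (velocity0 m wc T theta s t z.1 z.2,
     force0 m e wc T theta E s t z.1 z.2))) =
  field m^-1 (wc / 2) (m * wc ^+ 2 / 4) (fun=> mean T theta)
    (fun=> mean T (fun r => theta r ^+ 2)) h j t (frame (m * wc / 2 * theta s) z).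
Proof.
move=> hz; rewrite /field hz /dframe derive1_cst /lfield /frame
  /velocity0 /force0.
move: (mean T theta) (mean T (fun r => theta r ^+ 2)) => A1 A2.
case: j hz => i _; elim/ord3_cases: i;
  rewrite ?(coord6D, coord6B, coord6N, coord6Z) /coord6 /=
    ?(coord3D, coord3N, coord3Z) /coord3 /perp /= /GRing.scale /=; field; rewrite ?m_neq0 //.
Qed.

(** The shift by theta(s) - theta(0) in the datum compensates the frame at s, so the result is
    independent of s and equals the datum of f^eps in its frame at time 0. *)
Lemma initial0_frame (fin : V R -> R) s z :
  initial0 m wc theta fin s (frame (- (m * wc / 2 * theta s)) z) =
  fin (frame (- (m * wc / 2 * theta 0)) z).
Proof. by rewrite /initial0; congr fin; rewrite /frame; vcoord. Qed.

End vlasov_fields.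

(** * Support and Lipschitz bound of the datum in a frame *)

Section initial_datum.
Variables (R : realType) (fin : V R -> R) (c : R).

Lemma frame_out (rho : R) z : (1 + `|c|) * rho < `|z| -> rho < `|frame c z|.
Proof.
move=> zr; rewrite ltNge; apply/negP => le; move: zr; rewrite ltNge => /negP; apply.
rewrite -(frameK c z); apply: le_trans (frame_growth _ _) _.
by rewrite normrN; apply: ler_pM.
Qed.

Lemma pulled_back_support : ae_compact_support fin ->
  exists2 rho, 0 <= rho & {ae leb6 R, forall z, rho < `|z| -> fin (frame c z) = 0}.
Proof.
move=> [S cS fS]; have [rho [rho0 Sr]] : exists rho : R, 0 <= rho /\ forall z, S z -> `|z| <= rho.
  have [M [_ MS]] := compact_bounded cS.
  exists (`|M| + 1); split=> [|z Sz]; first by rewrite addr_ge0.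
  by apply: MS => //; rewrite (le_lt_trans (ler_norm M))// ltrDl.
exists ((1 + `|c|) * rho); first by rewrite mulr_ge0// addr_ge0.
apply: aeS (mpres_ae (frame_mpres c) fS) => z fz zr; apply: fz => Sz.
by have := frame_out zr; rewrite ltNge (Sr _ Sz).
Qed.

(** [fin] agrees almost everywhere with g, whose mollification is Lipschitz at all points and within
    6 M d of g almost everywhere; these null sets pull back to null sets under the
    measure-preserving maps. *)
Lemma pulled_back_lip (M : R) (g : V R -> R) : weak_lip M g ->
  {ae leb6 R, forall z, g z = fin z} ->
  forall d S1 S2, 0 < d -> mpres (leb6 R) S1 -> mpres (leb6 R) S2 ->
  {ae leb6 R, forall y, `|fin (frame c (S1 y)) - fin (frame c (S2 y))| <=
     6 * M * (1 + `|c|) * (`|S1 y - S2 y| + 2 * d)}.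
Proof.
move=> gl gE d S1 S2 d0 m1 m2.
have M0 : 0 <= M by have [_ b _] := gl; exact: le_trans (b 0).
have [K' _ KP] := mollify_C11 d0; have [D DC] := KP _ _ gl.
have mc := mollify_close d0 gl.
have p1 := mpres_comp (frame_mpres c) m1; have p2 := mpres_comp (frame_mpres c) m2.
apply: aeS (aeI (aeI (mpres_ae p1 gE) (mpres_ae p2 gE)) (aeI (mpres_ae p1 mc) (mpres_ae p2 mc))).
move=> y [[/= <- <-] [c1 c2]].
set y1 := frame c (S1 y) in c1 *; set y2 := frame c (S2 y) in c2 *.
have yw : `|y1 - y2| <= (1 + `|c|) * `|S1 y - S2 y|.
  have -> : y1 - y2 = frame c (S1 y - S2 y).
    by rewrite -scaleN1r -(frameZ c (-1)) -frameD scaleN1r.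
  exact: frame_growth.
have := C11_lip DC y2 (y1 - y2); rewrite (addrC y2) subrK => L1.
have L2 := ler_wpM2l (mulr_ge0 (ler0n R 6) M0) yw.
have aux (p q a b x u v : R) : `|a - p| <= x -> `|b - q| <= x -> `|a - b| <= u -> u <= v ->
    `|p - q| <= 2 * x + v.
  rewrite !ler_norml => /andP[? ?] /andP[? ?] /andP[? ?] ?; apply/andP; split; lra.
apply: le_trans (aux _ _ _ _ _ _ _ c1 c2 L1 L2) _.
have Md : 0 <= 6 * M * `|c| * (2 * d).
  by rewrite mulr_ge0 ?mulr_ge0// ltW.
have -> : 6 * M * (1 + `|c|) * (`|S1 y - S2 y| + 2 * d) =
  2 * (6 * M * d) + 6 * M * ((1 + `|c|) * `|S1 y - S2 y|) + 6 * M * `|c| * (2 * d) by ring.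
by rewrite lerDl.
Qed.

End initial_datum.

(** * Uniformity of the constant in time, and conclusion *)

Definition error_constant (R : realType) (MG G rG C sg : R) : R :=
  MG * ((69 * (sg * expR (6 * sg)) + 1) * G *
    ((1 + (1 + rG) * expR (63 * sg)) * expR (63 * sg))) *
  cb ((1 + C) * ((1 + rG) * expR (63 * sg))).

(** Monotonicity in the accumulated size replaces its value at t by its value at I, so one constant
    serves the whole interval. *)
Lemma error_constant_le (R : realType) (MG G rG C sg sg' : R) : 0 <= MG -> 0 <= G ->
  0 <= rG -> 0 <= C -> 0 <= sg -> sg <= sg' ->
  error_constant MG G rG C sg <= error_constant MG G rG C sg'.
Proof.
move=> M0 G0 r0 C0 s0 ss.
have ex (x : R) : 0 <= x -> expR (x * sg) <= expR (x * sg').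
  by move=> x0; rewrite ler_expR; exact: ler_wpM2l.
have e0 (x : R) : 0 <= expR x by exact: expR_ge0.
have e6 := ex 6 (ler0n _ 6); have e63 := ex 63 (ler0n _ 63).
have E6 := e0 (6 * sg); have E63 := e0 (63 * sg).
rewrite /error_constant.
move: (expR (6 * sg)) (expR (6 * sg')) (expR (63 * sg)) (expR (63 * sg')) e6 e63 E6 E63.
move=> a a' b b' aa bb a0 b0.
have r10 : 0 <= 1 + rG by exact: addr_ge0.
have rb : (1 + rG) * b <= (1 + rG) * b' by exact: ler_wpM2l.
have rb0 : 0 <= (1 + rG) * b by exact: mulr_ge0.
have t1 : (69 * (sg * a) + 1) * G <= (69 * (sg' * a') + 1) * G.
  apply: ler_wpM2r => //; rewrite lerD2r; apply: (ler_wpM2l (ler0n _ 69)).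
  exact: ler_pM.
have t2 : (1 + (1 + rG) * b) * b <= (1 + (1 + rG) * b') * b'.
  by apply: ler_pM => //; [exact: addr_ge0|rewrite lerD2l].
have t10 : 0 <= (69 * (sg * a) + 1) * G.
  apply: mulr_ge0 => //; apply: addr_ge0 => //; exact: mulr_ge0 (ler0n _ 69) (mulr_ge0 s0 a0).
have t20 : 0 <= (1 + (1 + rG) * b) * b by apply: mulr_ge0 => //; exact: addr_ge0.
apply: ler_pM; [exact: mulr_ge0 M0 (mulr_ge0 t10 t20)|exact: cb_ge0| |].
  by apply: ler_wpM2l => //; exact: ler_pM.
have p x : 0 <= x -> 2 * ((1 + C) * x) \is Num.nneg.
  move=> x0; exact: mulr_ge0 (ler0n _ 2) (mulr_ge0 (addr_ge0 ler01 C0) x0).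
apply: ler_wsqrtr; apply: (lerXn2r 6 (p _ rb0) (p _ (le_trans rb0 rb))).
by apply: (ler_wpM2l (ler0n _ 2)); apply: ler_wpM2l rb; exact: addr_ge0.
Qed.

Theorem theorem2p3 (R : realType) (m e B T : R)
    (m_gt0 : 0 < m) (B_gt0 : 0 < B) (T_gt0 : 0 < T)
    (wc : R) (wcE : wc = e * B / m)
    (theta : R -> R)
    (theta_derivable : forall s, derivable theta s 1)
    (theta_C1 : continuous (derive1 theta))
    (theta_periodic : periodic theta T)
    (E : R -> R3 R -> R3 R) (phi : R -> R3 R -> R)
    (E_potential : {ae leb R, forall t, 0 <= t -> is_minus_gradient (E t) (phi t)})
    (E_W2oo : forall i, L1loc_Woo 2 (fun t x => coord3 i (E t x)))
    (dtE : R -> R3 R -> R3 R)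
    (dtE_weak : forall i,
       weak_dt (fun t x => coord3 i (E t x)) (fun t x => coord3 i (dtE t x)))
    (dtE_Loo : forall i, L1loc_Woo 0 (fun t x => coord3 i (dtE t x)))
    (fin : R3 R * R3 R -> R)
    (fin_W2oo : Woo6 2 fin) (fin_supp : ae_compact_support fin)
    (f0 : R -> R -> R3 R * R3 R -> R)
    (f0_sol : forall s,
       weak_solution (velocity0 m wc T theta s) (force0 m e wc T theta E s)
         (initial0 m wc theta fin s) (fun t => f0 t s))
    (feps : R -> R -> R3 R * R3 R -> R)
    (feps_sol : forall eps, 0 < eps ->
       weak_solution (velocity_eps m) (force_eps m e wc theta E eps)
         fin (feps eps)) :
  forall I : R, 0 <= I -> exists C : R, forall eps t, 0 < eps ->
    0 <= t <= I ->
    ('N[leb6 R]_(2%:E)[EFin \o (feps eps t \- f0 t (t / eps))%R]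
       <= (C * eps)%:E)%E.
Proof.
move=> I I0.
have m0 : m != 0 by rewrite gt_eqF.
have [h [K [hm hl hf Ki hE]]] := force_data e E_W2oo.
have [M [g [gl gE]]] := initial_data fin_W2oo.
have M0 : 0 <= M by have [_ b _] := gl; exact: le_trans (b 0).
have mfin : measurable_fun [set: mV R] fin by have [M' []] := fin_W2oo.
have tc : continuous theta.
  by move=> r; apply: differentiable_continuous; apply/derivable1_diffP; exact: theta_derivable.
have tc2 : continuous (fun r => theta r ^+ 2) by move=> r; apply: cvgM; exact: tc.
have tp2 : periodic (fun r => theta r ^+ 2) T by move=> r; rewrite theta_periodic.
have [U1 tU] := periodic_bound T_gt0 theta_periodic tc.
have [U2 tU2] := periodic_bound T_gt0 tp2 tc2.
have U10 : 0 <= U1 by exact: le_trans (tU 0).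
have U20 : 0 <= U2 by exact: le_trans (tU2 0).
set mu1 := mean T theta; set mu2 := mean T (fun r => theta r ^+ 2).
(* One bound for the coefficients of both fields, so that both problems share the same [kk]. *)
pose U := U1 + U2 + `|mu1| + `|mu2|.
have [A1 A10 A1P] := periodic_average T_gt0 theta_periodic tc.
have [A2 A20 A2P] := periodic_average T_gt0 tp2 tc2.
pose c := m * wc / 2; pose al := m^-1; pose be := wc / 2; pose ga := m * wc ^+ 2 / 4.
have [rG rG0 rGP] := pulled_back_support (- (c * theta 0)) fin_supp.
pose MG := 6 * M * (1 + `|- (c * theta 0)|).
have MG0 : 0 <= MG by rewrite mulr_ge0 ?addr_ge0// mulr_ge0.
pose C1 := `|c| * U1.
have C10 : 0 <= C1 by rewrite mulr_ge0.
have bg0 : 0 <= `|be| + `|ga| by exact: addr_ge0.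
exists (error_constant MG (`|be| + `|ga|) rG C1 (kk U al be ga K 0 I) * (A1 + A2)).
move=> eps t eps0 /andP[t0 tI].
(* The parameter of the limit problem is frozen at this value while its own time runs over [0, t];
   at the final time its frame coincides with that of f^eps. *)
pose s := t / eps.
have en0 : eps != 0 by rewrite gt_eqF.
(* A frame leaves x unchanged and preserves null sets, so the force keeps its expression in frame
   coordinates. *)
have hE1 (vt : R -> R) : {ae leb R, forall t, 0 <= t -> {ae leb6 R, forall z, forall j,
    h j t (frame (vt t) z) = match j with inl _ => 0 | inr i => e * coord3 i (E t z.1) end}}.
  by apply: aeS hE => r hr r0; apply: aeS (mpres_ae (frame_mpres (vt r)) (hr r0)).
have b1E : {ae leb R, forall t, 0 <= t -> {ae leb6 R, forall z, forall j,
    coord6 j (dframe (vshift m wc theta eps) (t, z) (1, (velocity_eps m t z.1 z.2,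
      force_eps m e wc theta E eps t z.1 z.2))) =
    field al be ga (fun r => theta (r / eps)) (fun r => theta (r / eps) ^+ 2) h j t
      (frame (vshift m wc theta eps t) z)}}.
  apply: aeS (hE1 (vshift m wc theta eps)) => r hr r0; apply: aeS (hr r0) => z hz j.
  exact: field_eps.
have b2E : {ae leb R, forall t, 0 <= t -> {ae leb6 R, forall z, forall j,
    coord6 j (dframe (fun=> c * theta s) (t, z) (1, (velocity0 m wc T theta s t z.1 z.2,
      force0 m e wc T theta E s t z.1 z.2))) =
    field al be ga (fun=> mu1) (fun=> mu2) h j t (frame (c * theta s) z)}}.
  apply: aeS (hE1 (fun=> c * theta s)) => r hr r0; apply: aeS (hr r0) => z hz j.
  exact: field_mean.
have vb (r : R) : `|c * theta r| <= C1 by rewrite normrM ler_wpM2l.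
have d1 r : derivable (vshift m wc theta eps) r 1.
  exact: (@ex_derive _ _ _ _ _ _ _ (is_derive_vshift m wc theta_derivable eps r)).
have d2 (r : R) : derivable (fun=> c * theta s) r 1 by exact: derivable_cst.
have dc1 : continuous (derive1 (vshift m wc theta eps)) by exact: continuous_derive1_vshift.
have dc2 : continuous (derive1 (fun=> c * theta s) : R -> R).
  rewrite (_ : derive1 _ = fun=> 0); first by move=> r; exact: cvg_cst.
  by apply/funext => r; exact: derive1_cst.
have vb1 (r : R) : `|vshift m wc theta eps r| <= C1 by exact: vb.
have uc1 : continuous (fun r : R => theta (r / eps)) by exact: continuous_scaled.
have uc2 : continuous (fun r : R => theta (r / eps) ^+ 2) by exact: (continuous_scaled (f := fun r : R => theta r ^+ 2)).
have cm (x : R) : continuous (fun _ : R => x) by move=> r; exact: cvg_cst.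
have ub1 (r : R) : `|theta (r / eps)| <= U.
  by apply: le_trans (tU _) _; rewrite /U -!addrA lerDl !addr_ge0.
have ub2 (r : R) : `|theta (r / eps) ^+ 2| <= U.
  by apply: le_trans (tU2 _) _; rewrite /U (addrC U1) -!addrA lerDl !addr_ge0.
have mb1 (r : R) : `|mu1| <= U by rewrite /U -addrA addrCA lerDl !addr_ge0.
have mb2 (r : R) : `|mu2| <= U by rewrite /U lerDr !addr_ge0.
have cl1 (s0 t1 : R) : 0 <= s0 -> s0 <= t1 -> `|ubar (fun r => theta (r / eps)) s0 t1 -
    ubar (fun=> mu1) s0 t1| <= (A1 + A2) * eps.
  move=> s00 st; apply: le_trans (A1P _ _ _ eps0 s00 st) _.
  by apply: ler_wpM2r; [exact: ltW|rewrite lerDl].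
have cl2 (s0 t1 : R) : 0 <= s0 -> s0 <= t1 -> `|vbar (fun r => theta (r / eps) ^+ 2) s0 t1 -
    vbar (fun=> mu2) s0 t1| <= (A1 + A2) * eps.
  move=> s00 st; apply: le_trans (A2P _ _ _ eps0 s00 st) _.
  by apply: ler_wpM2r; [exact: ltW|rewrite lerDr].
pose G z := fin (frame (- (c * theta 0)) z).
have mG : measurable_fun [set: mV R] G by exact: (measurableT_comp mfin (frame_mpres _).1).
(* The datum of the limit problem is by definition [fin] composed with a frame. *)
have mi0 : measurable_fun [set: mV R] (initial0 m wc theta fin s).
  exact: (measurableT_comp mfin (frame_mpres (c * (theta s - theta 0))).1).
have g1E z : fin (frame (- vshift m wc theta eps 0) z) = G z by rewrite /vshift mul0r.
have g2E z : initial0 m wc theta fin s (frame (- (c * theta s)) z) = G z.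
  exact: initial0_frame.
have Gl := pulled_back_lip (- (c * theta 0)) gl gE.
have Gb : {ae leb6 R, forall z, `|G z| <= M}.
  have fb : {ae leb6 R, forall z, `|fin z| <= M}.
    by apply: aeS gE => z <-; have [_ b _] := gl.
  exact: (mpres_ae (frame_mpres _) fb).
have vtE : vshift m wc theta eps t = c * theta s by [].
have := difference_norm hm hl hf Ki (feps_sol eps eps0) (f0_sol s) d1 d2 dc1 dc2 vb1 (fun=> vb s)
  b1E b2E uc1 uc2 (cm _) (cm _) ub1 ub2 mb1 mb2 cl1 cl2 mfin mi0 mG g1E g2E MG0 Gl rG0 rGP Gb t0 vtE.
move=> /le_trans; apply; rewrite lee_fin.
have sg0 := kk_ge0 U al be ga hl t0.
have sgI : kk U al be ga K 0 t <= kk U al be ga K 0 I.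
  rewrite (kk_split U al be ga Ki (lexx 0) t0 tI) lerDl.
  exact: (kk_ge0 U al be ga hl tI).
have A0 : 0 <= (A1 + A2) * eps by rewrite mulr_ge0 ?addr_ge0// ltW.
have le := ler_wpM2r A0 (error_constant_le MG0 bg0 rG0 C10 sg0 sgI).
rewrite -[leRHS]mulrA; apply: le_trans le; rewrite /error_constant /gap_constant.
by rewrite le_eqVlt; apply/orP; left; apply/eqP; ring.
Qed.
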